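(* Let $\nu>0$ be real and let $z\in\mathbb{C}$ with $\mathrm{Re}\,z>0$. Then $$\int_0^{\pi/2}\tan\theta\;Y_0(z\sin^2\theta)\,J_\nu(z\cos^2\theta)\,d\theta=\frac{Y_\nu(z)\,(z/2)^{2\nu}}{2\nu\,\Gamma^2(\nu+1)}\,{}_2F_3\left(\left.\begin{array}{c}\nu,\ \frac12+\nu\\ 2\nu+1,\ \nu+1,\ \nu+1\end{array}\right|-z^2\right)-\frac{J_\nu(z)}{2\sqrt\pi}\,G_{2,4}^{3,0}\left(z^2\left|\begin{array}{c}\frac12,\ 1\\ 0,\ 0,\ \nu,\ -\nu\end{array}\right.\right).$$
   Context: Powers take their principal values. $J_\nu(z)=(z/2)^\nu\sum_{k\ge0}\frac{(-1)^k(z/2)^{2k}}{k!\,\Gamma(\nu+k+1)}$, and $Y_\nu(z)=\frac{J_\nu(z)\cos\pi\nu-J_{-\nu}(z)}{\sin\pi\nu}$ for $\nu\notin\mathbb{Z}$ (defined by the limit in $\nu$ for integral $\nu$). ${}_pF_q\left(\left.\begin{array}{c}a_1,\dots,a_p\\ b_1,\dots,b_q\end{array}\right|x\right)=\sum_{k\ge0}\frac{(a_1)_k\cdots(a_p)_k}{(b_1)_k\cdots(b_q)_k}\frac{x^k}{k!}$ with $(\alpha)_k=\alpha(\alpha+1)\cdots(\alpha+k-1)$. The Meijer $G$-function is $$G_{p,q}^{m,n}\left(x\left|\begin{array}{c}a_1,\dots,a_p\\ b_1,\dots,b_q\end{array}\right.\right)=\frac1{2\pi i}\int_L\frac{\prod_{\ell=1}^m\Gamma(b_\ell-s)\prod_{\ell=1}^n\Gamma(1-a_\ell+s)}{\prod_{\ell=m+1}^{q}\Gamma(1-b_\ell+s)\prod_{\ell=n+1}^{p}\Gamma(a_\ell-s)}\,x^s\,ds,$$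 where $L$ separates the poles of the factors $\Gamma(b_\ell-s)$ ($1\le\ell\le m$) from those of the factors $\Gamma(1-a_\ell+s)$ ($1\le\ell\le n$); for $p<q$ one may take $L$ to be a loop starting and ending at $+\infty$ and encircling all poles of the $\Gamma(b_\ell-s)$ once in the negative (clockwise) direction. $x^s$ is the principal value. *)

(* Defs.v *)
From Stdlib Require Import Reals List Factorial.
From Coquelicot Require Import Coquelicot.
Import ListNotations.
Open Scope R_scope.

(* Limits and sums of complex sequences are taken on real and imaginary parts,
   through Coquelicot's total operators. *)
Definition CLim_seq (u : nat -> C) : C :=
  (real (Lim_seq (fun n => Re (u n))), real (Lim_seq (fun n => Im (u n)))).

Definition CLim (f : R -> C) (x : R) : C :=
  (real (Lim (fun t => Re (f t)) x), real (Lim (fun t => Im (f t)) x)).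

Definition CSeries (a : nat -> C) : C :=
  (Series (fun n => Re (a n)), Series (fun n => Im (a n))).

Definition Cexp (z : C) : C :=
  (exp (Re z) * cos (Im z), exp (Re z) * sin (Im z)).

(* Principal argument, with values in (-PI, PI] for z <> 0. *)
Definition Carg (z : C) : R :=
  if Rle_dec 0 (Im z) then acos (Re z / Cmod z) else - acos (Re z / Cmod z).

Definition Clog (z : C) : C := (ln (Cmod z), Carg z).

Definition Cpower (z s : C) : C := Cexp (s * Clog z)%C.

Fixpoint poch (a : C) (k : nat) : C :=
  match k with
  | O => RtoC 1
  | S k' => (poch a k' * (a + INR k'))%C
  end.

Definition Cprod (l : list C) : C := fold_right Cmult (RtoC 1) l.

(* Euler-Gauss limit n! n^s / (s (s+1) ... (s+n)).  Since / 0 = 0 for complex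
   numbers, the value at the poles 0, -1, -2, ... is 0, and so is the
   value of / CGamma there: this is the usual convention 1 / Gamma(-k) = 0. *)
Definition CGamma (s : C) : C :=
  CLim_seq (fun n => (INR (fact n) * Cpower (INR n) s / poch s (S n))%C).

Definition BesselJ (nu : R) (z : C) : C :=
  (Cpower (z / 2) nu *
   CSeries (fun k => (-1) ^ k * (z / 2) ^ (2 * k) /
                     (INR (fact k) * CGamma (nu + INR k + 1))))%C.

Definition BesselY_quot (nu : R) (z : C) : C :=
  ((BesselJ nu z * cos (PI * nu) - BesselJ (- nu) z) / sin (PI * nu))%C.

(* frac_part nu = 0 means that nu is an integer; CLim is a limit over the
   punctured neighbourhoods of nu. *)
Definition BesselY (nu : R) (z : C) : C :=
  if Req_EM_T (frac_part nu) 0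
  then CLim (fun mu => BesselY_quot mu z) nu
  else BesselY_quot nu z.

Definition hypergeom (a b : list C) (x : C) : C :=
  CSeries (fun k => (Cprod (map (fun c => poch c k) a) /
                     Cprod (map (fun c => poch c k) b) *
                     (x ^ k / INR (fact k)))%C).

Definition MeijerG_integrand (m n : nat) (a b : list C) (x s : C) : C :=
  (Cprod (map (fun c => CGamma (c - s)) (firstn m b)) *
   Cprod (map (fun c => CGamma (1 - c + s)) (firstn n a)) /
   (Cprod (map (fun c => CGamma (1 - c + s)) (skipn m b)) *
    Cprod (map (fun c => CGamma (c - s)) (skipn n a))) *
   Cpower x s)%C.

(* The loop with parameters sigma, c1 < c2 is the clockwise boundary of the
   half-strip sigma < Re s, c1 < Im s < c2: it comes from +oo + i c1 along a
   horizontal ray to sigma + i c1, goes up to sigma + i c2, and returns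
   horizontally to +oo + i c2. *)
Definition is_loop_int (sigma c1 c2 : R) (f : C -> C) (w : C) : Prop :=
  exists Ibot Ileft Itop : C,
    is_RInt_gen (V := C_R_NormedModule) (fun t : R => f (t, c1))
      (at_point sigma) (Rbar_locally p_infty) Ibot /\
    is_RInt (V := C_R_NormedModule) (fun y : R => f (sigma, y)) c1 c2 Ileft /\
    is_RInt_gen (V := C_R_NormedModule) (fun t : R => f (t, c2))
      (at_point sigma) (Rbar_locally p_infty) Itop /\
    w = (- Ibot + Ci * Ileft + Itop)%C.

(* The loop encircles the poles c + k of Gamma(c - s), c among b_1, ..., b_m,
   and separates them from the poles c - 1 - k of Gamma(1 - c + s),
   c among a_1, ..., a_n. *)
Definition separating_loop (m n : nat) (a b : list C) (sigma c1 c2 : R) : Prop :=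
  c1 < c2 /\
  (forall (c : C) (k : nat), In c (firstn m b) ->
     sigma < Re (c + INR k)%C /\ c1 < Im (c + INR k)%C < c2) /\
  (forall (c : C) (k : nat), In c (firstn n a) ->
     ~ (sigma <= Re (c - 1 - INR k)%C /\ c1 <= Im (c - 1 - INR k)%C <= c2)).

(* w is the value of G^{m,n}_{p,q}(x | a; b), p = length a < q = length b.
   Loops as above exist, and all of them give the same value w. *)
Definition is_MeijerG (m n : nat) (a b : list C) (x w : C) : Prop :=
  (m <= length b)%nat /\ (n <= length a < length b)%nat /\
  (exists sigma c1 c2 : R, separating_loop m n a b sigma c1 c2) /\
  (forall sigma c1 c2 : R, separating_loop m n a b sigma c1 c2 ->
     exists I : C,
       is_loop_int sigma c1 c2 (MeijerG_integrand m n a b x) I /\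
       w = (I / (2 * PI * Ci))%C).

(* Main.v *)
Require Import Defs.
From Stdlib Require Import ZArith Reals List Factorial Lra Lia Psatz FunctionalExtensionality Classical ClassicalEpsilon.
From Coquelicot Require Import Coquelicot.
Import ListNotations.
Open Scope R_scope.

(** Both sides are equal to (1 / (pi nu)) d/dnu J_nu(z).

    On the left, Y_0 is 2 / pi times the derivative of J_mu in the order at mu = 0; termwise integration of the double
    series gives Beta integrals and their derivatives, and the resulting finite sums are convolutions evaluated by the
    Rothe-Hagen identity and its derivative in a parameter.

    On the right, the hypergeometric term without the factor Y_nu is S = int_0^z J_nu^2 dt / t.  For nu outside Z the loop
    integral is minus the sum of the residues of the integrand at nu + j, at k >= 1 and at the double pole 0.  By the
    reflection and duplication formulas, this sum times J_nu / (2 sqrt pi) is J_nu (T - cos(pi nu) S) / sin(pi nu), where T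
    is a primitive of J_nu J_(-nu) / t whose constant comes from the double pole.  Hence the cotangent terms cancel, and
    what remains is J_nu T - J_(-nu) S = sin(pi nu) / (pi nu) d/dnu J_nu: variation of parameters for the Bessel
    equation differentiated in nu, proved on power series from the constancy of the Wronskian.  Integral nu are reached
    by continuity along nu + 1 / (n + 2), the integrand decaying exponentially on the rays of the loop, uniformly in nu. *)

(** * Complex differentiability *)

(** The common value has a classical source: with J_mu in place of Y_0 the integral equals
    [J_(mu+nu)(z) / (2 nu)], and the derivative at mu = 0 is the left-hand side up to the factor 2 /
    pi. The derivative is taken in the finite sum behind each coefficient, never under the integral
    sign; the logarithm [ln (sin^2 t)] that it creates is what calls for digamma.

    Gamma enters only through its reciprocal, which is entire: poles become zeros, and [/ 0 = 0]
    reproduces the conventions of the definitions. Reflection and duplication are established on the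
    real axis, where all the residues lie.

    Contours are rectangles because the loop of the G-function bounds a half-strip, and cutting it
    off on the right leaves the boundary of a rectangle. For integral nu the poles at nu + j fall on
    poles at k and become double, so that all residues from some index on change shape; approaching
    from non-integral orders avoids computing them. As every loop must give the same G, limits are
    taken for each loop along one fixed sequence of orders. *)

Lemma Cmod_minus_sym (a b : C) : Cmod (a - b) = Cmod (b - a).
Proof. replace (a - b)%C with (- (b - a))%C by ring. apply Cmod_opp. Qed.

Lemma Cmod_triangle_inv (a b : C) : Cmod a - Cmod b <= Cmod (a - b).
Proof.
  assert (H := Cmod_triangle (a - b) b).
  replace (a - b + b)%C with a in H by ring. lra.
Qed.

Lemma Cmod_re_im (s : C) : Cmod s <= Rabs (Re s) + Rabs (Im s).
Proof.
  replace s with (RtoC (Re s) + Ci * RtoC (Im s))%C.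
  - eapply Rle_trans. apply Cmod_triangle.
    rewrite Cmod_mult, Cmod_Ci, !Cmod_R, Rmult_1_l. simpl.
    apply Req_le. f_equal; f_equal; ring.
  - destruct s; unfold Re, Im, Ci, RtoC, Cplus, Cmult; simpl. f_equal; ring.
Qed.

Lemma im_le_Cmod (s : C) : Rabs (Im s) <= Cmod s.
Proof.
  eapply Rle_trans. 2: apply Rmax_Cmod. apply Rmax_r.
Qed.

Lemma C_ext (s t : C) : Re s = Re t -> Im s = Im t -> s = t.
Proof. destruct s, t; simpl; intros; subst; reflexivity. Qed.

Lemma Cmod_pos (s : C) : s <> 0%C -> 0 < Cmod s.
Proof. apply (proj1 (Cmod_gt_0 s)). Qed.

Lemma Cmod_pos_nz (s : C) : 0 < Cmod s -> s <> 0%C.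
Proof. apply (proj2 (Cmod_gt_0 s)). Qed.

Lemma Cmod_zero_of_small (s : C) : (forall eps, 0 < eps -> Cmod s <= eps) -> s = 0%C.
Proof.
  intros H. apply Cmod_eq_0.
  apply Rle_antisym. 2: apply Cmod_ge_0.
  apply Rnot_lt_le. intros H1. specialize (H (Cmod s / 2)). lra.
Qed.

Definition ccont (f : C -> C) (p : C) : Prop :=
  forall eps, 0 < eps -> exists d, 0 < d /\ forall s, Cmod (s - p) < d -> Cmod (f s - f p) < eps.

Lemma ccont_const (k p : C) : ccont (fun _ => k) p.
Proof.
  intros eps He. exists 1. split. lra. intros. replace (k - k)%C with (RtoC 0) by ring.
  rewrite Cmod_0. auto.
Qed.

Lemma ccont_id (p : C) : ccont (fun s => s) p.
Proof. intros eps He. exists eps. auto. Qed.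

Lemma ccont_plus (f g : C -> C) (p : C) : ccont f p -> ccont g p -> ccont (fun s => f s + g s)%C p.
Proof.
  intros Hf Hg eps He.
  destruct (Hf (eps/2)) as [d1 [Hd1 H1]]. lra.
  destruct (Hg (eps/2)) as [d2 [Hd2 H2]]. lra.
  exists (Rmin d1 d2). split. apply Rmin_pos; auto.
  intros s Hs.
  replace (f s + g s - (f p + g p))%C with ((f s - f p) + (g s - g p))%C by ring.
  eapply Rle_lt_trans. apply Cmod_triangle.
  specialize (H1 s). specialize (H2 s).
  assert (A1 := Rmin_l d1 d2). assert (A2 := Rmin_r d1 d2).
  assert (Cmod (f s - f p) < eps/2) by (apply H1; lra).
  assert (Cmod (g s - g p) < eps/2) by (apply H2; lra). lra.
Qed.

Lemma ccont_mult (f g : C -> C) (p : C) : ccont f p -> ccont g p -> ccont (fun s => f s * g s)%C p.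
Proof.
  intros Hf Hg eps He.
  set (A := Cmod (f p)). set (B := Cmod (g p)).
  assert (HA : 0 <= A) by apply Cmod_ge_0. assert (HB : 0 <= B) by apply Cmod_ge_0.
  destruct (Hf (Rmin 1 (eps/(2*(B+1))))) as [d1 [Hd1 H1]].
  { apply Rmin_pos. lra. apply Rdiv_lt_0_compat; lra. }
  destruct (Hg (eps/(2*(A+1)))) as [d2 [Hd2 H2]].
  { apply Rdiv_lt_0_compat; lra. }
  exists (Rmin d1 d2). split. apply Rmin_pos; auto.
  intros s Hs.
  assert (A1 := Rmin_l d1 d2). assert (A2 := Rmin_r d1 d2).
  assert (K1 : Cmod (f s - f p) < Rmin 1 (eps/(2*(B+1)))) by (apply H1; lra).
  assert (K2 : Cmod (g s - g p) < eps/(2*(A+1))) by (apply H2; lra).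
  assert (K3 : Cmod (f s - f p) < 1) by (eapply Rlt_le_trans; [apply K1 | apply Rmin_l]).
  assert (K4 : Cmod (f s - f p) < eps/(2*(B+1))) by (eapply Rlt_le_trans; [apply K1 | apply Rmin_r]).
  replace (f s * g s - f p * g p)%C with ((f s - f p) * g p + f s * (g s - g p))%C by ring.
  eapply Rle_lt_trans. apply Cmod_triangle. rewrite !Cmod_mult.
  assert (K5 : Cmod (f s) <= A + 1).
  { replace (f s) with ((f s - f p) + f p)%C by ring. eapply Rle_trans. apply Cmod_triangle. fold A. lra. }
  fold B.
  assert (M1 : Cmod (f s - f p) * B <= eps/(2*(B+1)) * B) by (apply Rmult_le_compat_r; lra).
  assert (M2 : Cmod (f s) * Cmod (g s - g p) <= (A+1) * Cmod (g s - g p)).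
  { apply Rmult_le_compat_r. apply Cmod_ge_0. lra. }
  assert (M3 : (A+1) * Cmod (g s - g p) < (A+1) * (eps/(2*(A+1)))) by (apply Rmult_lt_compat_l; lra).
  replace ((A+1) * (eps/(2*(A+1)))) with (eps/2) in M3 by (field; lra).
  assert (M4 : eps/(2*(B+1)) * B <= eps / 2).
  { replace (eps/2) with (eps/(2*(B+1)) * (B+1)) by (field; lra).
    apply Rmult_le_compat_l. apply Rlt_le, Rdiv_lt_0_compat; lra. lra. }
  lra.
Qed.

Lemma ccont_opp (f : C -> C) (p : C) : ccont f p -> ccont (fun s => - f s)%C p.
Proof.
  intros H eps He. destruct (H eps He) as [d [Hd K]]. exists d. split; auto.
  intros s Hs. replace (- f s - - f p)%C with (- (f s - f p))%C by ring. rewrite Cmod_opp. auto.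
Qed.

Lemma ccont_minus (f g : C -> C) (p : C) : ccont f p -> ccont g p -> ccont (fun s => f s - g s)%C p.
Proof. intros. apply ccont_plus; auto. apply ccont_opp; auto. Qed.

Lemma ccont_comp (f g : C -> C) (p : C) : ccont f p -> ccont g (f p) -> ccont (fun s => g (f s)) p.
Proof.
  intros Hf Hg eps He. destruct (Hg eps He) as [d [Hd K]]. destruct (Hf d Hd) as [d' [Hd' K']].
  exists d'. split; auto.
Qed.

Lemma ccont_Cinv (p : C) : p <> 0%C -> ccont Cinv p.
Proof.
  intros Hp eps He.
  assert (HP : 0 < Cmod p) by (apply Cmod_pos; auto).
  exists (Rmin (Cmod p / 2) (eps * (Cmod p)^2 / 2)). split.
  { apply Rmin_pos. lra. apply Rdiv_lt_0_compat. 2: lra. apply Rmult_lt_0_compat. lra. apply pow_lt; auto. }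
  intros s Hs.
  assert (K1 : Cmod (s - p) < Cmod p / 2) by (eapply Rlt_le_trans; [apply Hs | apply Rmin_l]).
  assert (K2 : Cmod (s - p) < eps * (Cmod p)^2 / 2) by (eapply Rlt_le_trans; [apply Hs | apply Rmin_r]).
  assert (K3 : Cmod p / 2 < Cmod s).
  { assert (H := Cmod_triangle_inv p s). rewrite Cmod_minus_sym in H. lra. }
  assert (Hs0 : s <> 0%C) by (apply Cmod_pos_nz; lra).
  replace (/ s - / p)%C with ((p - s) / (s * p))%C by (field; auto).
  rewrite Cmod_div by (apply Cmult_neq_0; auto).
  rewrite Cmod_mult, Cmod_minus_sym.
  apply Rmult_lt_reg_r with (Cmod s * Cmod p). nra.
  unfold Rdiv. rewrite Rmult_assoc, Rinv_l, Rmult_1_r by nra.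
  eapply Rlt_le_trans. apply K2.
  replace (eps * Cmod p ^ 2 / 2) with (eps * (Cmod p / 2 * Cmod p)) by (field).
  apply Rmult_le_compat_l. lra. apply Rmult_le_compat_r; lra.
Qed.

Lemma ccont_inv (f : C -> C) (p : C) : f p <> 0%C -> ccont f p -> ccont (fun s => / f s)%C p.
Proof. intros H0 H. apply (ccont_comp f Cinv); auto. apply ccont_Cinv; auto. Qed.

Lemma ccont_div (f g : C -> C) (p : C) : g p <> 0%C -> ccont f p -> ccont g p -> ccont (fun s => f s / g s)%C p.
Proof. intros. apply ccont_mult; auto. apply ccont_inv; auto. Qed.

Lemma ccont_ext_loc (f g : C -> C) (p : C) (d : R) : 0 < d -> (forall s, Cmod (s - p) < d -> f s = g s) -> ccont f p -> ccont g p.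
Proof.
  intros Hd H Hf eps He. destruct (Hf eps He) as [d' [Hd' K]]. exists (Rmin d d'). split.
  apply Rmin_pos; auto. intros s Hs. rewrite <- !H. apply K. eapply Rlt_le_trans. apply Hs. apply Rmin_r.
  replace (p - p)%C with (RtoC 0) by ring. rewrite Cmod_0. auto. eapply Rlt_le_trans. apply Hs. apply Rmin_l.
Qed.

(* Caratheodory's form of the derivative makes the rules of calculus algebraic identities. *)
Definition cdiff (f : C -> C) (p l : C) : Prop :=
  exists phi : C -> C, (forall s, f s = f p + phi s * (s - p))%C /\ phi p = l /\ ccont phi p.

(** The slope function only has to be filled in at [p], by the derivative itself. The estimate is
    the form used by bisection and Cauchy's inequalities, the slope the form used by the rules of
    calculus. *)
Lemma cdiff_small (f : C -> C) (p l : C) : cdiff f p l <->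
  forall eps, 0 < eps -> exists d, 0 < d /\ forall s, Cmod (s - p) < d ->
    Cmod (f s - f p - l * (s - p)) <= eps * Cmod (s - p).
Proof.
  split.
  - intros [phi [H1 [H2 H3]]] eps He. destruct (H3 eps He) as [d [Hd K]]. exists d. split; auto.
    intros s Hs. rewrite H1.
    replace (f p + phi s * (s - p) - f p - l * (s - p))%C with ((phi s - phi p) * (s - p))%C by (rewrite H2; ring).
    rewrite Cmod_mult. apply Rmult_le_compat_r. apply Cmod_ge_0. left. auto.
  - intros H. exists (fun s => if Ceq_dec s p then l else (f s - f p) / (s - p))%C. split; [|split].
    + intros s. destruct (Ceq_dec s p). subst; ring. field. apply Cminus_eq_contra; auto.
    + destruct (Ceq_dec p p); tauto.
    + intros eps He. destruct (H (eps/2)) as [d [Hd K]]. lra. exists d. split; auto.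
      intros s Hs. destruct (Ceq_dec p p); [|tauto]. destruct (Ceq_dec s p).
      replace (l - l)%C with (RtoC 0) by ring. rewrite Cmod_0. auto.
      assert (Hn : (s - p <> 0)%C) by (apply Cminus_eq_contra; auto).
      replace ((f s - f p) / (s - p) - l)%C with ((f s - f p - l * (s - p)) / (s - p))%C by (field; auto).
      rewrite Cmod_div; auto. specialize (K s Hs).
      assert (0 < Cmod (s - p)) by (apply Cmod_pos; auto).
      apply Rmult_lt_reg_r with (Cmod (s-p)); auto. unfold Rdiv. rewrite Rmult_assoc, Rinv_l by lra. nra.
Qed.

Lemma cdiff_ccont (f : C -> C) (p l : C) : cdiff f p l -> ccont f p.
Proof.
  intros [phi [H1 [H2 H3]]].
  replace f with (fun s => f p + phi s * (s - p))%C.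
  2:{ apply functional_extensionality. intros s. symmetry. apply H1. }
  apply ccont_plus. apply ccont_const. apply ccont_mult; auto. apply ccont_minus. apply ccont_id. apply ccont_const.
Qed.

Lemma cdiff_eq (f : C -> C) (p l l' : C) : cdiff f p l -> l = l' -> cdiff f p l'.
Proof. intros; subst; auto. Qed.

Lemma cdiff_const (k p : C) : cdiff (fun _ => k) p 0.
Proof. exists (fun _ => RtoC 0). split; [|split]. intros; ring. auto. apply ccont_const. Qed.

Lemma cdiff_id (p : C) : cdiff (fun s => s) p 1.
Proof. exists (fun _ => RtoC 1). split; [|split]. intros; ring. auto. apply ccont_const. Qed.

Lemma cdiff_plus (f g : C -> C) (p l m : C) : cdiff f p l -> cdiff g p m -> cdiff (fun s => f s + g s)%C p (l + m).
Proof.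
  intros [F [F1 [F2 F3]]] [G [G1 [G2 G3]]]. exists (fun s => F s + G s)%C. split; [|split].
  - intros s. rewrite F1, G1. ring.
  - congruence.
  - apply ccont_plus; auto.
Qed.

Lemma cdiff_mult (f g : C -> C) (p l m : C) : cdiff f p l -> cdiff g p m -> cdiff (fun s => f s * g s)%C p (l * g p + f p * m).
Proof.
  intros Hf Hg. assert (Hgc := cdiff_ccont _ _ _ Hg).
  destruct Hf as [F [F1 [F2 F3]]]. destruct Hg as [G [G1 [G2 G3]]].
  exists (fun s => F s * g s + f p * G s)%C. split; [|split].
  - intros s. rewrite F1, (G1 s). ring.
  - subst. reflexivity.
  - apply ccont_plus. apply ccont_mult; auto. apply ccont_mult; auto. apply ccont_const.
Qed.

Lemma cdiff_opp (f : C -> C) (p l : C) : cdiff f p l -> cdiff (fun s => - f s)%C p (- l).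
Proof.
  intros [F [F1 [F2 F3]]]. exists (fun s => - F s)%C. split; [|split].
  - intros s. rewrite F1. ring.
  - congruence.
  - apply ccont_opp; auto.
Qed.

Lemma cdiff_minus (f g : C -> C) (p l m : C) : cdiff f p l -> cdiff g p m -> cdiff (fun s => f s - g s)%C p (l - m).
Proof. intros. apply cdiff_plus; auto. apply cdiff_opp; auto. Qed.

Lemma cdiff_comp (f g : C -> C) (p l m : C) : cdiff f p l -> cdiff g (f p) m -> cdiff (fun s => g (f s)) p (m * l).
Proof.
  intros Hf Hg. assert (Hfc := cdiff_ccont _ _ _ Hf).
  destruct Hf as [F [F1 [F2 F3]]]. destruct Hg as [G [G1 [G2 G3]]].
  exists (fun s => G (f s) * F s)%C. split; [|split].
  - intros s. rewrite (G1 (f s)). rewrite (F1 s) at 2. ring.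
  - congruence.
  - apply ccont_mult; auto. apply (ccont_comp f G); auto.
Qed.

Lemma cdiff_inv (f : C -> C) (p l : C) : f p <> 0%C -> cdiff f p l -> cdiff (fun s => / f s)%C p (- l / (f p * f p)).
Proof.
  intros H0 Hf.
  assert (Hfc := cdiff_ccont _ _ _ Hf).
  assert (Hx : exists d, 0 < d /\ forall s, Cmod (s - p) < d -> f s <> 0%C).
  { destruct (Hfc (Cmod (f p))) as [d [Hd K]]. apply Cmod_pos; auto. exists d. split; auto.
    intros s Hs E. specialize (K s Hs). rewrite E in K.
    replace (0 - f p)%C with (- f p)%C in K by ring. rewrite Cmod_opp in K. lra. }
  destruct Hx as [d [Hd Hnz]].
  destruct Hf as [F [F1 [F2 F3]]].
  (* Where [f] might vanish, the slope is the bare difference quotient: the factorization must hold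
     for every [s], continuity only near [p]. *)
  exists (fun s => if Rlt_dec (Cmod (s - p)) d then - F s * / (f s * f p)
     else (/ f s - / f p) / (s - p))%C.
  split; [|split].
  - intros s. destruct (Rlt_dec (Cmod (s - p)) d).
    + assert (f s <> 0%C) by auto.
      assert (E := F1 s).
      assert (E2 : (F s * (s - p) = f s - f p)%C) by (rewrite E; ring).
      replace (- F s * / (f s * f p) * (s - p))%C with (- (F s * (s - p)) * / (f s * f p))%C by ring.
      rewrite E2. field; auto.
    + assert ((s - p)%C <> 0%C).
      { intros E. rewrite E, Cmod_0 in n. auto. }
      unfold Cdiv. rewrite <- Cmult_assoc, Cinv_l; auto. ring.
  - replace (p - p)%C with (RtoC 0) by ring. rewrite Cmod_0. destruct (Rlt_dec 0 d); [|lra].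
    subst. unfold Cdiv. reflexivity.
  - apply ccont_ext_loc with (f := fun s => (- F s * / (f s * f p))%C) (d := d); auto.
    + intros s Hs. destruct (Rlt_dec (Cmod (s - p)) d); tauto.
    + apply ccont_mult. apply ccont_opp; auto. apply ccont_inv. apply Cmult_neq_0; auto.
      apply ccont_mult; auto. apply ccont_const.
Qed.

Lemma cdiff_ext (f g : C -> C) (p l : C) : (forall s, f s = g s) -> cdiff f p l -> cdiff g p l.
Proof. intros H. replace g with f; auto. apply functional_extensionality; auto. Qed.

Lemma cdiff_unique (f : C -> C) (p l m : C) : cdiff f p l -> cdiff f p m -> l = m.
Proof.
  intros [F [F1 [F2 F3]]] [G [G1 [G2 G3]]].
  apply Ceq_minus. apply Cmod_zero_of_small. intros eps He.
  destruct (F3 (eps/2)) as [d1 [Hd1 K1]]. lra. destruct (G3 (eps/2)) as [d2 [Hd2 K2]]. lra.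
  (* The two slope functions agree off [p], so one real increment inside both neighbourhoods
     compares their values at [p]. *)
  set (h := Rmin d1 d2 / 2).
  assert (A1 := Rmin_l d1 d2). assert (A2 := Rmin_r d1 d2). assert (A3 := Rmin_pos _ _ Hd1 Hd2).
  assert (Hh : 0 < h) by (unfold h; lra).
  assert (E : Cmod ((p + RtoC h) - p) = h).
  { replace ((p + RtoC h) - p)%C with (RtoC h) by ring. rewrite Cmod_R, Rabs_pos_eq; lra. }
  specialize (K1 (p + RtoC h)%C). specialize (K2 (p + RtoC h)%C). rewrite E in K1, K2.
  assert (EQ : F (p + RtoC h)%C = G (p + RtoC h)%C).
  { assert (Q1 := F1 (p + RtoC h)%C). assert (Q2 := G1 (p + RtoC h)%C).
    rewrite Q1 in Q2.
    assert (Q3 : ((F (p + RtoC h) - G (p + RtoC h)) * RtoC h = 0)%C).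
    { replace ((F (p + RtoC h) - G (p + RtoC h)) * RtoC h)%C with
       ((f p + F (p + RtoC h) * (p + RtoC h - p)) - (f p + G (p + RtoC h) * (p + RtoC h - p)))%C by ring.
      rewrite Q2. ring. }
    destruct (Ceq_dec (F (p + RtoC h)%C) (G (p + RtoC h)%C)); auto.
    exfalso. revert Q3. apply Cmult_neq_0. apply Cminus_eq_contra; auto.
    intros E0. apply RtoC_inj in E0. lra. }
  subst l m.
  replace (F p - G p)%C with ((G (p + RtoC h) - G p) - (F (p + RtoC h) - F p))%C by (rewrite EQ; ring).
  eapply Rle_trans. apply Cmod_triangle. rewrite Cmod_opp.
  unfold h in *. assert (Hq := K1 ltac:(lra)). assert (Hq' := K2 ltac:(lra)). lra.
Qed.

(** * Cauchy's theorem and residues on rectangles *)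

Notation isCI f a b l := (is_RInt (V := C_R_NormedModule) f a b l).
Notation CI f a b := (RInt (V := C_R_CompleteNormedModule) f a b).
Notation exCI f a b := (ex_RInt (V := C_R_NormedModule) f a b).

Definition rcont (f : R -> C) (t : R) : Prop :=
  forall eps, 0 < eps -> exists d, 0 < d /\ forall u, Rabs (u - t) < d -> Cmod (f u - f t) < eps.

Lemma norm_C_R (x : C) : norm (V := C_R_NormedModule) x = Cmod x.
Proof.
  destruct x as [u v]. change (sqrt (Rabs u ^ 2 + Rabs v ^ 2) = sqrt (u ^ 2 + v ^ 2)).
  rewrite !pow2_abs. reflexivity.
Qed.

Lemma ball_C (x y : C) (e : posreal) : Cmod (y - x) < e -> ball (M := C_R_NormedModule) x e y.
Proof.
  intros H. split; unfold ball; simpl; unfold AbsRing_ball, abs, minus, plus, opp; simpl.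
  - assert (K := Rmax_Cmod (y - x)%C). assert (K1 := Rmax_l (Rabs (fst (y - x)%C)) (Rabs (snd (y - x)%C))).
    simpl in *. lra.
  - assert (K := Rmax_Cmod (y - x)%C). assert (K1 := Rmax_r (Rabs (fst (y - x)%C)) (Rabs (snd (y - x)%C))).
    simpl in *. lra.
Qed.

(** The uniform structure is that of pairs, whose balls are squares; hence the factor 2. *)
Lemma ball_C_inv (x y : C) (e : R) : ball (M := C_R_NormedModule) x e y -> Cmod (y - x) < 2 * e.
Proof.
  intros [H1 H2]. unfold ball in *; simpl in *; unfold AbsRing_ball, abs, minus, plus, opp in *; simpl in *.
  eapply Rle_lt_trans. apply Cmod_re_im. simpl. lra.
Qed.

Lemma rcont_continuous f t : rcont f t <-> continuous (U := C_R_NormedModule) f t.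
Proof.
  split.
  - intros H P [e He]. destruct (H e (cond_pos e)) as [d [Hd K]]. exists (mkposreal d Hd).
    intros u Hu. apply He. apply ball_C. apply K. exact Hu.
  - intros H eps Heps.
    assert (Hl : locally (f t) (fun y : C_R_NormedModule => Cmod (y - f t) < eps)).
    { assert (E2 : 0 < eps / 2) by lra. exists (mkposreal _ E2). intros y Hy. apply ball_C_inv in Hy. simpl in Hy. lra. }
    destruct (H _ Hl) as [d Hd]. exists d. split. apply cond_pos. intros u Hu. apply (Hd u). exact Hu.
Qed.

Lemma exCI_rcont f a b : (forall t, Rmin a b <= t <= Rmax a b -> rcont f t) -> exCI f a b.
Proof.
  intros H. apply (ex_RInt_continuous (V := C_R_CompleteNormedModule)). intros t Ht. apply rcont_continuous. auto.
Qed.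

Lemma isCI_pair (f : R -> C) a b (l : C) :
  isCI f a b l <-> is_RInt (fun t => Re (f t)) a b (Re l) /\ is_RInt (fun t => Im (f t)) a b (Im l).
Proof.
  split.
  - intros H. split.
    + apply (is_RInt_fct_extend_fst (U := R_NormedModule) (V := R_NormedModule) f a b l H).
    + apply (is_RInt_fct_extend_snd (U := R_NormedModule) (V := R_NormedModule) f a b l H).
  - intros [H1 H2]. destruct l as [l1 l2]. apply (is_RInt_fct_extend_pair (U := R_NormedModule) (V := R_NormedModule) f a b l1 l2 H1 H2).
Qed.

Lemma isCI_scal (f : R -> C) a b (k l : C) : isCI f a b l -> isCI (fun t => k * f t)%C a b (k * l)%C.
Proof.
  rewrite !isCI_pair. intros [H1 H2]. split.
  - apply (is_RInt_ext (fun t => minus (scal (Re k) (Re (f t))) (scal (Im k) (Im (f t))))).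
    { intros. reflexivity. }
    replace (Re (k * l)%C) with (minus (scal (Re k) (Re l)) (scal (Im k) (Im l))) by reflexivity.
    apply (is_RInt_minus (V := R_NormedModule)); apply (is_RInt_scal (V := R_NormedModule)); auto.
  - apply (is_RInt_ext (fun t => plus (scal (Re k) (Im (f t))) (scal (Im k) (Re (f t))))).
    { intros. reflexivity. }
    replace (Im (k * l)%C) with (plus (scal (Re k) (Im l)) (scal (Im k) (Re l))) by reflexivity.
    apply (is_RInt_plus (V := R_NormedModule)); apply (is_RInt_scal (V := R_NormedModule)); auto.
Qed.

Lemma isCI_plus (f g : R -> C) a b (k l : C) : isCI f a b k -> isCI g a b l -> isCI (fun t => f t + g t)%C a b (k + l)%C.
Proof. intros. apply (is_RInt_plus (V := C_R_NormedModule)); auto. Qed.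

Lemma isCI_opp (f : R -> C) a b (k : C) : isCI f a b k -> isCI (fun t => - f t)%C a b (- k)%C.
Proof. intros. apply (is_RInt_opp (V := C_R_NormedModule)); auto. Qed.

Lemma isCI_minus (f g : R -> C) a b (k l : C) : isCI f a b k -> isCI g a b l -> isCI (fun t => f t - g t)%C a b (k - l)%C.
Proof. intros. apply isCI_plus; auto. apply isCI_opp; auto. Qed.

Lemma isCI_unique (f : R -> C) a b (k : C) : isCI f a b k -> CI f a b = k.
Proof. intros. apply (is_RInt_unique (V := C_R_CompleteNormedModule)). auto. Qed.

Lemma CI_correct (f : R -> C) a b : exCI f a b -> isCI f a b (CI f a b).
Proof. intros. apply (RInt_correct (V := C_R_CompleteNormedModule)). auto. Qed.

Lemma isCI_ext (f g : R -> C) a b (l : C) : a <= b ->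
  (forall t, a <= t <= b -> f t = g t) -> isCI f a b l -> isCI g a b l.
Proof.
  intros Hab H. apply is_RInt_ext. intros t. rewrite Rmin_left, Rmax_right; auto. intros; apply H; lra.
Qed.

Lemma CI_ext (f g : R -> C) a b : a <= b -> (forall t, a <= t <= b -> f t = g t) -> CI f a b = CI g a b.
Proof.
  intros Hab H. apply RInt_ext. intros t. rewrite Rmin_left, Rmax_right; auto. intros; apply H; lra.
Qed.

Lemma isCI_Chasles (f : R -> C) a b c (k l : C) : isCI f a b k -> isCI f b c l -> isCI f a c (k + l)%C.
Proof. intros. apply (is_RInt_Chasles (V := C_R_NormedModule) f a b c); auto. Qed.

Lemma isCI_unicity (f : R -> C) a b (k l : C) : isCI f a b k -> isCI f a b l -> k = l.
Proof. intros H1 H2. apply isCI_unique in H1. apply isCI_unique in H2. congruence. Qed.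

Lemma isCI_bound (f : R -> C) a b M (l : C) : a <= b -> (forall t, a <= t <= b -> Cmod (f t) <= M) ->
  isCI f a b l -> Cmod l <= (b - a) * M.
Proof.
  intros Hab H Hl. rewrite <- norm_C_R.
  apply (norm_RInt_le_const (V := C_R_NormedModule) f a b l M); auto.
  intros x Hx. rewrite norm_C_R. auto.
Qed.

Lemma isCI_bound_fun (f : R -> C) (g : R -> R) a b (l : C) (m : R) : a <= b ->
  (forall t, a <= t <= b -> Cmod (f t) <= g t) ->
  isCI f a b l -> is_RInt g a b m -> Cmod l <= m.
Proof.
  intros Hab H Hl Hg. rewrite <- norm_C_R.
  apply (norm_RInt_le (V := C_R_NormedModule) f g a b l m); auto.
  intros x Hx. rewrite norm_C_R. auto.
Qed.

Lemma isCI_diff_bound (f g : R -> C) a b eps (k l : C) : a <= b ->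
  (forall t, a <= t <= b -> Cmod (f t - g t) <= eps) ->
  isCI f a b k -> isCI g a b l -> Cmod (k - l) <= (b - a) * eps.
Proof.
  intros Hab H Hk Hl. apply isCI_bound with (f := fun t => (f t - g t)%C); auto.
  apply isCI_minus; auto.
Qed.

Lemma isCI_const (k : C) a b : isCI (fun _ => k) a b (RtoC (b - a) * k)%C.
Proof.
  rewrite <- scal_R_Cmult. apply (is_RInt_const (V := C_R_NormedModule)).
Qed.

Lemma rcont_hor f x y : ccont f (x, y) -> rcont (fun t => f (t, y)) x.
Proof.
  intros H eps He. destruct (H eps He) as [d [Hd K]]. exists d. split; auto. intros u Hu.
  apply K. replace ((u, y) - (x, y))%C with (RtoC (u - x)).
  rewrite Cmod_R. auto. unfold RtoC, Cminus, Cplus, Copp; simpl. f_equal; ring.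
Qed.

Lemma rcont_ver f x y : ccont f (x, y) -> rcont (fun t => f (x, t)) y.
Proof.
  intros H eps He. destruct (H eps He) as [d [Hd K]]. exists d. split; auto. intros u Hu.
  apply K. replace ((x, u) - (x, y))%C with (Ci * RtoC (u - y))%C.
  rewrite Cmod_mult, Cmod_Ci, Cmod_R, Rmult_1_l. auto. unfold RtoC, Ci, Cminus, Cplus, Copp, Cmult; simpl. f_equal; ring.
Qed.

(** * Integrals over the boundary of a rectangle *)

Definition inrect (a b c d : R) (s : C) : Prop := a <= Re s <= b /\ c <= Im s <= d.

(** Counterclockwise, against the orientation of [is_loop_int]; this is the origin of the minus sign
    in [loop_residues]. *)
Definition rectI (f : C -> C) (a b c d : R) : C :=
  (CI (fun x => f (x, c)) a b + Ci * CI (fun y => f (b, y)) c d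
   - CI (fun x => f (x, d)) a b - Ci * CI (fun y => f (a, y)) c d)%C.

(** Singled out because the integrands to come have poles inside the rectangle and are continuous on
    its boundary only. *)
Definition onbd (a b c d : R) (s : C) : Prop :=
  inrect a b c d s /\ (Re s = a \/ Re s = b \/ Im s = c \/ Im s = d).

Lemma exCI_hor f a b c d y : a <= b -> c <= d -> y = c \/ y = d -> (forall s, onbd a b c d s -> ccont f s) ->
  exCI (fun x => f (x, y)) a b.
Proof.
  intros Hab Hcd Hy H. apply exCI_rcont. rewrite Rmin_left, Rmax_right by lra. intros t Ht.
  apply rcont_hor. apply H. split; [split|]; simpl; lra.
Qed.

Lemma exCI_ver f a b c d x : a <= b -> c <= d -> x = a \/ x = b -> (forall s, onbd a b c d s -> ccont f s) ->
  exCI (fun y => f (x, y)) c d.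
Proof.
  intros Hab Hcd Hy H. apply exCI_rcont. rewrite Rmin_left, Rmax_right by lra. intros t Ht.
  apply rcont_ver. apply H. split; [split|]; simpl; lra.
Qed.

Lemma rectI_split_hor f a m b c d : a <= m <= b -> c <= d -> (forall s, onbd a b c d s -> ccont f s) ->
  rectI f a b c d = (rectI f a m c d + rectI f m b c d)%C.
Proof.
  intros Hm Hcd H. unfold rectI.
  assert (E : forall y, y = c \/ y = d -> CI (fun x => f (x, y)) a b = (CI (fun x => f (x, y)) a m + CI (fun x => f (x, y)) m b)%C).
  { intros y Hy. apply isCI_unique. apply isCI_Chasles with m; apply CI_correct; apply exCI_rcont;
    rewrite Rmin_left, Rmax_right by lra; intros t Ht;
    apply rcont_hor; apply H; (split; [split|]; simpl; lra). }
  rewrite !E by auto. ring.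
Qed.

Lemma rectI_split_ver f a b c m d : a <= b -> c <= m <= d -> (forall s, onbd a b c d s -> ccont f s) ->
  rectI f a b c d = (rectI f a b c m + rectI f a b m d)%C.
Proof.
  intros Hm Hcd H. unfold rectI.
  assert (E : forall x, x = a \/ x = b -> CI (fun y => f (x, y)) c d = (CI (fun y => f (x, y)) c m + CI (fun y => f (x, y)) m d)%C).
  { intros x Hx. apply isCI_unique. apply isCI_Chasles with m; apply CI_correct; apply exCI_rcont;
    rewrite Rmin_left, Rmax_right by lra; intros t Ht;
    apply rcont_ver; apply H; (split; [split|]; simpl; lra). }
  rewrite !E by auto. ring.
Qed.

Lemma rectI_plus f g a b c d : a <= b -> c <= d -> (forall s, onbd a b c d s -> ccont f s) ->
  (forall s, onbd a b c d s -> ccont g s) ->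
  rectI (fun s => f s + g s)%C a b c d = (rectI f a b c d + rectI g a b c d)%C.
Proof.
  intros Hab Hcd Hf Hg. unfold rectI.
  assert (E1 : forall y, y = c \/ y = d -> CI (fun x => f (x, y) + g (x, y))%C a b = (CI (fun x => f (x, y)) a b + CI (fun x => g (x, y)) a b)%C).
  { intros y Hy. apply isCI_unique. apply isCI_plus; apply CI_correct; [apply (exCI_hor f a b c d y) | apply (exCI_hor g a b c d y)]; auto. }
  assert (E2 : forall x, x = a \/ x = b -> CI (fun y => f (x, y) + g (x, y))%C c d = (CI (fun y => f (x, y)) c d + CI (fun y => g (x, y)) c d)%C).
  { intros x Hx. apply isCI_unique. apply isCI_plus; apply CI_correct; [apply (exCI_ver f a b c d x) | apply (exCI_ver g a b c d x)]; auto. }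
  rewrite !E1, !E2 by auto. ring.
Qed.

Lemma rectI_scal k f a b c d : a <= b -> c <= d -> (forall s, onbd a b c d s -> ccont f s) ->
  rectI (fun s => k * f s)%C a b c d = (k * rectI f a b c d)%C.
Proof.
  intros Hab Hcd Hf. unfold rectI.
  assert (E1 : forall y, y = c \/ y = d -> CI (fun x => k * f (x, y))%C a b = (k * CI (fun x => f (x, y)) a b)%C).
  { intros y Hy. apply isCI_unique. apply isCI_scal; apply CI_correct; apply (exCI_hor f a b c d y); auto. }
  assert (E2 : forall x, x = a \/ x = b -> CI (fun y => k * f (x, y))%C c d = (k * CI (fun y => f (x, y)) c d)%C).
  { intros x Hx. apply isCI_unique. apply isCI_scal; apply CI_correct; apply (exCI_ver f a b c d x); auto. }
  rewrite !E1, !E2 by auto. ring.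
Qed.

Lemma rectI_ext f g a b c d : a <= b -> c <= d -> (forall s, onbd a b c d s -> f s = g s) ->
  rectI f a b c d = rectI g a b c d.
Proof.
  intros Hab Hcd H. unfold rectI.
  rewrite (CI_ext (fun x => f (x, c)) (fun x => g (x, c))), (CI_ext (fun x => f (x, d)) (fun x => g (x, d))),
   (CI_ext (fun x => f (a, x)) (fun x => g (a, x))), (CI_ext (fun x => f (b, x)) (fun x => g (b, x))); auto;
  intros t Ht; apply H; split; try split; simpl; lra.
Qed.

Lemma rectI_bound f a b c d M : a <= b -> c <= d -> (forall s, onbd a b c d s -> ccont f s) ->
  (forall s, onbd a b c d s -> Cmod (f s) <= M) ->
  Cmod (rectI f a b c d) <= 2 * ((b - a) + (d - c)) * M.
Proof.
  intros Hab Hcd Hf HM. unfold rectI.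
  assert (E1 : forall y, y = c \/ y = d -> Cmod (CI (fun x => f (x, y)) a b) <= (b - a) * M).
  { intros y Hy. apply isCI_bound with (f := fun x => f (x, y)); auto.
    intros t Ht. apply HM. split. split; simpl; lra. simpl; lra.
    apply CI_correct. apply (exCI_hor f a b c d y); auto. }
  assert (E2 : forall x, x = a \/ x = b -> Cmod (CI (fun y => f (x, y)) c d) <= (d - c) * M).
  { intros x Hx. apply isCI_bound with (f := fun y => f (x, y)); auto.
    intros t Ht. apply HM. split. split; simpl; lra. simpl; lra.
    apply CI_correct. apply (exCI_ver f a b c d x); auto. }
  assert (X1 := E1 c (or_introl eq_refl)). assert (X2 := E1 d (or_intror eq_refl)).
  assert (X3 := E2 a (or_introl eq_refl)). assert (X4 := E2 b (or_intror eq_refl)).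
  unfold Cminus.
  eapply Rle_trans. apply Cmod_triangle. rewrite Cmod_opp, Cmod_mult, Cmod_Ci.
  eapply Rle_trans. apply Rplus_le_compat_r. eapply Rle_trans. apply Cmod_triangle. apply Rplus_le_compat_r.
  apply Cmod_triangle. rewrite Cmod_opp, Cmod_mult, Cmod_Ci. lra.
Qed.

(** * Goursat's theorem by bisection *)

Lemma pow_half_small (w d : R) : 0 < d -> exists n : nat, w * (/2)^n < d.
Proof.
  intros Hd.
  destruct (Rle_dec w 0) as [Hw|Hw].
  - exists 0%nat. simpl. lra.
  - assert (Hw' : 0 < w) by lra.
    destruct (pow_lt_1_zero (/2) ltac:(rewrite Rabs_pos_eq; lra) (d / w)) as [N HN].
    apply Rdiv_lt_0_compat; auto. exists N. specialize (HN N (le_n N)).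
    rewrite Rabs_pos_eq in HN by (apply pow_le; lra).
    apply Rmult_lt_compat_l with (r := w) in HN; auto. replace (w * (d / w)) with d in HN by (field; lra). auto.
Qed.

Lemma nested_point (x : nat -> R) (w : R) : 0 <= w ->
  (forall n, x n <= x (S n) <= x n + w * (/2)^n / 2) ->
  exists p, forall n, x n <= p <= x n + w * (/2)^n.
Proof.
  intros Hw H.
  assert (Hp : forall n, 0 <= w * (/2)^n) by (intros; apply Rmult_le_pos; auto; apply pow_le; lra).
  assert (H1 : forall n k, x n <= x (n + k)%nat <= x n + w * (/2)^n - w * (/2)^(n+k)).
  { intros n k. induction k. rewrite Nat.add_0_r. split; lra.
    rewrite Nat.add_succ_r. specialize (H (n+k)%nat). simpl. specialize (Hp (n + k)%nat). lra. }
  destruct (completeness (fun y => exists n, y = x n)) as [p [Hub Hlub]].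
  - exists (x 0%nat + w). intros y [n ->]. specialize (H1 0%nat n). specialize (Hp n). simpl in *. lra.
  - exists (x 0%nat). exists 0%nat. auto.
  - exists p. intros n. split. apply Hub. exists n; auto.
    apply Hlub. intros y [m ->]. destruct (Nat.le_gt_cases n m).
    + specialize (H1 n (m-n)%nat). replace (n + (m-n))%nat with m in H1 by lia. specialize (Hp m). lra.
    + specialize (H1 m (n-m)%nat). replace (m + (n-m))%nat with n in H1 by lia. specialize (Hp n). lra.
Qed.

(* Goursat's bisection, as an induction principle on rectangles. *)
Lemma bisection_rect (P : R -> R -> R -> R -> Prop) (a c w h : R) :
  0 <= w -> 0 <= h ->
  (forall x y u v, 0 <= u -> 0 <= v ->
     a <= x -> x + 2 * u <= a + w -> c <= y -> y + 2 * v <= c + h ->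
     P x y u v -> P (x+u) y u v -> P x (y+v) u v -> P (x+u) (y+v) u v -> P x y (2*u) (2*v)) ->
  (forall p q, a <= p <= a + w -> c <= q <= c + h -> exists n0, forall n x y, (n0 <= n)%nat ->
     a <= x -> x + w * (/2)^n <= a + w -> c <= y -> y + h * (/2)^n <= c + h ->
     x <= p <= x + w * (/2)^n -> y <= q <= y + h * (/2)^n -> P x y (w * (/2)^n) (h * (/2)^n)) ->
  P a c w h.
Proof.
  intros Hw Hh Hsplit Hloc. apply NNPP. intros Hbad.
  set (W := fun n => w * (/2)^n). set (Hn := fun n => h * (/2)^n).
  assert (HW : forall n, 0 <= W n) by (intros; apply Rmult_le_pos; auto; apply pow_le; lra).
  assert (HH : forall n, 0 <= Hn n) by (intros; apply Rmult_le_pos; auto; apply pow_le; lra).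
  assert (HWS : forall n, W n = 2 * W (S n)) by (intros; unfold W; simpl; field).
  assert (HHS : forall n, Hn n = 2 * Hn (S n)) by (intros; unfold Hn; simpl; field).
  (* All rectangles of one generation have the same size, so a descending chain of bad ones is
     recorded by lower left corners alone. *)
  set (B := fun n (s : R * R) => a <= fst s /\ fst s + W n <= a + w /\ c <= snd s /\ snd s + Hn n <= c + h /\
     ~ P (fst s) (snd s) (W n) (Hn n)).
  assert (Hstep : forall n s, B n s -> exists t, B (S n) t /\ fst s <= fst t <= fst s + W n / 2 /\ snd s <= snd t <= snd s + Hn n / 2).
  { intros n [x y] [H1 [H2 [H3 [H4 H5]]]]. simpl in *.
    assert (A1 := HW (S n)). assert (A2 := HH (S n)). assert (A3 := HWS n). assert (A4 := HHS n).
    apply NNPP. intros Hno. apply H5. rewrite A3, A4.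
    assert (Hsub : forall x' y', x' = x \/ x' = x + W (S n) -> y' = y \/ y' = y + Hn (S n) -> P x' y' (W (S n)) (Hn (S n))).
    { intros x' y' Hx Hy. apply NNPP. intros Hx'. apply Hno. exists (x', y').
      unfold B; simpl. split; [|destruct Hx, Hy; subst; lra].
      destruct Hx, Hy; subst; repeat split; try lra; auto. }
    apply Hsplit; auto; lra. }
  set (nxt := fun n s => epsilon (inhabits s) (fun t => B (S n) t /\ fst s <= fst t <= fst s + W n / 2 /\ snd s <= snd t <= snd s + Hn n / 2)).
  set (sq := fix sq n := match n with O => (a, c) | S m => nxt m (sq m) end).
  assert (HB : forall n, B n (sq n)).
  { induction n.
    - unfold B, W, Hn; simpl. rewrite !Rmult_1_r. repeat split; try lra. auto.
    - simpl. exact (proj1 (epsilon_spec (inhabits (sq n)) _ (Hstep n (sq n) IHn))). }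
  assert (HS : forall n, fst (sq n) <= fst (sq (S n)) <= fst (sq n) + W n / 2 /\ snd (sq n) <= snd (sq (S n)) <= snd (sq n) + Hn n / 2).
  { intros n. exact (proj2 (epsilon_spec (inhabits (sq n)) _ (Hstep n (sq n) (HB n)))). }
  destruct (nested_point (fun n => fst (sq n)) w Hw (fun n => proj1 (HS n))) as [p Hp].
  destruct (nested_point (fun n => snd (sq n)) h Hh (fun n => proj2 (HS n))) as [q Hq].
  destruct (Hloc p q) as [n0 Hn0].
  { specialize (Hp 0%nat). simpl in Hp. lra. } { specialize (Hq 0%nat). simpl in Hq. lra. }
  destruct (HB n0) as [H1 [H2 [H3 [H4 H5]]]]. apply H5. apply Hn0; auto.
Qed.

(** Computed explicitly, for the affine part that Goursat's argument subtracts. *)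
Lemma rectI_affine (k l : C) a b c d : rectI (fun s => k + l * s)%C a b c d = 0%C.
Proof.
  unfold rectI.
  assert (E1 : forall y, CI (fun x => k + l * (x, y))%C a b = (RtoC (b - a) * k + l * (((b^2-a^2)/2)%R, (y*(b-a))%R))%C).
  { intros y. apply isCI_unique. apply isCI_plus. apply isCI_const. apply isCI_scal. apply isCI_pair. split; simpl.
    - replace ((b*(b*1)-a*(a*1))/2) with (minus (b^2/2) (a^2/2)) by (unfold minus, plus, opp; simpl; field).
      apply (is_RInt_derive (V := R_CompleteNormedModule) (fun x => x^2/2)).
      intros x _. auto_derive; auto. simpl; field. intros; apply continuous_id.
    - replace (y*(b-a)) with (scal (b - a) y) by (unfold scal; simpl; unfold mult; simpl; ring).
      apply (is_RInt_const (V := R_NormedModule)). }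
  assert (E2 : forall x, CI (fun y => k + l * (x, y))%C c d = (RtoC (d - c) * k + l * ((x * (d-c))%R, ((d^2-c^2)/2)%R))%C).
  { intros x. apply isCI_unique. apply isCI_plus. apply isCI_const. apply isCI_scal. apply isCI_pair. split; simpl.
    - replace (x*(d-c)) with (scal (d - c) x) by (unfold scal; simpl; unfold mult; simpl; ring).
      apply (is_RInt_const (V := R_NormedModule)).
    - replace ((d*(d*1)-c*(c*1))/2) with (minus (d^2/2) (c^2/2)) by (unfold minus, plus, opp; simpl; field).
      apply (is_RInt_derive (V := R_CompleteNormedModule) (fun x => x^2/2)).
      intros y _. auto_derive; auto. simpl; field. intros; apply continuous_id. }
  rewrite !E1, !E2. destruct k, l. unfold RtoC, Ci, Cminus, Cplus, Copp, Cmult; simpl. f_equal; field.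
Qed.

Definition cholo (f : C -> C) (a b c d : R) : Prop := forall s, inrect a b c d s -> exists l, cdiff f s l.

Lemma cholo_ccont f a b c d : cholo f a b c d -> forall s, inrect a b c d s -> ccont f s.
Proof. intros H s Hs. destruct (H s Hs) as [l Hl]. eapply cdiff_ccont; eauto. Qed.

Lemma goursat f a b c d : a <= b -> c <= d -> cholo f a b c d -> rectI f a b c d = 0%C.
Proof.
  intros Hab Hcd Hf. apply Cmod_zero_of_small. intros eps He.
  set (S := (b - a) + (d - c)).
  assert (HS : 0 <= S) by (unfold S; lra).
  (* The target is [eta] times the squared half-perimeter. This quantity is the sum of its values on
     the four quarters, so it passes through the bisection unchanged. The 1 covers a degenerate
     rectangle. *)
  set (eta := eps / (S * S + 1)).
  assert (Heta : 0 < eta) by (unfold eta; apply Rdiv_lt_0_compat; nra).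
  assert (Hmain : Cmod (rectI f a (a + (b-a)) c (c + (d - c))) <= eta * (((b-a)+(d-c)) * ((b-a)+(d-c)))).
  2:{ replace (a + (b - a)) with b in Hmain by ring. replace (c + (d - c)) with d in Hmain by ring.
      eapply Rle_trans. apply Hmain. fold S.
      assert (E : eta * (S * S + 1) = eps) by (unfold eta; field; nra). nra. }
  apply (bisection_rect (fun x y u v => Cmod (rectI f x (x + u) y (y + v)) <= eta * ((u+v)*(u+v)))); try lra.
  - intros x y u v Hu Hv H1 H2 H3 H4 P1 P2 P3 P4.
    assert (Hc : forall s, inrect x (x + 2*u) y (y + 2*v) s -> ccont f s).
    { intros s [K1 K2]. apply (cholo_ccont f a b c d); auto. split; lra. }
    rewrite (rectI_split_hor f x (x+u) (x+2*u)); [|lra|lra|intros s [K _]; auto].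
    rewrite (rectI_split_ver f x (x+u) y (y+v) (y+2*v)); try lra.
    2:{ intros s [[K1 K2] _]; apply Hc; split; lra. }
    rewrite (rectI_split_ver f (x+u) (x+2*u) y (y+v) (y+2*v)); try lra.
    2:{ intros s [[K1 K2] _]; apply Hc; split; lra. }
    replace (x + 2 * u) with (x + u + u) by ring. replace (y + 2 * v) with (y + v + v) by ring.
    eapply Rle_trans. apply Cmod_triangle.
    eapply Rle_trans. apply Rplus_le_compat; apply Cmod_triangle. nra.
  - intros p q Hp Hq.
    assert (Hpq : inrect a b c d (p, q)) by (split; simpl; lra).
    destruct (Hf _ Hpq) as [l Hl].
    (* Half of [eta], because the perimeter is twice [u + v]. *)
    destruct (proj1 (cdiff_small _ _ _) Hl (eta / 2)) as [dl [Hdl K]]. lra.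
    destruct (pow_half_small S dl Hdl) as [n0 Hn0]. exists n0.
    intros n x y Hn H1 H2 H3 H4 H5 H6.
    assert (Hpw : (/2)^n <= (/2)^n0).
    { replace n with (n0 + (n - n0))%nat by lia. rewrite pow_add.
      assert (0 < (/2)^n0) by (apply pow_lt; lra).
      assert ((/2)^(n-n0) <= 1). { rewrite <- (pow1 (n-n0)). apply pow_incr; lra. }
      nra. }
    assert (Hpn : 0 < (/2)^n) by (apply pow_lt; lra).
    set (u := (b - a) * (/2)^n) in *. set (v := (d - c) * (/2)^n) in *.
    assert (Hu : 0 <= u) by (unfold u; apply Rmult_le_pos; lra).
    assert (Hv : 0 <= v) by (unfold v; apply Rmult_le_pos; lra).
    assert (Huv : u + v < dl). { unfold u, v. unfold S in *. nra. }
    set (g := fun s => (f s + (- (f (p,q) + - l * (p,q)) + - l * s))%C).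
    assert (E : rectI f x (x+u) y (y+v) = rectI g x (x+u) y (y+v)).
    { unfold g. rewrite rectI_plus; try lra. rewrite rectI_affine. ring.
      intros s [[K1 K2] _]. apply (cholo_ccont f a b c d); auto. split; lra.
      intros s _. apply ccont_plus. apply ccont_const. apply ccont_mult. apply ccont_const. apply ccont_id. }
    rewrite E.
    eapply Rle_trans. apply rectI_bound with (M := eta / 2 * (u + v)); try lra.
    + intros s [[K1 K2] _]. unfold g. apply ccont_plus. apply (cholo_ccont f a b c d); auto. split; lra.
      apply ccont_plus. apply ccont_const. apply ccont_mult. apply ccont_const. apply ccont_id.
    + intros s [[K1 K2] _].
      assert (Hd : Cmod (s - (p, q)) <= u + v).
      { eapply Rle_trans. apply Cmod_re_im. destruct s as [s1 s2]. simpl in *.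
        apply Rplus_le_compat; apply Rabs_le; lra. }
      replace (g s) with (f s - f (p,q) - l * (s - (p,q)))%C by (unfold g; ring).
      eapply Rle_trans. apply K. lra. apply Rmult_le_compat_l; lra.
    + replace (x + u - x) with u by ring. replace (y + v - y) with v by ring. nra.
Qed.

(** * Primitives, residues and Cauchy's formula *)

Lemma Ci_sq : (Ci * Ci)%C = (- RtoC 1)%C.
Proof. apply C_ext; simpl; ring. Qed.

Lemma is_derive_C (g : R -> C) (t : R) (l : C) :
  (forall eps, 0 < eps -> exists d, 0 < d /\ forall u, Rabs (u - t) < d ->
     Cmod (g u - g t - l * RtoC (u - t)) <= eps * Rabs (u - t)) ->
  is_derive (V := C_R_NormedModule) g t l.
Proof.
  intros H. split. apply is_linear_scal_l.
  intros x Hx eps. apply (is_filter_lim_locally_unique t x) in Hx. subst x.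
  destruct (H eps (cond_pos eps)) as [d [Hd K]]. exists (mkposreal d Hd). intros u Hu.
  rewrite norm_C_R. specialize (K u Hu).
  eapply Rle_trans; [|exact K]. apply Req_le. f_equal. rewrite scal_R_Cmult.
  rewrite (Cmult_comm l). reflexivity.
Qed.

Lemma cdiff_hor F x y l : cdiff F (x, y) l -> is_derive (V := C_R_NormedModule) (fun t => F (t, y)) x l.
Proof.
  intros H. apply is_derive_C. intros eps He. destruct (proj1 (cdiff_small _ _ _) H eps He) as [d [Hd K]].
  exists d. split; auto. intros u Hu. specialize (K (u, y)).
  replace ((u, y) - (x, y))%C with (RtoC (u - x)) in K by (unfold RtoC, Cminus, Cplus, Copp; simpl; f_equal; ring).
  rewrite Cmod_R in K. auto.
Qed.

Lemma cdiff_ver F x y l : cdiff F (x, y) l -> is_derive (V := C_R_NormedModule) (fun t => F (x, t)) y (Ci * l)%C.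
Proof.
  intros H. apply is_derive_C. intros eps He. destruct (proj1 (cdiff_small _ _ _) H eps He) as [d [Hd K]].
  exists d. split; auto. intros u Hu. specialize (K (x, u)).
  replace ((x, u) - (x, y))%C with (Ci * RtoC (u - y))%C in K by (unfold RtoC, Ci, Cminus, Cplus, Copp, Cmult; simpl; f_equal; ring).
  rewrite Cmod_mult, Cmod_R, Cmod_Ci, Rmult_1_l in K.
  replace (Ci * l * RtoC (u - y))%C with (l * (Ci * RtoC (u - y)))%C by ring. auto.
Qed.

(** The primitive is required on the boundary only, so the lemma applies to the inverse square of
    [s - p] with the pole inside. *)
Lemma rectI_primitive F f a b c d : a <= b -> c <= d ->
  (forall s, onbd a b c d s -> cdiff F s (f s) /\ ccont f s) -> rectI f a b c d = 0%C.
Proof.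
  intros Hab Hcd H. unfold rectI.
  assert (E1 : forall y, y = c \/ y = d -> CI (fun x => f (x, y)) a b = (F (b, y) - F (a, y))%C).
  { intros y Hy. apply isCI_unique. apply (is_RInt_derive (V := C_R_CompleteNormedModule) (fun x => F (x, y)));
    rewrite Rmin_left, Rmax_right by lra; intros x Hx;
    assert (Hb : onbd a b c d (x, y)) by (split; [split|]; simpl; lra).
    apply cdiff_hor. apply H; auto. apply rcont_continuous, rcont_hor. apply H; auto. }
  assert (E2 : forall x, x = a \/ x = b -> CI (fun y => f (x, y)) c d = (- Ci * (F (x, d) - F (x, c)))%C).
  { intros x Hx.
    assert (X : isCI (fun y => Ci * f (x, y))%C c d (F (x, d) - F (x, c))%C).
    { apply (is_RInt_derive (V := C_R_CompleteNormedModule) (fun y => F (x, y)));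
      rewrite Rmin_left, Rmax_right by lra; intros y Hy;
      assert (Hb : onbd a b c d (x, y)) by (split; [split|]; simpl; lra).
      apply cdiff_ver. apply H; auto. apply rcont_continuous.
      apply (rcont_ver (fun s => Ci * f s)%C). apply ccont_mult. apply ccont_const. apply H; auto. }
    apply (isCI_scal _ _ _ (- Ci)%C) in X. apply isCI_unique.
    apply isCI_ext with (3 := X); auto. intros y _.
    replace (- Ci * (Ci * f (x, y)))%C with (- (Ci * Ci) * f (x, y))%C by ring.
    rewrite Ci_sq. ring. }
  rewrite !E1, !E2 by auto.
  replace (Ci * (- Ci * (F (b, d) - F (b, c))))%C with (- (Ci * Ci) * (F (b, d) - F (b, c)))%C by ring.
  replace (Ci * (- Ci * (F (a, d) - F (a, c))))%C with (- (Ci * Ci) * (F (a, d) - F (a, c)))%C by ring.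
  rewrite Ci_sq. ring.
Qed.

(** Of the five pieces, the four around the small square contain no singularity and vanish by
    Goursat. *)
Lemma rectI_shrink f a b c d p dl : 0 < dl -> a < Re p - dl -> Re p + dl < b -> c < Im p - dl -> Im p + dl < d ->
  (forall s, inrect a b c d s -> s <> p -> exists l, cdiff f s l) ->
  rectI f a b c d = rectI f (Re p - dl) (Re p + dl) (Im p - dl) (Im p + dl).
Proof.
  intros Hd H1 H2 H3 H4 H.
  assert (Hc : forall s, inrect a b c d s -> Re s <> Re p \/ Im s <> Im p -> ccont f s).
  { intros s Hs Hn. destruct (H s Hs) as [l Hl]. intros E. subst. lra. eapply cdiff_ccont; eauto. }
  rewrite (rectI_split_hor f a (Re p - dl) b c d); [|lra|lra|].
  2:{ intros s [Hs Hs']. apply Hc; auto. lra. }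
  rewrite (rectI_split_hor f (Re p - dl) (Re p + dl) b c d); [|lra|lra|].
  2:{ intros s [[Hs1 Hs2] Hs']. apply Hc. split; lra. lra. }
  rewrite (rectI_split_ver f (Re p - dl) (Re p + dl) c (Im p - dl) d); [|lra|lra|].
  2:{ intros s [[Hs1 Hs2] Hs']. apply Hc. split; lra. lra. }
  rewrite (rectI_split_ver f (Re p - dl) (Re p + dl) (Im p - dl) (Im p + dl) d); [|lra|lra|].
  2:{ intros s [[Hs1 Hs2] Hs']. apply Hc. split; lra. lra. }
  rewrite (goursat f a (Re p - dl) c d); [|lra|lra|].
  2:{ intros s [Hs1 Hs2]. apply H. split; lra. intros ->. lra. }
  rewrite (goursat f (Re p + dl) b c d); [|lra|lra|].
  2:{ intros s [Hs1 Hs2]. apply H. split; lra. intros ->. lra. }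
  rewrite (goursat f _ _ c (Im p - dl)); [|lra|lra|].
  2:{ intros s [Hs1 Hs2]. apply H. split; lra. intros ->. lra. }
  rewrite (goursat f _ _ (Im p + dl) d); [|lra|lra|].
  2:{ intros s [Hs1 Hs2]. apply H. split; lra. intros ->. lra. }
  ring.
Qed.

Lemma sum_sq_pos x dl : 0 < dl -> x^2 + dl^2 > 0.
Proof. intros. assert (0 < dl^2) by (apply pow_lt; auto). assert (H1 := pow2_ge_0 x). lra. Qed.

Lemma RInt_atan m dl : 0 < dl -> is_RInt (fun x => dl / ((x - m)^2 + dl^2)) (m - dl) (m + dl) (PI / 2).
Proof.
  intros Hd.
  replace (PI / 2) with (minus (atan ((m + dl - m) / dl)) (atan ((m - dl - m) / dl))).
  2:{ unfold minus, plus, opp; simpl. replace ((m + dl - m) / dl) with 1 by (field; lra).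
      replace ((m - dl - m) / dl) with (Ropp 1) by (field; lra). rewrite atan_opp, atan_1. field. }
  assert (Hp : forall x, (x - m)^2 + dl^2 <> 0) by (intros; apply Rgt_not_eq, sum_sq_pos; auto).
  apply (is_RInt_derive (V := R_CompleteNormedModule) (fun x => atan ((x - m) / dl))).
  - intros x _. auto_derive; auto. field. split; [apply Hp | lra].
  - intros x _. apply (ex_derive_continuous (V := R_NormedModule)). auto_derive. simpl in Hp. apply Hp.
Qed.

Lemma RInt_odd m dl : 0 < dl -> is_RInt (fun x => (x - m) / ((x - m)^2 + dl^2)) (m - dl) (m + dl) 0.
Proof.
  intros Hd.
  replace 0 with (minus (/2 * ln ((m + dl - m)^2 + dl^2)) (/2 * ln ((m - dl - m)^2 + dl^2))).
  2:{ unfold minus, plus, opp; simpl. replace (m - dl - m) with (- dl) by ring. replace (m + dl - m) with dl by ring.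
      replace (- dl * (- dl * 1)) with (dl * (dl * 1)) by ring. ring. }
  assert (Hp : forall x, (x - m)^2 + dl^2 > 0) by (intros; apply sum_sq_pos; auto).
  apply (is_RInt_derive (V := R_CompleteNormedModule) (fun x => /2 * ln ((x - m)^2 + dl^2))).
  - intros x _. specialize (Hp x). auto_derive. simpl in *; lra. simpl in *. field. lra.
  - intros x _. specialize (Hp x). apply (ex_derive_continuous (V := R_NormedModule)). auto_derive. simpl in *; lra.
Qed.

Ltac inv_den H :=
  match type of H with ?p <> 0 =>
    match goal with |- _ = _ / ?d => replace d with p by (simpl; ring) end;
    simpl in H |- *; field; let Q := fresh in (intros Q; apply H; rewrite <- Q; ring)
  end.

(** Each side contributes a quarter turn: on it [/ (s - p)] has an arctangent part with integral PI
    / 2 up to sign and an odd part with integral 0. *)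
Lemma rectI_inv_square p dl : 0 < dl ->
  rectI (fun s => / (s - p))%C (Re p - dl) (Re p + dl) (Im p - dl) (Im p + dl) = (2 * PI * Ci)%C.
Proof.
  intros Hd. destruct p as [m n]. simpl. unfold rectI.
  assert (I1 := RInt_atan m dl Hd). assert (I2 := RInt_odd m dl Hd).
  assert (I3 := RInt_atan n dl Hd). assert (I4 := RInt_odd n dl Hd).
  assert (Hp : forall x y, (x - y)^2 + dl^2 <> 0) by (intros; apply Rgt_not_eq, sum_sq_pos; auto).
  assert (E1 : CI (fun x => / ((x, (n - dl)%R) - (m, n)))%C (m - dl) (m + dl) = (0, PI/2)).
  { apply isCI_unique, isCI_pair. split; simpl.
    - apply (is_RInt_ext (fun x => (x - m) / ((x - m)^2 + dl^2))); auto. intros x _. specialize (Hp x m).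
      simpl; inv_den Hp.
    - apply (is_RInt_ext (fun x => dl / ((x - m)^2 + dl^2))); auto. intros x _. specialize (Hp x m).
      simpl; inv_den Hp. }
  assert (E2 : CI (fun x => / ((x, (n + dl)%R) - (m, n)))%C (m - dl) (m + dl) = (0, -(PI/2))).
  { apply isCI_unique, isCI_pair. split; simpl.
    - apply (is_RInt_ext (fun x => (x - m) / ((x - m)^2 + dl^2))); auto. intros x _. specialize (Hp x m).
      simpl; inv_den Hp.
    - apply (is_RInt_ext (fun x => opp (dl / ((x - m)^2 + dl^2)))). intros x _. specialize (Hp x m).
      unfold opp; simpl; inv_den Hp. apply (is_RInt_opp (V := R_NormedModule)); auto. }
  assert (E3 : CI (fun y => / (((m + dl)%R, y) - (m, n)))%C (n - dl) (n + dl) = (PI/2, 0)).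
  { apply isCI_unique, isCI_pair. split; simpl.
    - apply (is_RInt_ext (fun x => dl / ((x - n)^2 + dl^2))); auto. intros x _. specialize (Hp x n).
      simpl; inv_den Hp.
    - replace 0 with (- 0) by ring. apply (is_RInt_ext (fun x => opp ((x - n) / ((x - n)^2 + dl^2)))). intros x _. specialize (Hp x n).
      unfold opp; simpl; inv_den Hp. apply (is_RInt_opp (V := R_NormedModule)); auto. }
  assert (E4 : CI (fun y => / (((m - dl)%R, y) - (m, n)))%C (n - dl) (n + dl) = (-(PI/2), 0)).
  { apply isCI_unique, isCI_pair. split; simpl.
    - apply (is_RInt_ext (fun x => opp (dl / ((x - n)^2 + dl^2)))). intros x _. specialize (Hp x n).
      unfold opp; simpl; inv_den Hp. apply (is_RInt_opp (V := R_NormedModule)); auto.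
    - replace 0 with (- 0) by ring. apply (is_RInt_ext (fun x => opp ((x - n) / ((x - n)^2 + dl^2)))). intros x _. specialize (Hp x n).
      unfold opp; simpl; inv_den Hp. apply (is_RInt_opp (V := R_NormedModule)); auto. }
  rewrite E1, E2, E3, E4. unfold Ci, RtoC, Cminus, Cplus, Copp, Cmult; simpl. f_equal; field.
Qed.

Lemma onbd_square_Cmod p dl s : 0 < dl -> onbd (Re p - dl) (Re p + dl) (Im p - dl) (Im p + dl) s -> dl <= Cmod (s - p) <= 2 * dl.
Proof.
  intros Hd [[H1 H2] H3]. destruct s as [x y], p as [m n]. simpl in *. split.
  - assert (K1 := re_le_Cmod ((x, y) - (m, n))%C). assert (K2 := im_le_Cmod ((x, y) - (m, n))%C). simpl in *.
    destruct H3 as [H3|[H3|[H3|H3]]]; subst; [eapply Rle_trans; [|apply K1] .. | eapply Rle_trans; [|apply K2] | eapply Rle_trans; [|apply K2]];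
    (unfold Rabs; destruct (Rcase_abs _); lra).
  - eapply Rle_trans. apply Cmod_re_im. simpl.
    assert (Rabs (x + - m) <= dl) by (apply Rabs_le; lra). assert (Rabs (y + - n) <= dl) by (apply Rabs_le; lra). lra.
Qed.

Lemma cdiff_inv_shift (p s : C) : s <> p -> cdiff (fun s => / (s - p))%C s (- / ((s - p) * (s - p)))%C.
Proof.
  intros Hs.
  assert (Hn : (s - p <> 0)%C) by (apply Cminus_eq_contra; auto).
  eapply cdiff_eq. apply (cdiff_inv (fun s => s - p)%C); auto. apply cdiff_minus. apply cdiff_id. apply cdiff_const.
  field. auto.
Qed.

(** On a small square [E] is [E p + l * (s - p)] plus a remainder. After division, the constant term
    has a primitive, the linear one gives [2 * PI * Ci * l], and the remainder contributes
    arbitrarily little. *)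
Lemma residue2 E a b c d p l : a < Re p < b -> c < Im p < d -> cholo E a b c d -> cdiff E p l ->
  rectI (fun s => E s / ((s - p) * (s - p)))%C a b c d = (2 * PI * Ci * l)%C.
Proof.
  intros Hp1 Hp2 HE Hl.
  set (f := (fun s => E s / ((s - p) * (s - p)))%C).
  assert (Hf : forall s, inrect a b c d s -> s <> p -> exists l, cdiff f s l).
  { intros s Hs Hn. destruct (HE s Hs) as [l' Hl']. eexists. unfold f, Cdiv.
    assert (Hn' : (s - p <> 0)%C) by (apply Cminus_eq_contra; auto).
    apply cdiff_mult. apply Hl'. apply (cdiff_inv (fun s => (s - p) * (s - p))%C). apply Cmult_neq_0; auto.
    apply cdiff_mult; apply cdiff_minus; try apply cdiff_id; apply cdiff_const. }
  apply Ceq_minus. apply Cmod_zero_of_small. intros eps He.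
  (* On the boundary of a square of half-side [dl] the remainder is at most [eps / 8 / dl], and the
     perimeter is [8 * dl]. *)
  destruct (proj1 (cdiff_small _ _ _) Hl (eps / 8)) as [d0 [Hd0 K]]. lra.
  set (r := Rmin (Rmin (Re p - a) (b - Re p)) (Rmin (Im p - c) (d - Im p))).
  assert (Hr : 0 < r) by (repeat apply Rmin_pos; lra).
  assert (R1 := Rmin_l (Rmin (Re p - a) (b - Re p)) (Rmin (Im p - c) (d - Im p))).
  assert (R2 := Rmin_r (Rmin (Re p - a) (b - Re p)) (Rmin (Im p - c) (d - Im p))).
  assert (R3 := Rmin_l (Re p - a) (b - Re p)). assert (R4 := Rmin_r (Re p - a) (b - Re p)).
  assert (R5 := Rmin_l (Im p - c) (d - Im p)). assert (R6 := Rmin_r (Im p - c) (d - Im p)). fold r in R1, R2.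
  set (dl := Rmin r d0 / 4).
  assert (Hm := Rmin_pos _ _ Hr Hd0). assert (Hm1 := Rmin_l r d0). assert (Hm2 := Rmin_r r d0).
  assert (Hdl : 0 < dl) by (unfold dl; lra).
  rewrite (rectI_shrink f a b c d p dl); auto; try (unfold dl; lra).
  set (rho := fun s => ((E s - E p - l * (s - p)) / ((s - p) * (s - p)))%C).
  set (g1 := fun s => (E p * / ((s - p) * (s - p)))%C). set (g2 := fun s => (l * / (s - p))%C).
  assert (Hb : forall s, onbd (Re p - dl) (Re p + dl) (Im p - dl) (Im p + dl) s -> inrect a b c d s /\ s <> p /\ (s - p)%C <> 0%C /\ Cmod (s - p) < d0).
  { intros s Hs. assert (Hq := onbd_square_Cmod p dl s Hdl Hs). destruct Hs as [[Hs1 Hs2] _].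
    assert (Hz : (s - p)%C <> 0%C) by (apply Cmod_pos_nz; lra).
    split. split; unfold dl in *; lra. split. intros ->. apply Hz. ring. split; auto. unfold dl in *; lra. }
  assert (C2 : forall s, onbd (Re p - dl) (Re p + dl) (Im p - dl) (Im p + dl) s -> ccont (fun s => / (s - p))%C s).
  { intros s Hs. destruct (Hb s Hs) as [_ [_ [Hz _]]]. apply (ccont_inv (fun s => s - p)%C); auto. apply ccont_minus. apply ccont_id. apply ccont_const. }
  assert (C1 : forall s, onbd (Re p - dl) (Re p + dl) (Im p - dl) (Im p + dl) s -> ccont (fun s => / ((s - p) * (s - p)))%C s).
  { intros s Hs. destruct (Hb s Hs) as [_ [_ [Hz _]]]. apply (ccont_inv (fun s => (s - p) * (s - p))%C). apply Cmult_neq_0; auto.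
    apply ccont_mult; apply ccont_minus; try apply ccont_id; apply ccont_const. }
  assert (C3 : forall s, onbd (Re p - dl) (Re p + dl) (Im p - dl) (Im p + dl) s -> ccont rho s).
  { intros s Hs. destruct (Hb s Hs) as [Hi _]. unfold rho, Cdiv. apply ccont_mult; auto.
    apply ccont_minus. apply ccont_minus. apply (cholo_ccont E a b c d); auto. apply ccont_const.
    apply ccont_mult. apply ccont_const. apply ccont_minus. apply ccont_id. apply ccont_const. }
  rewrite (rectI_ext f (fun s => (g1 s + g2 s) + rho s)%C); try lra.
  2:{ intros s Hs. destruct (Hb s Hs) as [_ [_ [Hz _]]]. unfold f, g1, g2, rho. field. auto. }
  rewrite rectI_plus; try lra; auto.
  2:{ intros s Hs. apply ccont_plus; apply ccont_mult; auto; apply ccont_const. }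
  rewrite rectI_plus; try lra.
  2,3: intros s Hs; apply ccont_mult; auto; apply ccont_const.
  unfold g1 at 1, g2 at 1. rewrite !rectI_scal; try lra; auto.
  rewrite rectI_inv_square; auto.
  rewrite (rectI_primitive (fun s => - / (s - p))%C (fun s => / ((s - p) * (s - p)))%C); try lra.
  2:{ intros s Hs. split; auto. destruct (Hb s Hs) as [_ [Hz [Hz' _]]]. eapply cdiff_eq. apply cdiff_opp.
      apply cdiff_inv_shift; auto. field; auto. }
  replace (E p * 0 + l * (2 * PI * Ci) + rectI rho (Re p - dl) (Re p + dl) (Im p - dl) (Im p + dl) - 2 * PI * Ci * l)%C
    with (rectI rho (Re p - dl) (Re p + dl) (Im p - dl) (Im p + dl)) by ring.
  eapply Rle_trans. apply rectI_bound with (M := eps / 8 / dl); try lra; auto.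
  - intros s Hs. destruct (Hb s Hs) as [_ [_ [Hz Hz2]]]. unfold rho. assert (Hq := onbd_square_Cmod p dl s Hdl Hs).
    rewrite Cmod_div, Cmod_mult by (apply Cmult_neq_0; auto).
    assert (K' := K s Hz2).
    apply Rmult_le_reg_r with (Cmod (s - p) * Cmod (s - p)). nra.
    unfold Rdiv at 1. rewrite Rmult_assoc, Rinv_l, Rmult_1_r by nra.
    eapply Rle_trans. apply K'.
    replace (eps / 8 / dl * (Cmod (s - p) * Cmod (s - p))) with (eps / 8 * Cmod (s - p) * (Cmod (s - p) / dl)) by (field; lra).
    assert (1 <= Cmod (s - p) / dl). { apply Rmult_le_reg_r with dl; auto. unfold Rdiv. rewrite Rmult_assoc, Rinv_l; lra. }
    rewrite <- (Rmult_1_r (eps / 8 * Cmod (s - p))) at 1. apply Rmult_le_compat_l; auto.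
    apply Rmult_le_pos; lra.
  - apply Req_le. field. lra.
Qed.

(** A simple pole is the case [E s = F s * (s - p)] of [residue2], where the derivative of [E] at
    [p] is [F p]. *)
Lemma residue1 F a b c d p : a < Re p < b -> c < Im p < d -> cholo F a b c d ->
  rectI (fun s => F s / (s - p))%C a b c d = (2 * PI * Ci * F p)%C.
Proof.
  intros H1 H2 HF.
  rewrite (rectI_ext _ (fun s => (F s * (s - p)) / ((s - p) * (s - p)))%C); try lra.
  - apply residue2; auto.
    + intros s Hs. destruct (HF s Hs) as [l Hl]. eexists. apply cdiff_mult. apply Hl. apply cdiff_minus. apply cdiff_id. apply cdiff_const.
    + destruct (HF p) as [l Hl]. split; lra. eapply cdiff_eq. apply cdiff_mult. apply Hl. apply cdiff_minus. apply cdiff_id. apply cdiff_const.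
      simpl. ring.
  - intros s [Hs Hb]. field. apply Cminus_eq_contra. intros ->. lra.
Qed.

(* Cauchy's formula, with the second order remainder of the Cauchy kernel. *)
Lemma cauchy_taylor F p0 r M l : 0 < r ->
  cholo F (Re p0 - r) (Re p0 + r) (Im p0 - r) (Im p0 + r) ->
  (forall s, inrect (Re p0 - r) (Re p0 + r) (Im p0 - r) (Im p0 + r) s -> Cmod (F s) <= M) ->
  cdiff F p0 l ->
  Cmod l <= 2 * M / r /\
  forall p, Cmod (p - p0) <= r / 2 -> Cmod (F p - F p0 - l * (p - p0)) <= 4 * M / (r * r) * (Cmod (p - p0))^2.
Proof.
  intros Hr HF HM Hl.
  assert (HM0 : 0 <= M). { eapply Rle_trans. apply (Cmod_ge_0 (F p0)). apply HM. split; lra. }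
  (* The lower bound on PI absorbs the perimeter factor 8 into the clean constants 2 and 4. *)
  assert (Hpi : 3 < PI) by (assert (H := PI2_3_2); lra).
  assert (HpiC : (2 * PI * Ci)%C <> 0%C).
  { apply Cmult_neq_0. apply Cmult_neq_0; intros E; apply RtoC_inj in E; lra. apply Ci_nz. }
  assert (HpiM : Cmod (2 * PI * Ci) = 2 * PI).
  { rewrite !Cmod_mult, Cmod_Ci, !Cmod_R, !Rabs_pos_eq; lra. }
  set (B := fun g => rectI g (Re p0 - r) (Re p0 + r) (Im p0 - r) (Im p0 + r)).
  assert (Hbd : forall s, onbd (Re p0 - r) (Re p0 + r) (Im p0 - r) (Im p0 + r) s -> (s - p0)%C <> 0%C /\ r <= Cmod (s - p0)).
  { intros s Hs. assert (H := onbd_square_Cmod p0 r s Hr Hs). split; try lra. apply Cmod_pos_nz; lra. }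
  assert (R2 : B (fun s => F s / ((s - p0) * (s - p0)))%C = (2 * PI * Ci * l)%C).
  { unfold B. apply residue2; auto; lra. }
  assert (CF : forall s, onbd (Re p0 - r) (Re p0 + r) (Im p0 - r) (Im p0 + r) s -> ccont F s).
  { intros s [Hs _]. eapply cholo_ccont; eauto. }
  assert (Csub : forall q s, ccont (fun s => (s - q)%C) s).
  { intros. apply ccont_minus. apply ccont_id. apply ccont_const. }
  split.
  - assert (Hq : Cmod (2 * PI * Ci * l) <= 8 * r * (M / (r * r))).
    { rewrite <- R2. unfold B.
      replace (8 * r) with (2 * ((Re p0 + r - (Re p0 - r)) + (Im p0 + r - (Im p0 - r)))) by ring.
      apply rectI_bound; try lra.
      - intros s Hs. destruct (Hbd s Hs). apply ccont_div; auto. apply Cmult_neq_0; auto. apply ccont_mult; auto.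
      - intros s Hs. destruct (Hbd s Hs) as [Hz Hq]. rewrite Cmod_div by (apply Cmult_neq_0; auto). rewrite Cmod_mult.
        apply Rmult_le_compat. apply Cmod_ge_0. left. apply Rinv_0_lt_compat. nra. apply HM. apply Hs.
        apply Rinv_le_contravar; nra. }
    rewrite Cmod_mult, HpiM in Hq.
    replace (8 * r * (M / (r * r))) with (4 * (2 * M / r)) in Hq by (field; lra).
    assert (0 <= 2 * M / r). { apply Rmult_le_pos. lra. left. apply Rinv_0_lt_compat; lra. }
    assert (Hlp := Cmod_ge_0 l). nra.
  - intros p Hp.
    assert (Hpn : forall s, onbd (Re p0 - r) (Re p0 + r) (Im p0 - r) (Im p0 + r) s -> (s - p)%C <> 0%C /\ r / 2 <= Cmod (s - p)).
    { intros s Hs. destruct (Hbd s Hs) as [Hz Hq]. assert (H := Cmod_triangle (s - p) (p - p0)).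
      replace (s - p + (p - p0))%C with (s - p0)%C in H by ring. split; try lra. apply Cmod_pos_nz; lra. }
    assert (Hin : Re p0 - r < Re p < Re p0 + r /\ Im p0 - r < Im p < Im p0 + r).
    { assert (A1 := re_le_Cmod (p - p0)%C). assert (A2 := im_le_Cmod (p - p0)%C).
      destruct p as [x y], p0 as [m n]; simpl in *.
      assert (Rabs (x + - m) <= r / 2) by lra. assert (Rabs (y + - n) <= r / 2) by lra.
      apply Rabs_le_between in H, H0. lra. }
    assert (R1 : B (fun s => F s / (s - p))%C = (2 * PI * Ci * F p)%C) by (unfold B; apply residue1; auto; lra).
    assert (R0 : B (fun s => F s / (s - p0))%C = (2 * PI * Ci * F p0)%C) by (unfold B; apply residue1; auto; lra).
    (* The part of [F s / (s - p)] left after the first two terms of the expansion of the kernel in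
       powers of [p - p0]. *)
    set (K := fun s => (F s * ((p - p0) * (p - p0)) / ((s - p) * ((s - p0) * (s - p0))))%C).
    assert (CK : forall s, onbd (Re p0 - r) (Re p0 + r) (Im p0 - r) (Im p0 + r) s -> ccont K s).
    { intros s Hs. destruct (Hbd s Hs), (Hpn s Hs). unfold K. apply ccont_div; repeat apply Cmult_neq_0; auto;
      repeat apply ccont_mult; auto; apply ccont_const. }
    assert (RK : B (fun s => F s / (s - p))%C = (B (fun s => F s / (s - p0)) + ((p - p0) * B (fun s => F s / ((s - p0) * (s - p0))) + B K))%C).
    { unfold B. rewrite <- rectI_scal; try lra.
      rewrite <- rectI_plus; try lra; auto. rewrite <- rectI_plus; try lra.
      apply rectI_ext; try lra. intros s Hs. destruct (Hbd s Hs), (Hpn s Hs). unfold K. field. auto.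
      all: intros s Hs; destruct (Hbd s Hs), (Hpn s Hs).
      apply ccont_div; auto. apply ccont_plus; auto.
      all: try (apply ccont_mult; [apply ccont_const|]).
      all: apply ccont_div; auto; try apply Cmult_neq_0; auto; apply ccont_mult; auto. }
    assert (EK : (B K = 2 * PI * Ci * (F p - F p0 - l * (p - p0)))%C).
    { rewrite R1, R0, R2 in RK.
      replace (B K) with (2 * PI * Ci * F p - (2 * PI * Ci * F p0 + (p - p0) * (2 * PI * Ci * l)))%C by (rewrite RK; ring). ring. }
    assert (HK : Cmod (B K) <= 8 * r * (2 * M * Cmod (p - p0) ^ 2 / (r * r * r))).
    { unfold B.
      replace (8 * r) with (2 * ((Re p0 + r - (Re p0 - r)) + (Im p0 + r - (Im p0 - r)))) by ring.
      apply rectI_bound; try lra; auto. intros s Hs. destruct (Hbd s Hs), (Hpn s Hs). unfold K.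
      rewrite Cmod_div by (repeat apply Cmult_neq_0; auto). rewrite !Cmod_mult.
      replace (2 * M * Cmod (p - p0) ^ 2 / (r * r * r)) with (M * (Cmod (p-p0) * Cmod (p - p0)) * / (r / 2 * (r * r))) by (field; lra).
      assert (Q := Cmod_ge_0 (p - p0)%C).
      apply Rmult_le_compat.
      - apply Rmult_le_pos. apply Cmod_ge_0. nra.
      - left. apply Rinv_0_lt_compat. apply Rmult_lt_0_compat. lra. nra.
      - apply Rmult_le_compat_r. nra. apply HM. apply Hs.
      - apply Rinv_le_contravar. apply Rmult_lt_0_compat. lra. nra. apply Rmult_le_compat; try lra. nra. nra. }
    rewrite EK, Cmod_mult, HpiM in HK.
    set (X := Cmod (F p - F p0 - l * (p - p0))) in *.
    assert (0 <= X) by apply Cmod_ge_0.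
    set (Y := 4 * M / (r * r) * Cmod (p - p0) ^ 2).
    assert (0 <= Y). { unfold Y. apply Rmult_le_pos. apply Rmult_le_pos. lra. left; apply Rinv_0_lt_compat; nra. apply pow2_ge_0. }
    replace (8 * r * (2 * M * Cmod (p - p0) ^ 2 / (r * r * r))) with (4 * Y) in HK by (unfold Y; field; lra). nra.
Qed.

(** * Series of holomorphic functions *)

(** Convergence as a relation: the operators [CLim_seq] and [CSeries] are total and return a value
    even without convergence. *)
Definition Clim (u : nat -> C) (l : C) : Prop :=
  is_lim_seq (fun n => Re (u n)) (Re l) /\ is_lim_seq (fun n => Im (u n)) (Im l).

Definition Cser (a : nat -> C) (l : C) : Prop :=
  is_series (fun n => Re (a n)) (Re l) /\ is_series (fun n => Im (a n)) (Im l).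

(** The upper index is excluded, unlike in [sum_n]; this is the shift in [Csum_parts]. *)
Fixpoint Csum (a : nat -> C) (n : nat) : C :=
  match n with O => RtoC 0 | S m => (Csum a m + a m)%C end.

Lemma Clim_CLim_seq u l : Clim u l -> CLim_seq u = l.
Proof.
  intros [H1 H2]. unfold CLim_seq. rewrite (is_lim_seq_unique _ _ H1), (is_lim_seq_unique _ _ H2).
  destruct l; reflexivity.
Qed.

Lemma Cser_CSeries a l : Cser a l -> CSeries a = l.
Proof.
  intros [H1 H2]. unfold CSeries. rewrite (is_series_unique _ _ H1), (is_series_unique _ _ H2).
  destruct l; reflexivity.
Qed.

Lemma Clim_eps u l : Clim u l <-> forall eps, 0 < eps -> exists N, forall n, (N <= n)%nat -> Cmod (u n - l) < eps.
Proof.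
  split.
  - intros [H1 H2] eps He. apply is_lim_seq_spec in H1. apply is_lim_seq_spec in H2.
    assert (He2 : 0 < eps / 2) by lra.
    destruct (H1 (mkposreal _ He2)) as [N1 K1]. destruct (H2 (mkposreal _ He2)) as [N2 K2].
    exists (max N1 N2). intros n Hn. eapply Rle_lt_trans. apply Cmod_re_im.
    specialize (K1 n ltac:(lia)). specialize (K2 n ltac:(lia)). simpl in *.
    unfold Rminus in *. unfold Re, Im in *. lra.
  - intros H. split; apply is_lim_seq_spec; intros eps; destruct (H eps (cond_pos eps)) as [N K]; exists N; intros n Hn;
    (eapply Rle_lt_trans; [|apply (K n Hn)]).
    apply (re_le_Cmod (u n - l)%C). apply (im_le_Cmod (u n - l)%C).
Qed.

Lemma Clim_unique u l m : Clim u l -> Clim u m -> l = m.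
Proof. intros H1 H2. apply Clim_CLim_seq in H1. apply Clim_CLim_seq in H2. congruence. Qed.

Lemma Clim_ext u v l : (forall n, u n = v n) -> Clim u l -> Clim v l.
Proof. intros H. replace v with u; auto. apply functional_extensionality; auto. Qed.

Lemma Clim_ext_from u v l N : (forall n, (N <= n)%nat -> u n = v n) -> Clim u l -> Clim v l.
Proof.
  intros H Hu. apply Clim_eps. intros eps He. destruct (proj1 (Clim_eps _ _) Hu eps He) as [N' K].
  exists (max N N'). intros n Hn. rewrite <- H by lia. apply K. lia.
Qed.

Lemma Clim_const k : Clim (fun _ => k) k.
Proof. split; apply is_lim_seq_const. Qed.

Lemma Clim_plus u v l m : Clim u l -> Clim v m -> Clim (fun n => u n + v n)%C (l + m)%C.
Proof. intros [H1 H2] [H3 H4]. split; simpl; apply (is_lim_seq_plus' _ _ _ _); auto. Qed.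

Lemma Clim_mult u v l m : Clim u l -> Clim v m -> Clim (fun n => u n * v n)%C (l * m)%C.
Proof.
  intros [H1 H2] [H3 H4]. split; simpl.
  - apply (is_lim_seq_minus' _ _ _ _); apply (is_lim_seq_mult' _ _ _ _); auto.
  - apply (is_lim_seq_plus' _ _ _ _); apply (is_lim_seq_mult' _ _ _ _); auto.
Qed.

Lemma Clim_opp u l : Clim u l -> Clim (fun n => - u n)%C (- l)%C.
Proof. intros [H1 H2]. split; [apply (proj1 (is_lim_seq_opp (fun n => Re (u n)) (Finite (Re l)))) | apply (proj1 (is_lim_seq_opp (fun n => Im (u n)) (Finite (Im l))))]; auto. Qed.

Lemma Clim_minus u v l m : Clim u l -> Clim v m -> Clim (fun n => u n - v n)%C (l - m)%C.
Proof. intros. apply Clim_plus; auto. apply Clim_opp; auto. Qed.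

Lemma Clim_ccont f u p : ccont f p -> Clim u p -> Clim (fun n => f (u n)) (f p).
Proof.
  intros Hf Hu. apply Clim_eps. intros eps He. destruct (Hf eps He) as [d [Hd K]].
  destruct (proj1 (Clim_eps _ _) Hu d Hd) as [N HN]. exists N. auto.
Qed.

Lemma Clim_RtoC u (l : R) : is_lim_seq u l -> Clim (fun n => RtoC (u n)) (RtoC l).
Proof. intros H. split; simpl; auto. apply is_lim_seq_const. Qed.

Lemma Clim_incr u l : Clim (fun n => u (S n)) l <-> Clim u l.
Proof. split; intros [H1 H2]; split; [apply (is_lim_seq_incr_1 (fun n => Re (u n))) | apply (is_lim_seq_incr_1 (fun n => Im (u n)))
  | apply (is_lim_seq_incr_1 (fun n => Re (u n))) in H1 | apply (is_lim_seq_incr_1 (fun n => Im (u n))) in H2]; auto. Qed.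

Lemma Clim_bound u l M : (forall n, Cmod (u n) <= M) -> Clim u l -> Cmod l <= M.
Proof.
  intros H Hu. apply Rnot_lt_le. intros Hlt.
  destruct (proj1 (Clim_eps _ _) Hu (Cmod l - M)) as [N K]. lra.
  specialize (K N (le_n N)). specialize (H N). assert (Q := Cmod_triangle_inv l (u N)).
  rewrite Cmod_minus_sym in Q. lra.
Qed.

Lemma Clim_zero_bound u (v : nat -> R) : (forall n, Cmod (u n) <= v n) -> is_lim_seq v 0 -> Clim u 0%C.
Proof.
  intros H Hv. apply Clim_eps. intros eps He. apply is_lim_seq_spec in Hv.
  destruct (Hv (mkposreal _ He)) as [N K]. exists N. intros n Hn. specialize (K n Hn). simpl in K.
  replace (u n - 0)%C with (u n) by ring. eapply Rle_lt_trans. apply H.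
  rewrite Rminus_0_r in K. apply Rabs_def2 in K. lra.
Qed.

Lemma Csum_parts a n : Csum a (S n) = (sum_n (fun k => Re (a k)) n, sum_n (fun k => Im (a k)) n).
Proof.
  induction n.
  - rewrite !sum_O. simpl. apply C_ext; simpl; unfold Re, Im; simpl; try ring.
  - change (Csum a (S (S n))) with (Csum a (S n) + a (S n))%C. rewrite IHn, !sum_Sn. reflexivity.
Qed.

Lemma Cser_Clim a l : Cser a l <-> Clim (Csum a) l.
Proof.
  rewrite <- (Clim_incr (Csum a)). unfold Cser, Clim.
  split; intros [H1 H2]; split.
  - eapply is_lim_seq_ext. 2: apply H1. intros n; cbv beta. rewrite Csum_parts. reflexivity.
  - eapply is_lim_seq_ext. 2: apply H2. intros n; cbv beta. rewrite Csum_parts. reflexivity.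
  - eapply is_lim_seq_ext in H1. apply H1. intros n. rewrite Csum_parts. reflexivity.
  - eapply is_lim_seq_ext in H2. apply H2. intros n. rewrite Csum_parts. reflexivity.
Qed.

Lemma Cser_unique a l m : Cser a l -> Cser a m -> l = m.
Proof. intros H1 H2. apply Cser_CSeries in H1. apply Cser_CSeries in H2. congruence. Qed.

Lemma Cser_ext a b l : (forall n, a n = b n) -> Cser a l -> Cser b l.
Proof. intros H. replace b with a; auto. apply functional_extensionality; auto. Qed.

Lemma Csum_plus a b n : Csum (fun k => a k + b k)%C n = (Csum a n + Csum b n)%C.
Proof. induction n; simpl. ring. rewrite IHn. ring. Qed.

Lemma Csum_scal c a n : Csum (fun k => c * a k)%C n = (c * Csum a n)%C.
Proof. induction n; simpl. ring. rewrite IHn. ring. Qed.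

Lemma Csum_ext a b n : (forall k, (k < n)%nat -> a k = b k) -> Csum a n = Csum b n.
Proof. induction n; simpl; intros H; auto. rewrite IHn, H; auto. Qed.

Lemma Cser_plus a b l m : Cser a l -> Cser b m -> Cser (fun n => a n + b n)%C (l + m)%C.
Proof.
  rewrite !Cser_Clim. intros. eapply Clim_ext. intros n. symmetry. apply Csum_plus. apply Clim_plus; auto.
Qed.

Lemma Cser_scal c a l : Cser a l -> Cser (fun n => c * a n)%C (c * l)%C.
Proof.
  rewrite !Cser_Clim. intros. eapply Clim_ext. intros n. symmetry. apply Csum_scal. apply Clim_mult; auto. apply Clim_const.
Qed.

Lemma Cser_minus a b l m : Cser a l -> Cser b m -> Cser (fun n => a n - b n)%C (l - m)%C.
Proof.
  intros Ha Hb. replace (l - m)%C with (l + (- (1)) * m)%C by ring.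
  eapply Cser_ext. 2: apply Cser_plus; [apply Ha | apply (Cser_scal (- (1))%C), Hb]. intros n; simpl; ring.
Qed.

Lemma Csum_S a n : Csum a (S n) = (a 0%nat + Csum (fun k => a (S k)) n)%C.
Proof. induction n. simpl; ring. simpl in *. rewrite IHn. ring. Qed.

Lemma Cser_shift a l : Cser (fun k => a (S k)) l -> Cser a (a 0%nat + l)%C.
Proof.
  rewrite !Cser_Clim. intros H. apply Clim_incr. eapply Clim_ext. intros n. symmetry. apply Csum_S.
  apply Clim_plus; auto. apply Clim_const.
Qed.

Lemma Cser_telescope (u : nat -> C) l : Clim u l <-> Cser (fun n => match n with O => u O | S m => u (S m) - u m end)%C l.
Proof.
  rewrite Cser_Clim. rewrite <- (Clim_incr (Csum _)).
  assert (E : forall n, Csum (fun n => match n with O => u O | S m => u (S m) - u m end)%C (S n) = u n).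
  { induction n. simpl; ring. change (Csum ?a (S (S n))) with (Csum a (S n) + a (S n))%C. rewrite IHn. ring. }
  split; intros H; eapply Clim_ext; try apply H; intros n; cbv beta; rewrite E; auto.
Qed.

Lemma Cmod_Csum_le a (M : nat -> R) n : (forall k, Cmod (a k) <= M k) -> Cmod (Csum a (S n)) <= sum_n M n.
Proof.
  intros H. induction n.
  - simpl. rewrite Cplus_0_l, sum_O. auto.
  - change (Csum a (S (S n))) with (Csum a (S n) + a (S n))%C. rewrite sum_Sn. eapply Rle_trans. apply Cmod_triangle.
    apply Rplus_le_compat; auto.
Qed.

Lemma Cser_dominated a M : (forall k, Cmod (a k) <= M k) -> ex_series M -> exists l, Cser a l.
Proof.
  intros H HM.
  assert (H1 : ex_series (fun k => Re (a k))).
  { apply (ex_series_le (V := R_CompleteNormedModule)) with M; auto. intros n. eapply Rle_trans. apply re_le_Cmod. auto. }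
  assert (H2 : ex_series (fun k => Im (a k))).
  { apply (ex_series_le (V := R_CompleteNormedModule)) with M; auto. intros n. eapply Rle_trans. apply im_le_Cmod. auto. }
  destruct H1 as [x Hx]. destruct H2 as [y Hy]. exists (x, y). split; auto.
Qed.

Lemma sum_n_le_series (M : nat -> R) m n : (forall k, 0 <= M k) -> is_series M m -> sum_n M n <= m.
Proof.
  intros H Hm. apply (is_lim_seq_incr_compare (sum_n M) m Hm).
  intros k. rewrite sum_Sn. unfold plus; simpl. specialize (H (S k)). lra.
Qed.

Lemma Cser_bound a M l m : (forall k, Cmod (a k) <= M k) -> is_series M m -> Cser a l -> Cmod l <= m.
Proof.
  intros H Hm Hl. apply Cser_Clim in Hl. apply Clim_incr in Hl. eapply Clim_bound. 2: apply Hl.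
  intros n. simpl. eapply Rle_trans. apply (Cmod_Csum_le a M n H).
  apply sum_n_le_series; auto. intros k. eapply Rle_trans. apply Cmod_ge_0. apply H.
Qed.

Lemma Cser_tail a l N : Cser a l -> Cser (fun k => a (N + k)%nat) (l - Csum a N)%C.
Proof.
  rewrite !Cser_Clim. intros H.
  assert (E : forall n, Csum (fun k => a (N + k)%nat) n = (Csum a (n + N) - Csum a N)%C).
  { induction n. simpl; ring. simpl. rewrite IHn, Nat.add_comm. ring. }
  eapply Clim_ext. intros n. symmetry. apply E. apply Clim_minus. 2: apply Clim_const.
  apply Clim_eps. intros eps He. destruct (proj1 (Clim_eps _ _) H eps He) as [N' K]. exists N'. intros; apply K; lia.
Qed.

(** Squares replace discs because Cauchy's estimates are obtained on rectangles. *)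
Definition insq (p0 : C) (r : R) (s : C) : Prop := inrect (Re p0 - r) (Re p0 + r) (Im p0 - r) (Im p0 + r) s.

Lemma insq_of_Cmod p0 r s : Cmod (s - p0) <= r -> insq p0 r s.
Proof.
  intros H. assert (A1 := re_le_Cmod (s - p0)%C). assert (A2 := im_le_Cmod (s - p0)%C).
  destruct s as [x y], p0 as [m n]; unfold insq, inrect; simpl in *.
  assert (Q : Rabs (x + - m) <= r) by lra. assert (Q' : Rabs (y + - n) <= r) by lra.
  apply Rabs_le_between in Q, Q'. lra.
Qed.

Lemma insq_center p0 r : 0 <= r -> insq p0 r p0.
Proof. intros; split; lra. Qed.

Lemma insq_Cmod p0 r s : insq p0 r s -> Cmod (s - p0) <= 2 * r.
Proof.
  intros [H1 H2]. eapply Rle_trans. apply Cmod_re_im. destruct s as [x y], p0 as [m n]; simpl in *.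
  assert (Rabs (x + - m) <= r) by (apply Rabs_le; lra). assert (Rabs (y + - n) <= r) by (apply Rabs_le; lra). lra.
Qed.

(** Weierstrass's theorem. Cauchy's estimates bound the derivatives of the terms by [2 * M k / r],
    and their second order remainders by [4 * M k / (r * r)] times the squared distance. Both are
    summable, so the remainder of the sum is again quadratic. *)
Lemma holo_series (f : nat -> C -> C) (F : C -> C) (l : nat -> C) (M : nat -> R) (p0 : C) (r : R) :
  0 < r -> (forall k s, insq p0 r s -> exists m, cdiff (f k) s m) ->
  (forall k s, insq p0 r s -> Cmod (f k s) <= M k) -> ex_series M ->
  (forall k, cdiff (f k) p0 (l k)) ->
  (forall s, insq p0 r s -> Cser (fun k => f k s) (F s)) ->
  exists L, Cser l L /\ cdiff F p0 L.
Proof.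
  intros Hr Hh HM HMs Hl HF.
  assert (T : forall k, Cmod (l k) <= 2 * M k / r /\
     forall p, Cmod (p - p0) <= r / 2 -> Cmod (f k p - f k p0 - l k * (p - p0)) <= 4 * M k / (r * r) * (Cmod (p - p0))^2).
  { intros k. apply cauchy_taylor; auto. intros s Hs. apply Hh; auto. }
  destruct HMs as [m Hm].
  assert (Hm2 : forall c, is_series (fun k => c * M k) (c * m)).
  { intros c. apply (is_series_scal c M m Hm). }
  destruct (Cser_dominated l (fun k => (2 / r) * M k)) as [L HL].
  { intros k. eapply Rle_trans. apply T. apply Req_le. field. lra. }
  { eexists. apply Hm2. }
  exists L. split; auto. apply cdiff_small. intros eps He.
  assert (Hm0 : 0 <= m).
  { eapply Rle_trans. 2: apply (sum_n_le_series M m 0); auto. rewrite sum_O.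
    eapply Rle_trans. apply Cmod_ge_0. apply (HM 0%nat p0). apply insq_center; lra.
    intros k. eapply Rle_trans. apply Cmod_ge_0. apply (HM k p0). apply insq_center; lra. }
  (* The added 1 keeps [K] positive even if all the bounds vanish. *)
  set (K := 4 * m / (r * r) + 1).
  assert (HK : 0 < K). { unfold K. assert (0 <= 4 * m / (r * r)). apply Rmult_le_pos. lra. left; apply Rinv_0_lt_compat; nra. lra. }
  exists (Rmin (r / 2) (eps / K)). split. apply Rmin_pos. lra. apply Rdiv_lt_0_compat; auto.
  intros p Hp. assert (P1 := Rmin_l (r/2) (eps/K)). assert (P2 := Rmin_r (r/2) (eps/K)).
  assert (B : Cmod (F p - F p0 - L * (p - p0)) <= 4 / (r * r) * Cmod (p - p0) ^ 2 * m).
  { apply Cser_bound with (a := fun k => (f k p - f k p0 - l k * (p - p0))%C) (M := fun k => 4 / (r * r) * Cmod (p - p0) ^ 2 * M k).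
    - intros k. eapply Rle_trans. apply T. lra. apply Req_le. field. lra.
    - apply Hm2.
    - apply Cser_minus. apply Cser_minus; apply HF. apply insq_of_Cmod. lra. apply insq_center; lra.
      eapply Cser_ext. 2: { replace (L * (p - p0))%C with ((p - p0) * L)%C by ring. apply Cser_scal. apply HL. }
      intros n; simpl; ring. }
  eapply Rle_trans. apply B.
  assert (Q := Cmod_ge_0 (p - p0)%C).
  replace (4 / (r * r) * Cmod (p - p0) ^ 2 * m) with ((4 * m / (r * r)) * Cmod (p - p0) * Cmod (p - p0)) by (field; lra).
  apply Rmult_le_compat_r; auto.
  assert (E : eps = K * (eps / K)) by (field; lra). rewrite E.
  apply Rmult_le_compat; try lra. apply Rmult_le_pos. lra. left; apply Rinv_0_lt_compat; nra. unfold K; lra.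
Qed.

(** * The reciprocal of the Gamma function *)

Lemma Cexp_plus a b : Cexp (a + b) = (Cexp a * Cexp b)%C.
Proof.
  destruct a as [a1 a2], b as [b1 b2]. apply C_ext; simpl; rewrite exp_plus, ?cos_plus, ?sin_plus; ring.
Qed.

Lemma Cexp_0 : Cexp 0 = 1%C.
Proof. apply C_ext; simpl; rewrite exp_0, ?cos_0, ?sin_0; ring. Qed.

Lemma Cexp_RtoC (x : R) : Cexp x = RtoC (exp x).
Proof. apply C_ext; simpl; rewrite ?cos_0, ?sin_0; ring. Qed.

Lemma Cmod_Cexp z : Cmod (Cexp z) = exp (Re z).
Proof.
  unfold Cmod, Cexp; simpl.
  replace (_ + _) with (exp (Re z) * exp (Re z)).
  - apply sqrt_square. left. apply exp_pos.
  - assert (H := sin2_cos2 (Im z)). unfold Rsqr in H.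
    replace (exp (Re z) * exp (Re z)) with (exp (Re z) * exp (Re z) * (sin (Im z) * sin (Im z) + cos (Im z) * cos (Im z))) by (rewrite H; ring). ring.
Qed.

Lemma Cexp_nz z : Cexp z <> 0%C.
Proof. apply Cmod_pos_nz. rewrite Cmod_Cexp. apply exp_pos. Qed.

Lemma Cexp_opp z : Cexp (- z) = (/ Cexp z)%C.
Proof.
  assert (H : (Cexp (- z) * Cexp z = 1)%C). { rewrite <- Cexp_plus. replace (- z + z)%C with (RtoC 0) by ring. apply Cexp_0. }
  assert (Hz := Cexp_nz z).
  replace (Cexp (- z)) with (Cexp (- z) * Cexp z * / Cexp z)%C by (field; auto). rewrite H. ring.
Qed.

Lemma derivable_small (f : R -> R) (l : R) : is_derive f 0 l -> forall eps, 0 < eps ->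
  exists d, 0 < d /\ forall x, Rabs x < d -> Rabs (f x - f 0 - l * x) <= eps * Rabs x.
Proof.
  intros [_ H] eps He. specialize (H 0 (fun P HP => HP)). destruct (H (mkposreal _ He)) as [d Hd].
  exists d. split. apply cond_pos. intros x Hx.
  assert (Hb : ball (M := AbsRing_UniformSpace R_AbsRing) 0 d x).
  { unfold ball; simpl; unfold AbsRing_ball, abs, minus, plus, opp; simpl. replace (x + - 0) with x by ring. auto. }
  specialize (Hd x Hb). unfold norm, minus, plus, opp, scal in Hd; simpl in Hd. unfold abs, mult in Hd; simpl in Hd.
  unfold Rminus. replace (f x + - f 0 + - (l * x)) with (f x + - f 0 + - ((x + - 0) * l)) by ring.
  replace (eps * Rabs x) with (eps * Rabs (x + - 0)) by (f_equal; f_equal; ring). exact Hd.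
Qed.

Lemma cdiff_Cexp_0 : cdiff Cexp 0 1.
Proof.
  apply cdiff_small. intros eps He.
  assert (D1 : is_derive exp 0 1) by (auto_derive; auto; rewrite exp_0; ring).
  assert (D2 : is_derive cos 0 0) by (auto_derive; auto; rewrite sin_0; ring).
  assert (D3 : is_derive sin 0 1) by (auto_derive; auto; rewrite cos_0; ring).
  destruct (derivable_small _ _ D1 (Rmin 1 (eps / 8))) as [d1 [Hd1 K1]]. apply Rmin_pos; lra.
  destruct (derivable_small _ _ D2 (eps / 16)) as [d2 [Hd2 K2]]. lra.
  destruct (derivable_small _ _ D3 (eps / 16)) as [d3 [Hd3 K3]]. lra.
  exists (Rmin (Rmin d1 d2) (Rmin d3 (Rmin 1 (eps / 8)))). split.
  { repeat apply Rmin_pos; lra. }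
  intros s Hs. replace (s - 0)%C with s in * by ring. rewrite Cexp_0.
  assert (M1 := Rmin_l (Rmin d1 d2) (Rmin d3 (Rmin 1 (eps / 8)))). assert (M2 := Rmin_r (Rmin d1 d2) (Rmin d3 (Rmin 1 (eps / 8)))).
  assert (M3 := Rmin_l d1 d2). assert (M4 := Rmin_r d1 d2). assert (M5 := Rmin_l d3 (Rmin 1 (eps / 8))).
  assert (M6 := Rmin_r d3 (Rmin 1 (eps / 8))). assert (M7 := Rmin_l 1 (eps/8)). assert (M8 := Rmin_r 1 (eps/8)).
  assert (A1 := re_le_Cmod s). assert (A2 := im_le_Cmod s).
  destruct s as [x y]. simpl in A1, A2. set (m := Cmod (x, y)) in *.
  specialize (K1 x ltac:(lra)). specialize (K2 y ltac:(lra)). specialize (K3 y ltac:(lra)).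
  rewrite exp_0 in K1. rewrite cos_0 in K2. rewrite sin_0 in K3.
  assert (X := Rabs_pos x). assert (Y := Rabs_pos y).
  set (E := exp x - 1 - 1 * x) in *. set (Cc := cos y - 1 - 0 * y) in *. set (Ss := sin y - 0 - 1 * y) in *.
  assert (KE1 : Rabs E <= Rabs x) by (eapply Rle_trans; [apply K1|]; nra).
  assert (KE2 : Rabs E <= eps / 8 * m) by (eapply Rle_trans; [apply K1|]; nra).
  assert (Hex : exp x = 1 + x + E) by (unfold E; ring).
  assert (Hc : cos y = 1 + Cc) by (unfold Cc; ring).
  assert (Hsn : sin y = y + Ss) by (unfold Ss; ring).
  eapply Rle_trans. apply Cmod_re_im.
  unfold Cexp; simpl. rewrite Hex, Hc, Hsn.
  replace ((1 + x + E) * (1 + Cc) + - (1) + - (1 * x - 0 * y)) with (E + (1 + x + E) * Cc) by ring.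
  replace ((1 + x + E) * (y + Ss) + - 0 + - (1 * y + 0 * x)) with ((x + E) * y + (1 + x + E) * Ss) by ring.
  assert (HB : Rabs (1 + x + E) <= 3).
  { eapply Rle_trans. apply Rabs_triang. eapply Rle_trans. apply Rplus_le_compat_r. apply Rabs_triang. rewrite Rabs_R1. lra. }
  assert (HB2 : Rabs (x + E) <= eps / 4).
  { eapply Rle_trans. apply Rabs_triang. lra. }
  assert (T1 : Rabs (E + (1 + x + E) * Cc) <= eps / 8 * m + 3 * (eps / 16 * m)).
  { eapply Rle_trans. apply Rabs_triang. rewrite Rabs_mult. apply Rplus_le_compat; auto.
    apply Rmult_le_compat; auto using Rabs_pos. eapply Rle_trans. apply K2. apply Rmult_le_compat_l; lra. }
  assert (T2 : Rabs ((x + E) * y + (1 + x + E) * Ss) <= eps / 4 * m + 3 * (eps / 16 * m)).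
  { eapply Rle_trans. apply Rabs_triang. rewrite !Rabs_mult. apply Rplus_le_compat.
    apply Rmult_le_compat; auto using Rabs_pos.
    apply Rmult_le_compat; auto using Rabs_pos. eapply Rle_trans. apply K3. apply Rmult_le_compat_l; lra. }
  assert (0 <= m) by apply Cmod_ge_0. assert (0 <= eps * m) by nra. lra.
Qed.

Lemma cdiff_Cexp p : cdiff Cexp p (Cexp p).
Proof.
  apply cdiff_ext with (f := fun s => (Cexp p * Cexp (s - p))%C).
  - intros s. rewrite <- Cexp_plus. f_equal. ring.
  - eapply cdiff_eq. apply cdiff_mult. apply cdiff_const.
    apply (cdiff_comp (fun s => s - p)%C Cexp). apply cdiff_minus. apply cdiff_id. apply cdiff_const.
    cbv beta. replace (p - p)%C with (RtoC 0) by ring. apply cdiff_Cexp_0. simpl. ring.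
Qed.

(** Cauchy's estimate on the square of half-side 1, where the modulus of [Cexp] is at most
    [exp 1]. *)
Lemma Cexp_taylor : exists K, 0 < K /\ forall w, Cmod w <= / 2 -> Cmod (Cexp w - 1 - w) <= K * (Cmod w)^2.
Proof.
  exists (4 * exp 1). split. assert (H := exp_pos 1). lra.
  intros w Hw.
  destruct (cauchy_taylor Cexp 0 1 (exp 1) 1) as [_ H]; try lra.
  - intros s _. exists (Cexp s). apply cdiff_Cexp.
  - intros s [Hs _]. simpl in Hs. rewrite Cmod_Cexp. 
    destruct (Rle_lt_or_eq_dec (Re s) 1) as [H|H]; try lra. left; apply exp_increasing; auto. rewrite H; lra.
  - apply cdiff_Cexp_0.
  - specialize (H w). rewrite Cexp_0 in H. replace (w - 0)%C with w in H by ring.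
    replace (Cexp w - 1 - w)%C with (Cexp w - 1 - 1 * w)%C by ring.
    eapply Rle_trans. apply H. lra. apply Req_le. field.
Qed.

(** * Reciprocals of the Euler-Gauss approximants *)

Lemma exp_le_compat x y : x <= y -> exp x <= exp y.
Proof. intros [H|H]. left; apply exp_increasing; auto. subst; lra. Qed.

(** Reciprocal of the approximant in [CGamma]: an entire function of [s], with zeros where the
    approximant has poles. *)
Definition rgn (n : nat) (s : C) : C := (poch s (S n) / INR (fact n) * Cexp (- (s * RtoC (ln (INR n)))))%C.

Lemma ln_step_bounds n : (1 <= n)%nat -> / (INR n + 1) <= ln (INR n + 1) - ln (INR n) <= / INR n.
Proof.
  intros Hn. assert (Hp : 1 <= INR n) by (apply (le_INR 1); auto).
  rewrite <- ln_div by lra. split.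
  - assert (H : ln (INR n / (INR n + 1)) <= INR n / (INR n + 1) - 1).
    { assert (0 < INR n / (INR n + 1)) by (apply Rdiv_lt_0_compat; lra).
      assert (Q := exp_ineq1_le (ln (INR n / (INR n + 1)))). rewrite exp_ln in Q; lra. }
    rewrite ln_div in H by lra. rewrite ln_div by lra.
    replace (INR n / (INR n + 1) - 1) with (- / (INR n + 1)) in H by (field; lra). lra.
  - assert (0 < (INR n + 1) / INR n) by (apply Rdiv_lt_0_compat; lra).
    assert (Q := exp_ineq1_le (ln ((INR n + 1) / INR n))). rewrite exp_ln in Q by auto.
    replace ((INR n + 1) / INR n) with (1 + / INR n) in Q at 2 by (field; lra). lra.
Qed.

Lemma fact_C_nz n : RtoC (INR (fact n)) <> 0%C.
Proof. intros E. apply RtoC_inj in E. revert E. apply INR_fact_neq_0. Qed.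

Lemma RtoC_nz (x : R) : x <> 0 -> RtoC x <> 0%C.
Proof. intros H E. apply RtoC_inj in E. auto. Qed.

Definition rgratio (n : nat) (s : C) : C :=
  ((1 + s / (INR n + 1)) * Cexp (- (s * RtoC (ln (INR n + 1) - ln (INR n)))))%C.

Lemma rgn_S n s : rgn (S n) s = (rgn n s * rgratio n s)%C.
Proof.
  unfold rgn, rgratio.
  replace (- (s * RtoC (ln (INR (S n)))))%C with (- (s * RtoC (ln (INR n))) + - (s * RtoC (ln (INR n + 1) - ln (INR n))))%C.
  2:{ rewrite S_INR, RtoC_minus. ring. }
  rewrite Cexp_plus.
  change (poch s (S (S n))) with (poch s (S n) * (s + INR (S n)))%C.
  rewrite fact_simpl, mult_INR, S_INR. rewrite RtoC_mult, RtoC_plus.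
  assert (Hp := pos_INR n). field. split. rewrite <- RtoC_plus. apply RtoC_nz. lra.
  apply fact_C_nz.
Qed.

(* d_n = 1/n majorizes the product: |ratio - 1| <= C (1/n - 1/(n+1)) for |s| <= R. *)
Lemma rgratio_bound R0 : 0 <= R0 -> exists C0, 0 < C0 /\ forall n s, (1 <= n)%nat -> 2 * R0 <= INR n -> Cmod s <= R0 ->
  Cmod (rgratio n s - 1) <= C0 * (/ INR n - / INR (S n)).
Proof.
  intros HR. destruct Cexp_taylor as [K [HK HT]].
  exists (2 * (R0 + R0 * R0 + (1 + R0) * (K * (R0 * R0)) + 1)).
  assert (HKR : 0 <= K * (R0 * R0)) by (apply Rmult_le_pos; nra).
  split. nra.
  intros n s Hn Hn2 Hs. assert (Hp : 1 <= INR n) by (apply (le_INR 1); auto).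
  set (d := ln (INR n + 1) - ln (INR n)).
  assert (Hd := ln_step_bounds n Hn). fold d in Hd.
  assert (Hi : 0 < / (INR n + 1)) by (apply Rinv_0_lt_compat; lra).
  assert (Hi2 : / (INR n + 1) <= / INR n) by (apply Rinv_le_contravar; lra).
  assert (Hsm := Cmod_ge_0 s).
  set (w := (- (s * RtoC d))%C).
  assert (Hw : Cmod w <= R0 * / INR n).
  { unfold w. rewrite Cmod_opp, Cmod_mult, Cmod_R, Rabs_pos_eq by lra. apply Rmult_le_compat; lra. }
  assert (Hw2 : Cmod w <= / 2).
  { eapply Rle_trans. apply Hw. apply Rmult_le_reg_r with (INR n). lra. rewrite Rmult_assoc, Rinv_l by lra. lra. }
  specialize (HT w Hw2).
  set (E := (Cexp w - 1 - w)%C) in *.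
  set (q := (s / (INR n + 1))%C).
  assert (Hq : Cmod q <= R0 * / (INR n + 1)).
  { unfold q. rewrite <- RtoC_plus, Cmod_div, Cmod_R, Rabs_pos_eq by (try apply RtoC_nz; lra).
    apply Rmult_le_compat_r; lra. }
  unfold rgratio. fold d w q.
  replace (Cexp w) with (1 + w + E)%C by (unfold E; ring).
  replace ((1 + q) * (1 + w + E) - 1)%C with ((q + w) + (q * w + (1 + q) * E))%C by ring.
  assert (Hqw : Cmod (q + w) <= R0 * (/ INR n - / (INR n + 1))).
  { replace (q + w)%C with (s * RtoC (/ (INR n + 1) - d))%C.
    2:{ unfold q, w, Cdiv. rewrite RtoC_minus, RtoC_inv, RtoC_plus by lra. ring. }
    rewrite Cmod_mult, Cmod_R. apply Rmult_le_compat; auto using Rabs_pos. 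
    rewrite Rabs_minus_sym, Rabs_pos_eq; lra. }
  assert (Hsq : / INR n * / INR n <= 2 * (/ INR n - / (INR n + 1))).
  { replace (/ INR n - / (INR n + 1)) with (/ INR n * / (INR n + 1)) by (field; lra).
    assert (/ INR n <= 2 * / (INR n + 1)).
    { apply Rmult_le_reg_r with (INR n * (INR n + 1)). nra. 
      replace (/ INR n * (INR n * (INR n + 1))) with (INR n + 1) by (field; lra).
      replace (2 * / (INR n + 1) * (INR n * (INR n + 1))) with (2 * INR n) by (field; lra). lra. }
    assert (0 < / INR n) by (apply Rinv_0_lt_compat; lra). nra. }
  rewrite S_INR.
  set (D := / INR n - / (INR n + 1)) in *.
  assert (HI : 0 < / INR n) by (apply Rinv_0_lt_compat; lra).
  assert (Hq1 : Cmod q <= R0).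
  { eapply Rle_trans. apply Hq. assert (/ (INR n + 1) <= 1). { rewrite <- Rinv_1. apply Rinv_le_contravar; lra. } nra. }
  assert (HqN : Cmod q <= R0 * / INR n) by nra.
  assert (B1 : Cmod (q * w) <= R0 * R0 * (2 * D)).
  { rewrite Cmod_mult. apply Rle_trans with ((R0 * / INR n) * (R0 * / INR n)).
    apply Rmult_le_compat; auto using Cmod_ge_0. nra. }
  assert (B2 : Cmod ((1 + q) * E) <= (1 + R0) * (K * (R0 * R0)) * (2 * D)).
  { rewrite Cmod_mult. rewrite Rmult_assoc. apply Rmult_le_compat; auto using Cmod_ge_0.
    - eapply Rle_trans. apply Cmod_triangle. rewrite Cmod_1. lra.
    - eapply Rle_trans. apply HT. apply Rle_trans with (K * ((R0 * / INR n) * (R0 * / INR n))).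
      apply Rmult_le_compat_l. lra. simpl. rewrite Rmult_1_r. apply Rmult_le_compat; auto using Cmod_ge_0.
      replace (K * (R0 * R0) * (2 * D)) with (K * ((R0 * R0) * (2 * D))) by ring.
      apply Rmult_le_compat_l. lra. nra. }
  assert (HD : 0 <= D) by (unfold D; lra).
  eapply Rle_trans. apply Cmod_triangle. eapply Rle_trans. apply Rplus_le_compat_l. apply Cmod_triangle.
  nra.
Qed.

Lemma poch_bound R0 n : exists B, forall s, Cmod s <= R0 -> Cmod (poch s n) <= B.
Proof.
  induction n.
  - exists 1. intros; simpl. rewrite Cmod_1. lra.
  - destruct IHn as [B HB]. exists (B * (R0 + INR n)). intros s Hs. simpl. rewrite Cmod_mult.
    apply Rmult_le_compat; auto using Cmod_ge_0. eapply Rle_trans. apply Cmod_triangle.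
    rewrite Cmod_R, Rabs_pos_eq by apply pos_INR. lra.
Qed.

Lemma rgn_bound R0 n : exists B, 0 < B /\ forall s, Cmod s <= R0 -> Cmod (rgn n s) <= B.
Proof.
  destruct (poch_bound R0 (S n)) as [B HB].
  set (X := B * / INR (fact n) * exp (R0 * Rabs (ln (INR n)))).
  exists (Rabs X + 1). split. assert (H := Rabs_pos X). lra.
  intros s Hs. apply Rle_trans with X. 2: { assert (H := Rle_abs X). lra. }
  unfold rgn, X. rewrite Cmod_mult, Cmod_div, Cmod_Cexp, Cmod_R by apply fact_C_nz.
  assert (Hf : 0 < INR (fact n)) by (apply lt_0_INR, lt_O_fact).
  rewrite (Rabs_pos_eq (INR (fact n))) by lra.
  apply Rmult_le_compat.
  - apply Rmult_le_pos. apply Cmod_ge_0. left. apply Rinv_0_lt_compat; auto.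
  - left; apply exp_pos.
  - apply Rmult_le_compat_r. left. apply Rinv_0_lt_compat; auto. auto.
  - apply exp_le_compat. eapply Rle_trans. apply Rle_abs. eapply Rle_trans. apply re_le_Cmod.
    rewrite Cmod_opp, Cmod_mult, Cmod_R. apply Rmult_le_compat_r; auto using Rabs_pos.
Qed.

Definition rGamma (s : C) : C := CLim_seq (fun n => rgn n s).

(** The deviations of the successive ratios from 1 telescope to a total of at most 1 / 2. The upper
    bounds give uniform convergence; the lower bounds show that the limit vanishes only where
    [rgn N] already does. *)
Lemma rgn_geom_bounds R0 : 0 <= R0 -> exists N C0, (1 <= N)%nat /\ 0 < C0 /\
  C0 * / INR N <= / 2 /\
  (forall n s, (N <= n)%nat -> Cmod s <= R0 -> Cmod (rgratio n s - 1) <= C0 * (/ INR n - / INR (S n))) /\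
  (forall k s, Cmod s <= R0 -> Cmod (rgn (N + k) s) <= Cmod (rgn N s) * exp (C0 * (/ INR N - / INR (N + k)))) /\
  (forall k s, Cmod s <= R0 -> Cmod (rgn N s) * (1 - C0 * (/ INR N - / INR (N + k))) <= Cmod (rgn (N + k) s)).
Proof.
  intros HR. destruct (rgratio_bound R0 HR) as [C0 [HC0 H]].
  (* [N] exceeds [2 * R0], as [rgratio_bound] requires, and [2 * C0], which brings the total
     deviation below 1 / 2. *)
  destruct (nfloor_ex (2 * R0 + 2 * C0 + 1)) as [N0 HN0]. lra.
  set (N := S N0). assert (HN : INR N = INR N0 + 1) by apply S_INR.
  assert (HN1 : (1 <= N)%nat) by (unfold N; lia).
  assert (Hb : forall n s, (N <= n)%nat -> Cmod s <= R0 -> Cmod (rgratio n s - 1) <= C0 * (/ INR n - / INR (S n))).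
  { intros n s Hn Hs. apply H; auto. lia. apply le_INR in Hn. lra. }
  assert (HCN : C0 * / INR N <= / 2).
  { apply Rmult_le_reg_r with (2 * INR N). lra. field_simplify; lra. }
  assert (Hdec : forall n, (1 <= n)%nat -> / INR (S n) <= / INR n).
  { intros n Hn. apply le_INR in Hn. simpl in Hn. apply Rinv_le_contravar. lra. rewrite S_INR; lra. }
  assert (Hpos : forall n, (1 <= n)%nat -> 0 < / INR n).
  { intros n Hn. apply le_INR in Hn. simpl in Hn. apply Rinv_0_lt_compat. lra. }
  assert (Hle : forall k, / INR (N + k) <= / INR N).
  { intros k. apply Rinv_le_contravar. apply lt_0_INR; lia. apply le_INR; lia. }
  exists N, C0. repeat (split; [assumption|]). split.
  - intros k s Hs. induction k.
    + rewrite Nat.add_0_r. replace (/ INR N - / INR N) with 0 by ring. rewrite Rmult_0_r, exp_0. lra.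
    + rewrite Nat.add_succ_r, rgn_S, Cmod_mult.
      assert (Hr := Hb (N + k)%nat s ltac:(lia) Hs).
      assert (Hr2 : Cmod (rgratio (N + k) s) <= exp (C0 * (/ INR (N + k) - / INR (S (N + k))))).
      { eapply Rle_trans. 2: apply exp_ineq1_le. replace (rgratio (N + k) s) with (1 + (rgratio (N + k) s - 1))%C by ring.
        eapply Rle_trans. apply Cmod_triangle. rewrite Cmod_1. lra. }
      replace (C0 * (/ INR N - / INR (S (N + k)))) with (C0 * (/ INR N - / INR (N + k)) + C0 * (/ INR (N + k) - / INR (S (N + k)))) by ring.
      rewrite exp_plus, <- Rmult_assoc. apply Rmult_le_compat; auto using Cmod_ge_0.
  - intros k s Hs. induction k.
    + rewrite Nat.add_0_r. replace (/ INR N - / INR N) with 0 by ring. rewrite Rmult_0_r. lra.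
    + rewrite Nat.add_succ_r, rgn_S, Cmod_mult.
      assert (Hr := Hb (N + k)%nat s ltac:(lia) Hs).
      set (c := C0 * (/ INR (N + k) - / INR (S (N + k)))) in *.
      set (S0 := C0 * (/ INR N - / INR (N + k))) in *.
      replace (C0 * (/ INR N - / INR (S (N + k)))) with (S0 + c) by (unfold S0, c; ring).
      assert (Hr2 : 1 - c <= Cmod (rgratio (N + k) s)).
      { assert (Q := Cmod_triangle_inv 1 (1 - rgratio (N + k) s)%C). rewrite Cmod_1 in Q.
        replace (1 - (1 - rgratio (N + k) s))%C with (rgratio (N + k) s) in Q by ring.
        rewrite Cmod_minus_sym in Hr. lra. }
      assert (Hc : 0 <= c) by (unfold c; specialize (Hdec (N + k)%nat ltac:(lia)); nra).
      assert (HS0 : 0 <= S0) by (unfold S0; specialize (Hle k); nra).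
      assert (HSc : S0 + c <= / 2).
      { unfold S0, c. assert (0 < C0 * / INR (S (N + k))) by (apply Rmult_lt_0_compat; auto; apply Hpos; lia). lra. }
      assert (Q := Cmod_ge_0 (rgn N s)).
      assert (0 <= Cmod (rgn N s) * (S0 * c)) by (apply Rmult_le_pos; auto; apply Rmult_le_pos; auto).
      apply Rle_trans with (Cmod (rgn N s) * (1 - S0) * (1 - c)). nra.
      apply Rmult_le_compat; auto; nra.
Qed.

Lemma is_series_inv_telescope C0 N : is_series (fun k => C0 * (/ INR (N + k) - / INR (S (N + k)))) (C0 * / INR N).
Proof.
  apply (is_series_scal C0 (fun k => / INR (N + k) - / INR (S (N + k)))).
  assert (E : forall n, sum_n (fun k => / INR (N + k) - / INR (S (N + k))) n = / INR N - / INR (S (N + n))).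
  { induction n. rewrite sum_O, Nat.add_0_r. auto. rewrite sum_Sn, IHn. unfold plus; simpl plus.
    rewrite Nat.add_succ_r. change (/ INR N - / INR (S (N + n)) + (/ INR (S (N + n)) - / INR (S (S (N + n)))) = / INR N - / INR (S (S (N + n)))). ring. }
  change (is_lim_seq (sum_n (fun k => / INR (N + k) - / INR (S (N + k)))) (Finite (/ INR N))).
  apply is_lim_seq_ext with (u := fun n => / INR N - / INR (S (N + n))). intros; symmetry; apply E.
  replace (Finite (/ INR N)) with (Finite (/ INR N - 0)) by (f_equal; ring).
  apply is_lim_seq_minus'. apply is_lim_seq_const.
  apply is_lim_seq_ext with (u := fun n => / INR (n + S N)). intros n. f_equal. f_equal. lia.
  apply (is_lim_seq_incr_n (fun n => / INR n) (S N)).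
  replace (Finite 0) with (Rbar_inv p_infty) by reflexivity. apply is_lim_seq_inv. apply is_lim_seq_INR. discriminate.
Qed.

Lemma cdiff_poch n s : exists l, cdiff (fun s => poch s n) s l.
Proof.
  induction n; simpl. eexists; apply cdiff_const. destruct IHn as [l Hl].
  eexists. apply cdiff_mult. apply Hl. apply cdiff_plus. apply cdiff_id. apply cdiff_const.
Qed.

Lemma cdiff_rgn n s : exists l, cdiff (rgn n) s l.
Proof.
  destruct (cdiff_poch (S n) s) as [l Hl]. eexists. unfold rgn. apply cdiff_mult.
  - unfold Cdiv. apply cdiff_mult. apply Hl. apply cdiff_const.
  - apply (cdiff_comp (fun s => - (s * ln (INR n)))%C Cexp).
    apply cdiff_opp. apply cdiff_mult. apply cdiff_id. apply cdiff_const. apply cdiff_Cexp.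
Qed.

(** The increments of a sequence, so that theorems on series apply to sequences. *)
Definition tele (u : nat -> C) (n : nat) : C := match n with O => u O | S m => (u (S m) - u m)%C end.

(** On a whole square the increments are dominated by a telescoping series. So [holo_series] yields
    the differentiability of the limit together with the convergence of the derivatives of the
    approximants, from which digamma is later read off. *)
Lemma rGamma_spec s : Clim (fun n => rgn n s) (rGamma s) /\
  forall l, (forall n, cdiff (rgn n) s (l n)) -> exists L, cdiff rGamma s L /\ Clim l L.
Proof.
  (* The square of half-side 1 about [s] lies in the disc of radius 2 about [s]. *)
  set (R0 := Cmod s + 2).
  assert (HR : 0 <= R0) by (unfold R0; assert (H := Cmod_ge_0 s); lra).
  destruct (rgn_geom_bounds R0 HR) as [N [C0 [HN [HC0 [HCN [Hrat [Hup _]]]]]]].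
  destruct (rgn_bound R0 N) as [B [HB Bb]].
  set (B' := B * exp (/ 2)).
  assert (He : 0 < exp (/2)) by apply exp_pos.
  assert (Hup' : forall k t, Cmod t <= R0 -> Cmod (rgn (N + k) t) <= B').
  { intros k t Ht. eapply Rle_trans. apply Hup; auto. unfold B'. apply Rmult_le_compat; auto using Cmod_ge_0.
    left; apply exp_pos. apply exp_le_compat.
    assert (0 < / INR (N + k)). { apply Rinv_0_lt_compat. apply lt_0_INR; lia. } nra. }
  set (M := fun k => match k with O => B' | S k => B' * (C0 * (/ INR (N + k) - / INR (S (N + k)))) end).
  assert (HM : ex_series M).
  { apply ex_series_incr_1. unfold M. exists (B' * (C0 * / INR N)).
    apply (is_series_scal B' (fun k => C0 * (/ INR (N + k) - / INR (S (N + k))))). apply is_series_inv_telescope. }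
  assert (HfM : forall k t, Cmod t <= R0 -> Cmod (tele (fun k => rgn (N + k) t) k) <= M k).
  { intros k t Ht. destruct k; simpl. apply Hup'; auto.
    rewrite Nat.add_succ_r, rgn_S.
    replace (rgn (N + k) t * rgratio (N + k) t - rgn (N + k) t)%C with (rgn (N + k) t * (rgratio (N + k) t - 1))%C by ring.
    rewrite Cmod_mult. apply Rmult_le_compat; auto using Cmod_ge_0. apply Hrat; auto. lia. }
  assert (Hser : forall t, Cmod t <= R0 -> Cser (tele (fun k => rgn (N + k) t)) (rGamma t)).
  { intros t Ht. destruct (Cser_dominated (tele (fun k => rgn (N + k) t)) M) as [l Hl]; auto.
    assert (Q : Clim (fun k => rgn (N + k) t) l) by (apply Cser_telescope; auto).
    assert (Q' : Clim (fun n => rgn n t) l).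
    { clear - Q. apply Clim_eps. intros eps He. destruct (proj1 (Clim_eps _ _) Q eps He) as [N' K].
      exists (N + N')%nat. intros n Hn. replace n with (N + (n - N))%nat by lia. apply K. lia. }
    unfold rGamma. rewrite (Clim_CLim_seq _ _ Q'). auto. }
  assert (Hsq : forall t, insq s 1 t -> Cmod t <= R0).
  { intros t Ht. apply insq_Cmod in Ht. assert (Q := Cmod_triangle (t - s) s).
    replace (t - s + s)%C with t in Q by ring. unfold R0; lra. }
  split.
  - assert (Q : Clim (fun k => rgn (N + k) s) (rGamma s)).
    { apply Cser_telescope. apply Hser. apply Hsq. apply insq_center; lra. }
    apply Clim_eps. intros eps Heps. destruct (proj1 (Clim_eps _ _) Q eps Heps) as [N' K].
    exists (N + N')%nat. intros n Hn. replace n with (N + (n - N))%nat by lia. apply K. lia.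
  - intros l Hl.
    assert (Hdt : forall k t (m : nat -> C), (forall n, cdiff (rgn n) t (m n)) ->
        cdiff (fun t => tele (fun k => rgn (N + k) t) k) t (tele (fun k => m (N + k)%nat) k)).
    { intros k t m Hm. destruct k; simpl. apply Hm. apply cdiff_minus; apply Hm. }
    destruct (holo_series (fun k t => tele (fun k => rgn (N + k) t) k) rGamma (tele (fun k => l (N + k)%nat)) M s 1) as [L [HL1 HL2]]; auto.
    lra.
    + intros k t Ht. 
      destruct (choice (fun n l => cdiff (rgn n) t l) (fun n => cdiff_rgn n t)) as [m Hm].
      eexists. apply Hdt. apply Hm.
    + exists L. split; auto.
      apply Cser_telescope in HL1. apply Clim_eps. intros eps Heps. destruct (proj1 (Clim_eps _ _) HL1 eps Heps) as [N' K].
      exists (N + N')%nat. intros n Hn. replace n with (N + (n - N))%nat by lia. apply K. lia.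
Qed.

Lemma rGamma_lim s : Clim (fun n => rgn n s) (rGamma s).
Proof. apply rGamma_spec. Qed.

Lemma cdiff_rGamma s : exists l, cdiff rGamma s l.
Proof.
  destruct (choice (fun n l => cdiff (rgn n) s l) (fun n => cdiff_rgn n s)) as [m Hm].
  destruct (rGamma_spec s) as [_ H]. destruct (H m Hm) as [L [HL _]]. eauto.
Qed.

Lemma ccont_rGamma s : ccont rGamma s.
Proof. destruct (cdiff_rGamma s) as [l Hl]. eapply cdiff_ccont; eauto. Qed.

Lemma poch_S_left s n : poch s (S n) = (s * poch (s + 1) n)%C.
Proof.
  induction n.
  - simpl. ring.
  - change (poch s (S (S n))) with (poch s (S n) * (s + INR (S n)))%C. rewrite IHn.
    simpl poch at 2. rewrite S_INR, RtoC_plus. ring.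
Qed.

Lemma Clim_inv_INR : Clim (fun n => RtoC (/ INR n)) 0%C.
Proof.
  apply Clim_RtoC. replace (Finite 0) with (Rbar_inv p_infty) by reflexivity. apply is_lim_seq_inv. apply is_lim_seq_INR. discriminate.
Qed.

Lemma rGamma_step s : rGamma s = (s * rGamma (s + 1))%C.
Proof.
  apply (Clim_unique (fun n => s * rgn n (s + 1))%C).
  2: { apply Clim_mult. apply Clim_const. apply rGamma_lim. }
  (* The approximants satisfy the functional equation up to the factor [1 + (s + 1) / n]. *)
  apply Clim_ext_from with (u := fun n => (rgn n s * (1 + (s + 1) * RtoC (/ INR n)))%C) (N := 1%nat).
  - intros n Hn. apply le_INR in Hn. simpl in Hn. unfold rgn.
    change (poch s (S n)) with (poch s n * (s + INR n))%C.
    assert (E : (s * poch (s + 1) (S n) = poch s n * (s + INR n) * (s + INR (S n)))%C).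
    { rewrite <- poch_S_left. reflexivity. }
    replace (s * (poch (s + 1) (S n) / INR (fact n) * Cexp (- ((s + 1) * ln (INR n)))))%C
      with ((s * poch (s + 1) (S n)) / INR (fact n) * Cexp (- ((s + 1) * ln (INR n))))%C by (unfold Cdiv; ring).
    rewrite E.
    replace (- ((s + 1) * ln (INR n)))%C with (- (s * ln (INR n)) + - RtoC (ln (INR n)))%C by ring.
    rewrite Cexp_plus, (Cexp_opp (RtoC _)), Cexp_RtoC, exp_ln by lra.
    rewrite S_INR, RtoC_plus, RtoC_inv by lra. field. split. apply RtoC_nz; lra. apply fact_C_nz.
  - replace (rGamma s) with (rGamma s * (1 + (s + 1) * 0))%C by ring.
    apply Clim_mult. apply rGamma_lim. apply Clim_plus. apply Clim_const. apply Clim_mult. apply Clim_const. apply Clim_inv_INR.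
Qed.

Lemma poch_zero s n : poch s n = 0%C <-> exists k, (k < n)%nat /\ s = (- INR k)%C.
Proof.
  induction n; simpl.
  - split. intros E. exfalso. apply RtoC_inj in E. lra. intros [k [Hk _]]. lia.
  - split.
    + intros E. destruct (Ceq_dec (poch s n) 0) as [E1|E1].
      * apply IHn in E1. destruct E1 as [k [Hk Hs]]. exists k. split; auto.
      * exists n. split; auto. destruct (Ceq_dec (s + INR n) 0) as [E2|E2].
        replace s with ((s + INR n) - INR n)%C by ring. rewrite E2. ring.
        exfalso. revert E. apply Cmult_neq_0; auto.
    + intros [k [Hk Hs]]. destruct (Nat.eq_dec k n).
      * subst. ring.
      * replace (poch s n) with (RtoC 0). ring. symmetry. apply IHn. exists k. split; auto. lia.
Qed.

Lemma rGamma_pole k : rGamma (- INR k)%C = 0%C.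
Proof.
  apply (Clim_unique (fun n => rgn n (- INR k)%C)). apply rGamma_lim.
  apply Clim_ext_from with (u := fun _ => 0%C) (N := k). 2: apply Clim_const.
  intros n Hn. unfold rgn. replace (poch (- INR k) (S n)) with (RtoC 0). unfold Cdiv; ring.
  symmetry. apply poch_zero. exists k. split; auto. lia.
Qed.

(** The lower bound of [rgn_geom_bounds] preserves half of the nonzero modulus of [rgn N s] in the
    limit. *)
Lemma rGamma_nz s : (forall k, s <> (- INR k)%C) -> rGamma s <> 0%C.
Proof.
  intros Hs.
  destruct (rgn_geom_bounds (Cmod s) (Cmod_ge_0 s)) as [N [C0 [HN [HC0 [HCN [_ [_ Hlow]]]]]]].
  assert (Hnz : 0 < Cmod (rgn N s)).
  { apply Cmod_pos. unfold rgn. apply Cmult_neq_0. 2: apply Cexp_nz. unfold Cdiv. apply Cmult_neq_0.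
    intros E. apply poch_zero in E. destruct E as [k [_ E]]. apply (Hs k E).
    rewrite <- RtoC_inv by apply INR_fact_neq_0. apply RtoC_nz. apply Rinv_neq_0_compat. apply INR_fact_neq_0. }
  intros E.
  destruct (proj1 (Clim_eps _ _) (rGamma_lim s) (Cmod (rgn N s) / 2)) as [N' K]. lra.
  specialize (K (N + N')%nat ltac:(lia)). rewrite E in K. replace (rgn (N + N') s - 0)%C with (rgn (N + N') s) in K by ring.
  specialize (Hlow N' s (Rle_refl _)).
  assert (Hb : 0 < / INR (N + N')) by (apply Rinv_0_lt_compat, lt_0_INR; lia).
  assert (Q1 : 0 <= Cmod (rgn N s) * (/ 2 - C0 * / INR N)) by (apply Rmult_le_pos; lra).
  assert (Q2 : 0 < Cmod (rgn N s) * (C0 * / INR (N + N'))) by (repeat apply Rmult_lt_0_compat; lra).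
  lra.
Qed.

Lemma Cinv_0 : (/ 0)%C = 0%C.
Proof. apply C_ext; simpl; unfold Rdiv; ring. Qed.

Lemma Carg_pos (x : R) : 0 < x -> Carg x = 0.
Proof.
  intros H. unfold Carg. simpl. rewrite Cmod_R, Rabs_pos_eq by lra.
  replace (x / x) with 1 by (field; lra). destruct (Rle_dec 0 0); [|lra]. apply acos_1.
Qed.

Lemma Clog_pos (x : R) : 0 < x -> Clog x = RtoC (ln x).
Proof. intros H. unfold Clog. rewrite Carg_pos, Cmod_R, Rabs_pos_eq by lra. reflexivity. Qed.

(** Unconditional: at a pole the approximants are eventually 0 because [/ 0 = 0], and so is the
    inverse of the zero of [rGamma]. *)
Lemma CGamma_rGamma s : CGamma s = (/ rGamma s)%C.
Proof.
  unfold CGamma. apply Clim_CLim_seq.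
  destruct (classic (exists k, s = (- INR k)%C)) as [[k Hk]|Hn].
  - subst s. rewrite rGamma_pole, Cinv_0. apply Clim_ext_from with (u := fun _ => 0%C) (N := k). 2: apply Clim_const.
    intros n Hn. replace (poch (- INR k) (S n)) with (RtoC 0). unfold Cdiv; rewrite Cinv_0; ring.
    symmetry. apply poch_zero. exists k. split; auto. lia.
  - assert (Hp : forall n, poch s n <> 0%C).
    { intros n E. apply poch_zero in E. destruct E as [k [_ E]]. apply Hn. eauto. }
    apply Clim_ext_from with (u := fun n => (/ rgn n s)%C) (N := 1%nat).
    + intros n Hn1. apply le_INR in Hn1. simpl in Hn1. unfold rgn, Cpower. rewrite Clog_pos by lra.
      rewrite Cexp_opp. field. repeat split; auto using Cexp_nz, fact_C_nz.
    + apply (Clim_ccont Cinv). apply ccont_Cinv. apply rGamma_nz. intros k E. apply Hn. eauto. apply rGamma_lim.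
Qed.

Lemma rGamma_1 : rGamma 1 = 1%C.
Proof.
  apply (Clim_unique (fun n => rgn n 1)). apply rGamma_lim.
  apply Clim_ext_from with (u := fun n => (1 + RtoC (/ INR n))%C) (N := 1%nat).
  - intros n Hn. apply le_INR in Hn. simpl in Hn. unfold rgn.
    assert (E : poch 1 (S n) = RtoC (INR (fact (S n)))).
    { clear. induction n. simpl. ring. change (poch 1 (S (S n))) with (poch 1 (S n) * (1 + INR (S n)))%C. rewrite IHn.
      rewrite (fact_simpl (S n)), mult_INR, (S_INR (S n)), RtoC_mult, RtoC_plus. ring. }
    rewrite E. replace (- (1 * ln (INR n)))%C with (- RtoC (ln (INR n)))%C by ring.
    rewrite Cexp_opp, Cexp_RtoC, exp_ln by lra. rewrite fact_simpl, mult_INR, S_INR, RtoC_mult, RtoC_plus, RtoC_inv by lra.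
    field. split. apply RtoC_nz; lra. apply fact_C_nz.
  - assert (H := Clim_plus _ _ _ _ (Clim_const 1) Clim_inv_INR). rewrite Cplus_0_r in H. exact H.
Qed.

(** * The sine product *)

(** Wallis integrals with a frequency. Passing from [n] to [n + 2] splits off one factor
    [1 - x^2 / k^2] from the ratio of the values at [x] and at 0, which yields the sine product by
    real calculus. *)
Definition cosint (n : nat) (x : R) : R := RInt (fun t => cos t ^ n * cos (2 * x * t)) 0 (PI / 2).

Lemma cosint_ex n x : ex_RInt (fun t => cos t ^ n * cos (2 * x * t)) 0 (PI / 2).
Proof.
  apply (ex_RInt_continuous (V := R_CompleteNormedModule)). intros t _.
  apply (ex_derive_continuous (V := R_NormedModule)). auto_derive; auto.
Qed.

Lemma cosint_correct n x : is_RInt (fun t => cos t ^ n * cos (2 * x * t)) 0 (PI / 2) (cosint n x).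
Proof. apply (RInt_correct (V := R_CompleteNormedModule)). apply cosint_ex. Qed.

Lemma cosint_rec n x : (INR n + 2) * (INR n + 1) * cosint n x = ((INR n + 2) ^ 2 - 4 * x ^ 2) * cosint (S (S n)) x.
Proof.
  assert (H1 := is_RInt_scal _ _ _ ((INR n + 2) * (INR n + 1)) _ (cosint_correct n x)).
  assert (H2 := is_RInt_scal _ _ _ ((INR n + 2) ^ 2 - 4 * x ^ 2) _ (cosint_correct (S (S n)) x)).
  assert (H3 := is_RInt_minus _ _ _ _ _ _ H1 H2).
  (* From two integrations by parts; [F] vanishes at both ends, through [cos] at PI / 2 and through
     [sin] at 0. *)
  set (F := fun t => (INR n + 2) * (cos t ^ (S n) * sin t * cos (2 * x * t)) - 2 * x * (cos t ^ (S (S n)) * sin (2 * x * t))).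
  assert (H4 : is_RInt (fun t => minus (scal ((INR n + 2) * (INR n + 1)) (cos t ^ n * cos (2 * x * t)))
     (scal ((INR n + 2) ^ 2 - 4 * x ^ 2) (cos t ^ (S (S n)) * cos (2 * x * t)))) 0 (PI / 2) (minus (- F (PI / 2)) (- F 0))).
  { apply (is_RInt_derive (V := R_CompleteNormedModule) (fun t => - F t)).
    - intros t _. unfold F. auto_derive; auto.
      unfold minus, plus, opp, scal; simpl. unfold mult; simpl.
      assert (Hs := sin2_cos2 t). unfold Rsqr in Hs.
      rewrite !(Rmult_1_l). replace (match n with O => 1 | S _ => INR n + 1 end) with (INR n + 1) by (destruct n; simpl; ring).
      set (c := cos t) in *. set (s := sin t) in *. set (p := c ^ n).
      replace (c * p) with (p * c) by ring.
      assert (Hss : s * s = 1 - c * c) by lra.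
      match goal with |- ?L = ?R => assert (E : L - R = 0) end; [|lra].
      set (C := cos (2 * x * t)). set (S0 := sin (2 * x * t)).
      match goal with |- ?L = 0 => replace L with ((INR n + 2) * (INR n + 1) * p * C * (s * s - (1 - c * c))) by ring end.
      rewrite Hss. ring.
    - intros t _. apply (ex_derive_continuous (V := R_NormedModule)). unfold minus, plus, opp, scal; simpl. unfold mult; simpl. auto_derive; auto. }
  assert (E := eq_trans (eq_sym (is_RInt_unique _ _ _ _ H3)) (is_RInt_unique _ _ _ _ H4)).
  unfold F, minus, plus, opp, scal in E; simpl in E. unfold mult in E; simpl in E.
  rewrite cos_PI2, ?Rmult_0_r, ?sin_0 in E. simpl. lra.
Qed.

Lemma cosint_0_pos n : 0 < cosint n 0.
Proof.
  unfold cosint. apply RInt_gt_0. assert (H := PI_RGT_0); lra.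
  - intros t Ht. rewrite Rmult_0_r, Rmult_0_l, cos_0, Rmult_1_r. apply pow_lt. apply cos_gt_0; lra.
  - intros t Ht. apply (ex_derive_continuous (V := R_NormedModule)). auto_derive; auto.
Qed.

Lemma sin_ge_third t : 0 <= t <= PI / 2 -> t <= 3 * sin t.
Proof.
  intros Ht. assert (P := PI_4). assert (P2 := PI_RGT_0).
  assert (H := SIN_bound t).
  destruct (sin_bound t 0) as [H1 _]; try lra.
  unfold sin_approx, sum_f_R0, sin_term in H1. simpl in H1.
  assert (t * t <= 4) by nra. assert (t * (t * t) <= t * 4) by nra. lra.
Qed.

Lemma one_minus_cos_le u : 1 - cos u <= u ^ 2 / 2.
Proof.
  replace (cos u) with (cos (2 * (u / 2))) by (f_equal; field). rewrite cos_2a_sin.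
  assert (H : Rabs (sin (u / 2)) <= Rabs (u / 2)).
  { assert (Hp : forall v, 0 <= v -> Rabs (sin v) <= v).
    { intros v Hv. destruct (Rle_lt_or_eq_dec 0 v Hv) as [H|H]. 2: subst; rewrite sin_0, Rabs_R0; lra.
      assert (A := sin_lt_x v H). apply Rabs_le. split; [|lra].
      destruct (Rle_dec v 1). assert (0 <= sin v). apply sin_ge_0; try lra. assert (P := PI2_3_2); lra. lra.
      assert (B := SIN_bound v). lra. }
    destruct (Rle_dec 0 (u / 2)) as [H|H]. rewrite (Rabs_pos_eq (u/2)); auto.
    rewrite <- Rabs_Ropp, <- sin_neg, <- (Rabs_Ropp (u / 2)). rewrite (Rabs_pos_eq (- (u/2))); [apply Hp|]; lra. }
  apply Rsqr_le_abs_1 in H. unfold Rsqr in H. simpl. nra.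
Qed.

(** By [1 - cos (2 x t) <= 2 x^2 t^2] and [t <= 3 sin t], the factor of [cos^n] changes by at most
    [18 x^2 sin^2 t]; by the recursion at 0, the weight [sin^2] gains a factor [1 / (n + 2)]. *)
Lemma cosint_close n x : Rabs (cosint n 0 - cosint n x) <= 18 * x ^ 2 * cosint n 0 / (INR n + 2).
Proof.
  assert (HP := PI_RGT_0). assert (Hn := pos_INR n).
  assert (Hrec := cosint_rec n 0).
  assert (HI : is_RInt (fun t => cos t ^ n * cos (2 * 0 * t) - cos t ^ n * cos (2 * x * t)) 0 (PI / 2) (cosint n 0 - cosint n x)).
  { apply (is_RInt_minus (V := R_NormedModule)); apply cosint_correct. }
  assert (HJ : is_RInt (fun t => 18 * x ^ 2 * (cos t ^ n * cos (2 * 0 * t) - cos t ^ (S (S n)) * cos (2 * 0 * t))) 0 (PI / 2) (18 * x ^ 2 * (cosint n 0 - cosint (S (S n)) 0))).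
  { apply (is_RInt_scal (V := R_NormedModule)). apply (is_RInt_minus (V := R_NormedModule)); apply cosint_correct. }
  replace (18 * x ^ 2 * cosint n 0 / (INR n + 2)) with (18 * x ^ 2 * (cosint n 0 - cosint (S (S n)) 0)).
  2:{ replace (cosint (S (S n)) 0) with ((INR n + 1) / (INR n + 2) * cosint n 0). field; lra.
      apply Rmult_eq_reg_l with ((INR n + 2)^2). 2: apply pow_nonzero; lra.
      replace ((INR n + 2) ^ 2 * cosint (S (S n)) 0) with (((INR n + 2) ^ 2 - 4 * 0 ^ 2) * cosint (S (S n)) 0) by ring.
      rewrite <- Hrec. field. lra. }
  apply (norm_RInt_le (V := R_NormedModule) (fun t => cos t ^ n * cos (2 * 0 * t) - cos t ^ n * cos (2 * x * t)) _ 0 (PI / 2) _ _) with (3 := HI) (4 := HJ). lra.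
  intros t Ht. change (norm ?a) with (Rabs a).
  rewrite Rmult_0_r, Rmult_0_l, cos_0.
  assert (Hc : 0 <= cos t) by (apply cos_ge_0; lra). assert (Hcn := pow_le _ n Hc).
  replace (cos t ^ n * 1 - cos t ^ n * cos (2 * x * t)) with (cos t ^ n * (1 - cos (2 * x * t))) by ring.
  rewrite Rabs_pos_eq. 2:{ apply Rmult_le_pos; auto. assert (B := COS_bound (2 * x * t)). lra. }
  replace (18 * x ^ 2 * (cos t ^ n * 1 - cos t ^ S (S n) * 1)) with (cos t ^ n * (18 * x ^ 2 * (1 - cos t * cos t))) by (simpl; ring).
  apply Rmult_le_compat_l; auto. eapply Rle_trans. apply one_minus_cos_le.
  assert (Hs := sin2_cos2 t). unfold Rsqr in Hs. replace (1 - cos t * cos t) with (sin t * sin t) by lra.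
  assert (Ht2 := sin_ge_third t Ht).
  assert (t * t <= 9 * (sin t * sin t)) by nra. assert (0 <= x ^ 2) by apply pow2_ge_0.
  replace ((2 * x * t) ^ 2 / 2) with (2 * (x ^ 2 * (t * t))) by (simpl; field). nra.
Qed.

Fixpoint sineprod (x : R) (m : nat) : R :=
  match m with O => 1 | S k => sineprod x k * (1 - x ^ 2 / (INR (S k)) ^ 2) end.

Lemma cosint_sineprod x m : cosint 0 x / cosint 0 0 = sineprod x m * (cosint (2 * m) x / cosint (2 * m) 0).
Proof.
  induction m. simpl. ring. rewrite IHm. change (sineprod x (S m)) with (sineprod x m * (1 - x ^ 2 / (INR (S m)) ^ 2)). rewrite Rmult_assoc. f_equal.
  replace (2 * S m)%nat with (S (S (2 * m))) by lia.
  assert (R1 := cosint_rec (2 * m) x). assert (R2 := cosint_rec (2 * m) 0).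
  assert (P1 := cosint_0_pos (2 * m)). assert (P2 := cosint_0_pos (S (S (2 * m)))).
  assert (Hm := pos_INR m). rewrite mult_INR in *. simpl (INR 2) in *. rewrite S_INR.
  set (a := cosint (2 * m) x) in *. set (b := cosint (2 * m) 0) in *.
  set (c := cosint (S (S (2 * m))) x) in *. set (d := cosint (S (S (2 * m))) 0) in *. set (k := INR m) in *.
  assert (Ea : a = (4 * (k + 1) ^ 2 - 4 * x ^ 2) * c / ((2 * k + 2) * (2 * k + 1))).
  { apply Rmult_eq_reg_l with ((2 * k + 2) * (2 * k + 1)). 2: apply Rgt_not_eq; nra. field_simplify; nra. }
  assert (Eb : b = 4 * (k + 1) ^ 2 * d / ((2 * k + 2) * (2 * k + 1))).
  { apply Rmult_eq_reg_l with ((2 * k + 2) * (2 * k + 1)). 2: apply Rgt_not_eq; nra. field_simplify; nra. }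
  rewrite Ea, Eb. field. repeat split; try lra.
Qed.

Lemma sineprod_lim x : x <> 0 -> is_lim_seq (sineprod x) (sin (PI * x) / (PI * x)).
Proof.
  intros Hx. assert (HP := PI_RGT_0).
  assert (E0 : cosint 0 x = sin (PI * x) / (2 * x)).
  { unfold cosint. apply is_RInt_unique.
    replace (sin (PI * x) / (2 * x)) with (minus (sin (2 * x * (PI / 2)) / (2 * x)) (sin (2 * x * 0) / (2 * x))).
    2:{ unfold minus, plus, opp; simpl. rewrite Rmult_0_r, sin_0. replace (2 * x * (PI / 2)) with (PI * x) by field. field. auto. }
    apply (is_RInt_derive (V := R_CompleteNormedModule) (fun t => sin (2 * x * t) / (2 * x))).
    intros t _. auto_derive; auto. field; auto.
    intros t _. apply (ex_derive_continuous (V := R_NormedModule)). auto_derive; auto. }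
  assert (E1 : cosint 0 0 = PI / 2).
  { unfold cosint. apply is_RInt_unique.
    apply is_RInt_ext with (fun _ => 1). intros; simpl. rewrite Rmult_0_r, Rmult_0_l, cos_0. ring.
    replace (PI / 2) with (scal (PI / 2 - 0) 1) at 2 by (unfold scal; simpl; unfold mult; simpl; ring).
    apply (is_RInt_const (V := R_NormedModule)). }
  set (L := sin (PI * x) / (PI * x)).
  assert (EL : cosint 0 x / cosint 0 0 = L) by (rewrite E0, E1; unfold L; field; lra).
  (* High powers of the cosine concentrate at 0, where [cos (2 x t)] is 1. *)
  assert (Hq : is_lim_seq (fun m => cosint (2 * m) x / cosint (2 * m) 0) 1).
  { apply is_lim_seq_le_le with (u := fun m => 1 - 18 * x ^ 2 * / INR (m + 1)) (w := fun m => 1 + 18 * x ^ 2 * / INR (m + 1)).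
    - intros m. assert (P1 := cosint_0_pos (2 * m)). assert (C := cosint_close (2 * m) x). assert (Hm := pos_INR m).
      apply Rabs_le_between' in C || apply Rabs_le_between in C.
      assert (Hb : 18 * x ^ 2 * cosint (2 * m) 0 / (INR (2 * m) + 2) <= 18 * x ^ 2 * / INR (m + 1) * cosint (2 * m) 0).
      { rewrite mult_INR, plus_INR. simpl (INR 2). simpl (INR 1). 
        assert (/ (2 * INR m + 2) <= / (INR m + 1)) by (apply Rinv_le_contravar; lra).
        assert (0 <= 18 * x ^ 2 * cosint (2 * m) 0). { apply Rmult_le_pos. assert (0 <= x ^ 2) by apply pow2_ge_0. lra. lra. }
        replace (18 * x ^ 2 * / (INR m + 1) * cosint (2 * m) 0) with (18 * x ^ 2 * cosint (2 * m) 0 * / (INR m + 1)) by ring.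
        apply Rmult_le_compat_l; auto. }
      set (B := 18 * x ^ 2 * / INR (m + 1)) in *.
      split; apply Rmult_le_reg_r with (cosint (2 * m) 0); auto; unfold Rdiv; rewrite Rmult_assoc, Rinv_l by lra; lra.
    - replace (Finite 1) with (Finite (1 - 18 * x ^ 2 * 0)) by (f_equal; ring). apply is_lim_seq_minus'. apply is_lim_seq_const.
      apply (is_lim_seq_scal_l _ (18 * x ^ 2) (Finite 0)). apply (is_lim_seq_incr_n (fun n => / INR n) 1).
      replace (Finite 0) with (Rbar_inv p_infty) by reflexivity. apply is_lim_seq_inv. apply is_lim_seq_INR. discriminate.
    - replace (Finite 1) with (Finite (1 + 18 * x ^ 2 * 0)) by (f_equal; ring). apply is_lim_seq_plus'. apply is_lim_seq_const.
      apply (is_lim_seq_scal_l _ (18 * x ^ 2) (Finite 0)). apply (is_lim_seq_incr_n (fun n => / INR n) 1).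
      replace (Finite 0) with (Rbar_inv p_infty) by reflexivity. apply is_lim_seq_inv. apply is_lim_seq_INR. discriminate. }
  assert (Hd : is_lim_seq (fun m => L / (cosint (2 * m) x / cosint (2 * m) 0)) (L / 1)).
  { apply is_lim_seq_div'. apply is_lim_seq_const. auto. lra. }
  replace (L / 1) with L in Hd by field.
  assert (Hev : eventually (fun m => cosint (2 * m) x / cosint (2 * m) 0 <> 0)).
  { apply is_lim_seq_spec in Hq. destruct (Hq (mkposreal (/2) ltac:(lra))) as [N HN]. exists N. intros m Hm E.
    specialize (HN m Hm). rewrite E in HN. simpl in HN. rewrite Rabs_left in HN; lra. }
  eapply is_lim_seq_ext_loc. 2: apply Hd.
  destruct Hev as [N HN]. exists N. intros m Hm. rewrite <- EL, (cosint_sineprod x m). field.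
  specialize (HN m Hm). assert (P1 := cosint_0_pos (2 * m)). split. lra.
  intros E. apply HN. rewrite E. unfold Rdiv; ring.
Qed.

(** * Special values of the Gamma function *)

(** Cauchy's estimate for [f] minus its affine part at [p0], on a square about [p] whose half-side
    is the distance to [p0]. *)
Lemma cderiv_ccont (f f' : C -> C) p0 r : 0 < r -> (forall s, Cmod (s - p0) < r -> cdiff f s (f' s)) -> ccont f' p0.
Proof.
  intros Hr Hf eps He.
  assert (H0 : cdiff f p0 (f' p0)). { apply Hf. replace (p0 - p0)%C with (RtoC 0) by ring. rewrite Cmod_0. auto. }
  (* The square lies within three times the distance from [p0], so the estimate ends at
     [6 * (eps / 7)]. *)
  destruct (proj1 (cdiff_small _ _ _) H0 (eps / 7)) as [d [Hd K]]. lra.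
  set (m := Rmin r d / 4). assert (M1 := Rmin_l r d). assert (M2 := Rmin_r r d). assert (M3 := Rmin_pos _ _ Hr Hd).
  exists m. split. unfold m; lra. intros p Hp. set (rho := Cmod (p - p0)) in *.
  destruct (Ceq_dec p p0) as [E|E].
  { subst. replace (f' p0 - f' p0)%C with (RtoC 0) by ring. rewrite Cmod_0. auto. }
  assert (Hrho : 0 < rho) by (apply Cmod_pos, Cminus_eq_contra; auto).
  set (g := fun s => (f s - f p0 - f' p0 * (s - p0))%C).
  assert (Hin : forall s, insq p rho s -> Cmod (s - p0) <= 3 * rho).
  { intros s Hs. apply insq_Cmod in Hs. replace (s - p0)%C with ((s - p) + (p - p0))%C by ring.
    eapply Rle_trans. apply Cmod_triangle. fold rho. lra. }
  assert (Hg : forall s, Cmod (s - p0) < r -> cdiff g s (f' s - f' p0)).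
  { intros s Hs. eapply cdiff_eq. apply cdiff_minus. apply cdiff_minus. apply Hf; auto. apply cdiff_const.
    apply cdiff_mult. apply cdiff_const. apply cdiff_minus. apply cdiff_id. apply cdiff_const. simpl. ring. }
  destruct (cauchy_taylor g p rho (eps / 7 * (3 * rho)) (f' p - f' p0)%C) as [B _]; auto.
  - intros s Hs. apply Hin in Hs. eexists. apply Hg. unfold m in Hp. lra.
  - intros s Hs. apply Hin in Hs. unfold g. eapply Rle_trans. apply K. unfold m in Hp. lra. apply Rmult_le_compat_l; lra.
  - apply Hg. unfold rho, m in *. lra.
  - eapply Rle_lt_trans. apply B. replace (2 * (eps / 7 * (3 * rho)) / rho) with (6 * (eps / 7)) by (field; lra). lra.
Qed.

(** * The reciprocal Gamma function on the real axis *)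

Definition drGamma (s : C) : C := proj1_sig (constructive_indefinite_description _ (cdiff_rGamma s)).

Lemma cdiff_drGamma s : cdiff rGamma s (drGamma s).
Proof. unfold drGamma. destruct (constructive_indefinite_description _ (cdiff_rGamma s)); auto. Qed.

Definition rg (x : R) : R := Re (rGamma x).
Definition drg (x : R) : R := Re (drGamma x).

Lemma Clim_real (u : nat -> C) l : (forall n, Im (u n) = 0) -> Clim u l -> l = RtoC (Re l).
Proof.
  intros H [_ H2]. apply C_ext; simpl; auto.
  assert (H3 : is_lim_seq (fun n => Im (u n)) 0).
  { apply is_lim_seq_ext with (u := fun _ => 0). auto. apply is_lim_seq_const. }
  apply is_lim_seq_unique in H2. apply is_lim_seq_unique in H3. rewrite H2 in H3. congruence.
Qed.

Fixpoint rpoch (x : R) (n : nat) : R := match n with O => 1 | S k => rpoch x k * (x + INR k) end.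

Lemma poch_real (x : R) n : poch x n = RtoC (rpoch x n).
Proof. induction n; simpl. auto. rewrite IHn, RtoC_mult, RtoC_plus. auto. Qed.

Definition rrgn (n : nat) (x : R) : R := rpoch x (S n) / INR (fact n) * exp (- (x * ln (INR n))).

Lemma rgn_real n (x : R) : rgn n x = RtoC (rrgn n x).
Proof.
  unfold rgn, rrgn. rewrite poch_real, RtoC_mult, RtoC_div by apply INR_fact_neq_0.
  rewrite <- RtoC_mult, <- RtoC_opp, Cexp_RtoC. reflexivity.
Qed.

Lemma rGamma_real (x : R) : rGamma x = RtoC (rg x).
Proof. apply Clim_real with (u := fun n => rgn n x). intros n. rewrite rgn_real. auto. apply rGamma_lim. Qed.

Lemma rrgn_lim x : is_lim_seq (fun n => rrgn n x) (rg x).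
Proof.
  destruct (rGamma_lim x) as [H _]. eapply is_lim_seq_ext. 2: apply H. intros n; cbv beta; rewrite rgn_real. auto.
Qed.

(** Real increments alone determine the derivative; as [f] is real on the axis, the imaginary part
    of [l] must vanish. *)
Lemma cdiff_real_axis (f : C -> C) (g : R -> R) (x : R) (l : C) : (forall t : R, f t = RtoC (g t)) -> cdiff f x l ->
  is_derive g x (Re l) /\ l = RtoC (Re l).
Proof.
  intros Hg Hl. assert (Hl2 := proj1 (cdiff_small _ _ _) Hl). clear Hl. rename Hl2 into Hl.
  assert (K : forall eps, 0 < eps -> exists d, 0 < d /\ forall u, Rabs (u - x) < d ->
     Rabs (g u - g x - Re l * (u - x)) <= eps * Rabs (u - x) /\ Rabs (Im l * (u - x)) <= eps * Rabs (u - x)).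
  { intros eps He. destruct (Hl eps He) as [d [Hd K]]. exists d. split; auto. intros u Hu.
    specialize (K (RtoC u)). rewrite <- RtoC_minus, Cmod_R in K. specialize (K Hu). rewrite !Hg in K.
    split; (eapply Rle_trans; [|apply K]).
    - eapply Rle_trans. 2: apply re_le_Cmod. simpl. apply Req_le. f_equal. unfold Re, Im; simpl. ring.
    - eapply Rle_trans. 2: apply im_le_Cmod. simpl. rewrite <- Rabs_Ropp. apply Req_le. f_equal. unfold Re, Im; simpl. ring. }
  split.
  - split. apply is_linear_scal_l. intros y Hy eps. apply (is_filter_lim_locally_unique x y) in Hy. subst y.
    destruct (K eps (cond_pos eps)) as [d [Hd K']]. exists (mkposreal d Hd). intros u Hu. destruct (K' u Hu) as [K1 _].
    eapply Rle_trans; [|exact K1]. apply Req_le. unfold norm, minus, plus, opp, scal; simpl. unfold abs, mult; simpl. f_equal. ring.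
  - apply C_ext; simpl; auto. apply Rle_antisym; apply Rnot_lt_le; intros Hlt.
    all: destruct (K (Rabs (Im l) / 2)) as [d [Hd K']]; [apply Rabs_pos_lt in Hlt || (assert (Hl0 := Rabs_pos_lt (Im l) ltac:(lra))); lra|].
    all: destruct (K' (x + d / 2)) as [_ K2]; replace (x + d / 2 - x) with (d / 2) in * by ring; [rewrite Rabs_pos_eq; lra|].
    all: rewrite Rabs_mult, (Rabs_pos_eq (d / 2)) in K2 by lra; assert (Hl0 := Rabs_pos_lt (Im l) ltac:(lra)); nra.
Qed.

Lemma is_derive_rg x : is_derive rg x (drg x).
Proof. apply (cdiff_real_axis rGamma rg x (drGamma x)). apply rGamma_real. apply cdiff_drGamma. Qed.

Lemma drGamma_real (x : R) : drGamma x = RtoC (drg x).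
Proof. apply (cdiff_real_axis rGamma rg x (drGamma x)). apply rGamma_real. apply cdiff_drGamma. Qed.

Lemma rg_step x : rg x = x * rg (x + 1).
Proof.
  assert (H := rGamma_step x). rewrite <- RtoC_plus, !rGamma_real, <- RtoC_mult in H. apply RtoC_inj in H. auto.
Qed.

Lemma rg_1 : rg 1 = 1.
Proof. unfold rg. rewrite rGamma_1. auto. Qed.

Lemma drGamma_step s : drGamma s = (rGamma (s + 1) + s * drGamma (s + 1))%C.
Proof.
  apply (cdiff_unique rGamma s). apply cdiff_drGamma.
  apply cdiff_ext with (f := fun s => (s * rGamma (s + 1))%C). intros; symmetry; apply rGamma_step.
  eapply cdiff_eq. apply cdiff_mult. apply cdiff_id. apply (cdiff_comp (fun s => s + 1)%C rGamma).
  apply cdiff_plus. apply cdiff_id. apply cdiff_const. apply cdiff_drGamma. simpl. ring.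
Qed.

Lemma drg_step x : drg x = rg (x + 1) + x * drg (x + 1).
Proof.
  assert (H := drGamma_step x). rewrite <- RtoC_plus, !drGamma_real, rGamma_real, <- RtoC_mult, <- RtoC_plus in H. apply RtoC_inj in H. auto.
Qed.

Lemma rg_nz x : (forall k, x <> - INR k) -> rg x <> 0.
Proof.
  intros H E. apply (rGamma_nz x). intros k Ek. rewrite <- RtoC_opp in Ek. apply RtoC_inj in Ek. apply (H k Ek).
  rewrite rGamma_real, E. auto.
Qed.

Lemma rpoch_pos x n : 0 < x -> 0 < rpoch x n.
Proof. intros H. induction n; simpl. lra. assert (Q := pos_INR n). apply Rmult_lt_0_compat; lra. Qed.

Lemma rg_pos x : 0 < x -> 0 < rg x.
Proof.
  intros H. assert (Hn : rg x <> 0). { apply rg_nz. intros k. assert (Q := pos_INR k). lra. }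
  assert (0 <= rg x); [|lra].
  apply (is_lim_seq_le (fun _ => 0) (fun n => rrgn n x) 0 (rg x)); auto using is_lim_seq_const, rrgn_lim.
  intros n. unfold rrgn. apply Rmult_le_pos. 2: left; apply exp_pos. apply Rmult_le_pos. left. apply rpoch_pos; auto.
  left. apply Rinv_0_lt_compat. apply lt_0_INR, lt_O_fact.
Qed.

Lemma rpoch_S_left x n : rpoch x (S n) = x * rpoch (x + 1) n.
Proof. apply RtoC_inj. rewrite RtoC_mult, <- !poch_real, RtoC_plus. apply poch_S_left. Qed.

Lemma rpoch_fact n : rpoch 1 n = INR (fact n).
Proof. induction n. auto. rewrite fact_simpl, mult_INR, S_INR, <- IHn. simpl. ring. Qed.

Lemma rg_rpoch x n : rg x = rpoch x n * rg (x + INR n).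
Proof.
  induction n. simpl. rewrite Rplus_0_r. ring. rewrite IHn, S_INR, (rg_step (x + INR n)). simpl. rewrite Rplus_assoc. ring.
Qed.

Lemma rg_fact n : rg (INR n + 1) = / INR (fact n).
Proof.
  assert (H := rg_rpoch 1 n). rewrite rg_1, rpoch_fact in H. rewrite Rplus_comm.
  apply Rmult_eq_reg_l with (INR (fact n)). rewrite <- H. field. all: apply INR_fact_neq_0.
Qed.

(** Before the limit, the Pochhammer symbols at [1 + x] and [1 - x] multiply to a partial sine
    product times a squared factorial. *)
Lemma rg_reflection x : x <> 0 -> rg (1 + x) * rg (1 - x) = sin (PI * x) / (PI * x).
Proof.
  intros Hx.
  assert (H1 : is_lim_seq (fun n => rrgn n (1 + x) * rrgn n (1 - x)) (rg (1 + x) * rg (1 - x))).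
  { apply is_lim_seq_mult'; apply rrgn_lim. }
  assert (H2 : is_lim_seq (fun n => sineprod x (S n) * ((1 + / INR n) * (1 + / INR n))) (sin (PI * x) / (PI * x) * ((1 + 0) * (1 + 0)))).
  { apply is_lim_seq_mult'. apply (is_lim_seq_incr_1 (sineprod x)), sineprod_lim; auto.
    assert (Hi : is_lim_seq (fun n => / INR n) 0).
    { replace (Finite 0) with (Rbar_inv p_infty) by reflexivity. apply is_lim_seq_inv. apply is_lim_seq_INR. discriminate. }
    apply is_lim_seq_mult'; apply is_lim_seq_plus'; auto using is_lim_seq_const. }
  assert (E : forall n, rpoch (1 + x) n * rpoch (1 - x) n = sineprod x n * (INR (fact n))^2).
  { induction n. simpl; ring.
    change (rpoch (1 + x) n * (1 + x + INR n) * (rpoch (1 - x) n * (1 - x + INR n)) =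
      sineprod x n * (1 - x ^ 2 / (INR (S n)) ^ 2) * INR (fact (S n)) ^ 2).
    replace (rpoch (1 + x) n * (1 + x + INR n) * (rpoch (1 - x) n * (1 - x + INR n))) with
      (rpoch (1 + x) n * rpoch (1 - x) n * ((1 + x + INR n) * (1 - x + INR n))) by ring.
    rewrite IHn, fact_simpl, mult_INR, S_INR. field. assert (Q := pos_INR n). lra. }
  apply is_lim_seq_unique in H2. rewrite (is_lim_seq_unique (fun n => sineprod x (S n) * ((1 + / INR n) * (1 + / INR n))) (rg (1 + x) * rg (1 - x))) in H2.
  - injection H2. intros ->. ring.
  - eapply is_lim_seq_ext_loc. 2: apply H1. exists 1%nat. intros n Hn. apply le_INR in Hn. simpl in Hn.
    unfold rrgn. 
    replace (rpoch (1 + x) (S n) / INR (fact n) * exp (- ((1 + x) * ln (INR n))) * (rpoch (1 - x) (S n) / INR (fact n) * exp (- ((1 - x) * ln (INR n)))))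
      with (rpoch (1 + x) (S n) * rpoch (1 - x) (S n) / (INR (fact n))^2 * (exp (- ((1 + x) * ln (INR n))) * exp (- ((1 - x) * ln (INR n)))))
      by (field; apply INR_fact_neq_0).
    rewrite E, <- exp_plus. replace (- ((1 + x) * ln (INR n)) + - ((1 - x) * ln (INR n))) with (- ln (INR n) + - ln (INR n)) by ring.
    rewrite exp_plus, exp_Ropp, exp_ln by lra. rewrite fact_simpl, mult_INR, S_INR. field. split. lra. apply INR_fact_neq_0.
Qed.

Lemma rg_half : rg (1 / 2) = / sqrt PI.
Proof.
  assert (HP := PI_RGT_0).
  assert (H := rg_reflection (1 / 2) ltac:(lra)). replace (PI * (1 / 2)) with (PI / 2) in H by field. rewrite sin_PI2 in H.
  replace (1 - 1 / 2) with (1 / 2) in H by field. assert (S := rg_step (1 / 2)). replace (1 / 2 + 1) with (1 + 1 / 2) in S by ring.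
  assert (P := rg_pos (1 / 2) ltac:(lra)).
  assert (Q : rg (1 / 2) * rg (1 / 2) = / PI). { rewrite S at 1. replace (1 / 2 * rg (1 + 1 / 2) * rg (1 / 2)) with (1 / 2 * (rg (1 + 1 / 2) * rg (1 / 2))) by ring. rewrite H. field. lra. }
  rewrite <- sqrt_inv. rewrite <- Q. symmetry. apply sqrt_square. lra.
Qed.

Lemma rpoch_duplication x n : rpoch x n * rpoch (x + 1 / 2) n = rpoch (2 * x) (2 * n) / 4 ^ n.
Proof.
  induction n. simpl. field. 
  replace (2 * S n)%nat with (S (S (2 * n))) by lia.
  change (rpoch x n * (x + INR n) * (rpoch (x + 1 / 2) n * (x + 1 / 2 + INR n)) = 
    rpoch (2 * x) (2 * n) * (2 * x + INR (2 * n)) * (2 * x + INR (S (2 * n))) / 4 ^ (S n)).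
  replace (rpoch x n * (x + INR n) * (rpoch (x + 1 / 2) n * (x + 1 / 2 + INR n))) with 
   (rpoch x n * rpoch (x + 1 / 2) n * ((x + INR n) * (x + 1 / 2 + INR n))) by ring.
  rewrite IHn, S_INR, mult_INR. simpl. field. apply pow_nonzero. lra.
Qed.

(* The quotient of the two sides of the duplication formula is, before the limit, independent of x up to a power tending to 1. *)
Lemma rg_duplication x : rg x * rg (x + 1 / 2) = exp (2 * x * ln 2) * (rg (1 / 2) / 2) * rg (2 * x).
Proof.
  set (kap := fun n => INR (fact (2 * n + 1)) / (INR (fact n) ^ 2 * 4 ^ (S n) * exp (/ 2 * ln (INR n)))).
  set (del := fun n => ln (INR (2 * n + 1)) - ln (INR n)).
  assert (Hdel : is_lim_seq del (ln 2)).
  { apply is_lim_seq_ext_loc with (u := fun n => ln (2 + / INR n)).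
    - exists 1%nat. intros n Hn. apply le_INR in Hn. simpl in Hn. unfold del. rewrite <- ln_div.
      f_equal. rewrite plus_INR, mult_INR. simpl. field. lra. rewrite plus_INR, mult_INR; simpl; lra. lra.
    - apply (is_lim_seq_continuous ln (fun n => 2 + / INR n) 2).
      + apply continuity_pt_filterlim. apply (ex_derive_continuous (V := R_NormedModule)). auto_derive. lra.
      + replace (Finite 2) with (Finite (2 + 0)) by (f_equal; ring). apply is_lim_seq_plus'. apply is_lim_seq_const.
        replace (Finite 0) with (Rbar_inv p_infty) by reflexivity. apply is_lim_seq_inv. apply is_lim_seq_INR. discriminate. }
  assert (Hid : forall y n, (1 <= n)%nat -> rrgn n y * rrgn n (y + 1 / 2) = kap n * exp (2 * y * del n) * rrgn (2 * n + 1) (2 * y)).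
  { intros y n Hn. apply le_INR in Hn. simpl in Hn. unfold rrgn, kap, del.
    replace (rpoch y (S n) / INR (fact n) * exp (- (y * ln (INR n))) * (rpoch (y + 1 / 2) (S n) / INR (fact n) * exp (- ((y + 1 / 2) * ln (INR n)))))
     with (rpoch y (S n) * rpoch (y + 1 / 2) (S n) / (INR (fact n)) ^ 2 * (exp (- (y * ln (INR n))) * exp (- ((y + 1 / 2) * ln (INR n)))))
     by (field; apply INR_fact_neq_0).
    rewrite rpoch_duplication. replace (2 * S n)%nat with (S (2 * n + 1)) by lia.
    rewrite <- exp_plus.
    replace (- (y * ln (INR n)) + - ((y + 1 / 2) * ln (INR n))) with (2 * y * (ln (INR (2 * n + 1)) - ln (INR n)) + - (2 * y * ln (INR (2 * n + 1))) + - (/ 2 * ln (INR n))) by field.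
    rewrite !exp_plus, (exp_Ropp (/ 2 * _)). field.
    repeat split; try apply INR_fact_neq_0. apply Rgt_not_eq, exp_pos. apply pow_nonzero; lra. }
  assert (Hsub : forall y, is_lim_seq (fun n => rrgn (2 * n + 1) y) (rg y)).
  { intros y. apply is_lim_seq_subseq with (phi := fun n => (2 * n + 1)%nat) (u := fun n => rrgn n y) (l := rg y). apply eventually_subseq. intros; lia. apply rrgn_lim. }
  assert (Hexp : forall y, is_lim_seq (fun n => exp (2 * y * del n)) (exp (2 * y * ln 2))).
  { intros y. apply (is_lim_seq_continuous exp (fun n => 2 * y * del n)). apply derivable_continuous, derivable_exp.
    apply (is_lim_seq_scal_l del (2 * y) (ln 2)). auto. }
  assert (Hlhs : forall y, is_lim_seq (fun n => rrgn n y * rrgn n (y + 1 / 2)) (rg y * rg (y + 1 / 2))).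
  { intros y. apply is_lim_seq_mult'; apply rrgn_lim. }
  (* The constant is identified at the argument 1 / 2, where all the other factors have known
     limits. *)
  assert (Hkap : is_lim_seq kap (rg (1 / 2) / 2)).
  { assert (Q : is_lim_seq (fun n => (rrgn n (1 / 2) * rrgn n (1 / 2 + 1 / 2)) / (exp (2 * (1 / 2) * del n) * rrgn (2 * n + 1) (2 * (1 / 2))))
       ((rg (1 / 2) * rg (1 / 2 + 1 / 2)) / (exp (2 * (1 / 2) * ln 2) * rg (2 * (1 / 2))))).
    { apply is_lim_seq_div'. apply Hlhs. apply is_lim_seq_mult'; auto.
      apply Rgt_not_eq. apply Rmult_lt_0_compat. apply exp_pos. apply rg_pos. lra. }
    replace (1 / 2 + 1 / 2) with 1 in Q by field. replace (2 * (1 / 2)) with 1 in Q by field. rewrite rg_1 in Q.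
    rewrite Rmult_1_l, exp_ln in Q by lra. replace (rg (1 / 2) * 1 / (2 * 1)) with (rg (1 / 2) / 2) in Q by field.
    eapply is_lim_seq_ext_loc. 2: apply Q. exists 1%nat. intros n Hn.
    assert (I := Hid (1 / 2) n Hn). replace (1 / 2 + 1 / 2) with 1 in I by field. replace (2 * (1 / 2)) with 1 in I by field.
    rewrite I. field. split. apply Rgt_not_eq. unfold rrgn. apply Rmult_lt_0_compat. 2: apply exp_pos. apply Rdiv_lt_0_compat.
    apply rpoch_pos. lra. apply lt_0_INR, lt_O_fact. apply Rgt_not_eq, exp_pos. }
  assert (R1 : is_lim_seq (fun n => kap n * exp (2 * x * del n) * rrgn (2 * n + 1) (2 * x)) (rg (1 / 2) / 2 * exp (2 * x * ln 2) * rg (2 * x))).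
  { apply is_lim_seq_mult'; auto. apply is_lim_seq_mult'; auto. }
  apply is_lim_seq_unique in R1.
  rewrite (is_lim_seq_unique (fun n => kap n * exp (2 * x * del n) * rrgn (2 * n + 1) (2 * x)) (rg x * rg (x + 1 / 2))) in R1.
  - injection R1. intros ->. ring.
  - eapply is_lim_seq_ext_loc. 2: apply (Hlhs x). exists 1%nat. intros n Hn. apply Hid; auto.
Qed.

(** The derivative of the duplication formula at 1 / 2. It enters the residue at the double pole,
    where its [drg 1] cancels and its [2 * ln 2] is absorbed by the passage from [z^2] to
    [z / 2]. *)
Lemma drg_half : drg (1 / 2) = rg (1 / 2) * (drg 1 + 2 * ln 2).
Proof.
  assert (D1 : is_derive (fun x => rg x * rg (x + 1 / 2)) (1 / 2) (drg (1 / 2) * rg (1 / 2 + 1 / 2) + rg (1 / 2) * drg (1 / 2 + 1 / 2))).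
  { apply (is_derive_mult rg (fun x => rg (x + 1 / 2))). apply is_derive_rg. 2: intros; apply Rmult_comm.
    replace (drg (1 / 2 + 1 / 2)) with (scal 1 (drg (1 / 2 + 1 / 2))) by (unfold scal; simpl; unfold mult; simpl; ring).
    apply (is_derive_comp rg (fun x => x + 1 / 2)). apply is_derive_rg. auto_derive; auto. }
  assert (D2 : is_derive (fun x => exp (2 * x * ln 2) * (rg (1 / 2) / 2) * rg (2 * x)) (1 / 2) 
     (2 * ln 2 * exp (2 * (1 / 2) * ln 2) * (rg (1 / 2) / 2) * rg (2 * (1 / 2)) + exp (2 * (1 / 2) * ln 2) * (rg (1 / 2) / 2) * (2 * drg (2 * (1 / 2))))).
  { apply (is_derive_mult (fun x => exp (2 * x * ln 2) * (rg (1 / 2) / 2)) (fun x => rg (2 * x))). auto_derive; auto. ring. 2: intros; apply Rmult_comm.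
    apply (is_derive_comp rg (fun x => 2 * x)). apply is_derive_rg. auto_derive; auto. ring. }
  apply is_derive_unique in D1. rewrite (Derive_ext _ _ _ rg_duplication) in D1. apply is_derive_unique in D2. assert (D3 := eq_trans (eq_sym D2) D1). clear D1 D2.
  replace (1 / 2 + 1 / 2) with 1 in D3 by field. replace (2 * (1 / 2)) with 1 in D3 by field. rewrite rg_1, Rmult_1_l, exp_ln in D3 by lra. lra.
Qed.

(** * Digamma and the integrals over (0, PI / 2) *)

Fixpoint harm (x : R) (n : nat) : R := match n with O => 0 | S k => harm x k + / (x + INR k) end.

Lemma cdiff_poch_real x n : 0 < x -> cdiff (fun s => poch s n) x (RtoC (rpoch x n * harm x n)).
Proof.
  intros Hx. induction n; simpl.
  - eapply cdiff_eq. apply cdiff_const. f_equal. ring.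
  - eapply cdiff_eq. apply cdiff_mult. apply IHn. apply cdiff_plus. apply cdiff_id. apply cdiff_const. cbv beta.
    rewrite poch_real. rewrite <- !RtoC_plus, <- !RtoC_mult, <- RtoC_plus. f_equal. assert (Q := pos_INR n). field. lra.
Qed.

Lemma cdiff_rgn_real x n : 0 < x -> cdiff (rgn n) x (RtoC (rrgn n x * (harm x (S n) - ln (INR n)))).
Proof.
  intros Hx. unfold rgn. eapply cdiff_eq.
  - apply cdiff_mult. unfold Cdiv. apply cdiff_mult. apply cdiff_poch_real; auto. apply cdiff_const.
    apply (cdiff_comp (fun s => - (s * ln (INR n)))%C Cexp). apply cdiff_opp, cdiff_mult. apply cdiff_id. apply cdiff_const. apply cdiff_Cexp.
  - cbv beta. replace (- (x * ln (INR n)))%C with (RtoC (- (x * ln (INR n)))) by (rewrite RtoC_opp, RtoC_mult; auto).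
    rewrite poch_real, Cexp_RtoC. unfold Cdiv. rewrite <- RtoC_inv by apply INR_fact_neq_0.
    rewrite Cmult_0_r, Cmult_1_l, Cplus_0_r, Cmult_0_r, Cplus_0_r.
    rewrite <- RtoC_opp, <- !RtoC_mult, <- RtoC_plus. f_equal. unfold rrgn, Rdiv. ring.
Qed.

(* The logarithmic derivative of 1/Gamma is - digamma. *)
Lemma digamma_lim x : 0 < x -> is_lim_seq (fun n => harm x (S n) - ln (INR n)) (drg x / rg x).
Proof.
  intros Hx. destruct (rGamma_spec x) as [_ H]. destruct (H _ (fun n => cdiff_rgn_real x n Hx)) as [L [HL1 [HL2 _]]].
  rewrite (cdiff_unique _ _ _ _ HL1 (cdiff_drGamma x)) in HL2.
  change (is_lim_seq (fun n => rrgn n x * (harm x (S n) - ln (INR n))) (drg x)) in HL2.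
  assert (Hp := rg_pos x Hx).
  eapply is_lim_seq_ext. 2: apply (is_lim_seq_div' _ _ _ _ HL2 (rrgn_lim x)). 2: lra.
  intros n. cbv beta. field. apply Rgt_not_eq. unfold rrgn. apply Rmult_lt_0_compat. 2: apply exp_pos. apply Rdiv_lt_0_compat.
  apply rpoch_pos; auto. apply lt_0_INR, lt_O_fact.
Qed.

Lemma digamma_diff_lim b : 0 < b -> is_lim_seq (fun n => harm 1 n - harm (b + 1) n) (drg 1 - drg (b + 1) / rg (b + 1)).
Proof.
  intros Hb. apply is_lim_seq_incr_1. assert (H1 := digamma_lim 1 ltac:(lra)). rewrite rg_1 in H1.
  replace (drg 1) with (drg 1 / 1) by field.
  eapply is_lim_seq_ext. 2: apply (is_lim_seq_minus' _ _ _ _ H1 (digamma_lim (b + 1) ltac:(lra))).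
  intros n. cbv beta. ring.
Qed.

(** * Improper integrals over (0, PI / 2) *)

Definition iInt (f : R -> C) (l : C) : Prop :=
  forall eps, 0 < eps -> exists d, 0 < d /\ forall x y, 0 < x < d -> PI / 2 - d < y < PI / 2 ->
    exists v, isCI f x y v /\ Cmod (v - l) < eps.

Lemma iInt_is_RInt_gen f l : iInt f l -> is_RInt_gen (V := C_R_NormedModule) f (at_right 0) (at_left (PI / 2)) l.
Proof.
  intros H P [e He]. destruct (H e (cond_pos e)) as [d [Hd K]].
  exists (fun x => 0 < x < d) (fun y => PI / 2 - d < y < PI / 2).
  - exists (mkposreal d Hd). intros x Hx Hx0. unfold ball in Hx; simpl in Hx; unfold AbsRing_ball, abs, minus, plus, opp in Hx; simpl in Hx.
    apply Rabs_def2 in Hx. lra.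
  - exists (mkposreal d Hd). intros y Hy Hy0. unfold ball in Hy; simpl in Hy; unfold AbsRing_ball, abs, minus, plus, opp in Hy; simpl in Hy.
    apply Rabs_def2 in Hy. lra.
  - intros x y Hx Hy. destruct (K x y Hx Hy) as [v [Hv1 Hv2]]. exists v. split; auto. apply He. apply ball_C. auto.
Qed.

Lemma iInt_ext f g l : (forall t, 0 < t < PI / 2 -> f t = g t) -> iInt f l -> iInt g l.
Proof.
  intros E H eps He. destruct (H eps He) as [d [Hd K]]. assert (P := PI_RGT_0). exists (Rmin d (PI / 4)). split. apply Rmin_pos; lra.
  assert (M1 := Rmin_l d (PI / 4)). assert (M2 := Rmin_r d (PI / 4)).
  intros x y Hx Hy. destruct (K x y) as [v [Hv1 Hv2]]; try lra. exists v. split; auto.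
  apply isCI_ext with (3 := Hv1). lra. intros; apply E; lra.
Qed.

Lemma iInt_plus f g l m : iInt f l -> iInt g m -> iInt (fun t => f t + g t)%C (l + m)%C.
Proof.
  intros Hf Hg eps He. destruct (Hf (eps / 2)) as [d1 [Hd1 K1]]. lra. destruct (Hg (eps / 2)) as [d2 [Hd2 K2]]. lra.
  exists (Rmin d1 d2). split. apply Rmin_pos; lra. assert (M1 := Rmin_l d1 d2). assert (M2 := Rmin_r d1 d2).
  intros x y Hx Hy. destruct (K1 x y) as [v [Hv1 Hv2]]; try lra. destruct (K2 x y) as [w [Hw1 Hw2]]; try lra.
  exists (v + w)%C. split. apply isCI_plus; auto. replace (v + w - (l + m))%C with ((v - l) + (w - m))%C by ring.
  eapply Rle_lt_trans. apply Cmod_triangle. lra.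
Qed.

Lemma iInt_scal k f l : iInt f l -> iInt (fun t => k * f t)%C (k * l)%C.
Proof.
  intros Hf eps He. assert (Hk := Cmod_ge_0 k).
  destruct (Hf (eps / (Cmod k + 1))) as [d [Hd K]]. apply Rdiv_lt_0_compat; lra.
  exists d. split; auto. intros x y Hx Hy. destruct (K x y Hx Hy) as [v [Hv1 Hv2]].
  exists (k * v)%C. split. apply isCI_scal; auto. replace (k * v - k * l)%C with (k * (v - l))%C by ring. rewrite Cmod_mult.
  apply Rle_lt_trans with (Cmod k * (eps / (Cmod k + 1))). apply Rmult_le_compat_l; lra.
  apply Rlt_le_trans with ((Cmod k + 1) * (eps / (Cmod k + 1))). apply Rmult_lt_compat_r. apply Rdiv_lt_0_compat; lra. lra.
  apply Req_le. field. lra.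
Qed.

Lemma iInt_Csum (f : nat -> R -> C) L n : (forall k, iInt (f k) (L k)) -> iInt (fun t => Csum (fun k => f k t) n) (Csum L n).
Proof.
  intros H. induction n; simpl.
  - intros eps He. exists 1. split. lra. intros x y _ _. exists (RtoC 0). split.
    assert (Q := isCI_const (RtoC 0) x y). rewrite Cmult_0_r in Q. exact Q. replace (0 - 0)%C with (RtoC 0) by ring. rewrite Cmod_0. auto.
  - apply iInt_plus; auto.
Qed.

Definition iIntR (f : R -> R) (l : R) : Prop := iInt (fun t => RtoC (f t)) (RtoC l).

Lemma is_RInt_zero a b : is_RInt (fun _ : R => 0) a b 0.
Proof.
  assert (Q := is_RInt_const (V := R_NormedModule) a b 0). rewrite (scal_zero_r (V := R_NormedModule)) in Q. exact Q.
Qed.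

Lemma isCI_RtoC (f : R -> R) a b l : is_RInt f a b l -> isCI (fun t => RtoC (f t)) a b (RtoC l).
Proof.
  intros H. apply isCI_pair. split; simpl; auto.
  apply is_RInt_zero.
Qed.

Lemma iIntR_FTC F f A B : (forall t, 0 < t < PI / 2 -> is_derive F t (f t) /\ continuous f t) ->
  (forall eps, 0 < eps -> exists d, 0 < d /\ forall x, 0 < x < d -> Rabs (F x - A) < eps) ->
  (forall eps, 0 < eps -> exists d, 0 < d /\ forall y, PI / 2 - d < y < PI / 2 -> Rabs (F y - B) < eps) ->
  iIntR f (B - A).
Proof.
  intros HF HA HB eps He. assert (P := PI_RGT_0).
  destruct (HA (eps / 2)) as [d1 [Hd1 K1]]. lra. destruct (HB (eps / 2)) as [d2 [Hd2 K2]]. lra.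
  exists (Rmin (Rmin d1 d2) (PI / 4)). split. repeat apply Rmin_pos; lra.
  assert (M1 := Rmin_l d1 d2). assert (M2 := Rmin_r d1 d2). assert (M3 := Rmin_l (Rmin d1 d2) (PI / 4)). assert (M4 := Rmin_r (Rmin d1 d2) (PI / 4)).
  intros x y Hx Hy. exists (RtoC (F y - F x)). split.
  - apply isCI_RtoC. apply (is_RInt_derive (V := R_CompleteNormedModule) F f); rewrite Rmin_left, Rmax_right by lra; intros t Ht; apply HF; lra.
  - rewrite <- RtoC_minus, Cmod_R. replace (F y - F x - (B - A)) with ((F y - B) - (F x - A)) by ring.
    eapply Rle_lt_trans. apply Rabs_triang. rewrite Rabs_Ropp. specialize (K1 x ltac:(lra)). specialize (K2 y ltac:(lra)). lra.
Qed.

Lemma iIntR_le f g l m : (forall t, 0 < t < PI / 2 -> f t <= g t) -> iIntR f l -> iIntR g m -> l <= m.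
Proof.
  intros H Hf Hg. apply Rnot_lt_le. intros Hlt. assert (P := PI_RGT_0).
  destruct (Hf ((l - m) / 2)) as [d1 [Hd1 K1]]. lra. destruct (Hg ((l - m) / 2)) as [d2 [Hd2 K2]]. lra.
  set (d := Rmin (Rmin d1 d2) (PI / 4)). assert (M1 := Rmin_l d1 d2). assert (M2 := Rmin_r d1 d2).
  assert (M3 := Rmin_l (Rmin d1 d2) (PI / 4)). assert (M4 := Rmin_r (Rmin d1 d2) (PI / 4)). fold d in M3, M4.
  assert (Hd : 0 < d) by (unfold d; repeat apply Rmin_pos; lra).
  destruct (K1 (d / 2) (PI / 2 - d / 2)) as [v [Hv1 Hv2]]; try lra. destruct (K2 (d / 2) (PI / 2 - d / 2)) as [w [Hw1 Hw2]]; try lra.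
  apply isCI_pair in Hv1, Hw1. destruct Hv1 as [Hv1 _]. destruct Hw1 as [Hw1 _]. simpl in Hv1, Hw1.
  assert (Q : Re v <= Re w). { eapply is_RInt_le with (2 := Hv1) (3 := Hw1). lra. intros; apply H; lra. }
  assert (Q1 := re_le_Cmod (v - RtoC l)%C). assert (Q2 := re_le_Cmod (w - RtoC m)%C). simpl in Q1, Q2.
  apply Rabs_le_between in Q1, Q2. unfold Re in *. lra.
Qed.

(** For nonnegative [w] the integrals over closed subintervals increase with the interval, and their
    supremum is the improper integral. *)
Lemma iIntR_exists (w : R -> R) B : (forall t, 0 < t < PI / 2 -> 0 <= w t /\ continuous w t) ->
  (forall x y v, 0 < x -> x <= y -> y < PI / 2 -> is_RInt w x y v -> v <= B) -> exists l, iIntR w l.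
Proof.
  intros Hw HB. assert (P := PI_RGT_0).
  assert (Hex : forall x y, 0 < x -> x <= y -> y < PI / 2 -> exists v, is_RInt w x y v).
  { intros x y H1 H2 H3. apply (ex_RInt_continuous (V := R_CompleteNormedModule)). rewrite Rmin_left, Rmax_right by lra. intros t Ht. apply Hw. lra. }
  destruct (completeness (fun v => exists x y, 0 < x /\ x <= y /\ y < PI / 2 /\ is_RInt w x y v)) as [l [Hub Hlub]].
  - exists B. intros v [x [y [H1 [H2 [H3 H4]]]]]. apply (HB x y v); auto.
  - destruct (Hex (PI / 4) (PI / 4)) as [v Hv]; try lra. exists v, (PI / 4), (PI / 4). repeat split; auto; lra.
  - exists l. intros eps He.
    assert (Hn : ~ forall v x y, 0 < x -> x <= y -> y < PI / 2 -> is_RInt w x y v -> v <= l - eps).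
    { intros K. assert (l <= l - eps). apply Hlub. intros v [x [y [H1 [H2 [H3 H4]]]]]. apply (K v x y); auto. lra. }
    apply not_all_ex_not in Hn. destruct Hn as [v Hn]. apply not_all_ex_not in Hn. destruct Hn as [x Hn]. apply not_all_ex_not in Hn. destruct Hn as [y Hn].
    apply imply_to_and in Hn. destruct Hn as [H1 Hn]. apply imply_to_and in Hn. destruct Hn as [H2 Hn].
    apply imply_to_and in Hn. destruct Hn as [H3 Hn]. apply imply_to_and in Hn. destruct Hn as [H4 Hn].
    exists (Rmin x (PI / 2 - y)). assert (M1 := Rmin_l x (PI / 2 - y)). assert (M2 := Rmin_r x (PI / 2 - y)). split. apply Rmin_pos; lra.
    intros x' y' Hx' Hy'. 
    destruct (Hex x' x) as [a Ha]; try lra. destruct (Hex y y') as [b Hb]; try lra.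
    assert (Ha0 : 0 <= a). { apply (is_RInt_le (fun _ => 0) w x' x 0 a); auto. lra. 
      apply is_RInt_zero. intros; apply Hw; lra. }
    assert (Hb0 : 0 <= b). { apply (is_RInt_le (fun _ => 0) w y y' 0 b); auto. lra. 
      apply is_RInt_zero. intros; apply Hw; lra. }
    assert (Hv : is_RInt w x' y' (a + (v + b))).
    { apply (is_RInt_Chasles (V := R_NormedModule) w x' x y'); auto. apply (is_RInt_Chasles (V := R_NormedModule) w x y y'); auto. }
    assert (a + (v + b) <= l). { apply Hub. exists x', y'. repeat split; auto; lra. }
    exists (RtoC (a + (v + b))). split. apply isCI_RtoC; auto. rewrite <- RtoC_minus, Cmod_R. apply Rabs_def1; lra.
Qed.

Lemma iIntR_interval_le (w : R -> R) W : (forall t, 0 < t < PI / 2 -> 0 <= w t /\ continuous w t) -> iIntR w W ->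
  forall x y v, 0 < x -> x <= y -> y < PI / 2 -> is_RInt w x y v -> v <= W.
Proof.
  intros Hw HW x y v Hx Hxy Hy Hv. apply Rnot_lt_le. intros Hlt.
  destruct (HW (v - W)) as [d [Hd K]]. lra.
  set (x' := Rmin x d / 2). set (y' := Rmax y (PI / 2 - d) / 2 + PI / 4).
  assert (M1 := Rmin_l x d). assert (M2 := Rmin_r x d). assert (M3 := Rmin_pos _ _ Hx Hd). assert (M4 := Rmax_l y (PI / 2 - d)). assert (M5 := Rmax_r y (PI / 2 - d)).
  assert (M6 : Rmax y (PI / 2 - d) < PI / 2) by (apply Rmax_lub_lt; lra).
  destruct (K x' y') as [u [Hu1 Hu2]]; try (unfold x', y'; lra).
  apply isCI_pair in Hu1. destruct Hu1 as [Hu1 _]. simpl in Hu1.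
  assert (Hex : forall x y, 0 < x -> x <= y -> y < PI / 2 -> exists v, is_RInt w x y v).
  { intros p q H1 H2 H3. apply (ex_RInt_continuous (V := R_CompleteNormedModule)). rewrite Rmin_left, Rmax_right by lra. intros t Ht. apply Hw. lra. }
  destruct (Hex x' x) as [a Ha]; try (unfold x'; lra). destruct (Hex y y') as [b Hb]; try (unfold y'; lra).
  assert (Ha0 : 0 <= a). { apply (is_RInt_le (fun _ => 0) w x' x 0 a); auto. unfold x'; lra. 
    apply is_RInt_zero. intros; apply Hw; unfold x' in *; lra. }
  assert (Hb0 : 0 <= b). { apply (is_RInt_le (fun _ => 0) w y y' 0 b); auto. unfold y'; lra. 
    apply is_RInt_zero. intros; apply Hw; unfold y' in *; lra. }
  assert (Hv' : is_RInt w x' y' (a + (v + b))).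
  { apply (is_RInt_Chasles (V := R_NormedModule) w x' x y'); auto. apply (is_RInt_Chasles (V := R_NormedModule) w x y y'); auto. }
  assert (E := eq_trans (eq_sym (is_RInt_unique _ _ _ _ Hv')) (is_RInt_unique _ _ _ _ Hu1)).
  assert (Q := re_le_Cmod (u - RtoC W)%C). simpl in Q. apply Rabs_le_between in Q. unfold Re in *. lra.
Qed.

(** * Trigonometric Beta integrals, with and without a logarithm *)

Definition cpow (b t : R) : R := exp (b * ln (cos t ^ 2)).

Lemma trig_pos t : 0 < t < PI / 2 -> 0 < sin t < 1 /\ 0 < cos t < 1.
Proof.
  intros H. assert (P := PI_RGT_0). assert (H1 : 0 < sin t) by (apply sin_gt_0; lra). assert (H2 : 0 < cos t) by (apply cos_gt_0; lra).
  assert (H3 := sin2_cos2 t). unfold Rsqr in H3. split; split; auto; nra.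
Qed.

Lemma cpow_S b t : 0 < t < PI / 2 -> cpow (b + 1) t = cpow b t * cos t ^ 2.
Proof.
  intros H. destruct (trig_pos t H) as [_ H2]. unfold cpow. rewrite Rmult_plus_distr_r, exp_plus, Rmult_1_l, exp_ln; auto. apply pow_lt; lra.
Qed.

Lemma cpow_bounds b t : 0 < b -> 0 < t < PI / 2 -> 0 < cpow b t <= 1.
Proof.
  intros Hb H. destruct (trig_pos t H) as [_ H2]. split. apply exp_pos. unfold cpow. rewrite <- exp_0. apply exp_le_compat.
  assert (ln (cos t ^ 2) <= 0). { rewrite <- ln_1. apply ln_le. apply pow_lt; lra. simpl. nra. } nra.
Qed.

Lemma cpow_decr b b' t : b <= b' -> 0 < t < PI / 2 -> cpow b' t <= cpow b t.
Proof.
  intros Hb H. destruct (trig_pos t H) as [_ H2]. unfold cpow. apply exp_le_compat.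
  assert (ln (cos t ^ 2) <= 0). { rewrite <- ln_1. apply ln_le. apply pow_lt; lra. simpl. nra. } nra.
Qed.

Lemma neg_ln_sin2_le t : 0 < t < PI / 2 -> 0 <= - ln (sin t ^ 2) <= 2 * (/ sin t - 1).
Proof.
  intros H. destruct (trig_pos t H) as [H1 _].
  assert (Hi : 0 < / sin t) by (apply Rinv_0_lt_compat; lra).
  assert (E : ln (sin t ^ 2) = 2 * ln (sin t)). { simpl. rewrite Rmult_1_r, ln_mult by lra. ring. }
  assert (A := exp_ineq1_le (ln (/ sin t))). rewrite exp_ln, ln_Rinv in A by lra.
  assert (B : ln (sin t) <= 0). { rewrite <- ln_1. apply ln_le; lra. } lra.
Qed.

Lemma continuous_eps (F : R -> R) x0 : continuous F x0 -> forall eps, 0 < eps -> exists d, 0 < d /\ forall x, Rabs (x - x0) < d -> Rabs (F x - F x0) < eps.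
Proof.
  intros H eps He. destruct (H (fun y => Rabs (y - F x0) < eps)) as [d Hd].
  - exists (mkposreal eps He). intros y Hy. exact Hy.
  - exists d. split. apply cond_pos. intros x Hx. apply Hd. exact Hx.
Qed.

Lemma cos_le_compl t : 0 < t < PI / 2 -> cos t <= PI / 2 - t.
Proof. intros H. rewrite <- sin_shift. left. apply sin_lt_x. lra. Qed.

Lemma is_derive_cpow b t : 0 < t < PI / 2 -> is_derive (cpow b) t (- 2 * b * (tan t * cpow b t)).
Proof.
  intros H. destruct (trig_pos t H) as [H1 H2]. unfold cpow, tan. auto_derive. nra.
  simpl. field. lra.
Qed.

Lemma continuous_wt (t : R) (g : R -> R) b : 0 < t < PI / 2 -> continuous g t -> continuous (fun t => tan t * cpow b t * g t) t.
Proof.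
  intros H Hg. destruct (trig_pos t H) as [H1 H2]. apply (continuous_mult (fun t => tan t * cpow b t) g); auto.
  apply (ex_derive_continuous (V := R_NormedModule)). unfold tan, cpow. auto_derive. repeat split; nra.
Qed.

Lemma continuous_ln_sin2 t : 0 < t < PI -> continuous (fun t => ln (sin t ^ 2)) t.
Proof.
  intros H. assert (0 < sin t) by (apply sin_gt_0; lra). apply (ex_derive_continuous (V := R_NormedModule)). auto_derive. nra.
Qed.

Lemma iIntR_ext f g l : (forall t, 0 < t < PI / 2 -> f t = g t) -> iIntR f l -> iIntR g l.
Proof. intros H. apply iInt_ext. intros t Ht. rewrite H; auto. Qed.

Lemma iIntR_plus f g l m : iIntR f l -> iIntR g m -> iIntR (fun t => f t + g t) (l + m).
Proof. intros Hf Hg. unfold iIntR. rewrite RtoC_plus. eapply iInt_ext. 2: apply (iInt_plus _ _ _ _ Hf Hg). intros; rewrite RtoC_plus; auto. Qed.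

Lemma iIntR_scal k f l : iIntR f l -> iIntR (fun t => k * f t) (k * l).
Proof. intros Hf. unfold iIntR. rewrite RtoC_mult. eapply iInt_ext. 2: apply (iInt_scal _ _ _ Hf). intros; rewrite RtoC_mult; auto. Qed.

Lemma iIntR_unique f l m : iIntR f l -> iIntR f m -> l = m.
Proof. intros H1 H2. apply Rle_antisym; eapply iIntR_le; eauto; intros; lra. Qed.

Lemma iIntR_tan_cpow b : 0 < b -> iIntR (fun t => tan t * cpow b t) (/ (2 * b)).
Proof.
  intros Hb. assert (P := PI_RGT_0). replace (/ (2 * b)) with (0 - - (/ (2 * b))) by ring.
  apply iIntR_FTC with (F := fun t => - / (2 * b) * cpow b t).
  - intros t Ht. split.
    + replace (tan t * cpow b t) with (- / (2 * b) * (- 2 * b * (tan t * cpow b t))) by (field; lra).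
      apply (is_derive_scal (cpow b)). apply is_derive_cpow; auto.
    + apply continuous_ext with (f := fun t => tan t * cpow b t * 1). intros; simpl; ring. apply continuous_wt; auto. apply continuous_const.
  - intros eps He. destruct (continuous_eps (fun t => - / (2 * b) * cpow b t) 0) with (eps := eps) as [d [Hd K]]; auto.
    { apply (ex_derive_continuous (V := R_NormedModule)). unfold cpow. auto_derive. rewrite cos_0. lra. }
    exists d. split; auto. intros x Hx. specialize (K x). unfold cpow at 2 in K. rewrite cos_0, pow1, ln_1, Rmult_0_r, exp_0, Rmult_1_r in K.
    apply K. rewrite Rminus_0_r, Rabs_pos_eq; lra.
  - intros eps He. 
    (* The radius chosen below is the [b]-th root of [e]: near PI / 2 one has [cos y <= PI / 2 - y],
       and squaring the cosine only decreases it. *)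
    set (e := 2 * b * eps). assert (Hbe : 0 < e) by (unfold e; apply Rmult_lt_0_compat; lra).
    exists (Rmin (exp (ln e / b)) (PI / 4)). split. apply Rmin_pos. apply exp_pos. lra. intros y Hy.
    assert (M1 := Rmin_l (exp (ln e / b)) (PI / 4)). assert (M2 := Rmin_r (exp (ln e / b)) (PI / 4)).
    assert (Hy' : 0 < y < PI / 2) by lra. destruct (trig_pos y Hy') as [H1 H2].
    assert (C := cos_le_compl y Hy'). assert (B := cpow_bounds b y Hb Hy').
    rewrite Rminus_0_r, Rabs_mult, Rabs_Ropp, !Rabs_pos_eq; try lra. 2: left; apply Rinv_0_lt_compat; lra.
    assert (cpow b y < e).
    { unfold cpow. rewrite <- (exp_ln e) by auto. apply exp_increasing.
      assert (ln (cos y ^ 2) < ln e / b). { rewrite <- (ln_exp (ln e / b)). apply ln_increasing. apply pow_lt; lra. simpl. nra. }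
      replace (ln e) with (b * (ln e / b)) by (field; lra). apply Rmult_lt_compat_l; auto. }
    replace eps with (/ (2 * b) * e) by (unfold e; field; lra). apply Rmult_lt_compat_l; auto. apply Rinv_0_lt_compat; lra.
Qed.

Lemma log_integral_exists b : 0 < b -> exists l, iIntR (fun t => tan t * cpow b t * - ln (sin t ^ 2)) l.
Proof.
  (* The integrand is at most 2: the logarithm is bounded by [2 cos^2 / sin], which the tangent
     turns into [2 cos]. *)
  intros Hb. apply iIntR_exists with (B := PI).
  - intros t Ht. destruct (trig_pos t Ht) as [H1 H2]. assert (L := neg_ln_sin2_le t Ht). assert (C := cpow_bounds b t Hb Ht). split.
    + apply Rmult_le_pos; [|lra]. apply Rmult_le_pos; [|lra]. unfold tan. apply Rmult_le_pos. lra. left; apply Rinv_0_lt_compat; lra.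
    + apply continuous_wt; auto. apply (continuous_opp (fun t => ln (sin t ^ 2))). apply continuous_ln_sin2. lra.
  - intros x y v Hx Hxy Hy Hv.
    assert (Q : v <= scal (y - x) 2).
    { apply (is_RInt_le _ (fun _ => 2) x y v (scal (y - x) 2) Hxy Hv). apply (is_RInt_const (V := R_NormedModule)).
      intros t Ht. assert (Ht' : 0 < t < PI / 2) by lra. destruct (trig_pos t Ht') as [H1 H2].
      assert (L := neg_ln_sin2_le t Ht'). assert (C := cpow_bounds b t Hb Ht').
      assert (L2 : - ln (sin t ^ 2) <= 2 * (cos t * cos t / sin t)).
      { eapply Rle_trans. apply L. apply Rmult_le_compat_l. lra. assert (S := sin2_cos2 t). unfold Rsqr in S.
        apply Rmult_le_reg_r with (sin t). lra. unfold Rdiv. rewrite Rmult_minus_distr_r, Rmult_assoc, !Rinv_l by lra. nra. }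
      assert (T : 0 < tan t) by (apply tan_gt_0; lra).
      apply Rle_trans with (tan t * 1 * (2 * (cos t * cos t / sin t))).
      - apply Rmult_le_compat; try lra. apply Rmult_le_pos; lra. apply Rmult_le_compat_l; lra.
      - unfold tan. replace (sin t / cos t * 1 * (2 * (cos t * cos t / sin t))) with (2 * cos t) by (field; lra). lra. }
    unfold scal in Q; simpl in Q; unfold mult in Q; simpl in Q. lra.
Qed.

(** Minus the logarithmic Beta integral with [a = 0]. Only its existence is known at this point,
    hence [epsilon]. *)
Definition logK (b : R) : R := epsilon (inhabits 0) (fun l => iIntR (fun t => tan t * cpow b t * - ln (sin t ^ 2)) l).

Lemma logK_spec b : 0 < b -> iIntR (fun t => tan t * cpow b t * - ln (sin t ^ 2)) (logK b).
Proof. intros Hb. unfold logK. apply (epsilon_spec (inhabits 0) (fun l => iIntR (fun t => tan t * cpow b t * - ln (sin t ^ 2)) l)). apply log_integral_exists; auto. Qed.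

(** In this form [b * logK b] is visibly increasing in [b], and raising [b] by 1 adds an elementary
    integral: these two facts determine [logK]. *)
Lemma logK_by_parts b : 0 < b -> iIntR (fun t => (1 - cpow b t) * (cos t / sin t)) (b * logK b).
Proof.
  intros Hb. assert (P := PI_RGT_0).
  assert (H0 : iIntR (fun t => (1 - cpow b t) * (cos t / sin t) + - b * (tan t * cpow b t * - ln (sin t ^ 2))) (0 - 0)).
  (* The primitive vanishes at both ends: near 0 its first factor is of the order of [sin^2], which
     beats the logarithm, and at PI / 2 the logarithm is 0. *)
  { apply iIntR_FTC with (F := fun t => / 2 * (1 - cpow b t) * ln (sin t ^ 2)).
    - intros t Ht. destruct (trig_pos t Ht) as [H1 H2]. split.
      + unfold cpow, tan. auto_derive. repeat split; nra. simpl. field. lra.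
      + apply (continuous_plus (fun t => (1 - cpow b t) * (cos t / sin t)) (fun t => - b * (tan t * cpow b t * - ln (sin t ^ 2)))).
        * apply (ex_derive_continuous (V := R_NormedModule)). unfold cpow. auto_derive. repeat split; nra.
        * apply (continuous_mult (fun _ => - b) (fun t => tan t * cpow b t * - ln (sin t ^ 2))). apply continuous_const.
          apply continuous_wt; auto. apply (continuous_opp (fun t => ln (sin t ^ 2))). apply continuous_ln_sin2. lra.
    - intros eps He. exists (Rmin (/ 2) (eps / (2 * b))). split. apply Rmin_pos. lra. apply Rdiv_lt_0_compat; lra.
      assert (M1 := Rmin_l (/ 2) (eps / (2 * b))). assert (M2 := Rmin_r (/ 2) (eps / (2 * b))). intros x Hx.
      assert (P3 := PI2_3_2). assert (Hx' : 0 < x < PI / 2) by lra. destruct (trig_pos x Hx') as [H1 H2].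
      assert (L := neg_ln_sin2_le x Hx'). assert (C := cpow_bounds b x Hb Hx').
      assert (Hcos : / 2 <= cos x ^ 2). { assert (Q := one_minus_cos_le x). simpl in *. nra. }
      assert (Hlc : 1 - cpow b x <= 2 * b * (sin x * sin x)).
      { unfold cpow. assert (Q := exp_ineq1_le (b * ln (cos x ^ 2))).
        assert (Q2 := exp_ineq1_le (ln (/ cos x ^ 2))). rewrite exp_ln, ln_Rinv in Q2; [|lra|apply Rinv_0_lt_compat; lra].
        assert (Q3 : / cos x ^ 2 - 1 <= 2 * (sin x * sin x)).
        { assert (S := sin2_cos2 x). unfold Rsqr in S. apply Rmult_le_reg_r with (cos x ^ 2). lra.
          rewrite Rmult_minus_distr_r, Rinv_l by lra. simpl in *. nra. }
        nra. }
      assert (Hs : sin x <= x) by (left; apply sin_lt_x; lra).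
      rewrite Rminus_0_r. replace (/ 2 * (1 - cpow b x) * ln (sin x ^ 2)) with (- (/ 2 * ((1 - cpow b x) * - ln (sin x ^ 2)))) by ring.
      rewrite Rabs_Ropp, Rabs_pos_eq. 2: apply Rmult_le_pos; [lra|]; apply Rmult_le_pos; lra.
      apply Rle_lt_trans with (/ 2 * (2 * b * (sin x * sin x) * (2 * / sin x))).
      + apply Rmult_le_compat_l. lra. apply Rmult_le_compat; lra.
      + replace (/ 2 * (2 * b * (sin x * sin x) * (2 * / sin x))) with (2 * b * sin x) by (field; lra).
        apply Rle_lt_trans with (2 * b * x). apply Rmult_le_compat_l; lra.
        replace eps with (2 * b * (eps / (2 * b))) by (field; lra). apply Rmult_lt_compat_l; lra.
    - intros eps He. destruct (continuous_eps (fun t => ln (sin t ^ 2)) (PI / 2)) with (eps := eps) as [d [Hd K]]; auto.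
      apply continuous_ln_sin2; lra.
      exists (Rmin d (PI / 4)). split. apply Rmin_pos; lra. assert (M1 := Rmin_l d (PI / 4)). assert (M2 := Rmin_r d (PI / 4)).
      intros y Hy. specialize (K y). rewrite sin_PI2, pow1, ln_1, Rminus_0_r in K. rewrite Rminus_0_r.
      assert (C := cpow_bounds b y Hb ltac:(lra)). rewrite !Rabs_mult, (Rabs_pos_eq (/ 2)), (Rabs_pos_eq (1 - _)) by lra.
      assert (Q := Rabs_pos (ln (sin y ^ 2))). assert (Q2 : Rabs (ln (sin y ^ 2)) < eps). { apply K. apply Rabs_def1; lra. } nra. }
  assert (H1 := iIntR_plus _ _ _ _ H0 (iIntR_scal b _ _ (logK_spec b Hb))).
  replace (b * logK b) with (0 - 0 + b * logK b) by ring. eapply iIntR_ext. 2: apply H1. intros; simpl; ring.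
Qed.

Lemma logK_step b : 0 < b -> 2 * (b + 1) * logK (b + 1) = 2 * b * logK b + / (b + 1).
Proof.
  intros Hb. assert (H : (b + 1) * logK (b + 1) = b * logK b + / (2 * (b + 1))).
  { apply iIntR_unique with (f := fun t => (1 - cpow (b + 1) t) * (cos t / sin t)). apply logK_by_parts; lra.
    eapply iIntR_ext. 2: apply (iIntR_plus _ _ _ _ (logK_by_parts b Hb) (iIntR_tan_cpow (b + 1) ltac:(lra))).
    intros t Ht. destruct (trig_pos t Ht) as [H1 H2]. rewrite cpow_S; auto. unfold tan.
    assert (S := sin2_cos2 t). unfold Rsqr in S. apply Rmult_eq_reg_r with (sin t * cos t). 2: apply Rgt_not_eq; nra.
    field_simplify; try lra. replace (sin t ^ 2) with (1 - cos t ^ 2) by (simpl; lra). ring. }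
  rewrite Rmult_assoc, H. field. lra.
Qed.

Lemma logK_1 : 2 * 1 * logK 1 = 1.
Proof.
  assert (H : 1 * logK 1 = / (2 * 1)).
  { apply iIntR_unique with (f := fun t => (1 - cpow 1 t) * (cos t / sin t)). apply logK_by_parts; lra.
    eapply iIntR_ext. 2: apply (iIntR_tan_cpow 1); lra.
    intros t Ht. destruct (trig_pos t Ht) as [H1 H2]. unfold tan.
    assert (E : cpow 1 t = cos t ^ 2). { unfold cpow. rewrite Rmult_1_l, exp_ln; auto. apply pow_lt; lra. } rewrite E.
    assert (S := sin2_cos2 t). unfold Rsqr in S. apply Rmult_eq_reg_r with (sin t * cos t). 2: apply Rgt_not_eq; nra.
    field_simplify; try lra. replace (sin t ^ 2) with (1 - cos t ^ 2) by (simpl; lra). ring. }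
  lra.
Qed.

Lemma logK_mono b b' : 0 < b -> b <= b' -> 2 * b * logK b <= 2 * b' * logK b'.
Proof.
  intros Hb Hbb. rewrite !Rmult_assoc. apply Rmult_le_compat_l. lra.
  eapply iIntR_le. 2: apply logK_by_parts; lra. 2: apply logK_by_parts; lra.
  intros t Ht. cbv beta. destruct (trig_pos t Ht) as [H1 H2]. assert (C := cpow_decr b b' t Hbb Ht).
  apply Rmult_le_compat_r. apply Rmult_le_pos. lra. left; apply Rinv_0_lt_compat; lra. lra.
Qed.

Lemma logK_shift b n : 0 < b -> 2 * (b + INR n) * logK (b + INR n) = 2 * b * logK b + harm (b + 1) n.
Proof.
  intros Hb. induction n. simpl. rewrite !Rplus_0_r. auto. rewrite S_INR. replace (b + (INR n + 1)) with (b + INR n + 1) by ring.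
  assert (Q := pos_INR n). rewrite logK_step, IHn by lra. simpl. replace (b + 1 + INR n) with (b + INR n + 1) by ring. ring.
Qed.

Lemma logK_nat n : 2 * (INR (S n)) * logK (INR (S n)) = harm 1 (S n).
Proof.
  rewrite S_INR, (Rplus_comm (INR n)), logK_shift, logK_1 by lra. clear.
  induction n. simpl. field. change (1 + (harm (1 + 1) n + / (1 + 1 + INR n)) = harm 1 (S n) + / (1 + INR (S n))).
  rewrite <- IHn, S_INR. replace (1 + 1 + INR n) with (1 + (INR n + 1)) by ring. ring.
Qed.

Lemma harm_diff n m : harm 1 (n + m) - harm 1 n <= INR m * / INR (n + 1).
Proof.
  induction m. rewrite Nat.add_0_r. simpl. lra.
  rewrite Nat.add_succ_r. change (harm 1 (S (n + m))) with (harm 1 (n + m) + / (1 + INR (n + m))). rewrite S_INR.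
  assert (/ (1 + INR (n + m)) <= / INR (n + 1)). { apply Rinv_le_contravar. apply lt_0_INR; lia. rewrite !plus_INR. simpl. assert (Q := pos_INR m). lra. } lra.
Qed.

(* Both u(b) = 2 b K(b) and digamma(b + 1) have increment 1/(b+1), and u is monotone, so u is determined by its values at the integers. *)
Lemma logK_value b : 0 < b -> 2 * b * logK b = drg 1 - drg (b + 1) / rg (b + 1).
Proof.
  intros Hb. destruct (nfloor_ex b) as [m Hm]. lra.
  assert (L : is_lim_seq (fun n => harm 1 n - harm (b + 1) n) (2 * b * logK b)).
  { apply is_lim_seq_incr_1.
    (* The point [b + S n] lies between the integers [S n] and [S n + S m], where [2 b * logK b] is
       a harmonic number; the two harmonic numbers differ by at most [S m / (n + 1)]. *)
    apply is_lim_seq_le_le with (u := fun n => 2 * b * logK b - INR (S m) * / INR (n + 1)) (w := fun _ => 2 * b * logK b).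
    - intros n. assert (A := logK_shift b (S n) Hb).
      assert (B1 := logK_mono (INR (S n)) (b + INR (S n)) ltac:(apply lt_0_INR; lia) ltac:(lra)).
      assert (B2 := logK_mono (b + INR (S n)) (INR (S (n + S m))) ltac:(assert (Q := pos_INR (S n)); lra)
        ltac:(replace (S (n + S m)) with (S n + S m)%nat by lia; rewrite plus_INR, (S_INR m); lra)).
      rewrite logK_nat in B1, B2. rewrite A in B1, B2.
      assert (D := harm_diff (S n) (S m)). replace (S n + S m)%nat with (S (n + S m)) in D by lia.
      assert (I : / INR (S n + 1) <= / INR (n + 1)). { apply Rinv_le_contravar. apply lt_0_INR; lia. apply le_INR; lia. }
      assert (0 <= INR (S m)) by apply pos_INR. nra.
    - replace (Finite (2 * b * logK b)) with (Finite (2 * b * logK b - INR (S m) * 0)) by (f_equal; ring).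
      apply is_lim_seq_minus'. apply is_lim_seq_const.
      apply (is_lim_seq_scal_l _ (INR (S m)) (Finite 0)). apply (is_lim_seq_incr_n (fun n => / INR n) 1).
      replace (Finite 0) with (Rbar_inv p_infty) by reflexivity. apply is_lim_seq_inv. apply is_lim_seq_INR. discriminate.
    - apply is_lim_seq_const. }
  apply is_lim_seq_unique in L. rewrite (is_lim_seq_unique _ _ (digamma_diff_lim b Hb)) in L. injection L. auto.
Qed.

(** [betaI] is Gamma(a+1) Gamma(b) / (2 Gamma(a+b+1)) and [betaL] its formal derivative in [a], both
    written with the reciprocal Gamma function. *)
Definition betaI (a : nat) (b : R) : R := INR (fact a) * rg (INR a + b + 1) / rg b / 2.
Definition betaL (a : nat) (b : R) : R :=
  INR (fact a) / rg b * (drg (INR a + b + 1) - INR (fact a) * drg (INR a + 1) * rg (INR a + b + 1)) / 2.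

Lemma betaI_integral a : forall b, 0 < b -> iIntR (fun t => tan t * (sin t ^ 2) ^ a * cpow b t) (betaI a b).
Proof.
  induction a; intros b Hb; assert (R0 := rg_pos b Hb).
  - replace (betaI 0 b) with (/ (2 * b)). eapply iIntR_ext. 2: apply iIntR_tan_cpow; auto. intros; simpl; ring.
    unfold betaI. simpl (INR 0). simpl (fact 0). simpl (INR 1). rewrite Rplus_0_l. rewrite (rg_step b) in *. field. split. intros E; rewrite E in R0; lra. lra.
  - assert (R1 := rg_pos (b + 1) ltac:(lra)).
    replace (betaI (S a) b) with (betaI a b + - (1) * betaI a (b + 1)).
    + eapply iIntR_ext. 2: apply (iIntR_plus _ _ _ _ (IHa b Hb) (iIntR_scal (- (1)) _ _ (IHa (b + 1) ltac:(lra)))).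
      intros t Ht. cbv beta. rewrite cpow_S; auto. simpl. assert (S := sin2_cos2 t). unfold Rsqr in S.
      replace (sin t * (sin t * 1)) with (1 - cos t * cos t) by lra. ring.
    + unfold betaI. rewrite fact_simpl, mult_INR, S_INR. rewrite (rg_step b) in *.
      replace (INR a + (b + 1) + 1) with (INR a + b + 1 + 1) by ring. replace (INR a + 1 + b + 1) with (INR a + b + 1 + 1) by ring.
      rewrite (rg_step (INR a + b + 1)). field. split; [lra|]. lra.
Qed.

(** For natural [a] no derivative in [a] has to be taken: the recursion from [sin^2 = 1 - cos^2] is
    started by the digamma value of [logK]. *)
Lemma betaL_integral a : forall b, 0 < b -> iIntR (fun t => tan t * (sin t ^ 2) ^ a * cpow b t * ln (sin t ^ 2)) (betaL a b).
Proof.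
  induction a; intros b Hb; assert (R0 := rg_pos b Hb); assert (R1 := rg_pos (b + 1) ltac:(lra)).
  - replace (betaL 0 b) with (- (1) * logK b). eapply iIntR_ext. 2: apply iIntR_scal, logK_spec; auto. intros; simpl; ring.
    assert (V := logK_value b Hb). replace (logK b) with ((drg 1 - drg (b + 1) / rg (b + 1)) / (2 * b)) by (rewrite <- V; field; lra).
    unfold betaL. simpl (INR 0). simpl (fact 0). simpl (INR 1). rewrite !Rplus_0_l. rewrite (rg_step b). field. lra.
  - replace (betaL (S a) b) with (betaL a b + - (1) * betaL a (b + 1)).
    + eapply iIntR_ext. 2: apply (iIntR_plus _ _ _ _ (IHa b Hb) (iIntR_scal (- (1)) _ _ (IHa (b + 1) ltac:(lra)))).
      intros t Ht. cbv beta. rewrite cpow_S; auto. simpl. assert (S := sin2_cos2 t). unfold Rsqr in S.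
      replace (sin t * (sin t * 1)) with (1 - cos t * cos t) by lra. ring.
    + unfold betaL. rewrite fact_simpl, mult_INR, S_INR. rewrite (rg_step b).
      replace (INR a + (b + 1) + 1) with (INR a + b + 1 + 1) by ring. replace (INR a + 1 + b + 1) with (INR a + b + 1 + 1) by ring.
      rewrite (rg_step (INR a + b + 1)), (drg_step (INR a + b + 1)), (drg_step (INR a + 1)).
      assert (F := rg_fact (S a)). rewrite fact_simpl, mult_INR, S_INR in F. rewrite F.
      assert (Q := pos_INR a). field. repeat split; try lra. apply INR_fact_neq_0.
Qed.

(** * Formal power series and convolution identities *)

(** The sum over [k + j = n], by shifts of the first index, so that no truncated subtraction
    occurs. *)
Fixpoint dsum (F : nat -> nat -> R) (n : nat) : R :=
  match n with O => F O O | S m => F O n + dsum (fun k j => F (S k) j) m end.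

Definition conv (a b : nat -> R) : nat -> R := dsum (fun k j => a k * b j).

Lemma dsum_ext F G n : (forall k j, (k + j = n)%nat -> F k j = G k j) -> dsum F n = dsum G n.
Proof.
  revert F G. induction n; intros F G H; simpl. apply H; auto. rewrite (H O (S n)) by lia. f_equal. apply IHn. intros; apply H; lia.
Qed.

Lemma dsum_plus F G n : dsum (fun k j => F k j + G k j) n = dsum F n + dsum G n.
Proof. revert F G. induction n; intros; simpl; auto. rewrite IHn. ring. Qed.

Lemma dsum_scal c F n : dsum (fun k j => c * F k j) n = c * dsum F n.
Proof. revert F. induction n; intros; simpl; auto. rewrite IHn. ring. Qed.

Lemma dsum_sum F n : dsum F n = sum_f_R0 (fun k => F k (n - k)%nat) n.
Proof.
  revert F. induction n; intros; auto. rewrite decomp_sum by lia. simpl dsum. f_equal. rewrite IHn. reflexivity.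
Qed.

Lemma dsum_swap F n : dsum F n = dsum (fun k j => F j k) n.
Proof.
  assert (H : forall n F, dsum F (S n) = dsum (fun k j => F k (S j)) n + F (S n) O).
  { clear. induction n; intros F. reflexivity. 
    change (dsum F (S (S n))) with (F O (S (S n)) + dsum (fun k j => F (S k) j) (S n)). rewrite IHn.
    change (dsum (fun k j => F k (S j)) (S n)) with (F O (S (S n)) + dsum (fun k j => F (S k) (S j)) n). ring. }
  revert F. induction n; intros F. auto. rewrite H. simpl dsum at 2. rewrite (IHn (fun k j => F k (S j))). ring.
Qed.

(** * The ring of formal power series *)

Definition sconst (c : R) (n : nat) : R := match n with O => c | _ => 0 end.
Definition splus (a b : nat -> R) (n : nat) : R := a n + b n.
Definition sopp (a : nat -> R) (n : nat) : R := - a n.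
Definition sminus (a b : nat -> R) : nat -> R := splus a (sopp b).
Definition sX (n : nat) : R := match n with 1%nat => 1 | _ => 0 end.
(** The Euler operator [y d/dy]: a derivation whose kernel consists of the constants. *)
Definition sD (a : nat -> R) (n : nat) : R := INR n * a n.
Definition ssh (a : nat -> R) (n : nat) : R := a (S n).

Lemma conv_S a b n : conv a b (S n) = a O * b (S n) + conv (ssh a) b n.
Proof. reflexivity. Qed.

Lemma conv_0 a b : conv a b O = a O * b O.
Proof. reflexivity. Qed.

Lemma conv_comm a b : conv a b = conv b a.
Proof. apply functional_extensionality. intros n. unfold conv. rewrite dsum_swap. apply dsum_ext. intros; ring. Qed.

Lemma conv_plus_l a b c : conv (splus a b) c = splus (conv a c) (conv b c).
Proof. apply functional_extensionality. intros n. unfold conv, splus. rewrite <- dsum_plus. apply dsum_ext. intros; ring. Qed.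

Lemma conv_scal c a b n : conv (fun k => c * a k) b n = c * conv a b n.
Proof. unfold conv. rewrite <- dsum_scal. apply dsum_ext. intros; ring. Qed.

Lemma conv_assoc a b c : conv a (conv b c) = conv (conv a b) c.
Proof.
  apply functional_extensionality. intros n. revert a b. induction n; intros a b. unfold conv; simpl; ring.
  rewrite !conv_S, conv_0, IHn.
  replace (ssh (conv a b)) with (splus (fun k => a O * ssh b k) (conv (ssh a) b)).
  2: apply functional_extensionality; intros k; unfold splus, ssh; rewrite conv_S; auto.
  rewrite conv_plus_l. unfold splus. rewrite conv_scal. ring.
Qed.

Lemma conv_sconst c a n : conv (sconst c) a n = c * a n.
Proof.
  destruct n. reflexivity. rewrite conv_S. replace (conv (ssh (sconst c)) a n) with 0. simpl; ring.
  assert (H : conv (fun k => 0 * sX k) a n = 0) by (rewrite conv_scal; ring). rewrite <- H at 1. f_equal.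
  apply functional_extensionality. intros k. unfold ssh. simpl. ring.
Qed.

Lemma conv_sX_S a n : conv sX a (S n) = a n.
Proof.
  rewrite conv_S. replace (ssh sX) with (sconst 1). rewrite conv_sconst. simpl. ring.
  apply functional_extensionality. intros [|k]; reflexivity.
Qed.

(** With this structure, consequences of differential equations between series are checked by
    [ring]. *)
Lemma sring_theory : ring_theory (sconst 0) (sconst 1) splus conv sminus sopp eq.
Proof.
  constructor; intros; try apply functional_extensionality; intros; unfold sminus; auto.
  - unfold splus. destruct x0; simpl; ring.
  - unfold splus; ring.
  - unfold splus; ring.
  - rewrite conv_sconst. ring.
  - rewrite conv_comm. auto.
  - rewrite conv_assoc. auto.
  - rewrite conv_plus_l. auto.
  - unfold splus, sopp. destruct x0; simpl; ring.
Qed.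

Add Ring sring : sring_theory.

Lemma sD_conv a b : sD (conv a b) = splus (conv (sD a) b) (conv a (sD b)).
Proof.
  apply functional_extensionality. intros n. unfold splus. revert a. induction n; intros a.
  - unfold sD, conv; simpl; ring.
  - rewrite !conv_S. replace (ssh (sD a)) with (splus (sD (ssh a)) (ssh a)).
    2: apply functional_extensionality; intros k; unfold splus, sD, ssh; rewrite S_INR; ring.
    rewrite conv_plus_l. unfold splus. specialize (IHn (ssh a)). unfold sD at 1 in IHn. unfold sD at 1. rewrite conv_S.
    change (sD a 0) with (0 * a O). change (sD b (S n)) with (INR (S n) * b (S n)). rewrite S_INR.
    replace ((INR n + 1) * (a O * b (S n) + conv (ssh a) b n)) with ((INR n + 1) * (a O * b (S n)) + INR n * conv (ssh a) b n + conv (ssh a) b n) by ring.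
    rewrite IHn. ring.
Qed.

Lemma sD_plus a b : sD (splus a b) = splus (sD a) (sD b).
Proof. apply functional_extensionality. intros n. unfold sD, splus. ring. Qed.

Lemma sD_sconst c : sD (sconst c) = sconst 0.
Proof. apply functional_extensionality. intros [|n]; unfold sD; simpl; ring. Qed.

Fixpoint fall (x : R) (n : nat) : R := match n with O => 1 | S k => fall x k * (x - INR k) end.

Definition bin (x : R) (n : nat) : R := fall x n / INR (fact n).

(** With f = (1 + y)^x this is the equation y f' = y (x f - y f'). *)
Lemma sD_bin x : sD (bin x) = conv sX (splus (conv (sconst x) (bin x)) (sopp (sD (bin x)))).
Proof.
  apply functional_extensionality. intros [|n]. unfold sD, conv; simpl; ring.
  rewrite conv_sX_S. unfold splus, sopp. rewrite conv_sconst. unfold sD, bin. rewrite fact_simpl, mult_INR. simpl fall.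
  rewrite S_INR. assert (Q := pos_INR n). field. split. apply INR_fact_neq_0. lra.
Qed.

(** The product solves the first order equation of [bin (x + y)] with the same constant term, and
    the factor [INR (S n)] makes the solution unique. *)
Lemma chu_vandermonde x y : conv (bin x) (bin y) = bin (x + y).
Proof.
  assert (H : sD (conv (bin x) (bin y)) = conv sX (splus (conv (sconst (x + y)) (conv (bin x) (bin y))) (sopp (sD (conv (bin x) (bin y)))))).
  { rewrite sD_conv, (sD_bin x) at 1. rewrite (sD_bin y) at 1. rewrite sD_conv.
    replace (sconst (x + y)) with (splus (sconst x) (sconst y)). ring.
    apply functional_extensionality. intros [|n]; unfold splus; simpl; ring. }
  apply functional_extensionality. intros n. induction n. unfold conv, bin; simpl; field.
  assert (E1 := f_equal (fun f => f (S n)) H). assert (E2 := f_equal (fun f => f (S n)) (sD_bin (x + y))). cbv beta in E1, E2.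
  rewrite conv_sX_S in E1, E2. unfold splus, sopp in E1, E2. rewrite conv_sconst in E1, E2. unfold sD in E1, E2.
  rewrite IHn in E1. rewrite <- E2 in E1. apply Rmult_eq_reg_l in E1; auto. apply not_0_INR. lia.
Qed.

Lemma fall_rpoch x n : fall (x + INR n) n = rpoch (x + 1) n.
Proof.
  assert (H : forall y m, fall (y + 1) (S m) = (y + 1) * fall y m).
  { clear. intros y m. induction m. simpl. ring. change (fall (y + 1) (S (S m))) with (fall (y + 1) (S m) * (y + 1 - INR (S m))). rewrite IHm, S_INR. simpl. ring. }
  revert x. induction n; intros x. auto. rewrite S_INR. replace (x + (INR n + 1)) with (x + INR n + 1) by ring. rewrite H, IHn. simpl. ring.
Qed.

(* With y = - z^2 / 4, J_nu z = (z / 2)^nu * sum_k besc nu k * y^k. *)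
Definition besc (nu : R) (k : nat) : R := rg (nu + INR k + 1) / INR (fact k).

(** Once the two Gamma factors of index [n] are pulled out, the coefficients are binomial and
    Chu-Vandermonde sums them. *)
Lemma besc_product mu nu n : conv (besc mu) (besc nu) n =
  rg (mu + INR n + 1) * rg (nu + INR n + 1) * rpoch (mu + nu + INR n + 1) n / INR (fact n).
Proof.
  transitivity (rg (mu + INR n + 1) * rg (nu + INR n + 1) * conv (bin (nu + INR n)) (bin (mu + INR n)) n).
  - unfold conv. rewrite <- dsum_scal. apply dsum_ext. intros k j E. unfold besc, bin.
    assert (E1 : forall x k j, (k + j = n)%nat -> rg (x + INR k + 1) = rg (x + INR n + 1) * fall (x + INR n) j).
    { intros x k' j' <-. rewrite (rg_rpoch (x + INR k' + 1) j'), plus_INR. replace (x + (INR k' + INR j')) with (x + INR k' + INR j') by ring.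
      rewrite fall_rpoch. replace (x + INR k' + 1 + INR j') with (x + INR k' + INR j' + 1) by ring. ring. }
    rewrite (E1 mu k j E), (E1 nu j k) by lia. field. split; apply INR_fact_neq_0.
  - rewrite chu_vandermonde. unfold bin. replace (nu + INR n + (mu + INR n)) with (mu + nu + INR n + INR n) by ring. rewrite fall_rpoch. 
    unfold Rdiv. ring.
Qed.

(** Polynomial functions in Horner form, used for the principle that a polynomial vanishing at all
    natural numbers is 0. *)
Fixpoint pdeg (d : nat) (f : R -> R) : Prop :=
  match d with
  | O => exists c, forall x, f x = c
  | S k => exists c g, pdeg k g /\ forall x, f x = c + x * g x
  end.

Lemma pdeg_lift d f : pdeg d f -> pdeg (S d) f.
Proof.
  revert f. induction d; intros f H.
  - destruct H as [c H]. exists c, (fun _ => 0). split. exists 0; auto. intros; rewrite H; ring.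
  - destruct H as [c [g [H1 H2]]]. exists c, g. split; auto.
Qed.

Lemma pdeg_le d e f : (d <= e)%nat -> pdeg d f -> pdeg e f.
Proof. intros H. induction H; auto. intros Q. apply pdeg_lift; auto. Qed.

Lemma pdeg_plus d f g : pdeg d f -> pdeg d g -> pdeg d (fun x => f x + g x).
Proof.
  revert f g. induction d; intros f g Hf Hg.
  - destruct Hf as [c Hf], Hg as [c' Hg]. exists (c + c'). intros; rewrite Hf, Hg; auto.
  - destruct Hf as [c [f1 [H1 H2]]], Hg as [c' [g1 [H3 H4]]]. exists (c + c'), (fun x => f1 x + g1 x). split. auto. intros; rewrite H2, H4; ring.
Qed.

Lemma pdeg_scal d k f : pdeg d f -> pdeg d (fun x => k * f x).
Proof.
  revert f. induction d; intros f Hf.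
  - destruct Hf as [c Hf]. exists (k * c). intros; rewrite Hf; auto.
  - destruct Hf as [c [f1 [H1 H2]]]. exists (k * c), (fun x => k * f1 x). split. auto. intros; rewrite H2; ring.
Qed.

Lemma pdeg_mult d e f g : pdeg d f -> pdeg e g -> pdeg (d + e) (fun x => f x * g x).
Proof.
  revert f. induction d; intros f Hf Hg.
  - destruct Hf as [c Hf]. replace (fun x => f x * g x) with (fun x => c * g x). apply pdeg_scal; auto.
    apply functional_extensionality; intros; rewrite Hf; auto.
  - destruct Hf as [c [f1 [H1 H2]]].
    replace (fun x => f x * g x) with (fun x => c * g x + x * (f1 x * g x)) by (apply functional_extensionality; intros; rewrite H2; ring).
    apply pdeg_plus. apply pdeg_le with e. lia. apply pdeg_scal; auto.
    exists 0, (fun x => f1 x * g x). split. apply IHd; auto. intros; ring.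
Qed.

Definition ispoly (f : R -> R) : Prop := exists d, pdeg d f.

Lemma ispoly_const c : ispoly (fun _ => c).
Proof. exists 0%nat, c. auto. Qed.

Lemma ispoly_id : ispoly (fun x => x).
Proof. exists 1%nat, 0, (fun _ => 1). split. exists 1; auto. intros; ring. Qed.

Lemma ispoly_plus f g : ispoly f -> ispoly g -> ispoly (fun x => f x + g x).
Proof. intros [d Hd] [e He]. exists (max d e). apply pdeg_plus; [apply pdeg_le with d | apply pdeg_le with e]; auto; lia. Qed.

Lemma ispoly_mult f g : ispoly f -> ispoly g -> ispoly (fun x => f x * g x).
Proof. intros [d Hd] [e He]. exists (d + e)%nat. apply pdeg_mult; auto. Qed.

Lemma pdeg_factor d f a : pdeg (S d) f -> exists g, pdeg d g /\ forall x, f x = f a + (x - a) * g x.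
Proof.
  revert f. induction d; intros f [c [h [H1 H2]]].
  - exists h. split; auto. destruct H1 as [k H1]. intros x. rewrite !H2, !H1. ring.
  - destruct (IHd h H1) as [h1 [K1 K2]]. exists (fun x => h x + a * h1 x). split.
    apply pdeg_plus; auto. apply pdeg_lift, pdeg_scal; auto. intros x. rewrite !H2. rewrite (K2 x). ring.
Qed.

(** Each zero splits off a linear factor and lowers the degree, while infinitely many zeros
    remain. *)
Lemma ispoly_zero f : ispoly f -> (forall n : nat, f (INR n) = 0) -> forall x, f x = 0.
Proof.
  intros [d Hd] H. assert (G : forall d f M, pdeg d f -> (forall n, (M <= n)%nat -> f (INR n) = 0) -> forall x, f x = 0).
  2: { intros x. apply (G d f 0%nat); auto. }
  clear. induction d; intros f M Hf H x.
  - destruct Hf as [c Hf]. rewrite Hf, <- (Hf (INR M)). auto.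
  - destruct (pdeg_factor d f (INR M) Hf) as [g [H1 H2]]. rewrite H2, H by lia. rewrite (IHd g (S M)); auto. ring.
    intros n Hn. assert (E := H2 (INR n)). rewrite !H in E by lia. 
    apply Rmult_eq_reg_l with (INR n - INR M). lra. assert (INR M < INR n) by (apply lt_INR; lia). lra.
Qed.

(** [cc mu n] is the binomial coefficient of [mu + 2 n] over [n], and [alpha nu k] is
    [nu / (nu + 2 k)] times that of [nu + 2 k] over [k], with the division carried out so that it is
    a polynomial in [nu]. *)
Definition cc (mu : R) (n : nat) : R := rpoch (mu + INR n + 1) n / INR (fact n).

Definition alpha (nu : R) (k : nat) : R :=
  match k with O => 1 | S j => nu * rpoch (nu + INR j + 2) j / INR (fact (S j)) end.

(** Pascal's rule; [alpha] obeys the same recursion. *)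
Lemma cc_step mu n : cc mu (S n) - cc (mu - 1) (S n) = cc (mu + 1) n.
Proof.
  unfold cc. rewrite S_INR. replace (mu - 1 + (INR n + 1) + 1) with (mu + INR n + 1) by ring. replace (mu + (INR n + 1) + 1) with (mu + INR n + 1 + 1) by ring.
  rewrite (rpoch_S_left (mu + INR n + 1)). change (rpoch (mu + INR n + 1 + 1) (S n)) with (rpoch (mu + INR n + 1 + 1) n * (mu + INR n + 1 + 1 + INR n)).
  replace (mu + 1 + INR n + 1) with (mu + INR n + 1 + 1) by ring. rewrite fact_simpl, mult_INR, S_INR. assert (Q := pos_INR n). field.
  split. apply INR_fact_neq_0. lra.
Qed.

Lemma alpha_step nu k : alpha nu (S k) - alpha (nu - 1) (S k) = alpha (nu + 1) k.
Proof.
  unfold alpha. destruct k. simpl. field.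
  rewrite S_INR. replace (nu - 1 + (INR k + 1) + 2) with (nu + INR k + 2) by ring. replace (nu + 1 + INR k + 2) with (nu + INR k + 2 + 1) by ring.
  replace (nu + (INR k + 1) + 2) with (nu + INR k + 2 + 1) by ring.
  rewrite (rpoch_S_left (nu + INR k + 2)). change (rpoch (nu + INR k + 2 + 1) (S k)) with (rpoch (nu + INR k + 2 + 1) k * (nu + INR k + 2 + 1 + INR k)).
  rewrite (fact_simpl (S k)), mult_INR, (S_INR (S k)), (S_INR k). assert (Q := pos_INR k). field.
  split. apply INR_fact_neq_0. lra.
Qed.

Lemma ispoly_rpoch f n : ispoly f -> ispoly (fun x => rpoch (f x) n).
Proof.
  intros Hf. induction n; simpl. apply ispoly_const. apply ispoly_mult; auto. apply ispoly_plus; auto. apply ispoly_const.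
Qed.

Lemma ispoly_alpha k : ispoly (fun nu => alpha nu k).
Proof.
  destruct k; simpl. apply ispoly_const. apply ispoly_mult. 2: apply ispoly_const. apply ispoly_mult. apply ispoly_id.
  apply ispoly_rpoch. apply ispoly_plus. 2: apply ispoly_const. apply ispoly_plus. apply ispoly_id. apply ispoly_const.
Qed.

Lemma ispoly_conv (u : R -> nat -> R) v n : (forall k, ispoly (fun x => u x k)) -> ispoly (fun x => conv (u x) v n).
Proof.
  revert u. induction n; intros u H. apply (ispoly_mult (fun x => u x O)); auto. apply ispoly_const.
  apply (ispoly_plus (fun x => u x O * v (S n)) (fun x => conv (ssh (u x)) v n)). apply (ispoly_mult (fun x => u x O)); auto. apply ispoly_const.
  apply (IHn (fun x => ssh (u x))). intros k. apply (H (S k)).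
Qed.

(* In the second parameter both sides are polynomials, and their difference is 1-periodic by induction on n. *)
Lemma rothe_hagen mu nu n : conv (alpha nu) (cc mu) n = cc (mu + nu) n.
Proof.
  revert nu. induction n; intros nu. unfold conv, cc; simpl; field.
  set (Dn := fun x => conv (alpha x) (cc mu) (S n) + - (1) * cc (mu + x) (S n)).
  assert (HP : ispoly Dn).
  { apply ispoly_plus. apply ispoly_conv. apply ispoly_alpha. apply ispoly_mult. apply ispoly_const.
    unfold cc. apply ispoly_mult. 2: apply ispoly_const. apply ispoly_rpoch. apply ispoly_plus. 2: apply ispoly_const.
    apply ispoly_plus. 2: apply ispoly_const. apply ispoly_plus. apply ispoly_const. apply ispoly_id. }
  assert (Hper : forall x, Dn x = Dn (x - 1)).
  { intros x. unfold Dn. assert (E := cc_step (mu + x) n).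
    assert (E2 : conv (alpha x) (cc mu) (S n) - conv (alpha (x - 1)) (cc mu) (S n) = conv (alpha (x + 1)) (cc mu) n).
    { rewrite !conv_S. simpl (alpha _ 0).
      replace (ssh (alpha x)) with (splus (ssh (alpha (x - 1))) (alpha (x + 1))).
      rewrite conv_plus_l. unfold splus. ring.
      apply functional_extensionality. intros k. unfold splus, ssh. rewrite <- alpha_step. ring. }
    rewrite IHn in E2. replace (mu + (x + 1)) with (mu + x + 1) in E2 by ring. replace (mu + (x - 1)) with (mu + x - 1) by ring. lra. }
  (* At 0 the series [alpha] is the unit of convolution; periodicity carries the zero to every
     natural number. *)
  assert (H0 : forall m : nat, Dn (INR m) = 0).
  { induction m.
    - unfold Dn. simpl INR. rewrite Rplus_0_r, conv_S.
      replace (ssh (alpha 0)) with (sconst 0). rewrite conv_sconst. simpl (alpha _ 0). ring.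
      apply functional_extensionality. intros k. unfold ssh, alpha. destruct k; simpl; unfold Rdiv; ring.
    - rewrite Hper, S_INR. replace (INR m + 1 - 1) with (INR m) by ring. auto. }
  assert (Z := ispoly_zero Dn HP H0 nu). unfold Dn in Z. lra.
Qed.

(** * Bessel functions as functions of the order *)

Lemma Clog_Cexp (l : C) : - PI < Im l <= PI -> Clog (Cexp l) = l.
Proof.
  intros H. destruct l as [a phi]. simpl in H. unfold Clog. rewrite Cmod_Cexp. simpl Re. rewrite ln_exp. f_equal.
  unfold Carg. rewrite Cmod_Cexp. unfold Cexp; simpl.
  assert (He := exp_pos a). replace (exp a * cos phi / exp a) with (cos phi) by (field; lra).
  assert (P := PI_RGT_0). destruct (Rle_dec 0 (exp a * sin phi)) as [Hs|Hs].
  - apply acos_cos. split; [|lra]. apply Rnot_lt_le. intros Hlt.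
    assert (0 < sin (- phi)) by (apply sin_gt_0; lra). rewrite sin_neg in *. nra.
  - rewrite <- (Ropp_involutive phi) at 2. f_equal. rewrite <- cos_neg. apply acos_cos. split; [|lra].
    apply Rnot_lt_le. intros Hlt. apply Hs. apply Rmult_le_pos. lra. apply sin_ge_0; lra.
Qed.

Lemma Carg_bound (w : C) : w <> 0%C -> -1 <= Re w / Cmod w <= 1.
Proof.
  intros Hw. assert (Hm := Cmod_pos w Hw). assert (H := re_le_Cmod w). apply Rabs_le_between in H.
  split; apply Rmult_le_reg_r with (Cmod w); auto; unfold Rdiv; rewrite Rmult_assoc, Rinv_l; lra.
Qed.

Lemma Cexp_Clog (w : C) : w <> 0%C -> Cexp (Clog w) = w.
Proof.
  intros Hw. assert (Hm := Cmod_pos w Hw). assert (B := Carg_bound w Hw).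
  unfold Cexp, Clog; simpl Re; simpl Im. rewrite exp_ln by auto.
  assert (Hc : cos (Carg w) = Re w / Cmod w). { unfold Carg. destruct (Rle_dec 0 (Im w)); rewrite ?cos_neg; apply cos_acos; auto. }
  assert (Hs : Cmod w * sqrt (1 - (Re w / Cmod w)²) = Rabs (Im w)).
  { rewrite <- (sqrt_Rsqr_abs (Im w)). rewrite <- (sqrt_Rsqr (Cmod w)) at 1 by lra. rewrite <- sqrt_mult_alt by apply Rle_0_sqr. f_equal.
    assert (Q := Cmod2_alt w). simpl in Q. unfold Rsqr. field_simplify; try lra. }
  assert (Hs' : Cmod w * sin (Carg w) = Im w).
  { unfold Carg. destruct (Rle_dec 0 (Im w)) as [H|H]; rewrite ?sin_neg, ?sin_acos by auto.
    rewrite Hs. apply Rabs_pos_eq; auto. rewrite <- Ropp_mult_distr_r, Hs, Rabs_left; lra. }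
  rewrite Hc, Hs'. apply C_ext; simpl; auto. unfold Re. field. lra.
Qed.

Lemma Carg_right_half (z : C) : 0 < Re z -> - (PI / 2) < Carg z < PI / 2.
Proof.
  intros Hz. assert (Hz0 : z <> 0%C) by (intros E; rewrite E in Hz; simpl in Hz; lra).
  assert (B := Carg_bound z Hz0). assert (Hm := Cmod_pos z Hz0). assert (P := PI_RGT_0).
  assert (A := acos_bound (Re z / Cmod z)).
  assert (H : acos (Re z / Cmod z) < PI / 2).
  { apply Rnot_le_lt. intros H. assert (Q : cos (acos (Re z / Cmod z)) <= 0) by (apply cos_le_0; lra).
    rewrite cos_acos in Q by auto. assert (0 < Re z / Cmod z) by (apply Rdiv_lt_0_compat; auto). lra. }
  unfold Carg. destruct (Rle_dec 0 (Im z)); lra.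
Qed.

Lemma Clog_scal (z : C) (r : R) : 0 < Re z -> 0 < r -> Clog (z * r) = (Clog z + ln r)%C.
Proof.
  intros Hz Hr. assert (Hz0 : z <> 0%C) by (intros E; rewrite E in Hz; simpl in Hz; lra).
  assert (P := PI_RGT_0). rewrite <- (Clog_Cexp (Clog z + ln r)).
  - rewrite Cexp_plus, Cexp_Clog, Cexp_RtoC, exp_ln by auto. auto.
  - simpl. assert (A := Carg_right_half z Hz). lra.
Qed.

(** For [0 < Re z] the argument is below PI / 2 in absolute value, so doubling it stays in the
    principal strip. *)
Lemma Clog_sq (z : C) : 0 < Re z -> Clog (z ^ 2) = (2 * Clog z)%C.
Proof.
  intros Hz. assert (Hz0 : z <> 0%C) by (intros E; rewrite E in Hz; simpl in Hz; lra).
  rewrite <- (Clog_Cexp (2 * Clog z)).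
  - replace (2 * Clog z)%C with (Clog z + Clog z)%C by ring. rewrite Cexp_plus, Cexp_Clog by auto. f_equal. simpl. ring.
  - simpl. assert (A := Carg_right_half z Hz). assert (P := PI_RGT_0). lra.
Qed.

(** * Bounds for the reciprocal Gamma function *)

Lemma rGamma_bounded R0 : 0 <= R0 -> exists B, 0 < B /\ forall s, Cmod s <= R0 -> Cmod (rGamma s) <= B.
Proof.
  intros HR. destruct (rgn_geom_bounds R0 HR) as [N [C0 [HN [HC0 [HCN [Hrat [Hup _]]]]]]].
  destruct (rgn_bound R0 N) as [B [HB Bb]]. exists (B * exp (/ 2)). split. apply Rmult_lt_0_compat; auto. apply exp_pos.
  intros s Hs. apply Clim_bound with (u := fun k => rgn (N + k) s).
  - intros k. eapply Rle_trans. apply Hup; auto. apply Rmult_le_compat; auto using Cmod_ge_0. left; apply exp_pos. apply exp_le_compat.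
    assert (0 < / INR (N + k)) by (apply Rinv_0_lt_compat, lt_0_INR; lia). nra.
  - apply Clim_eps. intros eps He. destruct (proj1 (Clim_eps _ _) (rGamma_lim s) eps He) as [N' K]. exists N'. intros; apply K; lia.
Qed.

(** A shift to the right divides by a factor of modulus at least 1 once [k] exceeds [A + 1]; the
    finitely many earlier arguments lie in one disc. *)
Lemma rGamma_shift_bound A : 0 <= A -> exists M, 0 < M /\ forall (nu : C) k, Cmod nu <= A -> Cmod (rGamma (nu + INR k + 1)) <= M.
Proof.
  intros HA. destruct (nfloor_ex (A + 1)) as [N HN]. lra.
  destruct (rGamma_bounded (A + INR N + 2)) as [M [HM B]]. assert (Q := pos_INR N). lra.
  exists M. split; auto. intros nu k Hnu. induction k.
  - apply B. simpl. eapply Rle_trans. apply Cmod_triangle. rewrite Cmod_1. eapply Rle_trans. apply Rplus_le_compat_r, Cmod_triangle. rewrite Cmod_0. assert (Q := pos_INR N). lra.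
  - destruct (Nat.le_gt_cases (S k) (N + 1)) as [H|H].
    + apply B. eapply Rle_trans. apply Cmod_triangle. rewrite Cmod_1. eapply Rle_trans. apply Rplus_le_compat_r, Cmod_triangle.
      rewrite Cmod_R, Rabs_pos_eq by apply pos_INR. apply le_INR in H. rewrite plus_INR in H. simpl (INR 1) in H. lra.
    + assert (E : (nu + INR (S k) + 1 = (nu + INR k + 1) + 1)%C) by (rewrite S_INR, RtoC_plus; ring). rewrite E.
      rewrite rGamma_step, Cmod_mult in IHk.
      assert (H1 : 1 <= Cmod (nu + INR k + 1)).
      { assert (T := Cmod_triangle_inv (INR k + 1) (- nu)%C). replace (INR k + 1 - - nu)%C with (nu + INR k + 1)%C in T by ring.
        rewrite <- RtoC_plus, Cmod_R, Cmod_opp, Rabs_pos_eq in T by (assert (Q := pos_INR k); lra).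
        assert (HNk : INR (N + 1) <= INR k) by (apply le_INR; lia). rewrite plus_INR in HNk. simpl (INR 1) in HNk.
        lra. }
      assert (H2 := Cmod_ge_0 (rGamma (nu + INR k + 1 + 1))). nra.
Qed.

(** Cauchy's estimate on a square of half-side 1, which is why the previous bound is taken at
    [A + 2]. *)
Lemma drGamma_shift_bound A : 0 <= A -> exists M, 0 < M /\ forall (nu : C) k, Cmod nu <= A ->
  Cmod (rGamma (nu + INR k + 1)) <= M /\ Cmod (drGamma (nu + INR k + 1)) <= M.
Proof.
  intros HA. destruct (rGamma_shift_bound (A + 2)) as [M [HM B]]. lra. exists (2 * M). split. lra. intros nu k Hnu. split.
  - eapply Rle_trans. apply B. lra. lra.
  - destruct (cauchy_taylor rGamma (nu + INR k + 1) 1 M (drGamma (nu + INR k + 1))) as [H _].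
    lra. intros s _. apply cdiff_rGamma. 2: apply cdiff_drGamma. 2: replace (2 * M) with (2 * M / 1) by field; auto.
    intros s Hs. replace s with ((s - INR k - 1) + INR k + 1)%C by ring. apply B. apply insq_Cmod in Hs.
    replace (s - INR k - 1)%C with ((s - (nu + INR k + 1)) + nu)%C by ring. eapply Rle_trans. apply Cmod_triangle. lra.
Qed.

(** * The Bessel series as an entire function of the order *)

Lemma ex_series_exp M y : ex_series (fun k => M * (y ^ k / INR (fact k))).
Proof.
  assert (H := is_exp_Reals y). apply is_pseries_R in H. exists (M * exp y).
  apply (is_series_scal M) in H. eapply is_series_ext. 2: apply H. intros n. cbv beta. unfold scal; simpl; unfold mult; simpl. unfold Rdiv. ring.
Qed.

Definition jcoef (y nu : C) (k : nat) : C := (y ^ k / INR (fact k) * rGamma (nu + INR k + 1))%C.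
Definition djcoef (y nu : C) (k : nat) : C := (y ^ k / INR (fact k) * drGamma (nu + INR k + 1))%C.
Definition jser (y nu : C) : C := CSeries (jcoef y nu).
Definition djser (y nu : C) : C := CSeries (djcoef y nu).

Lemma Cmod_powfact y k : Cmod (y ^ k / INR (fact k)) = Cmod y ^ k / INR (fact k).
Proof.
  rewrite Cmod_div by apply fact_C_nz. rewrite Cmod_pow, Cmod_R, Rabs_pos_eq; auto. apply pos_INR.
Qed.

Lemma jcoef_bound nu : exists M, 0 < M /\ forall y k,
  Cmod (jcoef y nu k) <= M * (Cmod y ^ k / INR (fact k)) /\ Cmod (djcoef y nu k) <= M * (Cmod y ^ k / INR (fact k)).
Proof.
  destruct (drGamma_shift_bound (Cmod nu) (Cmod_ge_0 nu)) as [M [HM B]]. exists M. split; auto. intros y k.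
  destruct (B nu k (Rle_refl _)) as [B1 B2].
  assert (Q : 0 <= Cmod y ^ k / INR (fact k)). { apply Rmult_le_pos. apply pow_le, Cmod_ge_0. left. apply Rinv_0_lt_compat, lt_0_INR, lt_O_fact. }
  unfold jcoef, djcoef. rewrite !Cmod_mult, Cmod_powfact. split; rewrite Rmult_comm; apply Rmult_le_compat_r; auto.
Qed.

Lemma Cser_correct a M : (forall k, Cmod (a k) <= M k) -> ex_series M -> Cser a (CSeries a).
Proof. intros H HM. destruct (Cser_dominated a M H HM) as [l Hl]. rewrite (Cser_CSeries _ _ Hl). auto. Qed.

Lemma jser_spec y nu : Cser (jcoef y nu) (jser y nu).
Proof.
  destruct (jcoef_bound nu) as [M [HM B]]. apply Cser_correct with (M := fun k => M * (Cmod y ^ k / INR (fact k))). apply B. apply ex_series_exp.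
Qed.

Lemma djser_spec y nu : Cser (djcoef y nu) (djser y nu).
Proof.
  destruct (jcoef_bound nu) as [M [HM B]]. apply Cser_correct with (M := fun k => M * (Cmod y ^ k / INR (fact k))). apply B. apply ex_series_exp.
Qed.

Lemma cdiff_shift_k nu k : cdiff (fun s => s + INR k + 1)%C nu 1.
Proof. eapply cdiff_eq. apply cdiff_plus. apply cdiff_plus. apply cdiff_id. apply cdiff_const. apply cdiff_const. ring. Qed.

Lemma cdiff_jser y nu : cdiff (jser y) nu (djser y nu).
Proof.
  destruct (rGamma_shift_bound (Cmod nu + 2)) as [M [HM B]]. assert (Q := Cmod_ge_0 nu); lra.
  assert (D : forall s k, cdiff (fun s => jcoef y s k) s (djcoef y s k)).
  { intros s k. unfold jcoef, djcoef. eapply cdiff_eq. apply cdiff_mult. apply cdiff_const.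
    apply (cdiff_comp (fun s => s + INR k + 1)%C rGamma). apply cdiff_shift_k. apply cdiff_drGamma. cbv beta. ring. }
  destruct (holo_series (fun k s => jcoef y s k) (jser y) (djcoef y nu) (fun k => M * (Cmod y ^ k / INR (fact k))) nu 1) as [L [HL1 HL2]].
  - lra.
  - intros k s _. eexists. apply D.
  - intros k s Hs. unfold jcoef. rewrite Cmod_mult, Cmod_powfact, Rmult_comm. apply Rmult_le_compat_r.
    apply Rmult_le_pos. apply pow_le, Cmod_ge_0. left. apply Rinv_0_lt_compat, lt_0_INR, lt_O_fact.
    apply B. apply insq_Cmod in Hs. replace s with ((s - nu) + nu)%C by ring. eapply Rle_trans. apply Cmod_triangle. lra.
  - apply ex_series_exp.
  - intros k. apply D.
  - intros s _. apply jser_spec.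
  - rewrite (Cser_unique _ _ _ (djser_spec y nu) HL1). auto.
Qed.

Definition yarg (z : C) : C := (- (z / 2 * (z / 2)))%C.
Definition JC (z nu : C) : C := (Cexp (nu * Clog (z / 2)) * jser (yarg z) nu)%C.
Definition dJC (z nu : C) : C := (Cexp (nu * Clog (z / 2)) * (Clog (z / 2) * jser (yarg z) nu + djser (yarg z) nu))%C.

(** True at 0 as well because [/ 0 = 0], so the zeros of [rGamma] create no side conditions. *)
Lemma Cinv_mult_full (a b : C) : (/ (a * b) = / a * / b)%C.
Proof.
  destruct (Ceq_dec a 0) as [->|Ha]. rewrite Cmult_0_l, Cinv_0. ring.
  destruct (Ceq_dec b 0) as [->|Hb]. rewrite Cmult_0_r, Cinv_0. ring. field. auto.
Qed.

Lemma Cinv_inv_full (a : C) : (/ / a = a)%C.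
Proof. destruct (Ceq_dec a 0) as [->|Ha]. rewrite !Cinv_0. auto. field. auto. Qed.

Lemma yarg_pow z k : (yarg z ^ k = (-1) ^ k * (z / 2) ^ (2 * k))%C.
Proof.
  replace (2 * k)%nat with (k + k)%nat by lia. rewrite Cpow_add_r, Cmult_assoc, <- !Cpow_mult_l. f_equal. unfold yarg. 
  replace (RtoC (-1)) with (- (1))%C by (rewrite <- RtoC_opp; auto). ring.
Qed.

Lemma BesselJ_JC (nu : R) z : BesselJ nu z = JC z nu.
Proof.
  unfold BesselJ, JC, Cpower, jser. f_equal. f_equal. apply functional_extensionality. intros k. unfold jcoef.
  rewrite CGamma_rGamma, yarg_pow. unfold Cdiv. rewrite Cinv_mult_full, Cinv_inv_full. ring.
Qed.

Lemma cdiff_Cexp_lin (c nu : C) : cdiff (fun s => Cexp (s * c)) nu (c * Cexp (nu * c)).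
Proof.
  eapply cdiff_eq. apply (cdiff_comp (fun s => s * c)%C Cexp). apply cdiff_mult. apply cdiff_id. apply cdiff_const. apply cdiff_Cexp. cbv beta. ring.
Qed.

Lemma cdiff_JC z nu : cdiff (JC z) nu (dJC z nu).
Proof.
  unfold JC, dJC. eapply cdiff_eq. apply cdiff_mult. apply cdiff_Cexp_lin. apply cdiff_jser. cbv beta. ring.
Qed.

(** This carries the left-hand value through the limit in the order. *)
Lemma ccont_dJC z nu : ccont (dJC z) nu.
Proof. apply cderiv_ccont with (f := JC z) (r := 1). lra. intros; apply cdiff_JC. Qed.

(** The first [n] coefficients sit at zeros of the reciprocal Gamma function. *)
Lemma jser_neg_nat y n : jser y (- INR n)%C = (y ^ n * jser y (INR n))%C.
Proof.
  assert (E : forall j, (jcoef y (- INR n) (n + j) = y ^ n * jcoef y (INR n) j)%C).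
  { intros j. unfold jcoef. rewrite Cpow_add_r.
    replace (- INR n + INR (n + j) + 1)%C with (RtoC (INR j + 1)) by (rewrite plus_INR, !RtoC_plus; ring).
    replace (INR n + INR j + 1)%C with (RtoC (INR (n + j) + 1)) by (rewrite plus_INR, !RtoC_plus; ring).
    rewrite !rGamma_real, !rg_fact, !RtoC_inv by apply INR_fact_neq_0. unfold Cdiv. ring. }
  assert (H := Cser_tail _ _ n (jser_spec y (- INR n)%C)).
  assert (Z : Csum (jcoef y (- INR n)) n = 0%C).
  { transitivity (Csum (fun _ => 0%C) n). 2: { clear; induction n; simpl; auto. rewrite IHn. ring. }
    apply Csum_ext. intros k Hk. unfold jcoef.
    replace (- INR n + INR k + 1)%C with (- INR (n - k - 1))%C. rewrite rGamma_pole. ring.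
    replace n with ((n - k - 1) + k + 1)%nat at 2 by lia. rewrite !plus_INR, !RtoC_plus. simpl. ring. }
  rewrite Z in H. replace (jser y (- INR n) - 0)%C with (jser y (- INR n)) in H by ring.
  eapply Cser_unique. apply H. eapply Cser_ext. intros k. symmetry. apply E. apply Cser_scal. apply jser_spec.
Qed.

Lemma half_nz (z : C) : 0 < Re z -> (z / 2)%C <> 0%C.
Proof.
  intros Hz. unfold Cdiv. apply Cmult_neq_0. intros E; rewrite E in Hz; simpl in Hz; lra.
  rewrite <- RtoC_inv by lra. apply RtoC_nz. lra.
Qed.

Lemma Cexp_nat_mult n (l : C) : Cexp (INR n * l) = (Cexp l ^ n)%C.
Proof.
  induction n. simpl. rewrite Cmult_0_l. apply Cexp_0. rewrite S_INR, RtoC_plus.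
  replace ((INR n + 1) * l)%C with (l + INR n * l)%C by ring. rewrite Cexp_plus, IHn. reflexivity.
Qed.

Lemma JC_neg_nat z n : 0 < Re z -> JC z (- INR n)%C = ((-1) ^ n * JC z (INR n))%C.
Proof.
  intros Hz. unfold JC. rewrite jser_neg_nat, yarg_pow. replace (- INR n * Clog (z / 2))%C with (- (INR n * Clog (z / 2)))%C by ring.
  rewrite Cexp_opp, Cexp_nat_mult, Cexp_Clog by (apply half_nz; auto).
  replace (2 * n)%nat with (n + n)%nat by lia. rewrite Cpow_add_r. field. apply Cpow_nz, half_nz; auto.
Qed.

(** Complex versions, so that numerator and denominator of the quotient for [Y] are complex
    differentiable in the order. *)
Definition Ccos (s : C) : C := ((Cexp (s * Ci) + Cexp (s * - Ci)) / 2)%C.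
Definition Csin (s : C) : C := ((Cexp (s * Ci) - Cexp (s * - Ci)) / (2 * Ci))%C.

Lemma Ccos_real (x : R) : Ccos x = RtoC (cos x).
Proof.
  unfold Ccos. apply C_ext; simpl; rewrite ?Rmult_0_r, ?Rmult_1_r, ?Rmult_0_l, ?Ropp_0, ?Rminus_0_r, ?Rplus_0_l, ?Rplus_0_r, ?Rmult_0_r;
  replace (x * - (1)) with (- x) by ring; rewrite ?cos_neg, ?sin_neg, ?Ropp_0, ?Rmult_0_r, ?Rminus_0_r, exp_0; field.
Qed.

Lemma Csin_real (x : R) : Csin x = RtoC (sin x).
Proof.
  unfold Csin. apply C_ext; simpl; rewrite ?Rmult_0_r, ?Rmult_1_r, ?Rmult_0_l, ?Ropp_0, ?Rminus_0_r, ?Rplus_0_l, ?Rplus_0_r, ?Rmult_0_r;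
  replace (x * - (1)) with (- x) by ring; rewrite ?cos_neg, ?sin_neg, ?Ropp_0, ?Rmult_0_r, ?Rminus_0_r, exp_0; field.
Qed.

Lemma cdiff_Ccos s : cdiff Ccos s (- Csin s).
Proof.
  unfold Ccos, Csin, Cdiv. eapply cdiff_eq. apply cdiff_mult. apply cdiff_plus; apply cdiff_Cexp_lin. apply cdiff_const. cbv beta.
  rewrite Cinv_mult_full, Ci_inv. ring.
Qed.

Lemma cdiff_Csin s : cdiff Csin s (Ccos s).
Proof.
  unfold Ccos, Csin, Cdiv. eapply cdiff_eq. apply cdiff_mult. apply cdiff_minus; apply cdiff_Cexp_lin. apply cdiff_const. cbv beta.
  field. apply Ci_nz.
Qed.

Lemma cos_PI_INR n : cos (PI * INR n) = (-1) ^ n.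
Proof.
  induction n. rewrite Rmult_0_r, cos_0. auto. rewrite S_INR, Rmult_plus_distr_l, Rmult_1_r, neg_cos, IHn. simpl. ring.
Qed.

Lemma sin_PI_INR n : sin (PI * INR n) = 0.
Proof.
  induction n. rewrite Rmult_0_r, sin_0. auto. rewrite S_INR, Rmult_plus_distr_l, Rmult_1_r, neg_sin, IHn. ring.
Qed.

Definition YN (z s : C) : C := (JC z s * Ccos (PI * s) - JC z (- s))%C.
Definition YD (s : C) : C := Csin (PI * s).

Lemma BesselY_quot_YN (nu : R) z : BesselY_quot nu z = (YN z nu / YD nu)%C.
Proof.
  unfold BesselY_quot, YN, YD. rewrite !BesselJ_JC, <- RtoC_mult, Ccos_real, Csin_real, RtoC_opp. auto.
Qed.

(* l'Hopital in Caratheodory form; the identity holds for every s <> p because / 0 = 0. *)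
Lemma lhopital_ccont (f g : C -> C) (p l m : C) : cdiff f p l -> cdiff g p m -> f p = 0%C -> g p = 0%C -> m <> 0%C ->
  exists q, ccont q p /\ q p = (l / m)%C /\ forall s, s <> p -> (f s / g s)%C = q s.
Proof.
  intros [F [F1 [F2 F3]]] [G [G1 [G2 G3]]] Hf Hg Hm. subst l m. exists (fun s => F s / G s)%C. split; [|split]; auto.
  - apply ccont_div; auto.
  - intros s Hs. rewrite F1, G1, Hf, Hg, !Cplus_0_l. unfold Cdiv. rewrite Cinv_mult_full.
    assert (s - p <> 0)%C by (apply Cminus_eq_contra; auto).
    replace (F s * (s - p) * (/ G s * / (s - p)))%C with (F s * / G s * ((s - p) * / (s - p)))%C by ring. rewrite Cinv_r by auto. ring.
Qed.

Lemma CLim_punctured (f : R -> C) (x : R) (q : C -> C) : (forall t : R, t <> x -> f t = q t) -> ccont q x -> CLim f x = q x.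
Proof.
  intros H Hq.
  assert (K : forall eps : posreal, exists d, 0 < d /\ forall t : R, Rabs (t - x) < d -> t <> x -> Cmod (f t - q x) < eps).
  { intros eps. destruct (Hq eps (cond_pos eps)) as [d [Hd K]]. exists d. split; auto. intros t Ht Hx. rewrite H by auto. apply K.
    rewrite <- RtoC_minus, Cmod_R. auto. }
  unfold CLim.
  assert (L1 : Lim (fun t => Re (f t)) x = Re (q x)).
  { apply is_lim_unique. apply is_lim_spec. intros eps. destruct (K eps) as [d [Hd K']]. exists (mkposreal d Hd). intros t Ht Hx.
    eapply Rle_lt_trans. 2: apply (K' t Ht Hx). apply (re_le_Cmod (f t - q x)%C). }
  assert (L2 : Lim (fun t => Im (f t)) x = Im (q x)).
  { apply is_lim_unique. apply is_lim_spec. intros eps. destruct (K eps) as [d [Hd K']]. exists (mkposreal d Hd). intros t Ht Hx.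
    eapply Rle_lt_trans. 2: apply (K' t Ht Hx). apply (im_le_Cmod (f t - q x)%C). }
  rewrite L1, L2. simpl. destruct (q x); auto.
Qed.

Lemma frac_part_INR n : frac_part (INR n) = 0.
Proof. symmetry. apply (Int_part_frac_part_spec (INR n) (Z.of_nat n) 0). lra. rewrite INR_IZR_INZ. ring. Qed.

Lemma frac_part_zero_nat nu : 0 <= nu -> frac_part nu = 0 -> exists n, nu = INR n.
Proof.
  intros H0 H. unfold frac_part in H. assert (E : nu = IZR (Int_part nu)) by lra.
  exists (Z.to_nat (Int_part nu)). rewrite INR_IZR_INZ, Z2Nat.id; auto. apply le_IZR. lra.
Qed.

Lemma BesselY_nonint (nu : R) z : frac_part nu <> 0 -> BesselY nu z = (YN z nu / YD nu)%C.
Proof. intros H. unfold BesselY. destruct (Req_EM_T (frac_part nu) 0); [tauto|]. apply BesselY_quot_YN. Qed.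

(** Besides the value, this gives a function [q] continuous at [INR n] and equal to the quotient
    elsewhere, as the approach along non-integral orders requires. *)
Lemma BesselY_nat z n : 0 < Re z -> exists q, ccont q (INR n) /\ BesselY (INR n) z = q (RtoC (INR n)) /\
  q (RtoC (INR n)) = ((dJC z (INR n) * RtoC ((-1) ^ n) + dJC z (- INR n)) / (PI * RtoC ((-1) ^ n)))%C /\
  forall s, s <> RtoC (INR n) -> (YN z s / YD s)%C = q s.
Proof.
  intros Hz.
  assert (E1 : Ccos (PI * INR n) = RtoC ((-1) ^ n)) by (rewrite <- RtoC_mult, Ccos_real, cos_PI_INR; auto).
  assert (E2 : Csin (PI * INR n) = 0%C) by (rewrite <- RtoC_mult, Csin_real, sin_PI_INR; auto).
  assert (Dl : forall s, cdiff (fun s => PI * s)%C s PI).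
  { intros s. eapply cdiff_eq. apply cdiff_mult. apply cdiff_const. apply cdiff_id. cbv beta. ring. }
  destruct (lhopital_ccont (YN z) YD (INR n) (dJC z (INR n) * RtoC ((-1) ^ n) + dJC z (- INR n)) (PI * RtoC ((-1) ^ n))) as [q [Q1 [Q2 Q3]]].
  - unfold YN. eapply cdiff_eq. apply cdiff_minus. apply cdiff_mult. apply cdiff_JC. apply (cdiff_comp (fun s => PI * s)%C Ccos). apply Dl. apply cdiff_Ccos.
    apply (cdiff_comp (fun s => - s)%C (JC z)). apply cdiff_opp, cdiff_id. apply cdiff_JC. cbv beta. rewrite E1, E2. ring.
  - unfold YD. eapply cdiff_eq. apply (cdiff_comp (fun s => PI * s)%C Csin). apply Dl. apply cdiff_Csin. cbv beta. rewrite E1. ring.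
  - unfold YN. rewrite E1, JC_neg_nat, RtoC_pow by auto. ring.
  - unfold YD. apply E2.
  - apply Cmult_neq_0; apply RtoC_nz. apply PI_neq0. apply pow_nonzero. lra.
  - exists q. repeat split; auto. unfold BesselY. destruct (Req_EM_T (frac_part (INR n)) 0) as [H|H].
    2: exfalso; apply H; apply frac_part_INR.
    apply CLim_punctured; auto. intros t Ht. rewrite BesselY_quot_YN. apply Q3. intros E. apply RtoC_inj in E. auto.
Qed.

Lemma BesselY_0 z : 0 < Re z -> BesselY 0 z = (2 / PI * dJC z 0)%C.
Proof.
  intros Hz. destruct (BesselY_nat z 0 Hz) as [q [_ [H1 [H2 _]]]]. simpl (INR 0) in *. rewrite H1, H2. simpl pow.
  replace (- 0)%C with (RtoC 0) by ring. field. apply RtoC_nz, PI_neq0.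
Qed.

(** * Evaluation of the integral *)

Lemma is_derive_dsum (f : nat -> nat -> R -> R) (f' : nat -> nat -> R) x n : (forall k j, is_derive (f k j) x (f' k j)) ->
  is_derive (fun m => dsum (fun k j => f k j m) n) x (dsum f' n).
Proof.
  revert f f'. induction n; intros f f' H; simpl. apply H.
  apply (is_derive_plus (V := R_NormedModule) (fun m => f O (S n) m)). apply H. apply (IHn (fun k j => f (S k) j)). intros; apply H.
Qed.

(* The j-th factor is (mu+j+1)_j / j!, written with Gamma quotients so that it can be differentiated in mu. *)
Definition ccg (j : nat) (mu : R) : R := rg (mu + INR j + 1) / (INR (fact j) * rg (mu + INR (2 * j) + 1)).
Definition dccg (j : nat) : R :=
  INR (fact (2 * j)) / INR (fact j) * (drg (INR j + 1) - rg (INR j + 1) * INR (fact (2 * j)) * drg (INR (2 * j) + 1)).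

Lemma ccg_cc j mu : -1 < mu -> ccg j mu = cc mu j.
Proof.
  intros H. unfold ccg, cc. assert (Hj := pos_INR (2 * j)). assert (P : 0 < rg (mu + INR (2 * j) + 1)) by (apply rg_pos; lra).
  rewrite (rg_rpoch (mu + INR j + 1) j).
  replace (mu + INR j + 1 + INR j) with (mu + INR (2 * j) + 1) by (rewrite mult_INR; simpl; ring). field.
  split. apply INR_fact_neq_0. lra.
Qed.

Lemma rg_nat n : rg (0 + INR n + 1) = / INR (fact n).
Proof. rewrite Rplus_0_l. apply rg_fact. Qed.

Lemma ccg_0 j : ccg j 0 = INR (fact (2 * j)) / (INR (fact j) * INR (fact j)).
Proof. unfold ccg. rewrite !rg_nat. field. split; apply INR_fact_neq_0. Qed.

Lemma is_derive_ccg j : is_derive (ccg j) 0 (dccg j).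
Proof.
  assert (D : forall n, is_derive (fun m => rg (m + INR n + 1)) 0 (drg (INR n + 1))).
  { intros n. replace (drg (INR n + 1)) with (scal 1 (drg (0 + INR n + 1))).
    apply (is_derive_comp rg (fun m => m + INR n + 1)). apply is_derive_rg. auto_derive; auto.
    unfold scal; simpl; unfold mult; simpl. rewrite Rplus_0_l. ring. }
  unfold ccg. assert (Hd := is_derive_div (fun m => rg (m + INR j + 1)) (fun m => INR (fact j) * rg (m + INR (2 * j) + 1)) 0 _ _ (D j)
    (is_derive_scal _ _ (INR (fact j)) _ (D (2 * j)%nat))).
  assert (F1 := INR_fact_neq_0 j). assert (F2 := INR_fact_neq_0 (2 * j)). cbv beta in Hd. rewrite !rg_nat in Hd.
  replace (dccg j) with ((drg (INR j + 1) * (INR (fact j) * / INR (fact (2 * j))) - / INR (fact j) * (INR (fact j) * drg (INR (2 * j) + 1))) / (INR (fact j) * / INR (fact (2 * j))) ^ 2).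
  apply Hd. apply Rmult_integral_contrapositive. split; auto. apply Rinv_neq_0_compat; auto.
  unfold dccg. rewrite rg_fact. field. auto.
Qed.

(** Multiplied by a reciprocal Gamma factor, the right-hand side of Rothe-Hagen collapses to a
    single one, whose derivative in [mu] is immediate. *)
Lemma rg_conv nu n mu : -1 < mu -> 0 < mu + nu + INR n + INR n + 1 ->
  dsum (fun k j => alpha nu k * ccg j mu) n * rg (mu + nu + INR n + INR n + 1) = rg (mu + nu + INR n + 1) / INR (fact n).
Proof.
  intros H H2. rewrite (dsum_ext _ (fun k j => alpha nu k * cc mu j)) by (intros; rewrite ccg_cc; auto).
  change (conv (alpha nu) (cc mu) n * rg (mu + nu + INR n + INR n + 1) = rg (mu + nu + INR n + 1) / INR (fact n)).
  rewrite rothe_hagen. unfold cc. rewrite (rg_rpoch (mu + nu + INR n + 1) n).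
  replace (mu + nu + INR n + 1 + INR n) with (mu + nu + INR n + INR n + 1) by ring. field. apply INR_fact_neq_0.
Qed.

(** The derivative of [rg_conv] in [mu] at 0, by the product rule. *)
Lemma drg_conv nu n : 0 < nu ->
  dsum (fun k j => alpha nu k * dccg j) n * rg (nu + INR n + INR n + 1) + dsum (fun k j => alpha nu k * ccg j 0) n * drg (nu + INR n + INR n + 1)
   = drg (nu + INR n + 1) / INR (fact n).
Proof.
  intros Hnu. assert (Hn := pos_INR n).
  assert (D : forall c, is_derive (fun m => rg (m + c)) 0 (drg c)).
  { intros c. replace (drg c) with (scal 1 (drg (0 + c))).
    apply (is_derive_comp rg (fun m => m + c)). apply is_derive_rg. auto_derive; auto.
    unfold scal; simpl; unfold mult; simpl. rewrite Rplus_0_l. ring. }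
  assert (D1 : is_derive (fun m => dsum (fun k j => alpha nu k * ccg j m) n * rg (m + (nu + INR n + INR n + 1))) 0
    (dsum (fun k j => alpha nu k * dccg j) n * rg (0 + (nu + INR n + INR n + 1)) + dsum (fun k j => alpha nu k * ccg j 0) n * drg (nu + INR n + INR n + 1))).
  { apply (is_derive_mult (fun m => dsum (fun k j => alpha nu k * ccg j m) n) (fun m => rg (m + (nu + INR n + INR n + 1)))); auto.
    2: intros; apply Rmult_comm. apply (is_derive_dsum (fun k j m => alpha nu k * ccg j m)). intros k j. apply (is_derive_scal (ccg j)). apply is_derive_ccg. }
  assert (D2 : is_derive (fun m => dsum (fun k j => alpha nu k * ccg j m) n * rg (m + (nu + INR n + INR n + 1))) 0 (drg (nu + INR n + 1) / INR (fact n))).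
  (* [rg_conv] holds for [mu > -1], so the neighbourhood of radius 1 suits it. *)
  { apply is_derive_ext_loc with (f := fun m => / INR (fact n) * rg (m + (nu + INR n + 1))).
    - exists (mkposreal 1 Rlt_0_1). intros m Hm. unfold ball in Hm; simpl in Hm; unfold AbsRing_ball, abs, minus, plus, opp in Hm; simpl in Hm.
      rewrite Ropp_0, Rplus_0_r in Hm. apply Rabs_def2 in Hm.
      replace (m + (nu + INR n + INR n + 1)) with (m + nu + INR n + INR n + 1) by ring. rewrite rg_conv by lra.
      replace (m + (nu + INR n + 1)) with (m + nu + INR n + 1) by ring. apply Rmult_comm.
    - replace (drg (nu + INR n + 1) / INR (fact n)) with (/ INR (fact n) * drg (nu + INR n + 1)) by (unfold Rdiv; ring).
      apply (is_derive_scal (fun m => rg (m + (nu + INR n + 1)))). apply D. }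
  apply is_derive_unique in D1. apply is_derive_unique in D2. rewrite D1 in D2. rewrite Rplus_0_l in D2. auto.
Qed.

(** The factor [rg (nu + 2 k)] cancels the denominator of [betaI] and [betaL], leaving Rothe-Hagen
    coefficients. *)
Lemma besc_alpha nu k : 0 < nu -> besc nu k = alpha nu k / nu * rg (nu + INR k + INR k).
Proof.
  intros H. unfold besc. destruct k.
  - simpl. rewrite !Rplus_0_r. rewrite (rg_step nu). field. lra.
  - unfold alpha. rewrite S_INR. rewrite (rg_rpoch (nu + (INR k + 1) + 1) k).
    replace (nu + (INR k + 1) + 1) with (nu + INR k + 2) by ring. replace (nu + (INR k + 1) + (INR k + 1)) with (nu + INR k + 2 + INR k) by ring.
    field. split. apply INR_fact_neq_0. lra.
Qed.

(** The [n]-th coefficient of the integral with J_0 in place of Y_0: it is that of J_nu divided by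
    [2 * nu]. *)
Lemma beta_sum nu n : 0 < nu ->
  dsum (fun k j => besc nu k * besc 0 j * betaI (2 * j) (nu + INR k + INR k)) n = rg (nu + INR n + 1) / INR (fact n) / (2 * nu).
Proof.
  intros Hnu. assert (Hn := pos_INR n). assert (H := rg_conv nu n 0 ltac:(lra) ltac:(lra)). rewrite !Rplus_0_l in H.
  rewrite <- H. rewrite Rmult_comm, <- dsum_scal. unfold Rdiv. rewrite Rmult_comm, <- dsum_scal. apply dsum_ext. intros k j E.
  rewrite besc_alpha, ccg_0 by auto. unfold besc, betaI. rewrite rg_nat.
  assert (Hk := pos_INR k). assert (P := rg_pos (nu + INR k + INR k) ltac:(lra)).
  replace (INR (2 * j) + (nu + INR k + INR k) + 1) with (nu + INR n + INR n + 1) by (subst n; rewrite mult_INR, plus_INR; simpl; ring).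
  field. repeat split; try apply INR_fact_neq_0; lra.
Qed.

(** The same coefficient with the order derivative of J_mu at 0: [betaL] comes from differentiating
    the power of [sin^2], and [drg] from differentiating the coefficients. *)
Lemma beta_log_sum nu n : 0 < nu ->
  dsum (fun k j => besc nu k * (besc 0 j * betaL (2 * j) (nu + INR k + INR k) + drg (0 + INR j + 1) / INR (fact j) * betaI (2 * j) (nu + INR k + INR k))) n
   = drg (nu + INR n + 1) / INR (fact n) / (2 * nu).
Proof.
  intros Hnu. assert (Hn := pos_INR n). assert (H := drg_conv nu n Hnu).
  rewrite <- H. rewrite (Rmult_comm (dsum _ n)), (Rmult_comm (dsum _ n)), <- !dsum_scal, <- dsum_plus. unfold Rdiv. rewrite Rmult_comm, <- dsum_scal. apply dsum_ext. intros k j E.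
  rewrite besc_alpha, ccg_0 by auto. unfold besc, betaI, betaL, dccg. rewrite rg_nat, rg_fact, Rplus_0_l.
  assert (Hk := pos_INR k). assert (P := rg_pos (nu + INR k + INR k) ltac:(lra)).
  replace (INR (2 * j) + (nu + INR k + INR k) + 1) with (nu + INR n + INR n + 1) by (subst n; rewrite mult_INR, plus_INR; simpl; ring).
  field. repeat split; try apply INR_fact_neq_0; lra.
Qed.

(** * Double series and termwise integration *)

Fixpoint Cdsum (F : nat -> nat -> C) (n : nat) : C :=
  match n with O => F O O | S m => (F O n + Cdsum (fun k j => F (S k) j) m)%C end.

Lemma Cdsum_parts F n : Cdsum F n = (dsum (fun k j => Re (F k j)) n, dsum (fun k j => Im (F k j)) n).
Proof.
  revert F. induction n; intros F. apply C_ext; reflexivity. simpl. rewrite IHn. apply C_ext; reflexivity.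
Qed.

Lemma Cdsum_ext F G n : (forall k j, (k + j = n)%nat -> F k j = G k j) -> Cdsum F n = Cdsum G n.
Proof.
  revert F G. induction n; intros F G H; simpl. apply H; auto. rewrite (H O (S n)) by lia. f_equal. apply IHn. intros; apply H; lia.
Qed.

Lemma Cdsum_plus F G n : Cdsum (fun k j => F k j + G k j)%C n = (Cdsum F n + Cdsum G n)%C.
Proof. revert F G. induction n; intros; simpl; auto. rewrite IHn. ring. Qed.

Lemma Cdsum_scal c F n : Cdsum (fun k j => c * F k j)%C n = (c * Cdsum F n)%C.
Proof. revert F. induction n; intros; simpl; auto. rewrite IHn. ring. Qed.

Lemma Cdsum_RtoC F n : Cdsum (fun k j => RtoC (F k j)) n = RtoC (dsum F n).
Proof. revert F. induction n; intros; simpl; auto. rewrite IHn, RtoC_plus. auto. Qed.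

Lemma Cmod_Cdsum F G n : (forall k j, Cmod (F k j) <= G k j) -> Cmod (Cdsum F n) <= dsum G n.
Proof.
  revert F G. induction n; intros F G H; simpl. auto. eapply Rle_trans. apply Cmod_triangle. apply Rplus_le_compat; auto.
Qed.

Lemma ex_series_conv a b : (forall k, 0 <= a k) -> (forall k, 0 <= b k) -> ex_series a -> ex_series b -> ex_series (conv a b).
Proof.
  intros Ha Hb [A HA] [B HB]. exists (A * B).
  eapply is_series_ext. 2: apply (is_series_mult a b A B HA HB). intros n. unfold conv. rewrite dsum_sum. auto.
  exists A. eapply is_series_ext. 2: apply HA. intros; rewrite Rabs_pos_eq; auto.
  exists B. eapply is_series_ext. 2: apply HB. intros; rewrite Rabs_pos_eq; auto.
Qed.

(** The product theorem for absolutely convergent real series, applied to the four pairs of real and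
    imaginary parts. *)
Lemma cauchy_product a b A B Ma Mb : Cser a A -> Cser b B -> (forall k, Cmod (a k) <= Ma k) -> (forall k, Cmod (b k) <= Mb k) ->
  ex_series Ma -> ex_series Mb -> Cser (Cdsum (fun k j => a k * b j)%C) (A * B)%C.
Proof.
  intros [HA1 HA2] [HB1 HB2] Ha Hb HMa HMb.
  assert (P : forall (u v : nat -> R) U V Mu Mv, is_series u U -> is_series v V -> (forall k, Rabs (u k) <= Mu k) -> (forall k, Rabs (v k) <= Mv k) ->
     ex_series Mu -> ex_series Mv -> is_series (dsum (fun k j => u k * v j)) (U * V)).
  { intros u v U V Mu Mv Hu Hv Bu Bv Eu Ev. eapply is_series_ext. 2: apply (is_series_mult u v U V Hu Hv).
    intros n. rewrite dsum_sum. auto.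
    apply (ex_series_le (V := R_CompleteNormedModule)) with Mu; auto. intros n. eapply Rle_trans. 2: apply Bu. change (Rabs (Rabs (u n)) <= Rabs (u n)). rewrite Rabs_Rabsolu. lra.
    apply (ex_series_le (V := R_CompleteNormedModule)) with Mv; auto. intros n. eapply Rle_trans. 2: apply Bv. change (Rabs (Rabs (v n)) <= Rabs (v n)). rewrite Rabs_Rabsolu. lra. }
  assert (B1 : forall k, Rabs (Re (a k)) <= Ma k) by (intros; eapply Rle_trans; [apply re_le_Cmod|auto]).
  assert (B2 : forall k, Rabs (Im (a k)) <= Ma k) by (intros; eapply Rle_trans; [apply im_le_Cmod|auto]).
  assert (B3 : forall k, Rabs (Re (b k)) <= Mb k) by (intros; eapply Rle_trans; [apply re_le_Cmod|auto]).
  assert (B4 : forall k, Rabs (Im (b k)) <= Mb k) by (intros; eapply Rle_trans; [apply im_le_Cmod|auto]).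
  split.
  - replace (Re (A * B)%C) with (Re A * Re B + - (1) * (Im A * Im B)) by (simpl; unfold Re, Im; ring).
    eapply is_series_ext. 2: apply (is_series_plus _ _ _ _ (P _ _ _ _ _ _ HA1 HB1 B1 B3 HMa HMb) (is_series_scal (- (1)) _ _ (P _ _ _ _ _ _ HA2 HB2 B2 B4 HMa HMb))).
    intros n. rewrite Cdsum_parts. unfold plus, scal; simpl; unfold mult; simpl. rewrite <- dsum_scal, <- dsum_plus. apply dsum_ext. intros; unfold Re, Im; ring.
  - replace (Im (A * B)%C) with (Re A * Im B + Im A * Re B) by (simpl; unfold Re, Im; ring).
    eapply is_series_ext. 2: apply (is_series_plus _ _ _ _ (P _ _ _ _ _ _ HA1 HB2 B1 B4 HMa HMb) (P _ _ _ _ _ _ HA2 HB1 B2 B3 HMa HMb)).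
    intros n. rewrite Cdsum_parts. unfold plus; simpl. rewrite <- dsum_plus. apply dsum_ext. intros; unfold Re, Im; ring.
Qed.

Lemma iInt_Cdsum (f : nat -> nat -> R -> C) L n : (forall k j, iInt (f k j) (L k j)) -> iInt (fun t => Cdsum (fun k j => f k j t) n) (Cdsum L n).
Proof.
  revert f L. induction n; intros f L H; simpl. apply H. apply iInt_plus. apply H. apply (IHn (fun k j => f (S k) j)). intros; apply H.
Qed.

Lemma rcont_plus f g t : rcont f t -> rcont g t -> rcont (fun t => f t + g t)%C t.
Proof. rewrite !rcont_continuous. apply (continuous_plus (V := C_R_NormedModule) f g). Qed.

Lemma rcont_Cdsum (f : nat -> nat -> R -> C) t n : (forall k j, rcont (f k j) t) -> rcont (fun t => Cdsum (fun k j => f k j t) n) t.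
Proof.
  revert f. induction n; intros f H; simpl. apply H. apply (rcont_plus (f O (S n))). apply H. apply (IHn (fun k j => f (S k) j)). intros; apply H.
Qed.

Lemma rcont_Csum (f : nat -> R -> C) t n : (forall k, rcont (f k) t) -> rcont (fun t => Csum (fun k => f k t) n) t.
Proof.
  intros H. induction n; simpl. intros eps He. exists 1. split. lra. intros. replace (0 - 0)%C with (RtoC 0) by ring. rewrite Cmod_0. auto.
  apply (rcont_plus (fun t => Csum (fun k => f k t) n)); auto.
Qed.

Lemma rcont_scal_real (k : C) (w : R -> R) t : continuous w t -> rcont (fun t => k * RtoC (w t))%C t.
Proof.
  intros H eps He. assert (Hk := Cmod_ge_0 k).
  destruct (continuous_eps w t H (eps / (Cmod k + 1))) as [d [Hd K]]. apply Rdiv_lt_0_compat; lra.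
  exists d. split; auto. intros u Hu. specialize (K u Hu). replace (k * RtoC (w u) - k * RtoC (w t))%C with (k * RtoC (w u - w t))%C by (rewrite RtoC_minus; ring).
  rewrite Cmod_mult, Cmod_R. apply Rle_lt_trans with (Cmod k * (eps / (Cmod k + 1))). apply Rmult_le_compat_l; lra.
  apply Rlt_le_trans with ((Cmod k + 1) * (eps / (Cmod k + 1))). apply Rmult_lt_compat_r. apply Rdiv_lt_0_compat; lra. lra. apply Req_le; field; lra.
Qed.

Lemma series_tail_bound (M : nat -> R) (m : R) N : is_series M m -> is_series (fun k => M (N + k)%nat) (m - match N with O => 0 | S n => sum_n M n end).
Proof.
  intros H. destruct N. simpl. rewrite Rminus_0_r. auto.
  assert (Q := is_series_incr_n M (S N) (m - sum_n M N) ltac:(lia)). apply Q. simpl.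
  change (is_series M ((m - sum_n M N) + sum_n M N)). unfold Rminus. rewrite Rplus_assoc, Rplus_opp_l, Rplus_0_r. auto.
Qed.

Lemma series_tails_vanish (M : nat -> R) (m : R) : is_series M m -> forall eps, 0 < eps -> exists N, m - match N with O => 0 | S n => sum_n M n end < eps.
Proof.
  intros H eps He. assert (H' : is_lim_seq (sum_n M) m) by exact H. apply is_lim_seq_spec in H'. destruct (H' (mkposreal eps He)) as [N HN]. exists (S N). specialize (HN N (le_n N)). simpl in HN.
  apply Rabs_def2 in HN. lra.
Qed.

(** The tail of the series is at most a numerical tail times the integrable weight [w]. This makes
    [F] continuous, hence integrable on closed subintervals, and controls its integrals uniformly up
    to both ends. *)
Lemma iInt_series (f : nat -> R -> C) (F : R -> C) (Ln : nat -> C) (M : nat -> R) (w : R -> R) W :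
  (forall n, iInt (f n) (Ln n)) -> (forall n t, 0 < t < PI / 2 -> Cmod (f n t) <= M n * w t) ->
  (forall n t, 0 < t < PI / 2 -> rcont (f n) t) -> (forall t, 0 < t < PI / 2 -> 0 <= w t /\ continuous w t) -> iIntR w W ->
  (forall n, 0 <= M n) -> ex_series M -> (forall t, 0 < t < PI / 2 -> Cser (fun n => f n t) (F t)) ->
  forall L, Cser Ln L -> iInt F L.
Proof.
  intros Hf Hb Hc Hw HW HM [m Hm] HF L HL. assert (P := PI_RGT_0).
  set (tl := fun N => m - match N with O => 0 | S n => sum_n M n end).
  assert (Htl : forall N, is_series (fun k => M (N + k)%nat) (tl N)) by (intros; apply series_tail_bound; auto).
  assert (Htl0 : forall N, 0 <= tl N).
  { intros N. eapply Rle_trans. 2: apply (sum_n_le_series _ _ 0 (fun k => HM (N + k)%nat) (Htl N)). rewrite sum_O. apply HM. }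
  assert (Hpt : forall N t, 0 < t < PI / 2 -> Cmod (F t - Csum (fun n => f n t) N) <= tl N * w t).
  { intros N t Ht. apply Cser_bound with (a := fun k => f (N + k)%nat t) (M := fun k => w t * M (N + k)%nat).
    - intros k. rewrite Rmult_comm. apply Hb; auto.
    - rewrite Rmult_comm. exact (is_series_scal (w t) _ _ (Htl N)).
    - apply (Cser_tail (fun n => f n t)). apply HF; auto. }
  assert (HFc : forall t, 0 < t < PI / 2 -> rcont F t).
  { intros t Ht eps He. destruct (Hw t Ht) as [Hw0 Hwc].
    destruct (series_tails_vanish M m Hm (eps / 3 / (w t + 1))) as [N HN]. apply Rdiv_lt_0_compat; lra. fold (tl N) in HN.
    destruct (continuous_eps w t Hwc 1 ltac:(lra)) as [d1 [Hd1 K1]].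
    destruct (rcont_Csum f t N (fun k => Hc k t Ht) (eps / 3) ltac:(lra)) as [d2 [Hd2 K2]].
    set (d := Rmin (Rmin d1 d2) (Rmin t (PI / 2 - t))). exists d.
    assert (M1 := Rmin_l (Rmin d1 d2) (Rmin t (PI / 2 - t))). assert (M2 := Rmin_r (Rmin d1 d2) (Rmin t (PI / 2 - t))).
    assert (M3 := Rmin_l d1 d2). assert (M4 := Rmin_r d1 d2). assert (M5 := Rmin_l t (PI / 2 - t)). assert (M6 := Rmin_r t (PI / 2 - t)).
    fold d in M1, M2. split. unfold d; repeat apply Rmin_pos; lra.
    intros u Hu. specialize (K1 u ltac:(lra)). specialize (K2 u ltac:(lra)). apply Rabs_def2 in Hu. apply Rabs_def2 in K1.
    assert (B1 := Hpt N u ltac:(lra)). assert (B2 := Hpt N t Ht).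
    assert (X : forall x, 0 <= x -> x <= w t + 1 -> tl N * x <= eps / 3).
    { intros x Hx1 Hx2. apply Rle_trans with (eps / 3 / (w t + 1) * (w t + 1)). apply Rmult_le_compat; lra || auto. apply Req_le. field. lra. }
    assert (B1' := X (w u) ltac:(apply Hw; lra) ltac:(lra)).
    assert (X2 : tl N * w t < eps / 3).
    { apply Rle_lt_trans with (eps / 3 / (w t + 1) * w t). apply Rmult_le_compat_r; lra. 
      apply Rlt_le_trans with (eps / 3 / (w t + 1) * (w t + 1)). apply Rmult_lt_compat_l. apply Rdiv_lt_0_compat; lra. lra. apply Req_le; field; lra. }
    replace (F u - F t)%C with ((F u - Csum (fun n => f n u) N) + ((Csum (fun n => f n u) N - Csum (fun n => f n t) N) + - (F t - Csum (fun n => f n t) N)))%C by ring.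
    eapply Rle_lt_trans. apply Cmod_triangle. eapply Rle_lt_trans. apply Rplus_le_compat_l, Cmod_triangle. rewrite Cmod_opp. lra. }
  intros eps He.
  assert (HW0 : 0 <= W).
  { apply (iIntR_interval_le w W Hw HW (PI / 4) (PI / 4) 0); try lra. apply (is_RInt_point (V := R_NormedModule)). }
  destruct (series_tails_vanish M m Hm (eps / 6 / (W + 1))) as [N HN]. apply Rdiv_lt_0_compat; lra. fold (tl N) in HN.
  assert (HNW : tl N * (W + 1) < eps / 6). { apply Rlt_le_trans with (eps / 6 / (W + 1) * (W + 1)). apply Rmult_lt_compat_r; lra. apply Req_le; field; lra. }
  assert (HtlW : tl N * W < eps / 6). { assert (Q := Htl0 N). lra. }
  destruct (iInt_Csum f Ln N Hf (eps / 3) ltac:(lra)) as [d1 [Hd1 K1]].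
  assert (HLt : Cmod (L - Csum Ln N) <= tl N * W).
  { apply Cser_bound with (a := fun k => Ln (N + k)%nat) (M := fun k => W * M (N + k)%nat).
    (* The bound on the improper integral is obtained from proper integrals over slightly smaller
       intervals. *)
    - intros k. apply Rnot_lt_le. cbv beta. intros Hlt. set (e := Cmod (Ln (N + k)%nat) - W * M (N + k)%nat).
      destruct (Hf (N + k)%nat (e / 2)) as [d [Hd K]]. unfold e; lra.
      set (dd := Rmin d (PI / 4)). assert (Q1 := Rmin_l d (PI / 4)). assert (Q2 := Rmin_r d (PI / 4)). assert (Q3 : 0 < dd) by (unfold dd; apply Rmin_pos; lra). fold dd in Q1, Q2.
      destruct (K (dd / 2) (PI / 2 - dd / 2)) as [v [Hv1 Hv2]]; try lra.
      assert (Hex : ex_RInt w (dd / 2) (PI / 2 - dd / 2)).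
      { apply (ex_RInt_continuous (V := R_CompleteNormedModule)). rewrite Rmin_left, Rmax_right by lra. intros t Ht. apply Hw. lra. }
      destruct Hex as [x Hx]. assert (HxW := iIntR_interval_le w W Hw HW (dd / 2) (PI / 2 - dd / 2) x ltac:(lra) ltac:(lra) ltac:(lra) Hx).
      assert (B : Cmod v <= M (N + k)%nat * x).
      { apply isCI_bound_fun with (3 := Hv1) (g := fun t => M (N + k)%nat * w t). lra. intros t Ht. apply Hb. lra. apply (is_RInt_scal (V := R_NormedModule)); auto. }
      assert (T := Cmod_triangle_inv (Ln (N + k)%nat) v). rewrite Cmod_minus_sym in T.
      assert (M (N + k)%nat * x <= M (N + k)%nat * W) by (apply Rmult_le_compat_l; auto). unfold e in *. lra.
    - rewrite Rmult_comm. exact (is_series_scal W _ _ (Htl N)).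
    - apply Cser_tail. auto. }
  exists (Rmin d1 (PI / 4)). assert (M1 := Rmin_l d1 (PI / 4)). assert (M2 := Rmin_r d1 (PI / 4)). split. apply Rmin_pos; lra.
  intros x y Hx Hy. destruct (K1 x y ltac:(lra) ltac:(lra)) as [v [Hv1 Hv2]].
  assert (Hex : exCI F x y). { apply exCI_rcont. rewrite Rmin_left, Rmax_right by lra. intros t Ht. apply HFc. lra. }
  destruct Hex as [u Hu]. exists u. split; auto.
  assert (Hex : ex_RInt w x y). { apply (ex_RInt_continuous (V := R_CompleteNormedModule)). rewrite Rmin_left, Rmax_right by lra. intros t Ht. apply Hw. lra. }
  destruct Hex as [wi Hwi]. assert (HxW := iIntR_interval_le w W Hw HW x y wi ltac:(lra) ltac:(lra) ltac:(lra) Hwi).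
  assert (B : Cmod (u - v) <= tl N * wi).
  { apply isCI_bound_fun with (f := fun t => (F t - Csum (fun k => f k t) N)%C) (a := x) (b := y) (g := fun t => tl N * w t). lra.
    intros t Ht. apply Hpt. lra. apply isCI_minus; auto. apply (is_RInt_scal (V := R_NormedModule)); auto. }
  assert (tl N * wi <= tl N * W) by (apply Rmult_le_compat_l; auto).
  replace (u - L)%C with ((u - v) + ((v - Csum Ln N) + - (L - Csum Ln N)))%C by ring.
  eapply Rle_lt_trans. apply Cmod_triangle. eapply Rle_lt_trans. apply Rplus_le_compat_l, Cmod_triangle. rewrite Cmod_opp. lra.
Qed.

(** For a positive real [r] the logarithm is additive; [r] will be the square of a sine or
    cosine. *)
Lemma JC_scaled z r nu : 0 < Re z -> 0 < r ->
  JC (z * RtoC r) nu = (Cexp (nu * Clog (z / 2)) * Cexp (nu * ln r) * jser (yarg z * RtoC (r * r)) nu)%C /\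
  dJC (z * RtoC r) nu = (Cexp (nu * Clog (z / 2)) * Cexp (nu * ln r) *
     ((Clog (z / 2) + ln r) * jser (yarg z * RtoC (r * r)) nu + djser (yarg z * RtoC (r * r)) nu))%C.
Proof.
  intros Hz Hr. unfold JC, dJC.
  assert (E1 : yarg (z * RtoC r) = (yarg z * RtoC (r * r))%C) by (unfold yarg; rewrite RtoC_mult; unfold Cdiv; ring).
  assert (E2 : Clog (z * RtoC r / 2) = (Clog (z / 2) + ln r)%C).
  { replace (z * RtoC r / 2)%C with (z / 2 * RtoC r)%C by (unfold Cdiv; ring). apply Clog_scal; auto.
    unfold Cdiv. rewrite <- RtoC_inv by lra. simpl. unfold Re in Hz. lra. }
  rewrite E1, E2, Cmult_plus_distr_l, Cexp_plus. split; ring.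
Qed.

Lemma jcoef_scaled y (q : R) nu k : jcoef (y * RtoC q) nu k = (jcoef y nu k * RtoC (q ^ k))%C /\ djcoef (y * RtoC q) nu k = (djcoef y nu k * RtoC (q ^ k))%C.
Proof. unfold jcoef, djcoef. rewrite Cpow_mult_l, <- RtoC_pow. unfold Cdiv. split; ring. Qed.

Lemma integrand_product z nu t : 0 < Re z -> 0 < t < PI / 2 ->
  (tan t * BesselY 0 (z * (sin t) ^ 2) * BesselJ nu (z * (cos t) ^ 2))%C =
  (2 / PI * Cexp (nu * Clog (z / 2)) *
    (RtoC (tan t * cpow nu t * ln (sin t ^ 2)) * (jser (yarg z * RtoC (cos t ^ 2 * cos t ^ 2)) nu * jser (yarg z * RtoC (sin t ^ 2 * sin t ^ 2)) 0)
     + RtoC (tan t * cpow nu t) * (jser (yarg z * RtoC (cos t ^ 2 * cos t ^ 2)) nu *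
         (Clog (z / 2) * jser (yarg z * RtoC (sin t ^ 2 * sin t ^ 2)) 0 + djser (yarg z * RtoC (sin t ^ 2 * sin t ^ 2)) 0))))%C.
Proof.
  intros Hz Ht. destruct (trig_pos t Ht) as [Hs Hc].
  assert (Hs2 : 0 < sin t ^ 2) by (apply pow_lt; lra). assert (Hc2 : 0 < cos t ^ 2) by (apply pow_lt; lra).
  rewrite <- !RtoC_pow, BesselJ_JC, BesselY_0.
  2: { replace (Re (z * RtoC (sin t ^ 2))%C) with (Re z * sin t ^ 2) by (simpl; unfold Re; ring). apply Rmult_lt_0_compat; auto. }
  rewrite (proj1 (JC_scaled z (cos t ^ 2) nu Hz Hc2)), (proj2 (JC_scaled z (sin t ^ 2) 0 Hz Hs2)).
  rewrite !Cmult_0_l, Cexp_0. replace (nu * ln (cos t ^ 2))%C with (RtoC (nu * ln (cos t ^ 2))) by apply RtoC_mult. rewrite Cexp_RtoC. fold (cpow nu t). rewrite !RtoC_mult. ring.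
Qed.

Lemma rcont_wt (k : C) (g : R -> R) b t : 0 < t < PI / 2 -> continuous g t -> rcont (fun t => k * RtoC (tan t * cpow b t * g t))%C t.
Proof. intros. apply rcont_scal_real. apply continuous_wt; auto. Qed.

Lemma cpow_pow nu k t : 0 < t < PI / 2 -> cpow (nu + INR k + INR k) t = cpow nu t * (cos t ^ 2 * cos t ^ 2) ^ k.
Proof.
  intros Ht. induction k. simpl. rewrite !Rplus_0_r. ring. rewrite S_INR.
  replace (nu + (INR k + 1) + (INR k + 1)) with (nu + INR k + INR k + 1 + 1) by ring. rewrite !cpow_S, IHk by auto. simpl. ring.
Qed.

(** Serves both parts of the integrand: [g] is the logarithm of [sin^2] with values [betaL], or the
    constant 1 with values [betaI]. *)
Lemma double_series_integral (d b : nat -> C) (Md Mb : nat -> R) (g : R -> R) (nu W : R) (val : nat -> R -> R) (D B : R -> C) (L : C) :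
  0 < nu -> (forall k, Cmod (d k) <= Md k) -> (forall k, Cmod (b k) <= Mb k) -> ex_series Md -> ex_series Mb ->
  (forall t, 0 < t < PI / 2 -> continuous g t) ->
  iIntR (fun t => tan t * cpow nu t * Rabs (g t)) W ->
  (forall j c, 0 < c -> iIntR (fun t => tan t * (sin t ^ 2) ^ j * cpow c t * g t) (val j c)) ->
  (forall t, 0 < t < PI / 2 -> Cser (fun k => d k * RtoC ((cos t ^ 2 * cos t ^ 2) ^ k))%C (D t)) ->
  (forall t, 0 < t < PI / 2 -> Cser (fun j => b j * RtoC ((sin t ^ 2 * sin t ^ 2) ^ j))%C (B t)) ->
  Cser (Cdsum (fun k j => d k * b j * RtoC (val (2 * j)%nat (nu + INR k + INR k)%R))%C) L ->
  iInt (fun t => RtoC (tan t * cpow nu t * g t) * (D t * B t))%C L.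
Proof.
  intros Hnu Hd Hb HMd HMb Hg HW Hval HD HB HL.
  assert (Md0 : forall k, 0 <= Md k) by (intros; eapply Rle_trans; [apply Cmod_ge_0|apply Hd]).
  assert (Mb0 : forall k, 0 <= Mb k) by (intros; eapply Rle_trans; [apply Cmod_ge_0|apply Hb]).
  assert (Htan : forall t, 0 < t < PI / 2 -> 0 < tan t) by (intros; apply tan_gt_0; lra).
  assert (Hsq : forall x k, 0 < x < 1 -> 0 <= (x ^ 2 * x ^ 2) ^ k <= 1).
  { intros x k Hx. assert (0 <= x ^ 2 <= 1) by (simpl; split; nra). assert (0 <= x ^ 2 * x ^ 2 <= 1) by (split; nra). split. apply pow_le; lra. rewrite <- (pow1 k). apply pow_incr; lra. }
  apply iInt_series with (f := fun n t => Cdsum (fun k j => d k * b j * RtoC (tan t * cpow nu t * (g t * ((cos t ^ 2 * cos t ^ 2) ^ k * (sin t ^ 2 * sin t ^ 2) ^ j))))%C n)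
    (Ln := Cdsum (fun k j => d k * b j * RtoC (val (2 * j)%nat (nu + INR k + INR k)%R))%C)
    (M := conv Md Mb) (w := fun t => tan t * cpow nu t * Rabs (g t)) (W := W); auto.
  - intros n. apply (iInt_Cdsum (fun k j t => d k * b j * RtoC (tan t * cpow nu t * (g t * ((cos t ^ 2 * cos t ^ 2) ^ k * (sin t ^ 2 * sin t ^ 2) ^ j))))%C). intros k j. apply iInt_scal.
    assert (Hk := pos_INR k). eapply iIntR_ext. 2: apply (Hval (2 * j)%nat (nu + INR k + INR k)%R); lra.
    (* The series run in powers of the squares of [sin^2] and [cos^2]; hence the exponents [2 * j]
       and [nu + 2 k] in [val]. *)
    intros t Ht. cbv beta. rewrite cpow_pow, pow_mult by auto. replace ((sin t ^ 2) ^ 2) with (sin t ^ 2 * sin t ^ 2) by ring. ring.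
  - intros n t Ht. destruct (trig_pos t Ht) as [Hs Hc]. rewrite (Rmult_comm (conv Md Mb n)). unfold conv. rewrite <- dsum_scal. apply Cmod_Cdsum. intros k j.
    rewrite !Cmod_mult, Cmod_R.
    assert (Q1 := Hsq (cos t) k Hc). assert (Q2 := Hsq (sin t) j Hs). assert (Q3 := cpow_bounds nu t Hnu Ht). assert (Q4 := Htan t Ht).
    rewrite !Rabs_mult, (Rabs_pos_eq (tan t)), (Rabs_pos_eq (cpow nu t)), (Rabs_pos_eq (_ ^ k)), (Rabs_pos_eq (_ ^ j)) by lra.
    rewrite (Rmult_comm (tan t * cpow nu t * Rabs (g t))). assert (Q5 := Rabs_pos (g t)).
    apply Rmult_le_compat. apply Rmult_le_pos; apply Cmod_ge_0.
    + apply Rmult_le_pos; [apply Rmult_le_pos; lra|]. apply Rmult_le_pos; [lra|]. apply Rmult_le_pos; lra.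
    + apply Rmult_le_compat; auto using Cmod_ge_0.
    + apply Rmult_le_compat_l. apply Rmult_le_pos; lra. rewrite <- (Rmult_1_r (Rabs (g t))) at 2. apply Rmult_le_compat_l; auto.
      rewrite <- (Rmult_1_r 1). apply Rmult_le_compat; lra.
  - intros n t Ht. apply (rcont_Cdsum (fun k j t => d k * b j * RtoC (tan t * cpow nu t * (g t * ((cos t ^ 2 * cos t ^ 2) ^ k * (sin t ^ 2 * sin t ^ 2) ^ j))))%C).
    intros k j. apply (rcont_wt (d k * b j) (fun t => g t * ((cos t ^ 2 * cos t ^ 2) ^ k * (sin t ^ 2 * sin t ^ 2) ^ j))); auto.
    apply (continuous_mult g). apply Hg; auto. apply (ex_derive_continuous (V := R_NormedModule)). auto_derive. auto.
  - intros t Ht. split. apply Rmult_le_pos. apply Rmult_le_pos. left; apply Htan; auto. left; apply cpow_bounds; auto. apply Rabs_pos.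
    apply (continuous_wt t (fun t => Rabs (g t))); auto. apply (continuous_comp g Rabs). apply Hg; auto. apply continuous_Rabs.
  - intros n. unfold conv. clear - Md0 Mb0. revert Md Md0. induction n; intros Md Md0; simpl. apply Rmult_le_pos; auto.
    apply Rplus_le_le_0_compat. apply Rmult_le_pos; auto. apply (IHn (fun k => Md (S k))). intros; apply Md0.
  - apply ex_series_conv; auto.
  - intros t Ht. destruct (trig_pos t Ht) as [Hs Hc].
    assert (Q := cauchy_product _ _ _ _ Md Mb (HD t Ht) (HB t Ht)).
    assert (R1 : Cser (Cdsum (fun k j => d k * RtoC ((cos t ^ 2 * cos t ^ 2) ^ k) * (b j * RtoC ((sin t ^ 2 * sin t ^ 2) ^ j))))%C (D t * B t)%C).
    { apply Q; auto.
      - intros k. rewrite Cmod_mult, Cmod_R. assert (Q1 := Hsq (cos t) k Hc). rewrite Rabs_pos_eq by lra. specialize (Hd k). assert (Z := Cmod_ge_0 (d k)). nra.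
      - intros k. rewrite Cmod_mult, Cmod_R. assert (Q1 := Hsq (sin t) k Hs). rewrite Rabs_pos_eq by lra. specialize (Hb k). assert (Z := Cmod_ge_0 (b k)). nra. }
    eapply Cser_ext. 2: apply (Cser_scal (RtoC (tan t * cpow nu t * g t))); apply R1.
    intros n. cbv beta. rewrite <- Cdsum_scal. apply Cdsum_ext. intros k j _. rewrite !RtoC_mult. ring.
Qed.

Lemma jcoef_real y (nu : R) k : jcoef y nu k = (y ^ k * RtoC (besc nu k))%C.
Proof.
  unfold jcoef, besc. rewrite <- !RtoC_plus, rGamma_real, RtoC_div by apply INR_fact_neq_0. unfold Cdiv. ring.
Qed.

Lemma djcoef_real y (nu : R) k : djcoef y nu k = (y ^ k * RtoC (drg (nu + INR k + 1) / INR (fact k)))%C.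
Proof.
  unfold djcoef. rewrite <- !RtoC_plus, drGamma_real, RtoC_div by apply INR_fact_neq_0. unfold Cdiv. ring.
Qed.

Lemma Cdsum_powers y (F : nat -> nat -> R) n : Cdsum (fun k j => y ^ k * y ^ j * RtoC (F k j))%C n = (y ^ n * RtoC (dsum F n))%C.
Proof.
  rewrite <- Cdsum_RtoC, <- Cdsum_scal. apply Cdsum_ext. intros k j <-. rewrite Cpow_add_r. ring.
Qed.

Lemma lhs_integral (nu : R) (z : C) : 0 < nu -> 0 < Re z ->
  is_RInt_gen (V := C_R_NormedModule)
    (fun theta : R => (tan theta * BesselY 0 (z * (sin theta) ^ 2) * BesselJ nu (z * (cos theta) ^ 2))%C)
    (at_right 0) (at_left (PI / 2)) (dJC z nu / (PI * nu))%C.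
Proof.
  intros Hnu Hz. apply iInt_is_RInt_gen. set (y := yarg z). set (l := Clog (z / 2)).
  destruct (jcoef_bound nu) as [M1 [HM1 B1]]. destruct (jcoef_bound 0) as [M2 [HM2 B2]].
  set (E := fun M k => M * (Cmod y ^ k / INR (fact k))).
  assert (HE : forall M, ex_series (E M)) by (intros; apply ex_series_exp).
  assert (SD : forall (q : R) (m : C), Cser (fun k => jcoef y m k * RtoC (q ^ k))%C (jser (y * RtoC q) m)).
  { intros q m. eapply Cser_ext. 2: apply jser_spec. intros k. apply jcoef_scaled. }
  assert (SD' : forall (q : R) (m : C), Cser (fun k => djcoef y m k * RtoC (q ^ k))%C (djser (y * RtoC q) m)).
  { intros q m. eapply Cser_ext. 2: apply djser_spec. intros k. apply jcoef_scaled. }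
  set (T1 := Cdsum (fun k j => jcoef y nu k * jcoef y 0 j * RtoC (betaL (2 * j) (nu + INR k + INR k)))%C).
  set (T2 := Cdsum (fun k j => jcoef y nu k * (l * jcoef y 0 j + djcoef y 0 j) * RtoC (betaI (2 * j) (nu + INR k + INR k)))%C).
  (* The closed form concerns the sum of the two coefficient sequences; neither is evaluated
     alone. *)
  assert (ET : forall n, (T1 n + T2 n = / (2 * nu) * (l * jcoef y nu n + djcoef y nu n))%C).
  { intros n. unfold T1, T2. rewrite <- Cdsum_plus.
    rewrite (Cdsum_ext _ (fun k j => l * (y ^ k * y ^ j * RtoC (besc nu k * besc 0 j * betaI (2 * j) (nu + INR k + INR k))) +
      y ^ k * y ^ j * RtoC (besc nu k * (besc 0 j * betaL (2 * j) (nu + INR k + INR k) + drg (0 + INR j + 1) / INR (fact j) * betaI (2 * j) (nu + INR k + INR k))))%C).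
    2: { intros k j _. rewrite !jcoef_real, djcoef_real. repeat rewrite ?RtoC_mult, ?RtoC_plus. ring. }
    rewrite Cdsum_plus, Cdsum_scal, !Cdsum_powers, beta_sum, beta_log_sum, jcoef_real, djcoef_real by auto.
    unfold besc. rewrite !(RtoC_div (_ / _)), RtoC_mult by lra. field. apply RtoC_nz; lra. }
  assert (Hint1 : forall k, Cmod (jcoef y nu k) <= E M1 k) by (intros; apply B1).
  assert (Hint2 : forall k, Cmod (jcoef y 0 k) <= E M2 k) by (intros; apply B2).
  assert (Hint3 : forall k, Cmod (l * jcoef y 0 k + djcoef y 0 k) <= E ((Cmod l + 1) * M2) k).
  { intros k. eapply Rle_trans. apply Cmod_triangle. rewrite Cmod_mult. destruct (B2 y k) as [Q1 Q2]. unfold E. assert (Z := Cmod_ge_0 l).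
    replace ((Cmod l + 1) * M2 * (Cmod y ^ k / INR (fact k))) with (Cmod l * (M2 * (Cmod y ^ k / INR (fact k))) + M2 * (Cmod y ^ k / INR (fact k))) by ring.
    apply Rplus_le_compat; auto. apply Rmult_le_compat_l; auto. }
  (* [T2] is summable by domination, since [betaI] is at most [/ (2 * nu)]. [T1] is then summable as
     a difference, without any bound for [betaL]. *)
  assert (Hex : exists L2, Cser T2 L2).
  { apply Cser_dominated with (M := fun n => / (2 * nu) * conv (E M1) (E ((Cmod l + 1) * M2)) n).
    2: { destruct (ex_series_conv (E M1) (E ((Cmod l + 1) * M2))) as [x Hx]; auto.
         intros k; eapply Rle_trans; [apply Cmod_ge_0|apply Hint1]. intros k; eapply Rle_trans; [apply Cmod_ge_0|apply Hint3].
         eexists. apply (is_series_scal (/ (2 * nu)) _ _ Hx). }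
    intros n. unfold conv. rewrite <- dsum_scal. apply Cmod_Cdsum. intros k j. rewrite !Cmod_mult, Cmod_R.
    rewrite (Rmult_comm (/ (2 * nu))). apply Rmult_le_compat; auto using Rabs_pos. apply Rmult_le_pos; apply Cmod_ge_0. apply Rmult_le_compat; auto using Cmod_ge_0.
    assert (Hk := pos_INR k). assert (P : 0 < nu + INR k + INR k) by lra.
    assert (0 <= betaI (2 * j) (nu + INR k + INR k) <= / (2 * nu)).
    { split. apply (iIntR_le (fun _ => 0) (fun t => tan t * (sin t ^ 2) ^ (2 * j) * cpow (nu + INR k + INR k) t)). 3: apply betaI_integral; auto.
      - intros t Ht. destruct (trig_pos t Ht) as [Hs Hc]. apply Rmult_le_pos. apply Rmult_le_pos. left; apply tan_gt_0; lra. apply pow_le, pow_le; lra. left; apply exp_pos.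
      - assert (Z0 := iIntR_scal 0 _ _ (iIntR_tan_cpow nu Hnu)). rewrite Rmult_0_l in Z0. eapply iIntR_ext. 2: apply Z0. intros; cbv beta; ring.
      - eapply iIntR_le. 2: apply betaI_integral; auto. 2: apply iIntR_tan_cpow; auto. intros t Ht. cbv beta. destruct (trig_pos t Ht) as [Hs Hc].
        assert (0 < tan t) by (apply tan_gt_0; lra). assert (C1 := cpow_decr nu (nu + INR k + INR k) t ltac:(lra) Ht). assert (C2 := cpow_bounds (nu + INR k + INR k) t P Ht).
        assert (0 <= (sin t ^ 2) ^ (2 * j) <= 1). { assert (0 <= sin t ^ 2 <= 1) by (simpl; split; nra). split. apply pow_le; lra. rewrite <- (pow1 (2 * j)). apply pow_incr; lra. }
        apply Rmult_le_compat; try lra. apply Rmult_le_pos; lra. rewrite <- (Rmult_1_r (tan t)) at 2. apply Rmult_le_compat_l; lra. }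
    rewrite Rabs_pos_eq; lra. }
  destruct Hex as [L2 HL2].
  set (Lt := (/ (2 * nu) * (l * jser y nu + djser y nu))%C).
  assert (HL1 : Cser T1 (Lt - L2)%C).
  { eapply Cser_ext. 2: apply Cser_minus; [|apply HL2]. 2: apply Cser_scal, Cser_plus; [apply Cser_scal, jser_spec|apply djser_spec].
    intros n. cbv beta. rewrite <- ET. ring. }
  assert (I1 : iInt (fun t => RtoC (tan t * cpow nu t * ln (sin t ^ 2)) * (jser (y * RtoC (cos t ^ 2 * cos t ^ 2)) nu * jser (y * RtoC (sin t ^ 2 * sin t ^ 2)) 0))%C (Lt - L2)%C).
  { apply double_series_integral with (d := jcoef y nu) (b := jcoef y 0) (Md := E M1) (Mb := E M2) (g := fun t => ln (sin t ^ 2)) (W := logK nu) (val := betaL); auto.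
    - intros t Ht. apply continuous_ln_sin2. lra.
    - eapply iIntR_ext. 2: apply logK_spec; auto. intros t Ht. cbv beta. assert (Q := neg_ln_sin2_le t Ht). rewrite Rabs_left1 by lra. auto.
    - intros; apply betaL_integral; auto. }
  assert (I2 : iInt (fun t => RtoC (tan t * cpow nu t * 1) * (jser (y * RtoC (cos t ^ 2 * cos t ^ 2)) nu * (l * jser (y * RtoC (sin t ^ 2 * sin t ^ 2)) 0 + djser (y * RtoC (sin t ^ 2 * sin t ^ 2)) 0)))%C L2).
  { apply double_series_integral with (d := jcoef y nu) (b := fun j => (l * jcoef y 0 j + djcoef y 0 j)%C) (Md := E M1) (Mb := E ((Cmod l + 1) * M2)) (g := fun t => 1) (W := / (2 * nu)) (val := betaI); auto.
    - intros t Ht. apply continuous_const.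
    - eapply iIntR_ext. 2: apply iIntR_tan_cpow; auto. intros t Ht. cbv beta. rewrite Rabs_R1. ring.
    - intros j c Hc. eapply iIntR_ext. 2: apply betaI_integral; auto. intros; cbv beta; ring.
    - intros t Ht. eapply Cser_ext. 2: apply Cser_plus; [apply (Cser_scal l), SD|apply SD']. intros n. cbv beta. ring. }
  assert (I3 := iInt_scal (2 / PI * Cexp (nu * l))%C _ _ (iInt_plus _ _ _ _ I1 I2)).
  replace (dJC z nu / (PI * nu))%C with (2 / PI * Cexp (nu * l) * (Lt - L2 + L2))%C.
  2: { unfold dJC, Lt. fold y l. field. repeat split; apply RtoC_nz; try lra. apply PI_neq0. }
  eapply iInt_ext. 2: apply I3. intros t Ht. cbv beta. rewrite integrand_product by auto. fold y l. rewrite Rmult_1_r. auto.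
Qed.

(** * The variation of parameters identity *)

Definition dbesc (nu : R) (k : nat) : R := drg (nu + INR k + 1) / INR (fact k).
(* sqint and crossint are the coefficients of the integrals of J_nu^2 dz / z and J_nu J_(-nu) dz / z, where bess0 / z is
   integrated to bess0 * ln (z / 2); the constant of integration in crossint makes series_identity hold at k = 0. *)
Definition bess0 (nu : R) : R := rg (nu + 1) * rg (- nu + 1).
Definition sqint (nu : R) (k : nat) : R := conv (besc nu) (besc nu) k / (2 * (nu + INR k)).
Definition crossint (nu : R) (k : nat) : R :=
  match k with
  | O => bess0 nu * (drg nu / rg nu + drg (nu + 1) / rg (nu + 1)) / 2
  | _ => conv (besc nu) (besc (- nu)) k / (2 * INR k)
  end.

Lemma besc_step nu k : besc nu k = INR (S k) * (nu + INR (S k)) * besc nu (S k).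
Proof.
  unfold besc. rewrite fact_simpl, mult_INR, (rg_step (nu + INR k + 1)), S_INR.
  replace (nu + INR k + 1 + 1) with (nu + (INR k + 1) + 1) by ring. assert (Q := pos_INR k). field. split. apply INR_fact_neq_0. lra.
Qed.

(** Bessel's equation in the variable [y], after removal of the factor [(z / 2)^nu]. *)
Lemma besc_ode nu : sD (sD (besc nu)) = splus (conv sX (besc nu)) (sopp (conv (sconst nu) (sD (besc nu)))).
Proof.
  apply functional_extensionality. intros [|k]; unfold splus, sopp; rewrite conv_sconst.
  - unfold conv, sD. simpl. ring.
  - rewrite conv_sX_S. unfold sD. rewrite (besc_step nu k). ring.
Qed.

(* The Wronskian of the two Frobenius series has vanishing derivative, so it equals its constant term. *)
Lemma besc_wronskian nu : splus (sminus (conv (besc (- nu)) (sD (besc nu))) (conv (besc nu) (sD (besc (- nu))))) (conv (sconst nu) (conv (besc nu) (besc (- nu)))) = sconst (nu * bess0 nu).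
Proof.
  set (a := besc nu). set (b := besc (- nu)). set (N := sconst nu).
  set (w := splus (sminus (conv b (sD a)) (conv a (sD b))) (conv N (conv a b))).
  assert (HN : sconst (- nu) = sopp N). { apply functional_extensionality. intros [|k]; unfold sopp; simpl; ring. }
  assert (Hopp : forall u, sD (sopp u) = sopp (sD u)). { intros. apply functional_extensionality. intros k. unfold sD, sopp. ring. }
  assert (HD : sD w = sconst 0).
  { unfold w, sminus. rewrite !sD_plus, Hopp, !sD_conv. unfold N at 1. rewrite sD_sconst. unfold a, b at 2 4. rewrite !besc_ode. fold a b. rewrite HN. fold N. rewrite ?sD_conv. ring. }
  apply functional_extensionality. intros [|k].
  - unfold w, sminus, splus, sopp, N, a, b, conv, sD, bess0, besc. simpl. rewrite !Rplus_0_r. field.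
  - assert (E := f_equal (fun f => f (S k)) HD). cbv beta in E. unfold sD at 1 in E. simpl (sconst 0 (S k)) in E.
    simpl (sconst _ (S k)). apply Rmult_integral in E. destruct E as [E|E]; auto. exfalso. revert E. apply not_0_INR. lia.
Qed.

(** Both sides satisfy Bessel's equation differentiated in [nu]: an inhomogeneous recursion with
    leading factor [k (nu + k)], determined by its constant term. *)
Lemma series_identity nu k : 0 < nu -> 
  conv (besc nu) (crossint nu) k - conv (besc (- nu)) (sqint nu) k = bess0 nu * dbesc nu k.
Proof.
  intros Hnu.
  set (a := besc nu). set (b := besc (- nu)). set (N := sconst nu). set (P := sconst (bess0 nu)).
  (* Doubled, because [y d/dy] is half of [z d/dz]. *)
  set (T := fun k => 2 * crossint nu k). set (S0 := fun k => 2 * sqint nu k).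
  assert (HN : sconst (- nu) = sopp N). { apply functional_extensionality. intros [|j]; unfold sopp; simpl; ring. }
  assert (HT : sD T = splus (conv a b) (sopp P)).
  { apply functional_extensionality. intros [|j]; unfold sD, T, splus, sopp, P.
    - unfold conv, a, b, bess0, besc. simpl. rewrite !Rplus_0_r. field. split; apply Rgt_not_eq, rg_pos; lra.
    - unfold crossint. fold a b. change (sconst (bess0 nu) (S j)) with 0. rewrite S_INR. assert (Q := pos_INR j). field. lra. }
  assert (HS : sD S0 = splus (conv a a) (sopp (conv N S0))).
  { apply functional_extensionality. intros j; unfold sD, S0, splus, sopp, N. rewrite conv_sconst. unfold sqint. fold a. assert (Q := pos_INR j). field. lra. }
  set (V := splus (conv a T) (sopp (conv b S0))).
  assert (Hopp : forall u, sD (sopp u) = sopp (sD u)). { intros. apply functional_extensionality. intros j. unfold sD, sopp. ring. }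
  assert (DN : sD N = sconst 0) by apply sD_sconst. assert (DP : sD P = sconst 0) by apply sD_sconst.
  assert (W : splus (sminus (conv b (sD a)) (conv a (sD b))) (conv N (conv a b)) = conv N P).
  { unfold a, b, N. rewrite besc_wronskian. apply functional_extensionality. intros j. unfold P. rewrite conv_sconst. destruct j; simpl; ring. }
  assert (HV : splus (sD (sD V)) (conv N (sD V)) = splus (conv sX V) (sopp (splus (conv P (sD a)) (conv P (sD a))))).
  (* Beyond the differential equations only the Wronskian enters: the last summand vanishes by
     [W]. *)
  { transitivity (splus (splus (conv sX V) (sopp (splus (conv P (sD a)) (conv P (sD a)))))
      (conv a (splus (splus (sminus (conv b (sD a)) (conv a (sD b))) (conv N (conv a b))) (sopp (conv N P))))).
    2: rewrite W; ring.
    assert (Da : sD (sD a) = splus (conv sX a) (sopp (conv N (sD a)))) by apply besc_ode.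
    assert (Db : sD (sD b) = splus (conv sX b) (conv N (sD b))). { unfold b. rewrite besc_ode, HN. ring. }
    unfold V. rewrite !sD_plus, !Hopp, !sD_conv, !sD_plus, !sD_conv, HT, HS, !sD_plus, !Hopp, !sD_conv, DN, DP, HS, Da, Db. ring. }
  assert (G : forall j, V j = 2 * (bess0 nu * dbesc nu j)).
  { induction j.
    - unfold V, splus, sopp, conv, T, S0, crossint, sqint, a, b, bess0, dbesc, besc, conv. simpl. rewrite ?Rplus_0_r.
      rewrite (drg_step nu). unfold besc. simpl. rewrite ?Rplus_0_r. rewrite (rg_step nu). assert (Q := rg_pos (nu + 1) ltac:(lra)). field. lra.
    - assert (E := f_equal (fun f => f (S j)) HV). cbv beta in E. unfold splus, sopp in E. rewrite conv_sX_S in E.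
      unfold P, N in E. rewrite !conv_sconst in E. unfold sD in E. rewrite IHj in E.
      assert (Hp : 0 < INR (S j)) by (apply lt_0_INR; lia).
      apply Rmult_eq_reg_l with (INR (S j) * (nu + INR (S j))). 2: apply Rgt_not_eq, Rmult_lt_0_compat; lra.
      replace (INR (S j) * (nu + INR (S j)) * V (S j)) with (INR (S j) * (INR (S j) * V (S j)) + nu * (INR (S j) * V (S j))) by ring. rewrite E.
      unfold dbesc, a, besc. rewrite (drg_step (nu + INR j + 1)), fact_simpl, mult_INR, S_INR. rewrite S_INR in Hp.
      replace (nu + INR j + 1 + 1) with (nu + (INR j + 1) + 1) by ring. field. split. apply INR_fact_neq_0. lra. }
  specialize (G k). unfold V, splus, sopp in G.
  rewrite (conv_comm a T), (conv_comm b S0) in G. unfold T, S0 in G. rewrite !conv_scal in G. rewrite (conv_comm _ a), (conv_comm _ b) in G. lra.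
Qed.

(** * Gamma quotients in the residues *)

Lemma sin_shift_nat x n : sin (PI * (x + INR n)) = (-1) ^ n * sin (PI * x).
Proof. rewrite Rmult_plus_distr_l, sin_plus, cos_PI_INR, sin_PI_INR. ring. Qed.

Lemma rg_reflection_sin x : (forall k : nat, x <> - INR k) -> rg x * rg (1 - x) = sin (PI * x) / PI.
Proof.
  intros H. assert (Hx : x <> 0) by (intros E; apply (H 0%nat); simpl; lra).
  rewrite (rg_step x). replace (x + 1) with (1 + x) by ring. rewrite Rmult_assoc, rg_reflection by auto. field. split; auto. apply PI_neq0.
Qed.

Lemma sqrt_PI_pos : 0 < sqrt PI.
Proof. apply sqrt_lt_R0, PI_RGT_0. Qed.

Lemma rg_half_plus k : / rg (1 / 2 + INR k) = sqrt PI * rpoch (1 / 2) k.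
Proof.
  assert (H := rg_rpoch (1 / 2) k). rewrite rg_half in H. assert (S := sqrt_PI_pos).
  assert (Q := pos_INR k). assert (P := rg_pos (1 / 2 + INR k) ltac:(lra)). 
  apply Rmult_eq_reg_r with (rg (1 / 2 + INR k)); [|lra]. rewrite Rinv_l, Rmult_assoc, <- H by lra. field. lra.
Qed.

Lemma half_rpoch_fact k : 4 ^ k * rpoch (1 / 2) k = INR (fact (2 * k)) / INR (fact k).
Proof.
  assert (H := rpoch_duplication (1 / 2) k). replace (1 / 2 + 1 / 2) with 1 in H by field. replace (2 * (1 / 2)) with 1 in H by field.
  rewrite !rpoch_fact in H. apply Rmult_eq_reg_r with (INR (fact k)); [|apply INR_fact_neq_0].
  rewrite Rmult_assoc, H. field. split. apply INR_fact_neq_0. apply pow_nonzero. lra.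
Qed.

Lemma rpoch_S_nat k : rpoch (INR k + 1) k = INR (fact (2 * k)) / INR (fact k).
Proof.
  assert (H := rg_rpoch (INR k + 1) k). replace (INR k + 1 + INR k) with (INR (2 * k) + 1) in H by (rewrite mult_INR; simpl; ring).
  rewrite !rg_fact in H. assert (F1 := INR_fact_neq_0 k). assert (F2 := INR_fact_neq_0 (2 * k)).
  apply Rmult_eq_reg_r with (/ INR (fact (2 * k))). rewrite <- H. field; auto. apply Rinv_neq_0_compat; auto.
Qed.

(** The left-hand side is the residue at [k] without its power of [y], divided by [2 * sqrt PI];
    [(-4)^k] comes from [z^2 = - 4 y]. Reflection at [nu - k] brings in the sine, reflection at
    [1 / 2 - k] a quotient of factorials, and the signs cancel in pairs. *)
Lemma crossint_residue nu k : (1 <= k)%nat -> (forall j, nu <> INR j) -> (forall j, nu <> - INR j) -> sin (PI * nu) <> 0 ->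
  / INR k * ((-1) ^ k / INR (fact k)) * / rg (nu - INR k) * (rg (1 + nu + INR k) * rg (1 / 2 - INR k)) * (-4) ^ k / (2 * sqrt PI)
   = crossint nu k / sin (PI * nu).
Proof.
  intros Hk Hnu Hnu' Hs. unfold crossint. destruct k; [lia|]. set (n := S k) in *. rewrite besc_product.
  assert (HP := PI_RGT_0). assert (SP := sqrt_PI_pos). assert (Hn : 0 < INR n) by (apply lt_0_INR; lia).
  assert (Hni : forall j, nu - INR n <> - INR j).
  { intros j E. destruct (Nat.le_gt_cases j n) as [H|H]. apply (Hnu (n - j)%nat). rewrite minus_INR by auto. lra.
    apply (Hnu' (j - n)%nat). rewrite minus_INR by lia. lra. }
  assert (R1 := rg_reflection_sin (nu - INR n) Hni).
  assert (E1 : sin (PI * (nu - INR n)) = (-1) ^ n * sin (PI * nu)).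
  { replace nu with (nu - INR n + INR n) at 2 by ring. rewrite sin_shift_nat, <- Rmult_assoc, <- Rpow_mult_distr. replace (-1 * -1) with 1 by ring. rewrite pow1. ring. }
  rewrite E1 in R1.
  assert (R2 := rg_reflection_sin (1 / 2 - INR n)).
  assert (E2 : sin (PI * (1 / 2 - INR n)) = (-1) ^ n).
  { assert (Q := sin_shift_nat (1 / 2 - INR n) n). replace (1 / 2 - INR n + INR n) with (1 / 2) in Q by ring. replace (PI * (1 / 2)) with (PI / 2) in Q by field. rewrite sin_PI2 in Q.
    apply Rmult_eq_reg_l with ((-1) ^ n). rewrite <- Q, <- Rpow_mult_distr. replace (-1 * -1) with 1 by ring. rewrite pow1. auto. apply pow_nonzero; lra. }
  rewrite E2 in R2. replace (1 - (1 / 2 - INR n)) with (1 / 2 + INR n) in R2 by field.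
  assert (Hhalf : forall j, 1 / 2 - INR n <> - INR j).
  { intros j E. assert (E' : 1 = 2 * INR n - 2 * INR j) by lra. destruct (Nat.le_gt_cases n j) as [H|H].
    apply le_INR in H. lra. assert (H' : (j + 1 <= n)%nat) by lia. apply le_INR in H'. rewrite plus_INR in H'. simpl (INR 1) in H'. lra. }
  specialize (R2 Hhalf).
  assert (P1 : rg (1 / 2 + INR n) <> 0) by (apply Rgt_not_eq, rg_pos; lra).
  assert (P2 : rg (nu - INR n) <> 0) by (apply rg_nz; auto).
  assert (pw : (-1) ^ n * (-1) ^ n = 1). { rewrite <- Rpow_mult_distr. replace (-1 * -1) with 1 by ring. apply pow1. }
  assert (V2 : rg (1 / 2 - INR n) = (-1) ^ n / PI * / rg (1 / 2 + INR n)).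
  { apply Rmult_eq_reg_r with (rg (1 / 2 + INR n)); auto. rewrite R2. field; repeat split; auto; lra. }
  assert (V1 : rg (1 - (nu - INR n)) = (-1) ^ n * sin (PI * nu) / PI * / rg (nu - INR n)).
  { apply Rmult_eq_reg_l with (rg (nu - INR n)); auto. rewrite R1. field; repeat split; auto; lra. }
  rewrite V2, rg_half_plus. replace (- nu + INR n + 1) with (1 - (nu - INR n)) by ring. rewrite V1.
  replace (nu + - nu + INR n + 1) with (INR n + 1) by ring. rewrite rpoch_S_nat, <- half_rpoch_fact.
  replace ((-4) ^ n) with ((-1) ^ n * 4 ^ n) by (rewrite <- Rpow_mult_distr; f_equal; ring).
  replace (1 + nu + INR n) with (nu + INR n + 1) by ring.
  match goal with |- _ = ?R => transitivity (R * ((-1) ^ n * (-1) ^ n)) end.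
  field; repeat split; auto using INR_fact_neq_0; lra. rewrite pw. ring.
Qed.

(** The residue at [nu + j], normalized likewise. Reflection at [1 + p] and at [1 / 2 + p] gives a
    sine and a cosine, hence the cotangent; duplication at [p + 1 / 2] relates the remaining Gamma
    factors. *)
Lemma sqint_residue nu j : 0 < nu -> (forall k, nu <> INR k) -> sin (PI * nu) <> 0 ->
  / (nu + INR j) * / rg (- (nu + INR j)) * ((-1) ^ j / INR (fact j)) * (rg (1 + 2 * nu + INR j) * rg (1 / 2 - (nu + INR j))) * (exp (2 * nu * ln 2) * (-4) ^ j) / (2 * sqrt PI)
  = - (cos (PI * nu) / sin (PI * nu)) * sqint nu j.
Proof.
  intros Hnu Hni Hs. unfold sqint. rewrite besc_product.
  assert (HP := PI_RGT_0). assert (SP := sqrt_PI_pos). assert (Hj := pos_INR j).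
  set (p := nu + INR j) in *. assert (Hp : 0 < p) by (unfold p; lra).
  assert (R1 := rg_reflection_sin (1 + p)). replace (1 - (1 + p)) with (- p) in R1 by ring.
  assert (pw : (-1) ^ j * (-1) ^ j = 1). { rewrite <- Rpow_mult_distr. replace (-1 * -1) with 1 by ring. apply pow1. }
  assert (E1 : sin (PI * (1 + p)) = - ((-1) ^ j * sin (PI * nu))).
  { unfold p. replace (1 + (nu + INR j)) with (nu + INR j + 1) by ring. rewrite (Rmult_plus_distr_l PI (nu + INR j)), Rmult_1_r, neg_sin, sin_shift_nat. auto. }
  rewrite E1 in R1. specialize (R1 ltac:(intros k; assert (Q := pos_INR k); lra)).
  assert (R2 := rg_reflection_sin (1 / 2 + p)). replace (1 - (1 / 2 + p)) with (1 / 2 - p) in R2 by field.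
  assert (E2 : sin (PI * (1 / 2 + p)) = (-1) ^ j * cos (PI * nu)).
  { unfold p. replace (1 / 2 + (nu + INR j)) with (1 / 2 + nu + INR j) by ring. rewrite sin_shift_nat. f_equal.
    replace (PI * (1 / 2 + nu)) with (PI / 2 + PI * nu) by field. rewrite <- cos_sin. auto. }
  rewrite E2 in R2. specialize (R2 ltac:(intros k; assert (Q := pos_INR k); lra)).
  assert (P1 := rg_pos (1 + p) ltac:(lra)). assert (P2 := rg_pos (1 / 2 + p) ltac:(lra)). assert (P3 := rg_pos (2 * p + 1) ltac:(lra)).
  assert (P4 : rg (- p) <> 0). { intros E. rewrite E, Rmult_0_r in R1. assert ((-1) ^ j * sin (PI * nu) <> 0). apply Rmult_integral_contrapositive. split; auto. apply pow_nonzero; lra.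
     apply H. apply Rmult_eq_reg_r with (/ PI). 2: apply Rinv_neq_0_compat; lra. unfold Rdiv in R1. lra. }
  assert (D := rg_duplication (p + 1 / 2)). rewrite rg_half in D. replace (p + 1 / 2 + 1 / 2) with (p + 1) in D by field. replace (2 * (p + 1 / 2)) with (2 * p + 1) in D by field.
  assert (Ee : exp ((2 * p + 1) * ln 2) = 2 * (exp (2 * nu * ln 2) * 4 ^ j)).
  { unfold p. replace ((2 * (nu + INR j) + 1) * ln 2) with (ln 2 + (2 * nu * ln 2 + INR j * (ln 2 + ln 2))) by ring. rewrite !exp_plus, exp_ln by lra.
    rewrite <- ln_mult by lra. replace (2 * 2) with 4 by ring. rewrite <- (exp_ln (4 ^ j)) at 1 by (apply pow_lt; lra). rewrite ln_pow by lra. ring. }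
  rewrite Ee in D. set (e := exp (2 * nu * ln 2)) in *. set (Sn := sin (PI * nu)) in *. set (Cn := cos (PI * nu)) in *.
  assert (V1 : rg (- p) = - ((-1) ^ j * Sn) / PI * / rg (1 + p)). { apply Rmult_eq_reg_l with (rg (1 + p)); [|lra]. rewrite R1. field. lra. }
  assert (V2 : rg (1 / 2 - p) = (-1) ^ j * Cn / PI * / rg (1 / 2 + p)). { apply Rmult_eq_reg_l with (rg (1 / 2 + p)); [|lra]. rewrite R2. field. lra. }
  rewrite V1, V2. replace (nu + INR j + 1) with (1 + p) by (unfold p; ring).
  assert (R3 := rg_rpoch (nu + nu + INR j + 1) j). replace (nu + nu + INR j + 1 + INR j) with (2 * p + 1) in R3 by (unfold p; ring).
  replace (1 + 2 * nu + INR j) with (nu + nu + INR j + 1) by ring. rewrite R3.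
  set (rp := rpoch (nu + nu + INR j + 1) j).
  replace (p + 1 / 2) with (1 / 2 + p) in D by ring. replace (p + 1) with (1 + p) in D by ring.
  assert (V3 : rg (2 * p + 1) = rg (1 / 2 + p) * rg (1 + p) * sqrt PI / (e * 4 ^ j)).
  { rewrite D. field. repeat split; try lra. apply pow_nonzero; lra. apply Rgt_not_eq, exp_pos. }
  rewrite V3. replace ((-4) ^ j) with ((-1) ^ j * 4 ^ j) by (rewrite <- Rpow_mult_distr; f_equal; ring).
  assert (pn : (-1) ^ j <> 0) by (apply pow_nonzero; lra). assert (p4 : 4 ^ j <> 0) by (apply pow_nonzero; lra).
  assert (en : e <> 0) by (apply Rgt_not_eq, exp_pos).
  transitivity (- (Cn / Sn) * (rg (1 + p) * rg (1 + p) * rp / INR (fact j) / (2 * p)) * ((-1) ^ j * (-1) ^ j)).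
  field. repeat split; auto using INR_fact_neq_0; lra. rewrite pw, (Rplus_comm p 1). ring.
Qed.

(** * Residues of the Meijer integrand *)

(* The integrand of the G-function at exp X, with Gamma(-s) / Gamma(1 - s) cancelled to - 1 / s; the two can
   differ only at the naturals, where the inverses take junk values. *)
Definition hM (nu : R) (X s : C) : C :=
  (- / s * / rGamma (- s) * / rGamma (nu - s) * (rGamma (1 + nu + s) * rGamma (1 / 2 - s)) * Cexp (s * X))%C.

Lemma rGamma_opp_nz s : (forall k : nat, s <> RtoC (INR k)) -> rGamma (- s) <> 0%C.
Proof. intros H. apply rGamma_nz. intros k E. apply (H k). replace s with (- - s)%C by ring. rewrite E. ring. Qed.

Lemma MeijerG_integrand_hM nu z s : (forall k : nat, s <> RtoC (INR k)) ->
  MeijerG_integrand 3 0 [RtoC (1 / 2); RtoC 1] [RtoC 0; RtoC 0; RtoC nu; RtoC (- nu)] (z ^ 2)%C s = hM nu (Clog (z ^ 2)) s.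
Proof.
  intros H. unfold MeijerG_integrand, hM, Cpower. simpl firstn. simpl skipn. unfold Cprod. simpl map. simpl fold_right.
  assert (Hs : s <> RtoC 0) by apply (H 0%nat). assert (Hn := rGamma_opp_nz s H).
  rewrite !CGamma_rGamma. unfold Cdiv. rewrite !Cinv_mult_full, !Cinv_inv_full.
  replace (0 - s)%C with (- s)%C by ring. replace (1 - (- nu)%R + s)%C with (1 + nu + s)%C by (rewrite RtoC_opp; ring).
  assert (E : rGamma (1 - s) = (- / s * rGamma (- s))%C).
  { rewrite (rGamma_step (- s)). replace (- s + 1)%C with (1 - s)%C by ring. field. auto. }
  rewrite E. replace (RtoC (1 / 2)) with (1 * / 2)%C by (unfold Rdiv; rewrite RtoC_mult, RtoC_inv; auto; lra).
  replace (/ rGamma (- s) * (/ rGamma (- s) * (/ rGamma (nu - s) * 1)) * 1 * (rGamma (1 + nu + s) * / 1 * (rGamma (1 * / 2 - s) * (- / s * rGamma (- s) * / 1))) * Cexp (s * Clog (z ^ 2)))%C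
   with ((rGamma (- s) * / rGamma (- s)) * (/ 1 * / 1) * (- / s * / rGamma (- s) * / rGamma (nu - s) * (rGamma (1 + nu + s) * rGamma (1 * / 2 - s)) * Cexp (s * Clog (z ^ 2))))%C by ring.
  rewrite Cinv_r by auto. replace (/ 1)%C with (RtoC 1) by field. ring.
Qed.

Definition regM (nu : R) (s : C) : Prop := (forall k : nat, s <> RtoC (INR k)) /\ (forall k : nat, s <> (nu + INR k)%C).

Lemma regM_im nu s : Im s <> 0 -> regM nu s.
Proof. intros H. split; intros k E; apply H; rewrite E; simpl; ring. Qed.

Lemma regM_nz nu s : regM nu s -> s <> 0%C /\ rGamma (- s) <> 0%C /\ rGamma (nu - s) <> 0%C.
Proof.
  intros [H1 H2]. split; [apply (H1 0%nat)|split]. apply rGamma_opp_nz; auto.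
  apply rGamma_nz. intros k E. apply (H2 k). replace s with (nu - (nu - s))%C by ring. rewrite E. ring.
Qed.

Lemma cdiff_rGamma_affine (c d s : C) : exists l, cdiff (fun s => rGamma (c + d * s)) s l.
Proof.
  destruct (cdiff_rGamma (c + d * s)) as [l Hl]. eexists. apply (cdiff_comp (fun s => c + d * s)%C rGamma); [|apply Hl].
  apply cdiff_plus. apply cdiff_const. apply cdiff_mult. apply cdiff_const. apply cdiff_id.
Qed.

Lemma cdiff_rGamma_pieces (nu : R) (s : C) : (exists l, cdiff (fun s => rGamma (- s)) s l) /\ (exists l, cdiff (fun s => rGamma (nu - s)) s l) /\
  (exists l, cdiff (fun s => rGamma (1 + nu + s)) s l) /\ (exists l, cdiff (fun s => rGamma (1 / 2 - s)) s l).
Proof.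
  assert (A : forall c d (g : C -> C), (forall s, g s = rGamma (c + d * s)) -> exists l, cdiff g s l).
  { intros c d g H. destruct (cdiff_rGamma_affine c d s) as [l Hl]. exists l. eapply cdiff_ext. 2: apply Hl. intros; symmetry; apply H. }
  repeat split.
  - apply (A 0%C (- (1))%C). intros; f_equal; ring.
  - apply (A (RtoC nu) (- (1))%C). intros; f_equal; ring.
  - apply (A (1 + nu)%C 1%C). intros; f_equal; ring.
  - apply (A (1 / 2)%C (- (1))%C). intros; f_equal; ring.
Qed.

Lemma cdiff_hM nu X s : regM nu s -> exists l, cdiff (hM nu X) s l.
Proof.
  intros H. destruct (regM_nz nu s H) as [N1 [N2 N3]]. destruct (cdiff_rGamma_pieces nu s) as [[l1 D1] [[l2 D2] [[l3 D3] [l4 D4]]]].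
  eexists. unfold hM. apply cdiff_mult; [apply cdiff_mult; [apply cdiff_mult; [apply cdiff_mult|]|apply cdiff_mult]|].
  - apply cdiff_opp. apply (cdiff_inv (fun s => s)); auto. apply cdiff_id.
  - apply (cdiff_inv (fun s => rGamma (- s))); eauto.
  - apply (cdiff_inv (fun s => rGamma (nu - s))); eauto.
  - eauto.
  - eauto.
  - apply cdiff_Cexp_lin.
Qed.

Lemma ccont_hM nu X s : regM nu s -> ccont (hM nu X) s.
Proof. intros H. destruct (cdiff_hM nu X s H) as [l Hl]. eapply cdiff_ccont; eauto. Qed.

(** * Decay of the integrand to the right *)

Lemma Cmod_le_shift (s : C) (a : R) : 0 <= Re s -> 0 <= a -> Cmod s <= Cmod (s + a).
Proof. intros H1 H2. unfold Cmod. apply sqrt_le_1_alt. simpl. unfold Re in H1. nra. Qed.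

Lemma hM_step nu X s : 0 < nu -> nu < Re s -> hM nu X (s + 1) =
  (hM nu X s * (Cexp X * (s / (s + 1)) * ((s + / 2) / (s + 1)) * / ((nu - s - 1) * (1 + nu + s))))%C.
Proof.
  intros Hnu Hs.
  assert (N : forall q : C, Re q <> 0 -> q <> 0%C) by (intros q Hq E; apply Hq; rewrite E; auto).
  assert (N1 : s <> 0%C) by (apply N; lra). assert (N2 : (s + 1)%C <> 0%C) by (apply N; simpl; unfold Re in *; lra).
  assert (N3 : (nu - s - 1)%C <> 0%C) by (apply N; simpl; unfold Re in *; lra). assert (N4 : (1 + nu + s)%C <> 0%C) by (apply N; simpl; unfold Re in *; lra).
  unfold hM.
  assert (E1 : rGamma (- (s + 1)) = ((- (s + 1)) * rGamma (- s))%C). { rewrite rGamma_step. f_equal. f_equal. ring. }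
  assert (E2 : rGamma (nu - (s + 1)) = ((nu - s - 1) * rGamma (nu - s))%C). { rewrite rGamma_step. f_equal. ring. f_equal. ring. }
  assert (E3 : rGamma (1 + nu + (s + 1)) = (/ (1 + nu + s) * rGamma (1 + nu + s))%C). { rewrite (rGamma_step (1 + nu + s)). replace (1 + nu + s + 1)%C with (1 + nu + (s + 1))%C by ring. field. auto. }
  assert (E4 : rGamma (1 / 2 - (s + 1)) = (- (s + / 2) * rGamma (1 / 2 - s))%C). { rewrite rGamma_step. f_equal. field. f_equal. ring. }
  rewrite E1, E2, E3, E4, !Cinv_mult_full. replace ((s + 1) * X)%C with (X + s * X)%C by ring. rewrite Cexp_plus.
  replace (/ - (s + 1))%C with (- / (s + 1))%C by (field; auto). unfold Cdiv.
  replace (- / (s + 1))%C with (- (s * / s) * / (s + 1))%C at 1 by (rewrite Cinv_r by auto; ring). ring.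
Qed.

(** The ratio of consecutive values is [Cexp X] over a product of two factors growing with [Re s],
    times two quotients of modulus at most 1; the threshold makes it at most [e / (2 * e + 2)]. *)
Lemma hM_decay nu X s : 0 < nu -> nu + 2 + 2 * Cmod (Cexp X) <= Re s -> Cmod (hM nu X (s + 1)) <= / 2 * Cmod (hM nu X s).
Proof.
  intros Hnu Hs. set (e := Cmod (Cexp X)) in *. assert (He : 0 <= e) by apply Cmod_ge_0.
  rewrite hM_step by lra. rewrite Cmod_mult, Rmult_comm. apply Rmult_le_compat_r. apply Cmod_ge_0.
  assert (A1 : Re s + 1 - nu <= Cmod (nu - s - 1)%C). { assert (Q := re_le_Cmod (nu - s - 1)%C). simpl in Q. apply Rabs_le_between in Q. unfold Re in *. lra. }
  assert (A2 : Re s <= Cmod (1 + nu + s)%C). { assert (Q := re_le_Cmod (1 + nu + s)%C). simpl in Q. apply Rabs_le_between in Q. unfold Re in *. lra. }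
  assert (B1 := Cmod_le_shift s 1 ltac:(lra) ltac:(lra)).
  assert (B2 := Cmod_le_shift (s + / 2)%C (/ 2) ltac:(simpl; unfold Re in *; lra) ltac:(lra)).
  replace (s + / 2 + (/ 2)%R)%C with (s + 1)%C in B2 by (rewrite RtoC_inv by lra; field).
  assert (P : 1 <= Cmod (s + 1)). { assert (Q := re_le_Cmod (s + 1)%C). simpl in Q. apply Rabs_le_between in Q. unfold Re in *. lra. }
  assert (N2 : (s + 1)%C <> 0%C) by (apply Cmod_pos_nz; lra).
  rewrite !Cmod_mult, Cmod_inv, Cmod_mult by (apply Cmult_neq_0; apply Cmod_pos_nz; lra). rewrite !Cmod_div by auto. fold e.
  assert (C1 : forall x, 0 <= x -> x <= Cmod (s + 1) -> 0 <= x / Cmod (s + 1) <= 1).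
  { intros x Hx1 Hx2. split. apply Rmult_le_pos; auto. left; apply Rinv_0_lt_compat; lra. apply Rmult_le_reg_r with (Cmod (s + 1)). lra. unfold Rdiv. rewrite Rmult_assoc, Rinv_l; lra. }
  assert (D1 := C1 _ (Cmod_ge_0 s) B1). assert (D2 := C1 _ (Cmod_ge_0 (s + / 2)) B2).
  assert (D3 : / (Cmod (nu - s - 1) * Cmod (1 + nu + s)) <= / (2 * e + 2)).
  { apply Rinv_le_contravar. lra. nra. }
  assert (D4 : 0 < / (Cmod (nu - s - 1) * Cmod (1 + nu + s))) by (apply Rinv_0_lt_compat; nra).
  apply Rle_trans with (e * 1 * 1 * / (2 * e + 2)).
  - apply Rmult_le_compat; try lra. apply Rmult_le_pos; [apply Rmult_le_pos; lra|lra].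
    apply Rmult_le_compat; try lra. apply Rmult_le_pos; lra. apply Rmult_le_compat; lra.
  - apply Rmult_le_reg_r with (2 * e + 2). lra. rewrite Rmult_assoc, Rinv_l by lra. lra.
Qed.

Lemma rcont_bounded (f : R -> C) a b : (forall t, a <= t <= b -> rcont f t) -> exists M, forall t, a <= t <= b -> Cmod (f t) <= M.
Proof.
  intros H. destruct (bounded_continuity (V := C_R_NormedModule) f a b) as [M HM].
  - intros x Hx. apply rcont_continuous. auto.
  - exists M. intros t Ht. rewrite <- norm_C_R. left. auto.
Qed.

Lemma inv_rGamma_line_bounded c a b : c <> 0 -> exists M, forall v, a <= v <= b -> Cmod (/ rGamma (v, c)) <= M.
Proof.
  intros Hc. apply (rcont_bounded (fun v => / rGamma (v, c))%C). intros t _. apply (rcont_hor (fun s => / rGamma s)%C).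
  apply (ccont_inv rGamma). 2: apply ccont_rGamma. apply rGamma_nz. intros k E. apply Hc. apply (f_equal Im) in E. simpl in E. lra.
Qed.

Lemma decay_of_step (f : R -> C) T B : (forall t, T <= t <= T + 1 -> Cmod (f t) <= B) -> (forall t, T <= t -> Cmod (f (t + 1)) <= / 2 * Cmod (f t)) ->
  forall t, T <= t -> Cmod (f t) <= 2 * B * exp (ln 2 * T) * exp (- (ln 2 * t)).
Proof.
  intros H1 H2 t Ht. destruct (nfloor_ex (t - T)) as [n Hn]. lra.
  assert (K : forall m r, 0 <= r <= 1 -> Cmod (f (T + r + INR m)) <= B * (/ 2) ^ m).
  { induction m; intros r Hr. simpl. rewrite Rplus_0_r, Rmult_1_r. apply H1. lra.
    rewrite S_INR, <- Rplus_assoc. eapply Rle_trans. apply H2. assert (Q := pos_INR m). lra. specialize (IHm r Hr). simpl. lra. }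
  specialize (K n (t - T - INR n) ltac:(lra)). replace (T + (t - T - INR n) + INR n) with t in K by ring.
  eapply Rle_trans. apply K. rewrite (Rmult_comm 2 B), !Rmult_assoc. apply Rmult_le_compat_l.
  eapply Rle_trans. apply (Cmod_ge_0 (f T)). apply H1. lra.
  assert (Hl : 0 < ln 2) by (rewrite <- ln_1; apply ln_increasing; lra).
  rewrite <- exp_plus. rewrite <- (exp_ln 2) at 2 by lra. rewrite <- exp_plus.
  rewrite <- (exp_ln ((/ 2) ^ n)) by (apply pow_lt; lra). apply exp_le_compat. rewrite ln_pow, ln_Rinv by lra. nra.
Qed.

(** Uniform in the order, for the later limit in [nu]. Off the real axis [rGamma] has no zeros, so
    compactness bounds the integrand on a unit segment, and halving does the rest. *)
Lemma hM_ray_bound nu0 X c : 0 < nu0 -> c <> 0 -> exists K T, 0 <= K /\ forall nu t, nu0 <= nu <= nu0 + 1 -> T <= t ->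
  Cmod (hM nu X (t, c)) <= K * exp (- (ln 2 * t)).
Proof.
  (* The threshold of [hM_decay] at the largest order [nu0 + 1]. *)
  intros Hnu Hc. set (T := nu0 + 1 + 2 + 2 * Cmod (Cexp X)). assert (He := Cmod_ge_0 (Cexp X)). assert (HT : 1 <= T) by (unfold T; lra).
  assert (Hc' : - c <> 0) by lra.
  destruct (inv_rGamma_line_bounded (- c) (- (T + 1)) (- T) Hc') as [M1 HM1].
  destruct (inv_rGamma_line_bounded (- c) (nu0 - (T + 1)) (nu0 + 1 - T) Hc') as [M2 HM2].
  destruct (rGamma_bounded (1 + (nu0 + 1) + (T + 1 + Rabs c))) as [M3 [HM3 B3]]. assert (Q := Rabs_pos c); lra.
  set (B := 1 * M1 * M2 * (M3 * M3) * exp ((T + 1 + Rabs c) * Cmod X)).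
  assert (HB : forall nu, nu0 <= nu <= nu0 + 1 -> forall t, T <= t <= T + 1 -> Cmod (hM nu X (t, c)) <= B).
  { intros nu Hn t Ht. unfold hM, B. rewrite !Cmod_mult, Cmod_opp, Cmod_Cexp.
    assert (S1 : Cmod (t, c) <= T + 1 + Rabs c). { eapply Rle_trans. apply Cmod_re_im. simpl. rewrite (Rabs_pos_eq t) by lra. lra. }
    assert (S2 : 1 <= Cmod (t, c)). { assert (Q := re_le_Cmod (t, c)). simpl in Q. apply Rabs_le_between in Q. lra. }
    repeat apply Rmult_le_compat; auto using Cmod_ge_0; try (repeat apply Rmult_le_pos; apply Cmod_ge_0).
    - left; apply exp_pos.
    - rewrite Cmod_inv by (apply Cmod_pos_nz; lra). rewrite <- Rinv_1. apply Rinv_le_contravar; lra.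
    - apply (HM1 (- t)). lra.
    - replace (nu - (t, c))%C with ((nu - t)%R, - c) by (apply C_ext; simpl; ring). apply HM2. lra.
    - apply B3. eapply Rle_trans. apply Cmod_triangle. apply Rplus_le_compat; auto. rewrite <- RtoC_plus, Cmod_R, Rabs_pos_eq; lra.
    - apply B3. eapply Rle_trans. apply Cmod_triangle. rewrite Cmod_opp. apply Rplus_le_compat; auto.
      rewrite <- RtoC_div, Cmod_R, Rabs_pos_eq; lra.
    - apply exp_le_compat. eapply Rle_trans. apply Rle_abs. eapply Rle_trans. apply re_le_Cmod. rewrite Cmod_mult. apply Rmult_le_compat_r; auto using Cmod_ge_0. }
  assert (B0 : 0 <= B). { eapply Rle_trans. apply (Cmod_ge_0 (hM nu0 X (T, c))). apply HB; lra. }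
  exists (2 * B * exp (ln 2 * T)), T. split. apply Rmult_le_pos. lra. left; apply exp_pos.
  intros nu t Hn Ht. apply decay_of_step with (f := fun t => hM nu X (t, c)); auto.
  intros u Hu. replace ((u + 1)%R, c) with ((u, c) + 1)%C by (apply C_ext; simpl; ring). apply hM_decay. lra. simpl. unfold T in *. lra.
Qed.

(** The integrals up to [Y + n] form a Cauchy sequence. The explicit rate is kept for moving the
    right edge of the rectangles and for the limit in the order. *)
Lemma ray_integral (f : R -> C) sg K T : (forall t, sg <= t -> rcont f t) -> 0 <= K -> (forall t, T <= t -> Cmod (f t) <= K * exp (- (ln 2 * t))) ->
  exists l, is_RInt_gen (V := C_R_NormedModule) f (at_point sg) (Rbar_locally p_infty) l /\
    forall y v, sg <= y -> T <= y -> isCI f sg y v -> Cmod (v - l) <= K / ln 2 * exp (- (ln 2 * y)).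
Proof.
  intros Hc HK Hb. assert (Hl : 0 < ln 2) by (rewrite <- ln_1; apply ln_increasing; lra).
  assert (Hex : forall x y, sg <= x -> x <= y -> exCI f x y).
  { intros x y H1 H2. apply exCI_rcont. rewrite Rmin_left, Rmax_right by lra. intros t Ht. apply Hc. lra. }
  assert (Htail : forall x y v, sg <= x -> T <= x -> x <= y -> isCI f x y v -> Cmod v <= K / ln 2 * exp (- (ln 2 * x))).
  { intros x y v H1 H2 H3 Hv.
    assert (HI : is_RInt (fun t => K * exp (- (ln 2 * t))) x y (minus (- (K / ln 2) * exp (- (ln 2 * y))) (- (K / ln 2) * exp (- (ln 2 * x))))).
    { apply (is_RInt_derive (V := R_CompleteNormedModule) (fun t => - (K / ln 2) * exp (- (ln 2 * t)))).
      intros t _. auto_derive; auto. field. lra. intros t _. apply (ex_derive_continuous (V := R_NormedModule)). auto_derive; auto. }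
    eapply Rle_trans. eapply isCI_bound_fun with (3 := Hv) (4 := HI). lra. intros t Ht. apply Hb. lra.
    unfold minus, plus, opp; simpl. assert (0 <= K / ln 2) by (apply Rmult_le_pos; [auto|left; apply Rinv_0_lt_compat; auto]).
    assert (Q := exp_pos (- (ln 2 * y))). nra. }
  set (Y := Rmax sg T). assert (HY1 := Rmax_l sg T). assert (HY2 := Rmax_r sg T). fold Y in HY1, HY2.
  set (u := fun n => CI f sg (Y + INR n)).
  assert (Hu : forall n, isCI f sg (Y + INR n) (u n)). { intros n. apply CI_correct. apply Hex. lra. assert (Q := pos_INR n). lra. }
  assert (Hdiff : forall x y v w, sg <= x -> T <= x -> x <= y -> isCI f sg x v -> isCI f sg y w -> Cmod (w - v) <= K / ln 2 * exp (- (ln 2 * x))).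
  { intros x y v w H1 H2 H3 Hv Hw. destruct (Hex x y H1 H3) as [q Hq]. assert (E := isCI_Chasles _ _ _ _ _ _ Hv Hq).
    rewrite (isCI_unicity _ _ _ _ _ Hw E). replace (v + q - v)%C with (q : C) by (generalize (q : C) (v : C); intros; ring). apply (Htail x y); auto. }
  assert (Hpow : forall n, exp (- (ln 2 * (Y + INR n))) = exp (- (ln 2 * Y)) * (/ 2) ^ n).
  { intros n. rewrite <- (exp_ln ((/ 2) ^ n)) by (apply pow_lt; lra). rewrite ln_pow, ln_Rinv, <- exp_plus by lra. f_equal. ring. }
  destruct (Cser_dominated (tele u) (fun n => match n with O => Cmod (u O) | S m => K / ln 2 * exp (- (ln 2 * Y)) * (/ 2) ^ m end)) as [l HL].
  { intros [|n]; simpl. lra. rewrite Rmult_assoc, <- Hpow. apply (Hdiff (Y + INR n) (Y + INR (S n))); auto; rewrite ?S_INR; assert (Q := pos_INR n); lra. }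
  { apply ex_series_incr_1. exists (K / ln 2 * exp (- (ln 2 * Y)) * / (1 - / 2)). exact (is_series_scal (K / ln 2 * exp (- (ln 2 * Y))) (fun k => (/ 2) ^ k) _ (is_series_geom (/ 2) ltac:(rewrite Rabs_pos_eq; lra))). }
  apply Cser_telescope in HL.
  assert (Hmain : forall y v, sg <= y -> T <= y -> isCI f sg y v -> Cmod (v - l) <= K / ln 2 * exp (- (ln 2 * y))).
  { intros y v H1 H2 Hv. destruct (nfloor_ex (Rabs (y - Y))) as [N HN]. apply Rabs_pos.
    rewrite Cmod_minus_sym. apply Clim_bound with (u := fun n => (u (S N + n)%nat - v)%C).
    - intros n. apply (Hdiff y (Y + INR (S N + n)) v); auto. rewrite plus_INR, S_INR. assert (Q := pos_INR n). assert (Q2 := Rle_abs (y - Y)). lra.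
    - apply Clim_minus. 2: apply Clim_const. apply Clim_eps. intros eps He. destruct (proj1 (Clim_eps _ _) HL eps He) as [N' K']. exists N'. intros n Hn. apply K'. lia. }
  exists l. split; auto.
  intros P [e He].
  assert (Hsmall : exists Z, sg <= Z /\ T <= Z /\ forall y, Z < y -> K / ln 2 * exp (- (ln 2 * y)) < e).
  { assert (A0 : 0 <= K / ln 2) by (apply Rmult_le_pos; [auto|left; apply Rinv_0_lt_compat; auto]).
    set (q := pos e / (K / ln 2 + 1)). assert (Hq : 0 < q) by (apply Rdiv_lt_0_compat; [apply cond_pos|lra]).
    exists (Rmax Y (- ln q / ln 2)). assert (Z1 := Rmax_l Y (- ln q / ln 2)). assert (Z2 := Rmax_r Y (- ln q / ln 2)).
    split; [lra|split;[lra|]]. intros y Hy. assert (exp (- (ln 2 * y)) < q).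
    { rewrite <- (exp_ln q) by auto. apply exp_increasing. assert (- ln q < y * ln 2). { replace (- ln q) with (- ln q / ln 2 * ln 2) by (field; lra). apply Rmult_lt_compat_r; lra. } lra. }
    apply Rle_lt_trans with (K / ln 2 * q). apply Rmult_le_compat_l; lra.
    apply Rlt_le_trans with ((K / ln 2 + 1) * q). apply Rmult_lt_compat_r; lra. apply Req_le. unfold q. field. lra. }
  destruct Hsmall as [Z [HZ1 [HZ2 HZ3]]].
  exists (fun x => x = sg) (fun y => Z < y).
  - unfold at_point. auto.
  - exists Z. auto.
  - intros x y -> Hy. simpl. destruct (Hex sg y) as [v Hv]; try lra. exists v. split; auto. apply He. apply ball_C. eapply Rle_lt_trans. apply (Hmain y v); auto; lra. auto.
Qed.

(** Lets linear arithmetic keep poles at different integers apart. *)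
Lemma INR_sep i k : i <> k -> INR i <= INR k - 1 \/ INR k + 1 <= INR i.
Proof.
  intros H. destruct (Nat.lt_total i k) as [L|[L|L]]; [left| tauto |right].
  - assert (Q : (i + 1 <= k)%nat) by lia. apply le_INR in Q. rewrite plus_INR in Q. simpl (INR 1) in Q. lra.
  - assert (Q : (k + 1 <= i)%nat) by lia. apply le_INR in Q. rewrite plus_INR in Q. simpl (INR 1) in Q. lra.
Qed.

(** * Poles of the integrand and the residue sum *)

Definition hMtail (nu : R) (X s : C) : C := (rGamma (1 + nu + s) * rGamma (1 / 2 - s) * Cexp (s * X))%C.
(* Regular cofactors of the poles of hM at k >= 1, at nu + j, and of the double pole at 0. *)
Definition poleA (nu : R) (X : C) (k : nat) (s : C) : C :=
  (/ s * / poch (- s) k * / rGamma (- s + INR (S k)) * / rGamma (nu - s) * hMtail nu X s)%C.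
Definition poleB (nu : R) (X : C) (j : nat) (s : C) : C :=
  (/ s * / rGamma (- s) * / poch (nu - s) j * / rGamma (nu - s + INR (S j)) * hMtail nu X s)%C.
Definition pole0 (nu : R) (X s : C) : C := (/ rGamma (1 - s) * / rGamma (nu - s) * hMtail nu X s)%C.

Lemma rGamma_poch s n : rGamma s = (poch s n * rGamma (s + INR n))%C.
Proof.
  induction n. simpl. rewrite Cplus_0_r. ring. rewrite IHn, (rGamma_step (s + INR n)), S_INR, RtoC_plus. simpl.
  replace (s + INR n + 1)%C with (s + (INR n + 1))%C by ring. ring.
Qed.

Lemma Cinv_opp_full (a : C) : (/ - a = - / a)%C.
Proof. destruct (Ceq_dec a 0) as [->|H]. replace (- 0)%C with (RtoC 0) by ring. rewrite Cinv_0. ring. field. auto. Qed.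

Lemma hM_poleA nu X k s : hM nu X s = (poleA nu X k s / (s - INR k))%C.
Proof.
  unfold hM, poleA, hMtail, Cdiv. rewrite (rGamma_poch (- s) (S k)), Cinv_mult_full. change (poch (- s) (S k)) with (poch (- s) k * (- s + INR k))%C.
  rewrite Cinv_mult_full. replace (- s + INR k)%C with (- (s - INR k))%C by ring. rewrite Cinv_opp_full. ring.
Qed.

Lemma hM_poleB nu X j s : hM nu X s = (poleB nu X j s / (s - RtoC (nu + INR j)))%C.
Proof.
  unfold hM, poleB, hMtail, Cdiv. rewrite (rGamma_poch (nu - s) (S j)), Cinv_mult_full. change (poch (nu - s) (S j)) with (poch (nu - s) j * (nu - s + INR j))%C.
  rewrite Cinv_mult_full. replace (nu - s + INR j)%C with (- (s - RtoC (nu + INR j)))%C by (rewrite RtoC_plus; ring). rewrite Cinv_opp_full. ring.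
Qed.

Lemma hM_pole0 nu X s : hM nu X s = (pole0 nu X s / ((s - 0) * (s - 0)))%C.
Proof.
  unfold hM, pole0, hMtail, Cdiv. rewrite (rGamma_step (- s)), Cinv_mult_full. replace (- s + 1)%C with (1 - s)%C by ring.
  replace (s - 0)%C with s by ring. rewrite Cinv_opp_full, Cinv_mult_full. ring.
Qed.

Lemma cdiff_hMtail nu X s : exists l, cdiff (hMtail nu X) s l.
Proof.
  destruct (cdiff_rGamma_pieces nu s) as [_ [_ [[l3 D3] [l4 D4]]]]. eexists. unfold hMtail. apply cdiff_mult. apply cdiff_mult; eauto. apply cdiff_Cexp_lin.
Qed.

Lemma cdiff_poch_affine (c s : C) n : exists l, cdiff (fun s => poch (c - s) n) s l.
Proof.
  destruct (cdiff_poch n (c - s)) as [l Hl]. eexists. apply (cdiff_comp (fun s => c - s)%C (fun s => poch s n)). apply cdiff_minus. apply cdiff_const. apply cdiff_id. apply Hl.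
Qed.

Lemma cdiff_rGamma_refl (c s : C) : exists l, cdiff (fun s => rGamma (c - s)) s l.
Proof.
  destruct (cdiff_rGamma (c - s)) as [l Hl]. eexists. apply (cdiff_comp (fun s => c - s)%C rGamma). apply cdiff_minus. apply cdiff_const. apply cdiff_id. apply Hl.
Qed.

Lemma cdiff_poleA (nu : R) (X : C) k (s : C) : s <> 0%C -> (forall i, i <> k -> s <> RtoC (INR i)) -> (forall j, s <> (nu + INR j)%C) -> exists l, cdiff (poleA nu X k) s l.
Proof.
  intros H0 H1 H2. destruct (cdiff_poch_affine 0 s k) as [l1 D1]. destruct (cdiff_rGamma_refl (INR (S k)) s) as [l2 D2]. destruct (cdiff_rGamma_refl nu s) as [l3 D3].
  destruct (cdiff_hMtail nu X s) as [l4 D4]. eexists. unfold poleA. apply cdiff_mult; [|apply D4]. apply cdiff_mult; [apply cdiff_mult; [apply cdiff_mult|]|].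
  - apply (cdiff_inv (fun s => s)); auto. apply cdiff_id.
  - apply (cdiff_inv (fun s => poch (- s) k)).
    + intros E. apply poch_zero in E. destruct E as [i [Hi E]]. apply (H1 i); [lia|]. replace s with (- - s)%C by ring. rewrite E. ring.
    + eapply cdiff_ext. 2: apply D1. intros; cbv beta; f_equal; ring.
  - apply (cdiff_inv (fun s => rGamma (- s + INR (S k)))).
    + apply rGamma_nz. intros i E. apply (H1 (S k + i)%nat); [lia|]. replace s with (INR (S k) - (- s + INR (S k)))%C by ring. rewrite E, plus_INR, RtoC_plus. ring.
    + eapply cdiff_ext. 2: apply D2. intros; cbv beta; f_equal; ring.
  - apply (cdiff_inv (fun s => rGamma (nu - s))); [|apply D3]. apply rGamma_nz. intros j E. apply (H2 j). replace s with (nu - (nu - s))%C by ring. rewrite E. ring.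
Qed.

Lemma cdiff_poleB (nu : R) (X : C) j (s : C) : (forall i, s <> RtoC (INR i)) -> (forall i, i <> j -> s <> (nu + INR i)%C) -> exists l, cdiff (poleB nu X j) s l.
Proof.
  intros H1 H2. destruct (cdiff_poch_affine nu s j) as [l1 D1]. destruct (cdiff_rGamma_refl 0 s) as [l2 D2]. destruct (cdiff_rGamma_refl (nu + INR (S j)) s) as [l3 D3].
  destruct (cdiff_hMtail nu X s) as [l4 D4]. eexists. unfold poleB. apply cdiff_mult; [|apply D4]. apply cdiff_mult; [apply cdiff_mult; [apply cdiff_mult|]|].
  - apply (cdiff_inv (fun s => s)). apply (H1 0%nat). apply cdiff_id.
  - apply (cdiff_inv (fun s => rGamma (- s))). apply rGamma_opp_nz; auto. eapply cdiff_ext. 2: apply D2. intros; cbv beta; f_equal; ring.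
  - apply (cdiff_inv (fun s => poch (nu - s) j)); [|apply D1].
    intros E. apply poch_zero in E. destruct E as [i [Hi E]]. apply (H2 i); [lia|]. replace s with (nu - (nu - s))%C by ring. rewrite E. ring.
  - apply (cdiff_inv (fun s => rGamma (nu - s + INR (S j)))).
    + apply rGamma_nz. intros i E. apply (H2 (S j + i)%nat); [lia|]. replace s with (nu + INR (S j) - (nu - s + INR (S j)))%C by ring. rewrite E, plus_INR, RtoC_plus. ring.
    + eapply cdiff_ext. 2: apply D3. intros; cbv beta; f_equal; ring.
Qed.

Lemma cdiff_pole0 (nu : R) (X s : C) : (forall i, s <> RtoC (INR (S i))) -> (forall j, s <> (nu + INR j)%C) -> exists l, cdiff (pole0 nu X) s l.
Proof.
  intros H1 H2. destruct (cdiff_rGamma_refl 1 s) as [l2 D2]. destruct (cdiff_rGamma_refl nu s) as [l3 D3].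
  destruct (cdiff_hMtail nu X s) as [l4 D4]. eexists. unfold pole0. apply cdiff_mult; [|apply D4]. apply cdiff_mult.
  - apply (cdiff_inv (fun s => rGamma (1 - s))); [|apply D2]. apply rGamma_nz. intros i E. apply (H1 i). rewrite S_INR, RtoC_plus.
    replace s with (1 - (1 - s))%C by ring. rewrite E. ring.
  - apply (cdiff_inv (fun s => rGamma (nu - s))); [|apply D3]. apply rGamma_nz. intros j E. apply (H2 j). replace s with (nu - (nu - s))%C by ring. rewrite E. ring.
Qed.

(* For nu in (m, m + 1), a rectangle whose right edge moves from k to k + 1 acquires the poles k and nu + (k - m). *)
Definition residM (nu : R) (X : C) (m : nat) (l0 : C) (k : nat) : C :=
  ((match k with O => l0 | _ => poleA nu X k (INR k) end) + (if lt_dec k m then 0 else poleB nu X (k - m) (nu + INR (k - m))))%C.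

(** The vertical cuts run midway between neighbouring poles: [k + f0 / 2] separates [k] from
    [nu + (k - m) = k + f0], and [k + (1 + f0) / 2] separates the latter from [k + 1]. *)
Lemma rectI_hM_residues nu X m f0 sg c1 c2 l0 : nu = INR m + f0 -> 0 < f0 < 1 -> sg < 0 -> c1 < 0 -> 0 < c2 -> cdiff (pole0 nu X) 0 l0 ->
  forall N, rectI (hM nu X) sg (INR N + (1 + f0) / 2) c1 c2 = (2 * PI * Ci * Csum (residM nu X m l0) (S N))%C.
Proof.
  intros Hnu Hf Hsg Hc1 Hc2 Hl0. assert (Hm := pos_INR m).
  assert (Hnuj : forall j (s : C), s = (nu + INR j)%C -> Re s = INR (m + j) + f0).
  { intros j s ->. simpl. rewrite Hnu, plus_INR. ring. }
  assert (Hnat : forall (s : C) i, s = RtoC (INR i) -> Re s = INR i) by (intros s i ->; reflexivity).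
  assert (HregL : forall s, Re s < 0 -> regM nu s).
  { intros s Hs. split; intros k E. apply Hnat in E. assert (Q := pos_INR k). lra. apply Hnuj in E. assert (Q := pos_INR (m + k)). lra. }
  assert (HregA : forall s k, Re s = INR k + f0 / 2 -> regM nu s).
  { intros s k Hs. split; intros i E. apply Hnat in E. destruct (Nat.eq_dec i k) as [->|H]. lra. apply INR_sep in H. lra.
    apply Hnuj in E. destruct (Nat.eq_dec (m + i) k) as [H|H]. rewrite H in E; lra. apply INR_sep in H. lra. }
  assert (HregB : forall s k, Re s = INR k + (1 + f0) / 2 -> regM nu s).
  { intros s k Hs. split; intros i E. apply Hnat in E. destruct (Nat.eq_dec i k) as [->|H]. lra. apply INR_sep in H. lra.
    apply Hnuj in E. destruct (Nat.eq_dec (m + i) k) as [H|H]. rewrite H in E; lra. apply INR_sep in H. lra. }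
  assert (HregI : forall s, Im s = c1 \/ Im s = c2 -> regM nu s) by (intros; apply regM_im; lra).
  assert (HA : forall k, (1 <= k)%nat -> rectI (hM nu X) (INR k - (1 - f0) / 2) (INR k + f0 / 2) c1 c2 = (2 * PI * Ci * poleA nu X k (INR k))%C).
  { intros k Hk. replace (hM nu X) with (fun s => poleA nu X k s / (s - INR k))%C by (apply functional_extensionality; intros; symmetry; apply hM_poleA).
    apply residue1; simpl; try lra. intros s [[Hs1 Hs2] _]. assert (Hk1 : 1 <= INR k) by (apply (le_INR 1); auto). apply cdiff_poleA.
    - intros E. apply (Hnat s 0%nat) in E. simpl in E. lra.
    - intros i Hi E. apply Hnat in E. apply INR_sep in Hi. lra.
    - intros j E. apply Hnuj in E. destruct (Nat.eq_dec (m + j) k) as [H|H]. rewrite H in E; lra. apply INR_sep in H. lra. }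
  assert (HB : forall k, rectI (hM nu X) (INR k + f0 / 2) (INR k + (1 + f0) / 2) c1 c2 = (2 * PI * Ci * (if lt_dec k m then 0 else poleB nu X (k - m) (nu + INR (k - m))))%C).
  { intros k. destruct (lt_dec k m) as [H|H].
    (* To the left of [nu], where [k < m], this strip contains no pole. *)
    - rewrite goursat; try lra. ring. intros s [[Hs1 Hs2] _]. apply cdiff_hM. split.
      + intros i E. apply Hnat in E. destruct (Nat.eq_dec i k) as [->|Hi]. lra. apply INR_sep in Hi. lra.
      + intros j E. apply Hnuj in E. assert (Hj : (m + j)%nat <> k) by lia. apply INR_sep in Hj. lra.
    - assert (Hp : nu + INR (k - m) = INR k + f0) by (rewrite minus_INR by lia; lra).
      replace (hM nu X) with (fun s => poleB nu X (k - m) s / (s - RtoC (nu + INR (k - m))))%C by (apply functional_extensionality; intros; symmetry; apply hM_poleB).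
      rewrite <- RtoC_plus. apply residue1; simpl; try lra. intros s [[Hs1 Hs2] _]. apply cdiff_poleB.
      + intros i E. apply Hnat in E. destruct (Nat.eq_dec i k) as [->|Hi]. lra. apply INR_sep in Hi. lra.
      + intros i Hi E. apply Hnuj in E. assert (Hj : (m + i)%nat <> k) by lia. apply INR_sep in Hj. lra. }
  assert (H0 : rectI (hM nu X) sg (f0 / 2) c1 c2 = (2 * PI * Ci * l0)%C).
  { replace (hM nu X) with (fun s => pole0 nu X s / ((s - 0) * (s - 0)))%C by (apply functional_extensionality; intros; symmetry; apply hM_pole0).
    apply residue2; simpl; try lra; auto. intros s [[Hs1 Hs2] _]. apply cdiff_pole0.
    - intros i E. apply Hnat in E. rewrite S_INR in E. assert (Q := pos_INR i). lra.
    - intros j E. apply Hnuj in E. assert (Q := pos_INR (m + j)). lra. }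
  induction N.
  - rewrite (rectI_split_hor _ sg (INR 0 + f0 / 2)); simpl (INR 0); try lra.
    + assert (Q := HB 0%nat). simpl (INR 0) in Q. rewrite Q, Rplus_0_l, H0. simpl Csum. unfold residM. ring.
    + intros s [_ [Hs|[Hs|Hs]]]; apply ccont_hM. apply HregL; lra. apply (HregB s 0%nat). simpl; lra. apply HregI. tauto.
  - assert (HN := pos_INR N). rewrite (rectI_split_hor _ sg (INR N + (1 + f0) / 2)); try (rewrite ?S_INR; lra).
    2: { intros s [_ [Hs|[Hs|Hs]]]; apply ccont_hM. apply HregL; lra. apply (HregB s (S N)). lra. apply HregI. tauto. }
    rewrite IHN. rewrite (rectI_split_hor _ (INR N + (1 + f0) / 2) (INR (S N) + f0 / 2)); try (rewrite ?S_INR; lra).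
    2: { intros s [_ [Hs|[Hs|Hs]]]; apply ccont_hM. apply (HregB s N); lra. apply (HregB s (S N)). lra. apply HregI. tauto. }
    rewrite HB. replace (INR N + (1 + f0) / 2) with (INR (S N) - (1 - f0) / 2) by (rewrite S_INR; field). rewrite HA by lia.
    change (Csum (residM nu X m l0) (S (S N))) with (Csum (residM nu X m l0) (S N) + residM nu X m l0 (S N))%C. unfold residM at 3. ring.
Qed.

Lemma loop_exists nu X sg c1 c2 : 0 < nu -> sg < 0 -> c1 < 0 -> 0 < c2 -> exists lb ll lt K Y, 0 <= K /\
  is_RInt_gen (V := C_R_NormedModule) (fun t : R => hM nu X (t, c1)) (at_point sg) (Rbar_locally p_infty) lb /\
  isCI (fun y => hM nu X (sg, y)) c1 c2 ll /\
  is_RInt_gen (V := C_R_NormedModule) (fun t : R => hM nu X (t, c2)) (at_point sg) (Rbar_locally p_infty) lt /\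
  (forall y v, Y <= y -> isCI (fun t => hM nu X (t, c1)) sg y v -> Cmod (v - lb) <= K * exp (- (ln 2 * y))) /\
  (forall y v, Y <= y -> isCI (fun t => hM nu X (t, c2)) sg y v -> Cmod (v - lt) <= K * exp (- (ln 2 * y))).
Proof.
  intros Hnu Hsg H1 H2. assert (Hl : 0 < ln 2) by (rewrite <- ln_1; apply ln_increasing; lra).
  destruct (hM_ray_bound nu X c1 Hnu ltac:(lra)) as [K1 [T1 [HK1 B1]]]. destruct (hM_ray_bound nu X c2 Hnu ltac:(lra)) as [K2 [T2 [HK2 B2]]].
  destruct (ray_integral (fun t => hM nu X (t, c1)) sg K1 T1) as [lb [Lb Tb]]; auto.
  { intros t _. apply rcont_hor, ccont_hM, regM_im. simpl; lra. } { intros t Ht. apply B1; lra. }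
  destruct (ray_integral (fun t => hM nu X (t, c2)) sg K2 T2) as [lt [Lt Tt]]; auto.
  { intros t _. apply rcont_hor, ccont_hM, regM_im. simpl; lra. } { intros t Ht. apply B2; lra. }
  assert (Hex : exCI (fun y => hM nu X (sg, y)) c1 c2).
  { apply exCI_rcont. intros t _. apply rcont_ver, ccont_hM. split; intros k E; apply (f_equal Re) in E; simpl in E; assert (Q := pos_INR k); lra. }
  destruct Hex as [ll Hll]. assert (P1 : 0 <= K1 / ln 2) by (apply Rmult_le_pos; [auto|left; apply Rinv_0_lt_compat; auto]).
  assert (P2 : 0 <= K2 / ln 2) by (apply Rmult_le_pos; [auto|left; apply Rinv_0_lt_compat; auto]).
  exists lb, ll, lt, (K1 / ln 2 + K2 / ln 2), (Rmax sg (Rmax T1 T2)).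
  assert (M1 := Rmax_l sg (Rmax T1 T2)). assert (M2 := Rmax_r sg (Rmax T1 T2)). assert (M3 := Rmax_l T1 T2). assert (M4 := Rmax_r T1 T2).
  repeat split; auto. lra.
  - intros y v Hy Hv. eapply Rle_trans. apply (Tb y v); auto; lra. apply Rmult_le_compat_r. left; apply exp_pos. lra.
  - intros y v Hy Hv. eapply Rle_trans. apply (Tt y v); auto; lra. apply Rmult_le_compat_r. left; apply exp_pos. lra.
Qed.

Lemma exp_ln2_half n x : exp (- (ln 2 * (INR n + x))) = (/ 2) ^ n * exp (- (ln 2 * x)).
Proof. rewrite <- (exp_ln ((/ 2) ^ n)) by (apply pow_lt; lra). rewrite ln_pow, ln_Rinv, <- exp_plus by lra. f_equal. ring. Qed.

Lemma geom_half_lim c : is_lim_seq (fun n => c * (/ 2) ^ n) 0.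
Proof.
  replace (Finite 0) with (Rbar_mult c 0) by (simpl; f_equal; ring). apply is_lim_seq_scal_l. apply is_lim_seq_geom. rewrite Rabs_pos_eq; lra.
Qed.

(** The rectangles exhaust the half-strip: their horizontal sides tend to the rays and the integrals
    over their right edges to 0. *)
Lemma loop_residues nu X m f0 sg c1 c2 l0 : nu = INR m + f0 -> 0 < f0 < 1 -> sg < 0 -> c1 < 0 -> 0 < c2 -> cdiff (pole0 nu X) 0 l0 ->
  exists I, is_loop_int sg c1 c2 (hM nu X) I /\ Clim (Csum (residM nu X m l0)) (- (I / (2 * PI * Ci)))%C.
Proof.
  intros Hnu Hf Hsg Hc1 Hc2 Hl0. assert (Hm := pos_INR m). assert (Hnu0 : 0 < nu) by lra.
  destruct (loop_exists nu X sg c1 c2) as [lb [ll [lt [K [Y [HK [L1 [L2 [L3 [T1 T2]]]]]]]]]]; auto.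
  exists (- lb + Ci * ll + lt)%C. split. { exists lb, ll, lt. auto. }
  set (x := fun N => INR N + (1 + f0) / 2).
  assert (Hreg : forall s k, Re s = x k -> regM nu s).
  { intros s k Hs. unfold x in Hs. split; intros i E; apply (f_equal Re) in E; simpl in E.
    destruct (Nat.eq_dec i k) as [->|H]. unfold Re in *; lra. apply INR_sep in H. unfold Re in *; lra.
    assert (E' : Re s = INR (m + i) + f0) by (rewrite plus_INR; unfold Re in *; lra).
    destruct (Nat.eq_dec (m + i) k) as [H|H]. rewrite H in E'; lra. apply INR_sep in H. lra. }
  destruct (nfloor_ex (nu + 2 + 2 * Cmod (Cexp X) + Rabs Y)) as [N0 HN0]. { assert (Q := Cmod_ge_0 (Cexp X)). assert (Q' := Rabs_pos Y). lra. }
  set (N1 := S N0). assert (HN1 : nu + 2 + 2 * Cmod (Cexp X) + Rabs Y < INR N1) by (unfold N1; rewrite S_INR; lra).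
  clearbody N1. clear HN0 N0.
  assert (HY := Rle_abs Y). assert (HY0 := Rabs_pos Y). assert (HX0 := Cmod_ge_0 (Cexp X)).
  (* One right edge beyond the threshold of [hM_decay] is bounded by compactness; each unit step
     then halves the bound. *)
  destruct (rcont_bounded (fun y => hM nu X (x N1, y)) c1 c2) as [B HB].
  { intros t _. apply rcont_ver, ccont_hM. apply (Hreg _ N1). reflexivity. }
  assert (HBn : forall n y, c1 <= y <= c2 -> Cmod (hM nu X (x (N1 + n)%nat, y)) <= B * (/ 2) ^ n).
  { induction n; intros y Hy. rewrite Nat.add_0_r. simpl. rewrite Rmult_1_r. apply HB; auto.
    assert (E : (x (N1 + S n)%nat, y) = ((x (N1 + n)%nat, y) + 1)%C). { apply C_ext; simpl; [|ring]. unfold x. rewrite Nat.add_succ_r, S_INR. ring. }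
    rewrite E. eapply Rle_trans. apply hM_decay; auto. change (nu + 2 + 2 * Cmod (Cexp X) <= x (N1 + n)%nat). unfold x. rewrite plus_INR. assert (Q := pos_INR n). lra. specialize (IHn y Hy). simpl. lra. }
  assert (Hpi : (2 * PI * Ci)%C <> 0%C). { apply Cmult_neq_0. apply Cmult_neq_0; apply RtoC_nz. lra. apply PI_neq0. apply Ci_nz. }
  set (D := K * exp (- (ln 2 * ((1 + f0) / 2)))). assert (HD : 0 <= D) by (apply Rmult_le_pos; [auto|left; apply exp_pos]).
  assert (Hlim : Clim (fun n => (2 * PI * Ci * Csum (residM nu X m l0) (S (N1 + n)) + (- lb + Ci * ll + lt))%C) 0%C).
  { apply Clim_zero_bound with (v := fun n => (2 * D + (c2 - c1) * B) * (/ 2) ^ n).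
    2: apply geom_half_lim.
    intros n. rewrite <- (rectI_hM_residues nu X m f0 sg c1 c2 l0) by auto. fold (x (N1 + n)%nat). set (xn := x (N1 + n)%nat).
    assert (Hxn : Y <= xn /\ sg <= xn). { unfold xn, x. rewrite plus_INR. assert (Q := pos_INR n). lra. }
    assert (Hexp : K * exp (- (ln 2 * xn)) <= D * (/ 2) ^ n).
    { unfold xn, x, D. rewrite exp_ln2_half, pow_add. assert (0 < (/ 2) ^ n) by (apply pow_lt; lra).
      assert ((/ 2) ^ N1 <= 1). { rewrite <- (pow1 N1). apply pow_incr; lra. } assert (0 < (/ 2) ^ N1) by (apply pow_lt; lra). assert (E := exp_pos (- (ln 2 * ((1 + f0) / 2)))).
      rewrite !Rmult_assoc. apply Rmult_le_compat_l; auto. rewrite <- Rmult_assoc, (Rmult_comm _ (exp _)). apply Rmult_le_compat_l. lra. nra. }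
    assert (Hb : exCI (fun t => hM nu X (t, c1)) sg xn). { apply exCI_rcont. intros t _. apply rcont_hor, ccont_hM, regM_im. simpl; lra. }
    assert (Ht : exCI (fun t => hM nu X (t, c2)) sg xn). { apply exCI_rcont. intros t _. apply rcont_hor, ccont_hM, regM_im. simpl; lra. }
    assert (Hr : exCI (fun y => hM nu X (xn, y)) c1 c2). { apply exCI_rcont. intros t _. apply rcont_ver, ccont_hM. apply (Hreg _ (N1 + n)%nat). reflexivity. }
    apply CI_correct in Hb, Ht, Hr.
    assert (Eb := T1 _ _ (proj1 Hxn) Hb). assert (Et := T2 _ _ (proj1 Hxn) Ht).
    assert (Er := isCI_bound _ c1 c2 _ _ ltac:(lra) (HBn n) Hr).
    unfold rectI. rewrite (isCI_unique _ _ _ _ L2).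
    set (vb := CI (fun t => hM nu X (t, c1)) sg xn) in *. set (vt := CI (fun t => hM nu X (t, c2)) sg xn) in *. set (vr := CI (fun y => hM nu X (xn, y)) c1 c2) in *.
    change (Cmod (vb + Ci * vr - vt - Ci * ll + (- lb + Ci * ll + lt)) <= (2 * D + (c2 - c1) * B) * (/ 2) ^ n).
    replace (vb + Ci * vr - vt - Ci * ll + (- lb + Ci * ll + lt))%C with ((vb - lb) + (- (vt - lt) + Ci * vr))%C by (generalize vb vr vt ll lb lt; clear; intros; unfold Cminus; apply C_ext; simpl; ring).
    eapply Rle_trans. apply Cmod_triangle. eapply Rle_trans. apply Rplus_le_compat_l, Cmod_triangle. rewrite Cmod_opp, Cmod_mult, Cmod_Ci. lra. }
  apply Clim_eps. intros eps He. destruct (proj1 (Clim_eps _ _) Hlim (eps * Cmod (2 * PI * Ci))) as [N HN]. apply Rmult_lt_0_compat; auto. apply Cmod_pos; auto.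
  exists (S (N1 + N)). intros n Hn. specialize (HN (n - S N1)%nat ltac:(lia)). replace (S (N1 + (n - S N1))) with n in HN by lia.
  apply Rmult_lt_reg_r with (Cmod (2 * PI * Ci)). apply Cmod_pos; auto. rewrite <- Cmod_mult. eapply Rle_lt_trans. 2: apply HN. apply Req_le. f_equal. set (w := (2 * PI * Ci)%C) in *. clearbody w. field.
  auto.
Qed.

(** * Non-integral order *)

Lemma Clog_z2 z : 0 < Re z -> Clog (z ^ 2) = (2 * (Clog (z / 2) + ln 2))%C.
Proof.
  intros H. rewrite Clog_sq by auto. f_equal. rewrite <- Clog_scal; try lra.
  - f_equal. field.
  - unfold Cdiv. rewrite <- RtoC_inv by lra. destruct z as [u v]; simpl in *. lra.
Qed.

Lemma Cexp_z2 z : 0 < Re z -> Cexp (Clog (z ^ 2)) = (RtoC (-4) * yarg z)%C.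
Proof.
  intros H. rewrite Cexp_Clog. unfold yarg. replace (RtoC (-4)) with (- RtoC 4)%C by (rewrite <- RtoC_opp; auto). simpl. field.
  apply Cpow_nz. intros E. rewrite E in H. simpl in H. lra.
Qed.

Lemma rpoch_neg_nat k : rpoch (- INR k) k = (-1) ^ k * INR (fact k).
Proof.
  induction k. simpl; ring. rewrite rpoch_S_left. replace (- INR (S k) + 1) with (- INR k) by (rewrite S_INR; ring).
  rewrite IHk, fact_simpl, mult_INR. simpl pow. ring.
Qed.

Lemma conv_power_bound y (mu nu : R) : exists M, ex_series M /\ (forall k, 0 <= M k) /\ forall k, Cmod (y ^ k * RtoC (conv (besc mu) (besc nu) k)) <= M k.
Proof.
  destruct (jcoef_bound mu) as [M1 [H1 B1]]. destruct (jcoef_bound nu) as [M2 [H2 B2]].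
  assert (P : forall M k, 0 < M -> 0 <= M * (Cmod y ^ k / INR (fact k))).
  { intros M k HM. apply Rmult_le_pos. lra. apply Rmult_le_pos. apply pow_le, Cmod_ge_0. left. apply Rinv_0_lt_compat, INR_fact_lt_0. }
  assert (E : forall k, Cmod (y ^ k * RtoC (conv (besc mu) (besc nu) k)) <= conv (fun k => M1 * (Cmod y ^ k / INR (fact k))) (fun k => M2 * (Cmod y ^ k / INR (fact k))) k).
  { intros k. unfold conv at 1. rewrite <- Cdsum_powers. apply Cmod_Cdsum. intros i j.
    replace (y ^ i * y ^ j * RtoC (besc mu i * besc nu j))%C with (jcoef y mu i * jcoef y nu j)%C by (rewrite !jcoef_real, RtoC_mult; ring).
    rewrite Cmod_mult. apply Rmult_le_compat; auto using Cmod_ge_0. apply B1. apply B2. }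
  exists (conv (fun k => M1 * (Cmod y ^ k / INR (fact k))) (fun k => M2 * (Cmod y ^ k / INR (fact k)))). repeat split; auto.
  - apply ex_series_conv; auto; apply ex_series_exp.
  - intros k. eapply Rle_trans. apply Cmod_ge_0. apply E.
Qed.

Lemma sqint_power_bound y nu : 0 < nu -> exists M, ex_series M /\ forall k, Cmod (y ^ k * RtoC (sqint nu k)) <= M k.
Proof.
  intros Hnu. destruct (conv_power_bound y nu nu) as [M [HM [HP B]]]. exists (fun k => / (2 * nu) * M k). split.
  - apply (ex_series_scal (/ (2 * nu)) M) in HM. exact HM.
  - intros k. assert (Q := pos_INR k). unfold sqint, Rdiv. rewrite RtoC_mult, Cmult_assoc, Cmod_mult, Cmod_R, Rmult_comm.
    apply Rmult_le_compat; auto using Rabs_pos, Cmod_ge_0. rewrite Rabs_pos_eq by (left; apply Rinv_0_lt_compat; lra). apply Rinv_le_contravar; lra.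
Qed.

Lemma ex_series_sconst c : ex_series (sconst c).
Proof.
  apply ex_series_incr_1. apply ex_series_ext with (a := fun k => scal 0 (0 ^ k)). intros n; simpl. unfold scal; simpl; unfold mult; simpl. ring.
  apply (ex_series_scal (V := R_NormedModule) 0 (fun k => 0 ^ k)). apply ex_series_geom. rewrite Rabs_R0; lra.
Qed.

Lemma crossint_power_bound y nu : exists M, ex_series M /\ forall k, Cmod (y ^ k * RtoC (crossint nu k)) <= M k.
Proof.
  destruct (conv_power_bound y nu (- nu)) as [M [HM [HP B]]]. exists (fun k => M k + sconst (Rabs (crossint nu 0)) k). split.
  - apply (ex_series_plus M _ HM (ex_series_sconst _)).
  - intros [|k].
    + simpl Cpow. rewrite Cmult_1_l, Cmod_R. unfold sconst. specialize (HP 0%nat). lra.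
    + simpl sconst. rewrite Rplus_0_r. eapply Rle_trans; [|apply (B (S k))]. assert (Q := pos_INR k). unfold crossint, Rdiv.
      rewrite RtoC_mult, Cmult_assoc, (Cmod_mult _ (RtoC (/ _))), Cmod_R. rewrite <- (Rmult_1_r (Cmod (_ * RtoC (conv _ _ _)))) at 2.
      apply Rmult_le_compat_l. apply Cmod_ge_0. rewrite Rabs_pos_eq by (left; apply Rinv_0_lt_compat; rewrite S_INR; lra).
      rewrite <- Rinv_1. apply Rinv_le_contravar. lra. rewrite S_INR. lra.
Qed.

Definition sqser (y : C) (nu : R) : C := CSeries (fun k => y ^ k * RtoC (sqint nu k))%C.
Definition crossser (y : C) (nu : R) : C := CSeries (fun k => y ^ k * RtoC (crossint nu k))%C.

(** Cauchy products lift the coefficient identity to the convergent series. *)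
Lemma series_identity_sum y nu : 0 < nu ->
  (jser y nu * crossser y nu - jser y (- nu) * sqser y nu = RtoC (bess0 nu) * djser y nu)%C.
Proof.
  intros Hnu. destruct (sqint_power_bound y nu Hnu) as [Ms [HMs Bs]]. destruct (crossint_power_bound y nu) as [Mc [HMc Bc]].
  destruct (jcoef_bound nu) as [M1 [H1 B1]]. destruct (jcoef_bound (- nu)) as [M2 [H2 B2]].
  assert (Cs := Cser_correct _ _ Bs HMs). assert (Cc := Cser_correct _ _ Bc HMc). fold (sqser y nu) in Cs. fold (crossser y nu) in Cc.
  assert (P1 := cauchy_product _ _ _ _ _ _ (jser_spec y nu) Cc (fun k => proj1 (B1 y k)) Bc (ex_series_exp _ _) HMc).
  assert (P2 := cauchy_product _ _ _ _ _ _ (jser_spec y (- nu)) Cs (fun k => proj1 (B2 y k)) Bs (ex_series_exp _ _) HMs).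
  eapply Cser_unique. apply (Cser_minus _ _ _ _ P1 P2).
  eapply Cser_ext. 2: apply (Cser_scal _ _ _ (djser_spec y nu)). intros n. cbv beta.
  transitivity (y ^ n * RtoC (conv (besc nu) (crossint nu) n) - y ^ n * RtoC (conv (besc (- nu)) (sqint nu) n))%C.
  - rewrite djcoef_real. transitivity (y ^ n * RtoC (bess0 nu * dbesc nu n))%C. rewrite RtoC_mult. unfold dbesc. ring.
    rewrite <- series_identity, RtoC_minus by auto. ring.
  - unfold conv. rewrite <- !Cdsum_powers. f_equal; apply Cdsum_ext; intros k j _; rewrite ?(RtoC_opp nu), <- ?RtoC_opp, jcoef_real, RtoC_mult; ring.
Qed.

(** The pole [nu + j] is collected together with the integer [j + m], hence the delay by [m] in
    [residM]. *)
Lemma Cser_delay (b : nat -> C) l m : Cser b l -> Cser (fun k => if lt_dec k m then RtoC 0 else b (k - m)%nat) l.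
Proof.
  induction m; intros H.
  - eapply Cser_ext. 2: apply H. intros n. destruct (lt_dec n 0). lia. f_equal. lia.
  - replace l with ((fun k : nat => if lt_dec k (S m) then RtoC 0 else b (k - S m)%nat) O + l)%C. 2: destruct (lt_dec 0 (S m)); [ring|lia].
    apply Cser_shift. eapply Cser_ext. 2: apply IHm; auto. intros n. cbv beta. destruct (lt_dec n m), (lt_dec (S n) (S m)); try lia; auto.
Qed.

(** A logarithmic derivative. Euler's constant, in the form [drg 1], cancels between
    [rGamma (1 - s)] and [rGamma (1 / 2 - s)]; the two remaining digamma terms are those of
    [crossint nu 0]. *)
Lemma cdiff_pole0_0 nu X : 0 < nu ->
  cdiff (pole0 nu X) 0 (RtoC (/ (nu * sqrt PI)) * (RtoC (drg nu / rg nu + drg (nu + 1) / rg (nu + 1) - 2 * ln 2) + X))%C.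
Proof.
  intros Hnu. assert (SP := sqrt_PI_pos). assert (G0 := rg_pos nu Hnu). assert (G1 := rg_pos (nu + 1) ltac:(lra)).
  assert (A : forall (c d : R) (g : C -> C), (forall s, g s = rGamma (c + RtoC d * s)) -> g 0%C = RtoC (rg c) /\ cdiff g 0 (RtoC (d * drg c))).
  { intros c d g H. split. rewrite H, Cmult_0_r, Cplus_0_r, rGamma_real. auto.
    apply cdiff_ext with (f := fun s => rGamma (c + RtoC d * s)). intros; symmetry; auto.
    eapply cdiff_eq. apply (cdiff_comp (fun s => c + RtoC d * s)%C rGamma). apply cdiff_plus. apply cdiff_const. apply cdiff_mult. apply cdiff_const. apply cdiff_id. apply cdiff_drGamma.
    cbv beta. rewrite Cmult_0_r, Cplus_0_r, drGamma_real, RtoC_mult. ring. }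
  destruct (A 1 (-1) (fun s => rGamma (1 - s))) as [V1 D1]. { intros; f_equal. replace (RtoC (-1)) with (- (1))%C by (rewrite <- RtoC_opp; auto). ring. }
  destruct (A nu (-1) (fun s => rGamma (nu - s))) as [V2 D2]. { intros; f_equal. replace (RtoC (-1)) with (- (1))%C by (rewrite <- RtoC_opp; auto). ring. }
  destruct (A (nu + 1) 1 (fun s => rGamma (1 + nu + s))) as [V3 D3]. { intros; f_equal. rewrite RtoC_plus. ring. }
  destruct (A (1 / 2) (-1) (fun s => rGamma (1 / 2 - s))) as [V4 D4]. { intros; f_equal. replace (RtoC (-1)) with (- (1))%C by (rewrite <- RtoC_opp; auto). rewrite RtoC_div by lra. ring. }
  rewrite rg_1 in V1. rewrite drg_half in D4. rewrite rg_half in V4, D4.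
  eapply cdiff_eq. unfold pole0, hMtail. apply cdiff_mult. apply cdiff_mult.
  apply (cdiff_inv (fun s => rGamma (1 - s))). rewrite V1. apply RtoC_nz. lra. apply D1.
  apply (cdiff_inv (fun s => rGamma (nu - s))). rewrite V2. apply RtoC_nz. lra. apply D2.
  apply cdiff_mult. apply cdiff_mult. apply D3. apply D4. apply cdiff_Cexp_lin.
  cbv beta in *. rewrite V1, V2, V3, V4, Cmult_0_l, Cexp_0. rewrite (rg_step nu) in *. set (g1 := rg (nu + 1)) in *.
  unfold Rdiv, Rminus. repeat rewrite ?RtoC_plus, ?RtoC_mult, ?RtoC_opp. rewrite !RtoC_inv by nra. repeat rewrite ?RtoC_mult, ?RtoC_opp.
  assert (N1 : RtoC nu <> 0%C) by (apply RtoC_nz; lra). assert (N2 : RtoC (sqrt PI) <> 0%C) by (apply RtoC_nz; lra). assert (N3 : RtoC g1 <> 0%C) by (apply RtoC_nz; lra).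
  replace (RtoC (-1)) with (- (1))%C by (rewrite <- RtoC_opp; auto). field. auto.
Qed.

Lemma poleA_value nu z k : (1 <= k)%nat -> 0 < Re z -> (forall j, nu <> INR j) -> (forall j, nu <> - INR j) -> sin (PI * nu) <> 0 ->
  poleA nu (Clog (z ^ 2)) k (INR k) = (RtoC (2 * sqrt PI / sin (PI * nu)) * (yarg z ^ k * RtoC (crossint nu k)))%C.
Proof.
  intros Hk Hz H1 H2 Hs. assert (SP := sqrt_PI_pos). unfold poleA, hMtail. rewrite Cexp_nat_mult, Cexp_z2, Cpow_mult_l by auto.
  rewrite <- (RtoC_opp (INR k)), poch_real, rpoch_neg_nat. rewrite <- (RtoC_div 1 2) by lra. rewrite <- !RtoC_plus, <- !RtoC_minus, !rGamma_real.
  replace (- INR k + INR (S k)) with 1 by (rewrite S_INR; ring). rewrite rg_1.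
  assert (E := crossint_residue nu k Hk H1 H2 Hs). 
  assert (E' : crossint nu k = sin (PI * nu) * (/ INR k * ((-1) ^ k / INR (fact k)) * / rg (nu - INR k) * (rg (1 + nu + INR k) * rg (1 / 2 - INR k)) * (-4) ^ k / (2 * sqrt PI))) by (rewrite E; field; auto).
  rewrite E'. assert (HN : rg (nu - INR k) <> 0). { apply rg_nz. intros j Ej. destruct (Nat.le_gt_cases j k) as [H|H]. apply (H1 (k - j)%nat). rewrite minus_INR by auto. lra. apply (H2 (j - k)%nat). rewrite minus_INR by lia. lra. }
  assert (Hk0 : INR k <> 0) by (apply not_0_INR; lia). assert (Hm : (-1) ^ k <> 0) by (apply pow_nonzero; lra). assert (Hf := INR_fact_neq_0 k).
  rewrite <- !RtoC_inv, <- RtoC_pow by (auto; try lra; apply Rmult_integral_contrapositive; auto).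
  transitivity (RtoC (/ INR k * / ((-1) ^ k * INR (fact k)) * / 1 * / rg (nu - INR k) * (rg (1 + nu + INR k) * rg (1 / 2 - INR k) * (-4) ^ k)) * yarg z ^ k)%C.
  rewrite !RtoC_mult. ring.
  transitivity (RtoC (2 * sqrt PI / sin (PI * nu) * (sin (PI * nu) * (/ INR k * ((-1) ^ k / INR (fact k)) * / rg (nu - INR k) * (rg (1 + nu + INR k) * rg (1 / 2 - INR k)) * (-4) ^ k / (2 * sqrt PI)))) * yarg z ^ k)%C.
  2: rewrite (RtoC_mult (2 * sqrt PI / _)); ring. f_equal. f_equal. assert (pw : (-1) ^ k * (-1) ^ k = 1). { rewrite <- Rpow_mult_distr. replace (-1 * -1) with 1 by ring. apply pow1. }
  replace (/ ((-1) ^ k * INR (fact k))) with ((-1) ^ k / INR (fact k)). field. repeat split; auto; lra.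
  apply Rmult_eq_reg_r with ((-1) ^ k * INR (fact k)). 2: apply Rmult_integral_contrapositive; auto. rewrite Rinv_l by (apply Rmult_integral_contrapositive; auto).
  field_simplify; auto. rewrite <- pw. ring.
Qed.

Lemma poleB_value nu z j : 0 < nu -> 0 < Re z -> (forall j, nu <> INR j) -> sin (PI * nu) <> 0 ->
  poleB nu (Clog (z ^ 2)) j (nu + INR j) = (- RtoC (2 * sqrt PI * cos (PI * nu) / sin (PI * nu)) * (Cexp (2 * nu * Clog (z / 2)) * (yarg z ^ j * RtoC (sqint nu j))))%C.
Proof.
  intros Hnu Hz H1 Hs. assert (SP := sqrt_PI_pos). assert (Hj := pos_INR j). unfold poleB, hMtail.
  assert (EX : Cexp ((nu + INR j) * Clog (z ^ 2)) = (Cexp (2 * nu * Clog (z / 2)) * RtoC (exp (2 * nu * ln 2)) * (RtoC ((-4) ^ j) * yarg z ^ j))%C).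
  { rewrite Cmult_plus_distr_r, Cexp_plus, Cexp_nat_mult, Cexp_z2, Cpow_mult_l, <- RtoC_pow by auto. f_equal. rewrite Clog_z2, <- Cexp_RtoC, <- Cexp_plus by auto. f_equal. rewrite !RtoC_mult. ring. }
  rewrite EX. replace (nu - (nu + INR j))%C with (RtoC (- INR j)) by (rewrite RtoC_opp; ring). rewrite poch_real, rpoch_neg_nat.
  rewrite <- (RtoC_div 1 2) by lra. rewrite <- !RtoC_plus, <- RtoC_minus, <- RtoC_opp, !rGamma_real.
  replace (- INR j + INR (S j)) with 1 by (rewrite S_INR; ring). rewrite rg_1. replace (1 + nu + (nu + INR j)) with (1 + 2 * nu + INR j) by ring.
  assert (E := sqint_residue nu j Hnu H1 Hs).
  assert (HN : rg (- (nu + INR j)) <> 0). { apply rg_nz. intros k Ek. destruct (Nat.le_gt_cases j k) as [H|H]. apply (H1 (k - j)%nat). rewrite minus_INR by auto. lra. apply lt_INR in H. lra. }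
  assert (Hm : (-1) ^ j <> 0) by (apply pow_nonzero; lra). assert (Hf := INR_fact_neq_0 j).
  rewrite <- !RtoC_inv by (auto; try lra; apply Rmult_integral_contrapositive; auto).
  transitivity (RtoC (/ (nu + INR j) * / rg (- (nu + INR j)) * / ((-1) ^ j * INR (fact j)) * / 1 * (rg (1 + 2 * nu + INR j) * rg (1 / 2 - (nu + INR j)) * exp (2 * nu * ln 2) * (-4) ^ j)) * (Cexp (2 * nu * Clog (z / 2)) * yarg z ^ j))%C.
  rewrite !RtoC_mult. ring.
  transitivity (RtoC (2 * sqrt PI * (- (cos (PI * nu) / sin (PI * nu)) * sqint nu j)) * (Cexp (2 * nu * Clog (z / 2)) * yarg z ^ j))%C.
  2: { rewrite <- RtoC_opp. transitivity (RtoC (- (2 * sqrt PI * cos (PI * nu) / sin (PI * nu)) * sqint nu j) * (Cexp (2 * nu * Clog (z / 2)) * yarg z ^ j))%C. f_equal. f_equal. field; auto. rewrite RtoC_mult. ring. }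
  rewrite <- E. f_equal. f_equal. assert (pw : (-1) ^ j * (-1) ^ j = 1). { rewrite <- Rpow_mult_distr. replace (-1 * -1) with 1 by ring. apply pow1. }
  replace (/ ((-1) ^ j * INR (fact j))) with ((-1) ^ j / INR (fact j)). field. repeat split; auto; lra.
  apply Rmult_eq_reg_r with ((-1) ^ j * INR (fact j)). 2: apply Rmult_integral_contrapositive; auto. rewrite Rinv_l by (apply Rmult_integral_contrapositive; auto).
  field_simplify; auto. rewrite <- pw. ring.
Qed.

Definition sqterm (z : C) (nu : R) : C := (Cexp (2 * nu * Clog (z / 2)) * sqser (yarg z) nu)%C.

Lemma loop_identity_nonint nu z m f0 : nu = INR m + f0 -> 0 < f0 < 1 -> 0 < Re z -> exists G,
  (forall sg c1 c2, sg < 0 -> c1 < 0 -> 0 < c2 -> exists I, is_loop_int sg c1 c2 (hM nu (Clog (z ^ 2))) I /\ G = (I / (2 * PI * Ci))%C) /\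
  (dJC z nu / (PI * nu) = YN z nu / YD nu * sqterm z nu - JC z nu / (2 * sqrt PI) * G)%C.
Proof.
  intros Hnu Hf Hz. assert (Hm := pos_INR m). assert (Hnu0 : 0 < nu) by lra. assert (HP := PI_RGT_0). assert (SP := sqrt_PI_pos).
  assert (H1 : forall j, nu <> INR j). { intros j E. destruct (Nat.eq_dec m j) as [->|H]. lra. apply INR_sep in H. lra. }
  assert (H2 : forall j, nu <> - INR j). { intros j E. assert (Q := pos_INR j). lra. }
  assert (Hs : sin (PI * nu) <> 0).
  { rewrite Hnu, Rplus_comm, sin_shift_nat. apply Rmult_integral_contrapositive. split. apply pow_nonzero; lra. assert (0 < sin (PI * f0)). apply sin_gt_0; nra. lra. }
  assert (HLR := fun sg c1 c2 Hsg Hc1 Hc2 => loop_residues nu (Clog (z ^ 2)) m f0 sg c1 c2 _ Hnu Hf Hsg Hc1 Hc2 (cdiff_pole0_0 nu (Clog (z ^ 2)) Hnu0)).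
  destruct (HLR (-1) (-1) 1 ltac:(lra) ltac:(lra) ltac:(lra)) as [I0 [_ HL]]. set (G := (I0 / (2 * PI * Ci))%C) in *. exists G. split.
  { intros sg c1 c2 Hsg Hc1 Hc2. destruct (HLR sg c1 c2 Hsg Hc1 Hc2) as [I [HI HI']]. exists I. split; auto.
    replace G with (- - G)%C by ring. rewrite (Clim_unique _ _ _ HL HI'). ring. }
  clear HLR. set (l0 := (RtoC (/ (nu * sqrt PI)) * _)%C) in HL.
  set (L := Clog (z / 2)). set (y := yarg z). set (sn := sin (PI * nu)) in *. set (cs := cos (PI * nu)).
  destruct (sqint_power_bound y nu Hnu0) as [Ms [HMs Bs]]. destruct (crossint_power_bound y nu) as [Mc [HMc Bc]].
  assert (Cs := Cser_correct _ _ Bs HMs). assert (Cc := Cser_correct _ _ Bc HMc). fold (sqser y nu) in Cs. fold (crossser y nu) in Cc.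
  assert (Eb : bess0 nu = sn / (PI * nu)). { unfold bess0. replace (nu + 1) with (1 + nu) by ring. replace (- nu + 1) with (1 - nu) by ring. apply rg_reflection. lra. }
  (* The [ln 2] from writing [z^2] through [z / 2] cancels that of the duplication formula, so the
     double pole contributes exactly the constant and the logarithmic term of the primitive T. *)
  assert (El0 : l0 = (RtoC (2 * sqrt PI / sn) * (RtoC (crossint nu 0) + RtoC (bess0 nu) * L))%C).
  { unfold l0. rewrite Clog_z2 by auto. fold L. simpl crossint. rewrite Eb. set (dd := drg nu / rg nu + drg (nu + 1) / rg (nu + 1)).
    transitivity (RtoC (/ (nu * sqrt PI)) * RtoC dd + RtoC (2 / (nu * sqrt PI)) * L)%C.
    unfold Rdiv, Rminus. rewrite RtoC_plus, RtoC_opp, !RtoC_mult. ring.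
    transitivity (RtoC (2 * sqrt PI / sn * (sn / (PI * nu) * dd / 2)) + RtoC (2 * sqrt PI / sn * (sn / (PI * nu))) * L)%C. 2: rewrite !(RtoC_mult (2 * sqrt PI / sn)); ring.
    assert (K : 2 * sqrt PI / sn * (sn / (PI * nu)) = 2 / (nu * sqrt PI)).
    { transitivity (2 * sqrt PI / (PI * nu)). field; repeat split; auto; lra. rewrite <- (sqrt_sqrt PI) at 2 by lra. field. split; lra. }
    rewrite K, <- RtoC_mult. f_equal. f_equal. transitivity (2 * sqrt PI / sn * (sn / (PI * nu)) * dd / 2). rewrite K. field. split; lra. field. repeat split; auto; lra. }
  assert (SA : Cser (fun k => match k with O => l0 | _ => poleA nu (Clog (z ^ 2)) k (INR k) end) (RtoC (2 * sqrt PI / sn) * (RtoC (bess0 nu) * L + crossser y nu))%C).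
  { assert (Cc' := Cser_tail _ _ 1 Cc). simpl Csum in Cc'.
    assert (Q := Cser_scal (RtoC (2 * sqrt PI / sn)) _ _ Cc').
    match goal with |- Cser ?u ?v => replace v with (u O + RtoC (2 * sqrt PI / sn) * (crossser y nu - (0 + 1 * RtoC (crossint nu 0))))%C end.
    2: { rewrite El0. ring. }
    apply Cser_shift. eapply Cser_ext. 2: apply Q. intros n. cbv beta. change (1 + n)%nat with (S n). symmetry. apply poleA_value; auto. lia. }
  assert (SB : Cser (fun k => if lt_dec k m then RtoC 0 else poleB nu (Clog (z ^ 2)) (k - m) (nu + INR (k - m))) (- RtoC (2 * sqrt PI * cs / sn) * (Cexp (2 * nu * L) * sqser y nu))%C).
  { apply (Cser_delay (fun j => poleB nu (Clog (z ^ 2)) j (nu + INR j))). eapply Cser_ext. 2: apply (Cser_scal _ _ _ (Cser_scal _ _ _ Cs)).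
    intros j. cbv beta. symmetry. apply poleB_value; auto. }
  assert (SR := Cser_plus _ _ _ _ SA SB). apply Cser_Clim in SR. assert (EG := Clim_unique _ _ _ HL SR). clear SA SB SR HL.
  assert (SI := series_identity_sum y nu Hnu0).
  assert (EG' : G = (- (RtoC (2 * sqrt PI / sn) * (RtoC (bess0 nu) * L + crossser y nu) + - RtoC (2 * sqrt PI * cs / sn) * (Cexp (2 * nu * L) * sqser y nu)))%C) by (rewrite <- EG; ring).
  rewrite EG'. unfold YN, YD, JC, dJC, sqterm. fold L y. rewrite <- !(RtoC_mult PI nu), Ccos_real, Csin_real. fold cs sn.
  replace (Cexp (2 * nu * L)) with (Cexp (nu * L) * Cexp (nu * L))%C by (rewrite <- Cexp_plus; f_equal; ring).
  replace (Cexp (- nu * L)) with (/ Cexp (nu * L))%C by (replace (- nu * L)%C with (- (nu * L))%C by ring; rewrite Cexp_opp; auto).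
  assert (HE := Cexp_nz (nu * L)). set (E := Cexp (nu * L)) in *.
  (* Division by [bess0 nu], nonzero for non-integral [nu], expresses the order derivative through
     the two primitives; the rest is algebra. *)
  assert (Edj : djser y nu = (RtoC (PI * nu / sn) * (jser y nu * crossser y nu - jser y (- nu) * sqser y nu))%C).
  { rewrite SI, Eb, Cmult_assoc, <- RtoC_mult. replace (PI * nu / sn * (sn / (PI * nu))) with 1 by (field; repeat split; auto; lra). ring. }
  rewrite Edj, Eb. rewrite !RtoC_div, !RtoC_mult by (try apply Rmult_integral_contrapositive; repeat split; auto; lra).
  assert (N1 : RtoC sn <> 0%C) by (apply RtoC_nz; auto). assert (N2 : RtoC PI <> 0%C) by (apply RtoC_nz; lra). assert (N3 : RtoC nu <> 0%C) by (apply RtoC_nz; lra). assert (N4 : RtoC (sqrt PI) <> 0%C) by (apply RtoC_nz; lra).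
  rewrite ?RtoC_mult. field. auto.
Qed.

(** * The hypergeometric term *)

Lemma rpoch_add x m n : rpoch x (m + n) = rpoch x m * rpoch (x + INR m) n.
Proof.
  induction n. rewrite Nat.add_0_r. simpl. ring.
  rewrite Nat.add_succ_r. simpl. rewrite IHn, plus_INR. ring.
Qed.

(** The factor [4^k] comes from [- z^2 = 4 y]. Duplication merges the two upper parameters into one
    Pochhammer symbol of length [2 k], which then splits into the factors of [besc_product]. *)
Lemma sqint_hypergeom nu k : 0 < nu ->
  rg (nu + 1) * rg (nu + 1) / (2 * nu) * (rpoch nu k * rpoch (1 / 2 + nu) k / (rpoch (2 * nu + 1) k * (rpoch (nu + 1) k * rpoch (nu + 1) k)) * 4 ^ k / INR (fact k)) = sqint nu k.
Proof.
  intros Hnu. assert (Hk := pos_INR k). assert (Hf := INR_fact_neq_0 k).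
  assert (P1 := rpoch_pos (nu + 1) k ltac:(lra)). assert (P2 := rpoch_pos (2 * nu + 1) k ltac:(lra)).
  assert (H4 : 4 ^ k <> 0) by (apply pow_nonzero; lra).
  unfold sqint. rewrite besc_product, (rg_rpoch (nu + 1) k). replace (nu + 1 + INR k) with (nu + INR k + 1) by ring.
  assert (D := rpoch_duplication nu k). rewrite (Rplus_comm nu (1 / 2)) in D. rewrite D.
  assert (E : rpoch (2 * nu) (2 * k) * (2 * (nu + INR k)) = 2 * nu * rpoch (2 * nu + 1) k * rpoch (nu + nu + INR k + 1) k).
  { transitivity (rpoch (2 * nu) (S (2 * k))). change (rpoch (2 * nu) (S (2 * k))) with (rpoch (2 * nu) (2 * k) * (2 * nu + INR (2 * k))). rewrite mult_INR. simpl (INR 2). ring.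
    rewrite rpoch_S_left. replace (2 * k)%nat with (k + k)%nat by lia. rewrite rpoch_add. replace (2 * nu + 1 + INR k) with (nu + nu + INR k + 1) by ring. ring. }
  assert (E' : rpoch (2 * nu) (2 * k) = 2 * nu * rpoch (2 * nu + 1) k * rpoch (nu + nu + INR k + 1) k / (2 * (nu + INR k))) by (rewrite <- E; field; lra).
  rewrite E'. field. repeat split; auto; lra.
Qed.

Lemma sqterm_hypergeom (nu : R) z : 0 < nu -> 
  (Cpower (z / 2) (2 * nu) / (2 * nu * (CGamma (nu + 1)) ^ 2) * hypergeom [RtoC nu; RtoC (1 / 2 + nu)] [RtoC (2 * nu + 1); RtoC (nu + 1); RtoC (nu + 1)] (- z ^ 2))%C = sqterm z nu.
Proof.
  intros Hnu. assert (G1 := rg_pos (nu + 1) ltac:(lra)).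
  destruct (sqint_power_bound (yarg z) nu Hnu) as [Ms [HMs Bs]]. assert (Cs := Cser_correct _ _ Bs HMs). fold (sqser (yarg z) nu) in Cs.
  set (c := rg (nu + 1) * rg (nu + 1) / (2 * nu)). assert (Hc : c <> 0). { unfold c. apply Rgt_not_eq. apply Rdiv_lt_0_compat; nra. }
  assert (H : hypergeom [RtoC nu; RtoC (1 / 2 + nu)] [RtoC (2 * nu + 1); RtoC (nu + 1); RtoC (nu + 1)] (- z ^ 2)%C = (RtoC (/ c) * sqser (yarg z) nu)%C).
  { unfold hypergeom. apply Cser_CSeries. eapply Cser_ext. 2: apply (Cser_scal _ _ _ Cs). intros k. cbv beta.
    rewrite <- sqint_hypergeom by auto. fold c. unfold Cprod, map, fold_right. rewrite !poch_real.
    assert (P1 := rpoch_pos (nu + 1) k ltac:(lra)). assert (P2 := rpoch_pos (2 * nu + 1) k ltac:(lra)).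
    replace (- z ^ 2)%C with (RtoC 4 * yarg z)%C by (unfold yarg; simpl; field). rewrite Cpow_mult_l, <- RtoC_pow, !Cmult_1_r.
    rewrite <- !RtoC_mult. set (A := rpoch nu k * rpoch (1 / 2 + nu) k). set (B := rpoch (2 * nu + 1) k * (rpoch (nu + 1) k * rpoch (nu + 1) k)).
    assert (HB : B <> 0). { unfold B. apply Rgt_not_eq. apply Rmult_lt_0_compat; [lra|nra]. }
    rewrite (RtoC_mult c), RtoC_inv by auto. rewrite !RtoC_div, RtoC_mult, RtoC_div by (auto using INR_fact_neq_0).
    field. repeat split. apply fact_C_nz. apply RtoC_nz; auto. apply RtoC_nz; auto. }
  rewrite H, CGamma_rGamma. unfold sqterm, Cpower. rewrite <- !RtoC_plus, rGamma_real, <- RtoC_mult.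
  transitivity (RtoC (c * / c) * (Cexp ((2 * nu)%R * Clog (z / 2)) * sqser (yarg z) nu))%C. 2: rewrite Rinv_r by auto; ring.
  rewrite (RtoC_mult c). unfold c at 2. rewrite RtoC_div, !RtoC_mult by lra. simpl. field. 
  repeat split; try (apply RtoC_nz; lra).
Qed.

(** * Integral order *)

(** Changing the order shifts the argument of Gamma, so uniform continuity in the order is
    continuity of [g] near a compact shifted path. *)
Lemma unif_shift (g : C -> C) (p : R -> C) a b (nu : R) : (forall t, a <= t <= b -> ccont g (p t + nu)%C) -> (forall t u, Cmod (p t - p u) <= Rabs (t - u)) ->
  forall eps, 0 < eps -> exists d, 0 < d /\ forall t nu', a <= t <= b -> Rabs (nu' - nu) < d -> Cmod (g (p t + RtoC nu') - g (p t + nu))%C < eps.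
Proof.
  intros Hg Hp eps He.
  assert (D : forall t, exists d : posreal, a <= t <= b -> forall s, Cmod (s - (p t + nu)) < 2 * d -> Cmod (g s - g (p t + nu))%C < eps / 2).
  { intros t. destruct (classic (a <= t <= b)) as [Ht|Ht]. 2: exists (mkposreal 1 Rlt_0_1); tauto.
    destruct (Hg t Ht (eps / 2)) as [d [Hd K]]. lra. assert (Hd' : 0 < d / 2) by lra. exists (mkposreal _ Hd'). intros _ s Hs. apply K. simpl in Hs. lra. }
  destruct (choice _ D) as [dl Hdl]. destruct (compactness_value_1d a b dl) as [d Hd]. exists d. split. apply cond_pos.
  (* The covering lemma supplies its centre [t] only under a double negation, hence the proof by
     contradiction. *)
  intros x nu' Hx Hn. apply Rnot_le_lt. intros Hc. apply (Hd x Hx). intros [t [Ht [H1 H2]]]. assert (Q := cond_pos (dl t)). assert (Hpx := Hp x t).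
  assert (E1 : Cmod (g (p x + RtoC nu') - g (p t + nu))%C < eps / 2).
  { apply Hdl; auto. replace (p x + RtoC nu' - (p t + nu))%C with ((p x - p t) + RtoC (nu' - nu))%C by (rewrite RtoC_minus; ring).
    eapply Rle_lt_trans. apply Cmod_triangle. rewrite Cmod_R. lra. }
  assert (E2 : Cmod (g (p t + nu) - g (p x + nu))%C < eps / 2).
  { rewrite Cmod_minus_sym. apply Hdl; auto. replace (p x + nu - (p t + nu))%C with (p x - p t)%C by ring. lra. }
  apply (Rlt_irrefl eps). eapply Rle_lt_trans. apply Hc.
  replace (g (p x + RtoC nu') - g (p x + nu))%C with ((g (p x + RtoC nu') - g (p t + nu)) + (g (p t + nu) - g (p x + nu)))%C by ring.
  eapply Rle_lt_trans. apply Cmod_triangle. lra.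
Qed.

(** The order occurs only in [nu - s] and [1 + nu + s]; all other factors form the bounded function
    [A]. *)
Lemma hM_unif (nu : R) (X : C) (p : R -> C) a b : (forall t u, Cmod (p t - p u) = Rabs (t - u)) -> (forall t, a <= t <= b -> regM nu (p t)) ->
  forall eps, 0 < eps -> exists d, 0 < d /\ forall t nu', a <= t <= b -> Rabs (nu' - nu) < d -> Cmod (hM nu' X (p t) - hM nu X (p t))%C < eps.
Proof.
  intros Hp Hr eps He.
  assert (Hpc : forall t, rcont p t). { intros t e H. exists e. split; auto. intros u Hu. rewrite Hp. auto. }
  assert (Hc : forall (g : C -> C) t, ccont g (p t) -> rcont (fun t => g (p t)) t).
  { intros g t Hg e H. destruct (Hg e H) as [d [Hd K]]. exists d. split; auto. intros u Hu. apply K. rewrite Hp. auto. }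
  set (A := fun s => (- / s * / rGamma (- s) * rGamma (1 / 2 - s) * Cexp (s * X))%C).
  set (B := fun s => (/ rGamma s)%C).
  assert (CA : forall s, regM nu s -> ccont A s).
  { intros s Hs. destruct (regM_nz nu s Hs) as [N1 [N2 N3]]. destruct (cdiff_rGamma_pieces nu s) as [[l1 D1] [_ [_ [l4 D4]]]].
    eapply cdiff_ccont. unfold A. apply cdiff_mult; [apply cdiff_mult; [apply cdiff_mult|]|].
    - apply cdiff_opp. apply (cdiff_inv (fun s => s)); auto. apply cdiff_id.
    - apply (cdiff_inv (fun s => rGamma (- s))); eauto.
    - eauto.
    - apply cdiff_Cexp_lin. }
  assert (CB : forall t, a <= t <= b -> ccont B (- p t + nu)%C).
  { intros t Ht. destruct (regM_nz nu _ (Hr t Ht)) as [_ [_ N3]]. unfold B. apply ccont_inv. replace (- p t + nu)%C with (nu - p t)%C by ring. auto. apply ccont_rGamma. }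
  destruct (rcont_bounded (fun t => A (p t)) a b) as [MA HA]. { intros t Ht. apply Hc, CA, Hr, Ht. }
  destruct (rcont_bounded (fun t => B (- p t + nu)%C) a b) as [MB HB].
  { intros t Ht. apply (Hc (fun s => B (- s + nu)%C)). apply (ccont_comp (fun s => - s + nu)%C B). apply ccont_plus. apply ccont_opp, ccont_id. apply ccont_const. apply CB; auto. }
  destruct (rcont_bounded (fun t => rGamma (1 + p t + nu)) a b) as [MC HC].
  { intros t Ht. apply (Hc (fun s => rGamma (1 + s + nu)%C)). apply (ccont_comp (fun s => 1 + s + nu)%C rGamma). apply ccont_plus. apply ccont_plus. apply ccont_const. apply ccont_id. apply ccont_const. apply ccont_rGamma. }
  set (W := Rabs MA * (Rabs MB + Rabs MC + 1) + 1). assert (HW : 0 < W). { unfold W. assert (0 <= Rabs MA * (Rabs MB + Rabs MC + 1)). apply Rmult_le_pos. apply Rabs_pos. assert (P := Rabs_pos MB). assert (P' := Rabs_pos MC). lra. lra. }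
  set (eta := Rmin 1 (eps / W)). assert (Heta : 0 < eta /\ eta <= 1 /\ eta <= eps / W).
  { unfold eta. split. apply Rmin_pos; [lra|apply Rdiv_lt_0_compat; auto]. split. apply Rmin_l. apply Rmin_r. }
  destruct (unif_shift B (fun t => - p t)%C a b nu CB) with (eps := eta) as [d1 [Hd1 K1]]; [|tauto|].
  { intros t u. replace (- p t - - p u)%C with (- (p t - p u))%C by ring. rewrite Cmod_opp, Hp. lra. }
  destruct (unif_shift rGamma (fun t => 1 + p t)%C a b nu) with (eps := eta) as [d2 [Hd2 K2]]; [| |tauto|].
  { intros. apply ccont_rGamma. } { intros t u. replace (1 + p t - (1 + p u))%C with (p t - p u)%C by ring. rewrite Hp. lra. }
  exists (Rmin d1 d2). split. apply Rmin_pos; auto. intros t nu' Ht Hn.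
  assert (Q1 := Rmin_l d1 d2). assert (Q2 := Rmin_r d1 d2).
  specialize (K1 t nu' Ht ltac:(lra)). specialize (K2 t nu' Ht ltac:(lra)). specialize (HA t Ht). specialize (HB t Ht). specialize (HC t Ht). cbv beta in *.
  assert (E : forall mu : R, hM mu X (p t) = (A (p t) * (B (- p t + mu) * rGamma (1 + p t + mu)))%C).
  { intros mu. unfold hM, A, B. replace (- p t + mu)%C with (mu - p t)%C by ring. replace (1 + p t + mu)%C with (1 + mu + p t)%C by ring. ring. }
  rewrite !E. set (a0 := A (p t)) in *. set (b0 := B (- p t + nu)%C) in *. set (b1 := B (- p t + nu')%C) in *. set (e0 := rGamma (1 + p t + nu)%C) in *. set (e1 := rGamma (1 + p t + nu')%C) in *.
  replace (a0 * (b1 * e1) - a0 * (b0 * e0))%C with (a0 * ((b1 - b0) * e0 + (b0 + (b1 - b0)) * (e1 - e0)))%C by ring.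
  rewrite Cmod_mult. apply Rle_lt_trans with (Rabs MA * (eta * Rabs MC + (Rabs MB + 1) * eta)).
  - apply Rmult_le_compat; auto using Cmod_ge_0. eapply Rle_trans. apply HA. apply Rle_abs.
    eapply Rle_trans. apply Cmod_triangle. rewrite !Cmod_mult. apply Rplus_le_compat; apply Rmult_le_compat; auto using Cmod_ge_0; try lra.
    eapply Rle_trans. apply HC. apply Rle_abs. eapply Rle_trans. apply Cmod_triangle. assert (Q := Rle_abs MB). lra.
  - apply Rlt_le_trans with (eta * W). unfold W. nra. apply Rle_trans with (eps / W * W). apply Rmult_le_compat_r; lra. apply Req_le. field. lra.
Qed.

(** Uniqueness of the improper integral transfers the rate of [ray_integral] to any given value. *)
Lemma ray_integral_tail (f : R -> C) sg K T l : (forall t, sg <= t -> rcont f t) -> 0 <= K -> (forall t, T <= t -> Cmod (f t) <= K * exp (- (ln 2 * t))) ->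
  is_RInt_gen (V := C_R_NormedModule) f (at_point sg) (Rbar_locally p_infty) l ->
  forall y v, sg <= y -> T <= y -> isCI f sg y v -> Cmod (v - l) <= K / ln 2 * exp (- (ln 2 * y)).
Proof.
  intros H1 H2 H3 Hl. destruct (ray_integral f sg K T H1 H2 H3) as [l' [Hl' B]].
  replace l with l'; auto. rewrite <- (is_RInt_gen_unique (V := C_R_CompleteNormedModule) f l' Hl').
  apply (is_RInt_gen_unique (V := C_R_CompleteNormedModule) f l Hl).
Qed.

Lemma exp_ln2_small c eps : 0 <= c -> 0 < eps -> exists T, forall y, T <= y -> c * exp (- (ln 2 * y)) < eps.
Proof.
  intros Hc He. assert (Hl : 0 < ln 2) by (rewrite <- ln_1; apply ln_increasing; lra). exists (- ln (eps / (c + 1)) / ln 2).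
  intros y Hy. assert (P : 0 < eps / (c + 1)) by (apply Rdiv_lt_0_compat; lra).
  assert (Q : exp (- (ln 2 * y)) <= eps / (c + 1)).
  { rewrite <- (exp_ln (eps / (c + 1))) by auto. apply exp_le_compat. apply Rmult_le_compat_l with (r := ln 2) in Hy. 2: lra.
    replace (ln 2 * (- ln (eps / (c + 1)) / ln 2)) with (- ln (eps / (c + 1))) in Hy by (field; lra). lra. }
  apply Rle_lt_trans with (c * (eps / (c + 1))). apply Rmult_le_compat_l; auto.
  apply Rmult_lt_reg_r with (c + 1). lra. unfold Rdiv. replace (c * (eps * / (c + 1)) * (c + 1)) with (c * eps) by (field; lra). nra.
Qed.

(** The tails are uniformly small by the common exponential bound, and on the remaining compact part
    convergence is uniform. *)
Lemma ray_limit (f : nat -> R -> C) (f0 : R -> C) sg K T (l : nat -> C) l0 :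
  (forall n t, sg <= t -> rcont (f n) t) -> (forall t, sg <= t -> rcont f0 t) -> 0 <= K ->
  (forall n t, T <= t -> Cmod (f n t) <= K * exp (- (ln 2 * t))) -> (forall t, T <= t -> Cmod (f0 t) <= K * exp (- (ln 2 * t))) ->
  (forall b eps, 0 < eps -> exists N, forall n t, (N <= n)%nat -> sg <= t <= b -> Cmod (f n t - f0 t) <= eps) ->
  (forall n, is_RInt_gen (V := C_R_NormedModule) (f n) (at_point sg) (Rbar_locally p_infty) (l n)) ->
  is_RInt_gen (V := C_R_NormedModule) f0 (at_point sg) (Rbar_locally p_infty) l0 -> Clim l l0.
Proof.
  intros H1 H2 HK B1 B2 HU L1 L2. apply Clim_eps. intros eps He. assert (Hl : 0 < ln 2) by (rewrite <- ln_1; apply ln_increasing; lra).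
  destruct (exp_ln2_small (K / ln 2) (eps / 4)) as [T' HT']. apply Rmult_le_pos; [auto|left; apply Rinv_0_lt_compat; auto]. lra.
  set (y := Rmax sg (Rmax T T')). assert (Hy : sg <= y /\ T <= y /\ T' <= y).
  { unfold y. assert (M1 := Rmax_l sg (Rmax T T')). assert (M2 := Rmax_r sg (Rmax T T')). assert (M3 := Rmax_l T T'). assert (M4 := Rmax_r T T'). lra. }
  destruct Hy as [Y1 [Y2 Y3]]. specialize (HT' y Y3). destruct (HU y (eps / (4 * (y - sg + 1)))) as [N HN]. apply Rdiv_lt_0_compat; lra.
  exists N. intros n Hn.
  assert (E1 : exCI (f n) sg y). { apply exCI_rcont. rewrite Rmin_left, Rmax_right by lra. intros t Ht. apply H1; lra. }
  assert (E2 : exCI f0 sg y). { apply exCI_rcont. rewrite Rmin_left, Rmax_right by lra. intros t Ht. apply H2; lra. }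
  destruct E1 as [v E1]. destruct E2 as [w E2].
  assert (D1 := ray_integral_tail _ _ _ _ _ (H1 n) HK (B1 n) (L1 n) y v Y1 Y2 E1). assert (D2 := ray_integral_tail _ _ _ _ _ H2 HK B2 L2 y w Y1 Y2 E2).
  assert (D3 := isCI_diff_bound _ _ _ _ _ _ _ Y1 (fun t Ht => HN n t Hn Ht) E1 E2).
  assert (D4 : (y - sg) * (eps / (4 * (y - sg + 1))) <= eps / 4).
  { replace (eps / (4 * (y - sg + 1))) with (eps / 4 * / (y - sg + 1)) by (field; lra).
    rewrite Rmult_comm, Rmult_assoc. rewrite <- (Rmult_1_r (eps / 4)) at 2. apply Rmult_le_compat_l. lra.
    apply Rmult_le_reg_l with (y - sg + 1). lra. rewrite <- Rmult_assoc, Rinv_r; lra. }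
  replace (l n - l0)%C with (- (v - l n) + ((v - w) + (w - l0)))%C by ring. eapply Rle_lt_trans. apply Cmod_triangle. rewrite Cmod_opp.
  eapply Rle_lt_trans. apply Rplus_le_compat_l, Cmod_triangle. lra.
Qed.

Lemma Clim_of_unif (f : nat -> R -> C) (f0 : R -> C) a b (v : nat -> C) v0 : a <= b ->
  (forall eps, 0 < eps -> exists N, forall n t, (N <= n)%nat -> a <= t <= b -> Cmod (f n t - f0 t) <= eps) ->
  (forall n, isCI (f n) a b (v n)) -> isCI f0 a b v0 -> Clim v v0.
Proof.
  intros Hab HU H1 H2. apply Clim_eps. intros eps He. destruct (HU (eps / (2 * (b - a + 1)))) as [N HN]. apply Rdiv_lt_0_compat; lra.
  exists N. intros n Hn. eapply Rle_lt_trans. apply (isCI_diff_bound _ _ _ _ _ _ _ Hab (fun t Ht => HN n t Hn Ht) (H1 n) H2).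
  apply Rmult_lt_reg_r with (2 * (b - a + 1)). lra. unfold Rdiv. rewrite !Rmult_assoc, Rinv_l by lra. nra.
Qed.

(** The three pieces avoid the poles for every order involved: the rays stay off the real axis, and
    the left side has negative real part. *)
Lemma loop_limit nu X (nus : nat -> R) sg c1 c2 (I : nat -> C) I0 : 0 < nu -> sg < 0 -> c1 < 0 -> 0 < c2 ->
  (forall n, nu <= nus n <= nu + 1) -> is_lim_seq nus nu ->
  (forall n, is_loop_int sg c1 c2 (hM (nus n) X) (I n)) -> is_loop_int sg c1 c2 (hM nu X) I0 -> Clim I I0.
Proof.
  intros Hnu Hsg Hc1 Hc2 Hn Hlim HI HI0.
  assert (U : forall (p : R -> C) a b, (forall t u, Cmod (p t - p u) = Rabs (t - u)) -> (forall t, a <= t <= b -> regM nu (p t)) ->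
    forall eps, 0 < eps -> exists N, forall n t, (N <= n)%nat -> a <= t <= b -> Cmod (hM (nus n) X (p t) - hM nu X (p t)) <= eps).
  { intros p a b Hp Hr eps He. destruct (hM_unif nu X p a b Hp Hr eps He) as [d [Hd K]]. apply is_lim_seq_spec in Hlim. destruct (Hlim (mkposreal d Hd)) as [N HN].
    exists N. intros n t H Ht. left. apply K; auto. }
  assert (Phor : forall c t u, Cmod ((t, c) - (u, c))%C = Rabs (t - u)).
  { intros c t u. replace ((t, c) - (u, c))%C with (RtoC (t - u)). apply Cmod_R. apply C_ext; simpl; ring. }
  assert (Pver : forall c t u, Cmod ((c, t) - (c, u))%C = Rabs (t - u)).
  { intros c t u. replace ((c, t) - (c, u))%C with (RtoC (t - u) * Ci)%C. rewrite Cmod_mult, Cmod_Ci, Cmod_R. ring. apply C_ext; simpl; ring. }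
  assert (Rsg : forall mu y, 0 < mu -> regM mu (sg, y)). { intros mu y Hmu. split; intros k E; apply (f_equal Re) in E; simpl in E; assert (Q := pos_INR k); lra. }
  assert (ray : forall c (l : nat -> C) l0, c <> 0 -> (forall n, is_RInt_gen (V := C_R_NormedModule) (fun t : R => hM (nus n) X (t, c)) (at_point sg) (Rbar_locally p_infty) (l n)) ->
     is_RInt_gen (V := C_R_NormedModule) (fun t : R => hM nu X (t, c)) (at_point sg) (Rbar_locally p_infty) l0 -> Clim l l0).
  { intros c l l0 Hc L1 L2. destruct (hM_ray_bound nu X c Hnu Hc) as [K [T [HK B]]].
    apply (ray_limit (fun n t => hM (nus n) X (t, c)) (fun t => hM nu X (t, c)) sg K T); auto.
    - intros n t _. apply rcont_hor, ccont_hM, regM_im. auto.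
    - intros t _. apply rcont_hor, ccont_hM, regM_im. auto.
    - intros t Ht. apply B; auto. lra.
    - intros b. apply (U (fun t => (t, c))). apply Phor. intros t _. apply regM_im. auto. }
  destruct (choice _ (fun n => HI n)) as [lb HI1]. destruct (choice _ HI1) as [ll HI2]. destruct (choice _ HI2) as [lt HI3]. clear HI1 HI2.
  destruct HI0 as [lb0 [ll0 [lt0 [A1 [A2 [A3 ->]]]]]].
  assert (T1 : Clim lb lb0). { apply (ray c1); auto. lra. intros n. exact (proj1 (HI3 n)). }
  assert (T2 : Clim lt lt0). { apply (ray c2); auto. lra. intros n. exact (proj1 (proj2 (proj2 (HI3 n)))). }
  assert (T3 : Clim ll ll0).
  { assert (Hc : c1 <= c2) by lra. exact (Clim_of_unif (fun n y => hM (nus n) X (sg, y)) (fun y => hM nu X (sg, y)) c1 c2 ll ll0 Hc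
      (U (fun t => (sg, t)) c1 c2 (Pver sg) (fun t _ => Rsg nu t Hnu)) (fun n => proj1 (proj2 (HI3 n))) A2). }
  eapply Clim_ext. intros n. symmetry. exact (proj2 (proj2 (proj2 (HI3 n)))). apply Clim_plus; auto. apply Clim_plus. apply Clim_opp; auto. apply Clim_mult; auto. apply Clim_const.
Qed.

Lemma cdiff_Cdsum (f : nat -> nat -> C -> C) s n : (forall k j, exists l, cdiff (f k j) s l) -> exists l, cdiff (fun s => Cdsum (fun k j => f k j s) n) s l.
Proof.
  revert f. induction n; intros f H; simpl. apply H. destruct (H O (S n)) as [l Hl]. destruct (IHn (fun k j => f (S k) j)) as [l' Hl']. intros; apply H.
  eexists. apply cdiff_plus; eauto.
Qed.

(** The coefficients extend to complex orders and the series is holomorphic near [nu]; half-side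
    [nu / 2] keeps the denominators [2 * (s + INR k)] away from 0. *)
Lemma sqser_continuous y nu (nus : nat -> R) : 0 < nu -> (forall n, nu <= nus n) -> is_lim_seq nus nu -> Clim (fun n => sqser y (nus n)) (sqser y nu).
Proof.
  intros Hnu Hn Hlim. set (f := fun (k : nat) (s : C) => (Cdsum (fun i j => jcoef y s i * jcoef y s j) k * / (2 * (s + INR k)))%C).
  set (r := nu / 2).
  assert (Hf : forall (mu : R) k, 0 < mu -> f k mu = (y ^ k * RtoC (sqint mu k))%C).
  { intros mu k Hmu. unfold f, sqint, conv, Rdiv. assert (Q := pos_INR k). rewrite RtoC_mult, Cmult_assoc, <- Cdsum_powers, RtoC_inv, !RtoC_mult, RtoC_plus by lra. f_equal.
    apply Cdsum_ext. intros i j _. rewrite !jcoef_real, RtoC_mult. ring. }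
  destruct (rGamma_shift_bound (Cmod nu + 2 * r)) as [M [HM B]]. { assert (Q := Cmod_ge_0 nu). unfold r. lra. }
  assert (Hin : forall s, insq nu r s -> nu / 2 <= Re s). { intros s [[H _] _]. simpl in H. unfold r in H. lra. }
  assert (Hnz : forall s k, insq nu r s -> (2 * (s + INR k))%C <> 0%C).
  { intros s k Hs E. apply Hin in Hs. apply (f_equal Re) in E. destruct s as [u v]. simpl in *. assert (Q := pos_INR k). lra. }
  assert (Hb : forall k s, insq nu r s -> Cmod (jcoef y s k) <= M * (Cmod y ^ k / INR (fact k))).
  { intros k s Hs. unfold jcoef. rewrite Cmod_mult, Cmod_powfact, Rmult_comm. apply Rmult_le_compat_r.
    apply Rmult_le_pos. apply pow_le, Cmod_ge_0. left. apply Rinv_0_lt_compat, lt_0_INR, lt_O_fact.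
    apply B. apply insq_Cmod in Hs. replace s with ((s - nu) + nu)%C by ring. eapply Rle_trans. apply Cmod_triangle. lra. }
  set (b := fun k => M * (Cmod y ^ k / INR (fact k))).
  assert (Hb0 : forall k, 0 <= b k). { intros k. apply Rmult_le_pos. lra. apply Rmult_le_pos. apply pow_le, Cmod_ge_0. left. apply Rinv_0_lt_compat, lt_0_INR, lt_O_fact. }
  assert (HD : forall k s, insq nu r s -> exists m, cdiff (f k) s m).
  { intros k s Hs. destruct (cdiff_Cdsum (fun i j s => jcoef y s i * jcoef y s j)%C s k) as [l Hl].
    - intros i j. assert (D : forall i, exists l, cdiff (fun s => jcoef y s i) s l).
      { intros i'. eexists. unfold jcoef. apply cdiff_mult. apply cdiff_const. apply (cdiff_comp (fun s => s + INR i' + 1)%C rGamma). apply cdiff_shift_k. apply cdiff_drGamma. }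
      destruct (D i) as [l1 D1]. destruct (D j) as [l2 D2]. eexists. apply cdiff_mult; eauto.
    - eexists. unfold f. apply cdiff_mult. apply Hl. apply (cdiff_inv (fun s => 2 * (s + INR k))%C). auto. apply cdiff_mult. apply cdiff_const. apply cdiff_plus. apply cdiff_id. apply cdiff_const. }
  assert (HB : forall k s, insq nu r s -> Cmod (f k s) <= / nu * conv b b k).
  { intros k s Hs. unfold f. rewrite Cmod_mult, Rmult_comm. apply Rmult_le_compat; auto using Cmod_ge_0.
    - rewrite Cmod_inv by auto. apply Rinv_le_contravar; auto. rewrite Cmod_mult, Cmod_R, Rabs_pos_eq by lra.
      assert (Q := re_le_Cmod (s + INR k)). assert (Q' := Rle_abs (Re (s + INR k))). assert (Q'' := pos_INR k). apply Hin in Hs. destruct s as [u v]; simpl in *. lra.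
    - apply Cmod_Cdsum. intros i j. rewrite Cmod_mult. apply Rmult_le_compat; auto using Cmod_ge_0; apply Hb; auto. }
  assert (HS : ex_series (fun k => / nu * conv b b k)).
  { apply (ex_series_scal (V := R_NormedModule) (/ nu) (conv b b)). apply ex_series_conv; auto; apply ex_series_exp. }
  assert (Hc : insq nu r nu) by (apply insq_center; unfold r; lra).
  destruct (choice _ (fun k => HD k nu Hc)) as [l Hl].
  destruct (holo_series f (fun s => CSeries (fun k => f k s)) l (fun k => / nu * conv b b k) nu r) as [L [_ HL]]; auto. unfold r; lra.
  { intros s Hs. apply (Cser_correct _ (fun k => / nu * conv b b k)); auto. }
  apply cdiff_ccont in HL. assert (HT := Clim_ccont _ _ _ HL (Clim_RtoC _ _ Hlim)).
  assert (E : forall mu : R, 0 < mu -> CSeries (fun k => f k mu) = sqser y mu). { intros mu Hmu. unfold sqser. f_equal. apply functional_extensionality. intros k. apply Hf; auto. }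
  cbv beta in HT. rewrite E in HT by auto. eapply Clim_ext. 2: apply HT. intros n. apply E. specialize (Hn n). lra.
Qed.

Lemma is_lim_seq_plus_inv x : is_lim_seq (fun n => x + / INR (S (S n))) x.
Proof.
  replace (Finite x) with (Finite (x + 0)) by (f_equal; ring). apply is_lim_seq_plus'. apply is_lim_seq_const.
  apply (is_lim_seq_incr_1 (fun n => / INR (S n))). apply (is_lim_seq_incr_1 (fun n => / INR n)).
  replace (Finite 0) with (Rbar_inv p_infty) by reflexivity. apply is_lim_seq_inv. apply is_lim_seq_INR. discriminate.
Qed.

Lemma loop_identity (nu : R) z : 0 < nu -> 0 < Re z -> exists G,
  (forall sg c1 c2, sg < 0 -> c1 < 0 -> 0 < c2 -> exists I, is_loop_int sg c1 c2 (hM nu (Clog (z ^ 2))) I /\ G = (I / (2 * PI * Ci))%C) /\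
  (dJC z nu / (PI * nu) = BesselY nu z * sqterm z nu - JC z nu / (2 * sqrt PI) * G)%C.
Proof.
  intros Hnu Hz. destruct (Req_EM_T (frac_part nu) 0) as [H0|H0].
  2: { rewrite BesselY_nonint by auto. destruct (nfloor_ex nu) as [m Hm]. lra. apply (loop_identity_nonint nu z m (nu - INR m)); auto. ring. split; [|lra].
    destruct Hm as [[H|H] _]. lra. exfalso. apply H0. rewrite <- H. apply frac_part_INR. }
  destruct (frac_part_zero_nat nu) as [m Hm]; [lra|auto|]. set (X := Clog (z ^ 2)).
  (* Strictly between 0 and 1, so every [nu + e n] lies in the interval from [m] to [m + 1] and the
     non-integral case applies with one fixed [m]. *)
  set (e := fun n => / INR (S (S n))). assert (He : forall n, 0 < e n < 1).
  { intros n. unfold e. assert (Q := pos_INR n). assert (Q' : 1 < INR (S (S n))) by (rewrite !S_INR; lra). split. apply Rinv_0_lt_compat. lra.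
    rewrite <- Rinv_1. apply Rinv_lt_contravar; lra. }
  set (nus := fun n => nu + e n). assert (Hlim : is_lim_seq nus nu) by apply is_lim_seq_plus_inv.
  destruct (choice _ (fun n => loop_identity_nonint (nus n) z m (e n) (f_equal (fun x => x + e n) Hm) (He n) Hz)) as [Gs HG].
  assert (Hpi : (2 * PI * Ci)%C <> 0%C). { apply Cmult_neq_0. apply Cmult_neq_0; apply RtoC_nz. lra. apply PI_neq0. apply Ci_nz. }
  (* One sequence [Gs] serves all loops; its limit is unique, so all loops of order [nu] give the
     same value. *)
  assert (HL : forall sg c1 c2, sg < 0 -> c1 < 0 -> 0 < c2 -> exists I, is_loop_int sg c1 c2 (hM nu X) I /\ Clim Gs (I / (2 * PI * Ci))%C).
  { intros sg c1 c2 Hsg Hc1 Hc2. destruct (loop_exists nu X sg c1 c2 Hnu Hsg Hc1 Hc2) as [lb [ll [lt [K [Y [_ [L1 [L2 [L3 _]]]]]]]]].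
    exists (- lb + Ci * ll + lt)%C. assert (HI : is_loop_int sg c1 c2 (hM nu X) (- lb + Ci * ll + lt)%C) by (exists lb, ll, lt; auto). split; auto.
    destruct (choice _ (fun n => proj1 (HG n) sg c1 c2 Hsg Hc1 Hc2)) as [I HIn].
    eapply Clim_ext. intros n. symmetry. apply (HIn n). apply Clim_mult. 2: apply Clim_const.
    apply (loop_limit nu X nus sg c1 c2); auto. intros n. specialize (He n). unfold nus. lra. intros n; exact (proj1 (HIn n)). }
  destruct (HL (-1) (-1) 1 ltac:(lra) ltac:(lra) ltac:(lra)) as [I0 [_ HI0]]. exists (I0 / (2 * PI * Ci))%C. split.
  { intros sg c1 c2 Hsg Hc1 Hc2. destruct (HL sg c1 c2 Hsg Hc1 Hc2) as [I [HI HI']]. exists I. split; auto. apply (Clim_unique Gs); auto. }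
  assert (Cn := Clim_RtoC _ _ Hlim).
  destruct (BesselY_nat z m Hz) as [q [Hq [Eq [_ Hne]]]]. rewrite <- Hm in *. rewrite Eq.
  apply (Clim_unique (fun n => dJC z (nus n) / (PI * nus n))%C).
  - apply (Clim_ccont (fun s => dJC z s / (PI * s))%C nus nu); auto. apply ccont_div.
    apply Cmult_neq_0; apply RtoC_nz. apply PI_neq0. lra. apply ccont_dJC. apply ccont_mult. apply ccont_const. apply ccont_id.
  - eapply Clim_ext. intros n. symmetry. apply (proj2 (HG n)). apply Clim_minus; apply Clim_mult; auto.
    + eapply Clim_ext. intros n. symmetry. apply Hne. intros E. apply RtoC_inj in E. specialize (He n). unfold nus in E. lra. apply (Clim_ccont q); auto.
    + unfold sqterm. apply Clim_mult. 2: apply sqser_continuous; auto. 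
      apply (Clim_ccont (fun s => Cexp (2 * s * Clog (z / 2)))%C nus nu); auto. eapply cdiff_ccont. eapply cdiff_ext. 2: apply (cdiff_Cexp_lin (2 * Clog (z / 2))). intros s. cbv beta. f_equal. ring.
      intros n. specialize (He n). unfold nus. lra.
    + apply Clim_mult. 2: apply Clim_const. apply (Clim_ccont (JC z) nus nu); auto. eapply cdiff_ccont. apply cdiff_JC.
Qed.

Theorem mainTheorem11 :
  forall (nu : R) (z : C), 0 < nu -> 0 < Re z ->
  exists G : C,
    is_MeijerG 3 0 [RtoC (1 / 2); RtoC 1] [RtoC 0; RtoC 0; RtoC nu; RtoC (- nu)]
      (z ^ 2)%C G /\
    is_RInt_gen (V := C_R_NormedModule)
      (fun theta : R =>
         (tan theta * BesselY 0 (z * (sin theta) ^ 2) *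
          BesselJ nu (z * (cos theta) ^ 2))%C)
      (at_right 0) (at_left (PI / 2))
      (BesselY nu z * Cpower (z / 2) (2 * nu) /
         (2 * nu * (CGamma (nu + 1)) ^ 2) *
         hypergeom [RtoC nu; RtoC (1 / 2 + nu)]
                   [RtoC (2 * nu + 1); RtoC (nu + 1); RtoC (nu + 1)]
                   (- z ^ 2)
       - BesselJ nu z / (2 * sqrt PI) * G)%C.
Proof.
  intros nu z Hnu Hz. destruct (loop_identity nu z Hnu Hz) as [G [HG E]]. exists G. split.
  - split; [simpl; lia|split; [simpl; lia|split]].
    + exists (-1), (-1), 1. split; [lra|split].
      * intros c k Hc. assert (Q := pos_INR k). simpl in Hc. destruct Hc as [<-|[<-|[<-|[]]]]; simpl; lra.
      * intros c k [].
    (* The pole 0 alone forces [sg < 0] and [c1 < 0 < c2]. *)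
    + intros sg c1 c2 [H1 [H2 _]]. destruct (H2 0%C O) as [A1 A2]. left; auto. simpl in A1, A2.
      destruct (HG sg c1 c2 ltac:(lra) ltac:(lra) ltac:(lra)) as [I [[lb [ll [lt [L1 [L2 [L3 L4]]]]]] EI]].
      exists I. split; auto. exists lb, ll, lt.
      (* No natural number lies on the loop, so the two integrands agree along it. *)
      assert (K : forall s : C, Im s <> 0 \/ Re s < 0 -> hM nu (Clog (z ^ 2)) s = MeijerG_integrand 3 0 [RtoC (1 / 2); RtoC 1] [RtoC 0; RtoC 0; RtoC nu; RtoC (- nu)] (z ^ 2)%C s).
      { intros s Hs. symmetry. apply MeijerG_integrand_hM. intros k ->. simpl in Hs. assert (Q := pos_INR k). lra. }
      repeat split; auto.
      * replace (fun t : R => MeijerG_integrand 3 0 _ _ _ (t, c1)) with (fun t : R => hM nu (Clog (z ^ 2)) (t, c1)); auto.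
        apply functional_extensionality. intros t. apply K. left; simpl; lra.
      * replace (fun t : R => MeijerG_integrand 3 0 _ _ _ (sg, t)) with (fun t : R => hM nu (Clog (z ^ 2)) (sg, t)); auto.
        apply functional_extensionality. intros t. apply K. right; simpl; lra.
      * replace (fun t : R => MeijerG_integrand 3 0 _ _ _ (t, c2)) with (fun t : R => hM nu (Clog (z ^ 2)) (t, c2)); auto.
        apply functional_extensionality. intros t. apply K. left; simpl; lra.
  - match goal with |- is_RInt_gen _ _ _ ?v => replace v with (dJC z nu / (PI * nu))%C end.
    + apply lhs_integral; auto.
    + rewrite E, <- sqterm_hypergeom, BesselJ_JC by auto. unfold Cdiv. ring.
Qed.
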